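(* Assume that $\sqrt{q}\in C^{2,1}(\overline{D})$, that $q\ge q_0>0$ in $D$ for a constant $q_0$, and that $D$ is of class $C^{2,1}$. Assume moreover that the equation $u^s-L(q\nabla u^s)=L(f)$ in $H^1_\alpha(D)$ is uniquely solvable (for any $f\in L^2(D,\mathbb{C}^2)$). Then the periodized equation $$u-L_{\mathrm{per}}(q\nabla u)=L_{\mathrm{per}}(f)\qquad\text{in }H^1_{\mathrm{per}}(\Omega_R)$$ has a unique solution $u\in H^1_{\mathrm{per}}(\Omega_R)$, and there is $N_0\in\mathbb{N}$ such that the finite-dimensional problem to find $u_N\in\mathcal{T}_N$ such that $$\langle u_N-L_{\mathrm{per}}(q\nabla u_N),w_N\rangle_{H^1_{\mathrm{per}}(\Omega_R)}=\langle f,w_N\rangle_{H^1_{\mathrm{per}}(\Omega_R)}\qquad\text{for all }w_N\in\mathcal{T}_N$$ possesses a unique solution for all $N\ge N_0$ and $f\in H^1_{\mathrm{per}}(\Omega_R)$. In this case $$\|u_N-u\|_{H^1_{\mathrm{per}}(\Omega_R)}\le C\inf_{w_N\in\mathcal{T}_N}\|w_N-u\|_{H^1_{\mathrm{per}}(\Omega_R)}\le C\,N^{-s}\|u\|_{H^{1+s}_{\mathrm{per}}(\Omega_R)},\qquad 0\le s<\tfrac12,$$ with a constant $C$ independent of $N\ge N_0$.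
   Context: Let $k>0$, $d=(d_1,d_2)\in\mathbb{R}^2$ with $|d|=1$, $d_2\neq0$, and $\alpha:=kd_1$. A function $u$ on $\mathbb{R}^2$ is $\alpha$-quasi-periodic if $u(x_1+2\pi,x_2)=e^{2\pi i\alpha}u(x_1,x_2)$. For $j\in\mathbb{Z}$ put $\alpha_j:=j+\alpha$ and $\beta_j:=\sqrt{k^2-\alpha_j^2}$, the root being chosen nonnegative real if $k^2\ge\alpha_j^2$ and equal to $i(\alpha_j^2-k^2)^{1/2}$ otherwise. Assume $k^2\neq\alpha_j^2$ for all $j\in\mathbb{Z}$. The $\alpha$-quasi-periodic Green's function is $$G_\alpha(x)=\frac{i}{4\pi}\sum_{j\in\mathbb{Z}}\frac{1}{\beta_j}\exp(i\alpha_jx_1+i\beta_j|x_2|),\qquad x\neq(2\pi m,0)^\top,\ m\in\mathbb{Z}.$$ For $r>0$ let $\Omega_r:=(-\pi,\pi)\times(-r,r)$. Fix $\rho>0$ and $R>2\rho$. The contrast $q$ is a real-valued bounded function on $\Omega_R$ with $q=0$ outside $D$, where $D$ is a Lipschitz domain with $\overline{D}=\mathrm{supp}(q)\subset\Omega_\rho$. $H^1_\alpha(D)$ is the space of restrictions to $D$ of $\alpha$-quasi-periodic functions in $H^1_{\mathrm{loc}}(\mathbb{R}^2)$, with the $H^1(D)$ norm. The operator $L:L^2(D,\mathbb{C}^2)\to H^1_\alpha(D)$ is the bounded operator $Lf:=\mathrm{div}\int_DG_\alpha(\cdot-y)f(y)\,dy$. For $j=(j_1,j_2)^\top\in\mathbb{Z}^2$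 let $\varphi_j(x)=(4\pi R)^{-1/2}\exp\big(i(j_1+\alpha)x_1+i\tfrac{j_2\pi}{R}x_2\big)$, an orthonormal basis of $L^2(\Omega_R)$, and $\hat f(j)=\int_{\Omega_R}f\,\overline{\varphi_j}\,dx$. For $s\ge0$, $H^s_{\mathrm{per}}(\Omega_R)$ is the space of $f\in L^2(\Omega_R)$ with $\|f\|^2_{H^s_{\mathrm{per}}(\Omega_R)}:=\sum_{j\in\mathbb{Z}^2}(1+|j|^2)^s|\hat f(j)|^2<\infty$, with the corresponding inner product. For $N\in\mathbb{N}$, $\mathbb{Z}^2_N:=\{j\in\mathbb{Z}^2:\,-N/2<j_1,j_2\le N/2\}$ and $\mathcal{T}_N:=\mathrm{span}\{\varphi_j:\,j\in\mathbb{Z}^2_N\}$. Kernel: let $\mathcal{K}_R$ be the function equal to $G_\alpha$ on $\mathbb{R}\times(-R,R)$ (away from the points $(2\pi m,0)^\top$) and extended $2R$-periodically in $x_2$ to $\mathbb{R}^2$. Let $\chi\in C^3(\mathbb{R})$ be $2R$-periodic with $0\le\chi\le1$, $\chi(x_2)=1$ for $|x_2|\le2\rho$, and $\chi^{(j)}(R)=0$ for $j=0,1,2,3$. Put $\mathcal{K}_{\mathrm{sm}}(x):=\chi(x_2)\mathcal{K}_R(x)$. The operator $L_{\mathrm{per}}:L^2(\Omega_R,\mathbb{C}^2)\to H^1_{\mathrm{per}}(\Omega_R)$ is the bounded operator $L_{\mathrm{per}}f:=\mathrm{div}\int_{\Omega_R}\mathcal{K}_{\mathrm{sm}}(\cdot-y)f(y)\,dy$.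 In the equations with right-hand sides $L(f)$ and $L_{\mathrm{per}}(f)$, $f$ is a vector field in $L^2(D,\mathbb{C}^2)$ (extended by zero to $\Omega_R$), typically $f=q\nabla u^i$ with $u^i$ a smooth $\alpha$-quasi-periodic incident field. *)

(* Defs.v *)
From HB Require Import structures.
From mathcomp Require Import all_boot all_order all_algebra.
From mathcomp Require Import complex.
From mathcomp Require Import all_classical all_reals all_analysis.
Set Implicit Arguments.
Unset Strict Implicit.
Unset Printing Implicit Defensive.
Import Order.TTheory GRing.Theory Num.Theory.
Import numFieldNormedType.Exports.
Local Open Scope classical_set_scope.
Local Open Scope complex_scope.
Local Open Scope ring_scope.

(* The plane is R * R with the product of the Lebesgue measures on Borel sets
   and complex numbers are R[i].  Elements of L^2 and of Sobolev spaces are represented by Borel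
   functions; equality in these spaces is equality almost everywhere. *)

Notation leb2 R := (@lebesgue_measure R \x @lebesgue_measure R)%E.

Definition sqnormc (R : realType) (z : R[i]) : R :=
  complex.Re z ^+ 2 + complex.Im z ^+ 2.

Definition cexp (R : realType) (z : R[i]) : R[i] :=
  (expR (complex.Re z))%:C * (cos (complex.Im z) +i* sin (complex.Im z)).

Definition clim (R : realType) (a : nat -> R[i]) : R[i] :=
  limn (fun n => complex.Re (a n)) +i* limn (fun n => complex.Im (a n)).

Definition cint (R : realType) (A : set (R * R)) (f : R * R -> R[i]) : R[i] :=
  (\int[leb2 R]_(x in A) complex.Re (f x)) +i*
  (\int[leb2 R]_(x in A) complex.Im (f x)).

Definition aeq (R : realType) (A : set (R * R)) (u v : R * R -> R[i]) : Prop :=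
  {ae leb2 R, forall x, A x -> u x = v x}.

Definition exists_unique_ae (R : realType) (A : set (R * R))
    (P : (R * R -> R[i]) -> Prop) : Prop :=
  exists u, P u /\ forall v, P v -> aeq A v u.

Definition cmeasurable (R : realType) (A : set (R * R)) (f : R * R -> R[i]) :=
  measurable_fun A (fun x => complex.Re (f x)) /\
  measurable_fun A (fun x => complex.Im (f x)).

Definition L2 (R : realType) (A : set (R * R)) (f : R * R -> R[i]) : Prop :=
  cmeasurable A f /\
  (\int[leb2 R]_(x in A) (sqnormc (f x))%:E < +oo)%E.

Definition L2vec (R : realType) (A : set (R * R)) (f : R * R -> R[i] * R[i]) :=
  L2 A (fun x => (f x).1) /\ L2 A (fun x => (f x).2).

Definition loc_integrable (R : realType) (A : set (R * R)) (f : R * R -> R[i]) :=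
  forall K : set (R * R), compact K -> K `<=` A ->
    (leb2 R).-integrable K (fun x => (complex.Re (f x))%:E) /\
    (leb2 R).-integrable K (fun x => (complex.Im (f x))%:E).

(* Classical partial derivatives: [false] is the direction x1, [true] is x2. *)
Definition dir (R : realType) (b : bool) : R * R :=
  if b then (0, 1) else (1, 0).

Definition pd (R : realType) (l : seq bool) (f : R * R -> R) : R * R -> R :=
  foldr (fun b (g : R * R -> R) => ('D_(dir R b) g : R * R -> R)) f l.

Definition Ck (R : realType) (n : nat) (A : set (R * R)) (f : R * R -> R) :=
  forall l : seq bool, (size l <= n)%N -> forall x, A x ->
    {for x, continuous (pd l f)} /\
    ((size l < n)%N -> forall b, derivable (pd l f) x (dir R b)).

Definition C21_closure (R : realType) (D : set (R * R)) (f : R * R -> R) :=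
  [/\ Ck 2 D f,
      forall l : seq bool, (size l <= 2)%N -> exists h : R * R -> R,
        {within closure D, continuous h} /\ (forall x, D x -> h x = pd l f x) &
      forall l : seq bool, size l = 2%N ->
        exists c : R, c.-lipschitz_D (pd l f)].

Definition test_fun (R : realType) (A : set (R * R)) (psi : R * R -> R) :=
  [/\ forall n, Ck n setT psi,
      compact (closure [set x | psi x != 0]) &
      closure [set x | psi x != 0] `<=` A].

Definition is_wgrad (R : realType) (A : set (R * R)) (u : R * R -> R[i])
    (g : R * R -> R[i] * R[i]) : Prop :=
  [/\ loc_integrable A u,
      loc_integrable A (fun x => (g x).1),
      loc_integrable A (fun x => (g x).2) &
      forall psi, test_fun A psi ->
        cint A (fun x => u x * (pd [:: false] psi x)%:C) =
          - cint A (fun x => (g x).1 * (psi x)%:C) /\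
        cint A (fun x => u x * (pd [:: true] psi x)%:C) =
          - cint A (fun x => (g x).2 * (psi x)%:C)].

Definition is_wdiv (R : realType) (A : set (R * R)) (V : R * R -> R[i] * R[i])
    (v : R * R -> R[i]) : Prop :=
  [/\ loc_integrable A (fun x => (V x).1),
      loc_integrable A (fun x => (V x).2),
      loc_integrable A v &
      forall psi, test_fun A psi ->
        cint A (fun x => (V x).1 * (pd [:: false] psi x)%:C +
                         (V x).2 * (pd [:: true] psi x)%:C) =
          - cint A (fun x => v x * (psi x)%:C)].

(* Weak gradient and weak divergence on the open set A: a representative,
   determined up to a null set (with junk value 0 when there is none). *)
Definition wgrad (R : realType) (A : set (R * R)) (u : R * R -> R[i]) :
    R * R -> R[i] * R[i] :=
  xget (fun=> (0, 0)) [set g | is_wgrad A u g].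

Definition wdiv (R : realType) (A : set (R * R)) (V : R * R -> R[i] * R[i]) :
    R * R -> R[i] :=
  xget (fun=> 0) [set v | is_wdiv A V v].

Definition H1loc (R : realType) (U : R * R -> R[i]) : Prop :=
  exists g, is_wgrad setT U g /\
    forall K : set (R * R), compact K -> L2 K U /\ L2vec K g.

Definition quasi_periodic (R : realType) (alpha : R) (U : R * R -> R[i]) :=
  {ae leb2 R, forall x : R * R,
    U (x.1 + 2 * pi, x.2) = cexp (0 +i* (2 * pi * alpha)) * U x}.

Definition H1alpha (R : realType) (alpha : R) (D : set (R * R))
    (u : R * R -> R[i]) : Prop :=
  exists U, [/\ H1loc U, quasi_periodic alpha U & forall x, D x -> u x = U x].

Definition Omega (R : realType) (r : R) : set (R * R) :=
  [set x | (- pi < x.1 < pi) && (- r < x.2 < r)].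

(* D lies, near each boundary point and after a rotation by theta, below the
   graph of a function zeta with property P.  The translation and reflection
   parts of a rigid motion are absorbed by theta and zeta.  As the condition is
   local, global and local regularity of zeta are interchangeable. *)
Definition loc_hypograph (R : realType) (P : (R -> R) -> Prop)
    (D : set (R * R)) : Prop :=
  forall p : R * R, closure D p -> ~ D p ->
    exists (W : set (R * R)) (theta : R) (zeta : R -> R),
      [/\ open W, W p, P zeta &
          forall x : R * R, W x ->
            (D x <-> - sin theta * x.1 + cos theta * x.2 <
                     zeta (cos theta * x.1 + sin theta * x.2))].

Definition domain (R : realType) (D : set (R * R)) : Prop :=
  [/\ open D, connected D & D !=set0].

Definition lipschitz_domain (R : realType) (D : set (R * R)) : Prop :=
  domain D /\
  loc_hypograph (fun zeta : R -> R => exists c : R, c.-lipschitz zeta) D.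

Definition C21_domain (R : realType) (D : set (R * R)) : Prop :=
  domain D /\
  loc_hypograph (fun zeta : R -> R =>
    (forall n t, (n < 2)%N -> derivable (derive1n n zeta) t 1) /\
    exists c : R, c.-lipschitz (derive1n 2 zeta)) D.

Definition alphaj (R : realType) (alpha : R) (j : int) : R := j%:~R + alpha.

Definition betaj (R : realType) (k alpha : R) (j : int) : R[i] :=
  if alphaj alpha j ^+ 2 <= k ^+ 2 then
    (Num.sqrt (k ^+ 2 - alphaj alpha j ^+ 2))%:C
  else 0 +i* Num.sqrt (alphaj alpha j ^+ 2 - k ^+ 2).

(* The series over the integers is the limit of its symmetric partial sums; it
   converges absolutely for x2 <> 0 and conditionally for x2 = 0 and x1 not in
   2 pi Z.  Values at the points (2 pi m, 0) are irrelevant. *)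
Definition green (R : realType) (k alpha : R) (x : R * R) : R[i] :=
  (0 +i* (4 * pi)^-1) *
  clim (fun n => \sum_(j \in [set j : int | `|j| <= n%:Z])
    ((betaj k alpha j)^-1 *
     cexp ((0 +i* (alphaj alpha j * x.1)) +
           (0 +i* 1) * betaj k alpha j * `|x.2|%:C))).

(* Representative of t modulo 2 r in [-r, r). *)
Definition wrap (R : realType) (r t : R) : R :=
  t - 2 * r * (Num.floor ((t + r) / (2 * r)))%:~R.

Definition KR (R : realType) (k alpha rR : R) (x : R * R) : R[i] :=
  green k alpha (x.1, wrap rR x.2).

Definition Ksm (R : realType) (k alpha rR : R) (chi : R -> R) (x : R * R) :
    R[i] :=
  (chi x.2)%:C * KR k alpha rR x.

Definition cutoff (R : realType) (rho rR : R) (chi : R -> R) : Prop :=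
  [/\ (forall n t, (n < 3)%N -> derivable (derive1n n chi) t 1) /\
        continuous (derive1n 3 chi),
      forall t, chi (t + 2 * rR) = chi t,
      forall t, 0 <= chi t <= 1,
      forall t, `|t| <= 2 * rho -> chi t = 1 &
      forall n, (n <= 3)%N -> derive1n n chi rR = 0].

Definition vpot (R : realType) (A : set (R * R)) (K : R * R -> R[i])
    (f : R * R -> R[i] * R[i]) (x : R * R) : R[i] * R[i] :=
  (cint A (fun y => K (x - y) * (f y).1), cint A (fun y => K (x - y) * (f y).2)).

Definition Lop (R : realType) (k alpha : R) (D : set (R * R))
    (f : R * R -> R[i] * R[i]) : R * R -> R[i] :=
  wdiv D (vpot D (green k alpha) f).

Definition Lper (R : realType) (k alpha rR : R) (chi : R -> R)
    (f : R * R -> R[i] * R[i]) : R * R -> R[i] :=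
  wdiv (Omega rR) (vpot (Omega rR) (Ksm k alpha rR chi) f).

Definition rscale (R : realType) (q : R * R -> R) (g : R * R -> R[i] * R[i])
    (x : R * R) : R[i] * R[i] :=
  ((q x)%:C * (g x).1, (q x)%:C * (g x).2).

Definition extend0 (R : realType) (D : set (R * R)) (f : R * R -> R[i] * R[i])
    (x : R * R) : R[i] * R[i] :=
  if `[< D x >] then f x else (0, 0).

Definition scatter_eq (R : realType) (k alpha : R) (D : set (R * R))
    (q : R * R -> R) (F u : R * R -> R[i]) : Prop :=
  aeq D (fun x => u x - Lop k alpha D (rscale q (wgrad D u)) x) F.

Definition per_op (R : realType) (k alpha rR : R) (chi : R -> R)
    (q : R * R -> R) (u : R * R -> R[i]) (x : R * R) : R[i] :=
  u x - Lper k alpha rR chi (rscale q (wgrad (Omega rR) u)) x.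

Definition per_eq (R : realType) (k alpha rR : R) (chi : R -> R)
    (q : R * R -> R) (F u : R * R -> R[i]) : Prop :=
  aeq (Omega rR) (per_op k alpha rR chi q u) F.

Definition phij (R : realType) (alpha rR : R) (j : int * int) (x : R * R) :
    R[i] :=
  ((Num.sqrt (4 * pi * rR))^-1)%:C *
  cexp (0 +i* ((j.1%:~R + alpha) * x.1 + j.2%:~R * pi / rR * x.2)).

Definition fhat (R : realType) (alpha rR : R) (f : R * R -> R[i])
    (j : int * int) : R[i] :=
  cint (Omega rR) (fun x => f x * (phij alpha rR j x)^*).

Definition hweight (R : realType) (s : R) (j : int * int) : R :=
  (1 + (j.1%:~R ^+ 2 + j.2%:~R ^+ 2)) `^ s.

Definition Hnorm (R : realType) (alpha rR s : R) (f : R * R -> R[i]) : \bar R :=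
  ((\esum_(j in [set: int * int])
      (hweight s j * sqnormc (fhat alpha rR f j))%:E) `^ (2^-1))%E.

Definition Hper (R : realType) (alpha rR s : R) (f : R * R -> R[i]) : Prop :=
  L2 (Omega rR) f /\ (Hnorm alpha rR s f < +oo)%E.

(* The series is absolutely convergent on H^s_per, so summation over squares
   gives its unordered sum. *)
Definition Hinner (R : realType) (alpha rR s : R) (f g : R * R -> R[i]) : R[i] :=
  clim (fun n => \sum_(j \in [set j : int * int |
                               (`|j.1| <= n%:Z) && (`|j.2| <= n%:Z)])
    ((hweight s j)%:C * fhat alpha rR f j * (fhat alpha rR g j)^*)).

Definition Z2N (N : nat) : set (int * int) :=
  [set j | [&& - N%:Z < j.1 *+ 2, j.1 *+ 2 <= N%:Z,
               - N%:Z < j.2 *+ 2 & j.2 *+ 2 <= N%:Z]].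

Definition TN (R : realType) (alpha rR : R) (N : nat) (w : R * R -> R[i]) :=
  exists c : int * int -> R[i],
    forall x, w x = \sum_(j \in Z2N N) (c j * phij alpha rR j x).

Definition galerkin_sol (R : realType) (k alpha rR : R) (chi : R -> R)
    (q : R * R -> R) (N : nat) (F uN : R * R -> R[i]) : Prop :=
  TN alpha rR N uN /\
  forall w, TN alpha rR N w ->
    Hinner alpha rR 1 (per_op k alpha rR chi q uN) w = Hinner alpha rR 1 F w.

Definition best_approx (R : realType) (alpha rR : R) (N : nat)
    (u : R * R -> R[i]) : \bar R :=
  ereal_inf [set Hnorm alpha rR 1 (w \- u) | w in TN alpha rR N].

(* Main.v *)
(* In the Fourier basis the periodized operator reads
   (A c)_j = c_j - kap_j * sum_b i xi_b(j) (q grad u)^_b(j), where kap_j is a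
   Fourier coefficient of the smoothed kernel.  Integrating the kernel twice by
   parts in x2 gives (1 + |xi(j)|^2) kap_j -> 1, so that
   testing with c in the weighted inner product yields, since q >= 0, a Garding
   inequality: identity plus a nonnegative part, up to finitely many modes and a
   small remainder.  A is injective: a solution of the homogeneous periodized
   equation restricts to a solution of the scattering equation on D, because the
   smoothed kernel agrees with the Green function on D - D, hence its gradient
   vanishes on D by uniqueness and it is itself 0.  A compactness argument now
   gives the stability of the Galerkin matrices for large N, from which both
   solvability of the equation and quasi-optimality follow. *)

Require Import Defs.
From HB Require Import structures.
From mathcomp Require Import all_boot all_order all_algebra.
From mathcomp Require Import complex finmap.
From mathcomp Require Import all_classical all_reals all_analysis.
From mathcomp Require Import measurable_realfun.
From mathcomp Require Import ring lra zify.
Set Implicit Arguments.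
Unset Strict Implicit.
Unset Printing Implicit Defensive.
Import Order.TTheory GRing.Theory Num.Theory.
Import numFieldNormedType.Exports.
Local Open Scope classical_set_scope.
Local Open Scope complex_scope.
Local Open Scope ring_scope.

(** The trial functions are orthogonal in every periodic Sobolev space, so testing with one basis
    function at a time turns the Galerkin problem into the equations (A c)_j = F_j for j in Z_N. The
    inner product drops out of the equations, and any equivalent weight may measure the error; 1 +
    |xi(j)|^2, built from the true frequencies, is the one for which the energy identity has a sign.
    No Fredholm theory is used: stability makes the square systems invertible, and a limit of their
    solutions along an ultrafilter, which supplies limits of all coefficients at once, solves the
    periodized equation. The remaining work links coefficients with the functions of the statement.
    There [wgrad] and [wdiv] are arbitrary representatives, determined up to null sets; the series
    of the kernel is treated, for each fixed x, as an orthogonal series in y; and uniqueness on D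
    concerns restrictions of quasi-periodic functions on the whole plane, so Fourier series have to
    be summed in L^2 on all large boxes and not on one period cell only. *)

Local Notation RR R := (measurableTypeR R * measurableTypeR R)%type.

(** * Complex arithmetic through real and imaginary parts *)

Lemma cReD (R : realType) (z w : R[i]) :
  complex.Re (z + w) = complex.Re z + complex.Re w.
Proof. by case: z w => [a b] [c d]. Qed.

Lemma cImD (R : realType) (z w : R[i]) :
  complex.Im (z + w) = complex.Im z + complex.Im w.
Proof. by case: z w => [a b] [c d]. Qed.

Lemma cReN (R : realType) (z : R[i]) : complex.Re (- z) = - complex.Re z.
Proof. by case: z. Qed.

Lemma cImN (R : realType) (z : R[i]) : complex.Im (- z) = - complex.Im z.
Proof. by case: z. Qed.

Lemma cReM (R : realType) (z w : R[i]) :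
  complex.Re (z * w) = complex.Re z * complex.Re w - complex.Im z * complex.Im w.
Proof. by case: z w => [a b] [c d]. Qed.

Lemma cImM (R : realType) (z w : R[i]) :
  complex.Im (z * w) = complex.Re z * complex.Im w + complex.Im z * complex.Re w.
Proof. by case: z w => [a b] [c d]. Qed.

Lemma cReJ (R : realType) (z : R[i]) : complex.Re (z^*) = complex.Re z.
Proof. by case: z. Qed.

Lemma cImJ (R : realType) (z : R[i]) : complex.Im (z^*) = - complex.Im z.
Proof. by case: z. Qed.

Lemma cRe_sum (R : realType) (I : Type) (s : seq I) (P : pred I) (F : I -> R[i]) :
  complex.Re (\sum_(i <- s | P i) F i) = \sum_(i <- s | P i) complex.Re (F i).
Proof. exact: (big_morph _ (@cReD R) erefl). Qed.

Lemma complexP (R : realType) (z w : R[i]) :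
  complex.Re z = complex.Re w -> complex.Im z = complex.Im w -> z = w.
Proof. by case: z w => [a b] [c d] /= -> ->. Qed.

Lemma JrealC (R : realType) (x : R) : (x%:C)^* = x%:C.
Proof. by apply: complexP; rewrite /= ?oppr0. Qed.

Lemma sqnormc_ge0 (R : realType) (z : R[i]) : 0 <= sqnormc z.
Proof. by rewrite addr_ge0 ?sqr_ge0. Qed.

Lemma sqnormc0 (R : realType) : sqnormc (0 : R[i]) = 0.
Proof. by rewrite /sqnormc /= expr0n addr0. Qed.

Lemma sqnormcM (R : realType) (z w : R[i]) :
  sqnormc (z * w) = sqnormc z * sqnormc w.
Proof. rewrite /sqnormc cReM cImM; ring. Qed.

Lemma sqnormcN (R : realType) (z : R[i]) : sqnormc (- z) = sqnormc z.
Proof. by rewrite /sqnormc cReN cImN !sqrrN. Qed.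

Lemma sqnormcJ (R : realType) (z : R[i]) : sqnormc (z^*) = sqnormc z.
Proof. by rewrite /sqnormc cReJ cImJ sqrrN. Qed.

Lemma sqnormc_real (R : realType) (x : R) : sqnormc x%:C = x ^+ 2.
Proof. by rewrite /sqnormc /= expr0n addr0. Qed.

Lemma sqnormci (R : realType) (x : R) : sqnormc (0 +i* x) = x ^+ 2.
Proof. by rewrite /sqnormc /= expr0n add0r. Qed.

Lemma sqnormc_eq0 (R : realType) (z : R[i]) : sqnormc z = 0 -> z = 0.
Proof.
move=> /eqP; rewrite paddr_eq0 ?sqr_ge0// !sqrf_eq0 => /andP[/eqP a /eqP b].
exact: complexP.
Qed.

Lemma sqnormcD (R : realType) (z w : R[i]) :
  sqnormc (z + w) <= 2 * (sqnormc z + sqnormc w).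
Proof.
rewrite /sqnormc cReD cImD.
have := sqr_ge0 (complex.Re z - complex.Re w).
have := sqr_ge0 (complex.Im z - complex.Im w); nra.
Qed.

Lemma mulcJ (R : realType) (z : R[i]) : z * z^* = (sqnormc z)%:C.
Proof. by apply: complexP; rewrite ?cReM ?cImM ?cReJ ?cImJ /sqnormc/=; ring. Qed.

(** The norm [|z|] of [R[i]] takes its values in [R[i]]; estimates need a modulus in [R]. *)
Definition cabs (R : realType) (z : R[i]) : R := Num.sqrt (sqnormc z).

Lemma cabs_ge0 (R : realType) (z : R[i]) : 0 <= cabs z.
Proof. exact: sqrtr_ge0. Qed.

Lemma cabs_sqr (R : realType) (z : R[i]) : cabs z ^+ 2 = sqnormc z.
Proof. by rewrite sqr_sqrtr ?sqnormc_ge0. Qed.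

Lemma cabs0 (R : realType) : cabs (0 : R[i]) = 0.
Proof. by rewrite /cabs sqnormc0 sqrtr0. Qed.

Lemma cabsM (R : realType) (z w : R[i]) : cabs (z * w) = cabs z * cabs w.
Proof. by rewrite /cabs sqnormcM sqrtrM ?sqnormc_ge0. Qed.

Lemma cabsN (R : realType) (z : R[i]) : cabs (- z) = cabs z.
Proof. by rewrite /cabs sqnormcN. Qed.

Lemma cabsJ (R : realType) (z : R[i]) : cabs (z^*) = cabs z.
Proof. by rewrite /cabs sqnormcJ. Qed.

Lemma cabs_real (R : realType) (x : R) : cabs x%:C = `|x|.
Proof. by rewrite /cabs sqnormc_real sqrtr_sqr. Qed.

Lemma cabsi (R : realType) (x : R) : cabs (0 +i* x) = `|x|.
Proof. by rewrite /cabs sqnormci sqrtr_sqr. Qed.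

Lemma Re_le_cabs (R : realType) (z : R[i]) : `|complex.Re z| <= cabs z.
Proof. by rewrite -sqrtr_sqr ler_wsqrtr// lerDl sqr_ge0. Qed.

Lemma Im_le_cabs (R : realType) (z : R[i]) : `|complex.Im z| <= cabs z.
Proof. by rewrite -sqrtr_sqr ler_wsqrtr// lerDr sqr_ge0. Qed.

Lemma cabs_le_ReIm (R : realType) (z : R[i]) :
  cabs z <= `|complex.Re z| + `|complex.Im z|.
Proof.
rewrite -(@ler_pXn2r _ 2) ?nnegrE ?cabs_ge0 ?addr_ge0// cabs_sqr /sqnormc.
rewrite -(real_normK (num_real (complex.Re z))).
rewrite -(real_normK (num_real (complex.Im z))).
have := normr_ge0 (complex.Re z); have := normr_ge0 (complex.Im z); nra.
Qed.

Lemma cabsD (R : realType) (z w : R[i]) : cabs (z + w) <= cabs z + cabs w.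
Proof.
rewrite -(@ler_pXn2r _ 2) ?nnegrE ?cabs_ge0 ?addr_ge0 ?cabs_ge0//.
rewrite sqrrD !cabs_sqr.
have -> : sqnormc (z + w) = sqnormc z + sqnormc w + 2 * complex.Re (z * w^*).
  rewrite /sqnormc cReD cImD cReM cReJ cImJ; ring.
have h : complex.Re (z * w^*) <= cabs z * cabs w.
  by rewrite -(cabsJ w) -cabsM; exact: le_trans (ler_norm _) (Re_le_cabs _).
rewrite mulr2n; lra.
Qed.

Lemma cabs_sum (R : realType) (I : Type) (s : seq I) (P : pred I) (F : I -> R[i]) :
  cabs (\sum_(i <- s | P i) F i) <= \sum_(i <- s | P i) cabs (F i).
Proof.
elim/big_ind2 : _ => //; first by rewrite cabs0.
move=> x1 x2 y1 y2 h1 h2; exact: le_trans (cabsD _ _) (lerD h1 h2).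
Qed.

(** * Complex inner product spaces *)

(** The form is only positive semidefinite: functions that agree almost everywhere are not
    identified, so equality of vectors reads [nsq (f - g) = 0]. Membership is a predicate because
    [ip] is sesquilinear on square-integrable functions only. *)
Record inner_space (R : realType) (V : lmodType R[i]) (S : V -> Prop)
    (ip : V -> V -> R[i]) : Prop := InnerSpace {
  inner0 : S 0;
  innerD : forall f g, S f -> S g -> S (f + g);
  innerZ : forall (a : R[i]) f, S f -> S (a *: f);
  inner_ipD : forall f g h, S f -> S g -> S h -> ip (f + g) h = ip f h + ip g h;
  inner_ipZ : forall (a : R[i]) f h, S f -> S h -> ip (a *: f) h = a * ip f h;
  inner_ipC : forall f g, S f -> S g -> ip g f = (ip f g)^*;
  inner_ge0 : forall f, S f -> 0 <= complex.Re (ip f f) }.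

Definition nsq (R : realType) (V : lmodType R[i]) (ip : V -> V -> R[i]) (f : V) : R :=
  complex.Re (ip f f).

Definition proj (R : realType) (V : lmodType R[i]) (ip : V -> V -> R[i])
    (I : Type) (e : I -> V) (s : seq I) (f : V) : V :=
  \sum_(i <- s) ip f (e i) *: e i.

Section inner_product.
Variables (R : realType) (V : lmodType R[i]) (S : V -> Prop) (ip : V -> V -> R[i]).
Hypothesis H : inner_space S ip.
Local Notation nsq := (nsq ip).
Let S0 := inner0 H.
Let SD := innerD H.
Let SZ := innerZ H.
Let ipDl := inner_ipD H.
Let ipZl := inner_ipZ H.
Let ipC := inner_ipC H.
Let ip_ge0 := inner_ge0 H.

Lemma spanS (I : Type) (s : seq I) (P : pred I) (F : I -> V) :
  (forall i, S (F i)) -> S (\sum_(i <- s | P i) F i).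
Proof. by move=> h; elim/big_ind : _. Qed.

Lemma SN f : S f -> S (- f).
Proof. by move=> h; rewrite -scaleN1r; exact: SZ. Qed.

Lemma SB f g : S f -> S g -> S (f - g).
Proof. by move=> Sf Sg; apply: SD => //; exact: SN. Qed.

Lemma ipDr f g h : S f -> S g -> S h -> ip h (f + g) = ip h f + ip h g.
Proof.
move=> Sf Sg Sh; rewrite (ipC (SD Sf Sg) Sh) (ipDl Sf Sg Sh) rmorphD/=.
by rewrite -(ipC Sf Sh) -(ipC Sg Sh).
Qed.

Lemma ipZr (a : R[i]) f h : S f -> S h -> ip h (a *: f) = a^* * ip h f.
Proof.
move=> Sf Sh; rewrite (ipC (SZ a Sf) Sh) (ipZl a Sf Sh) rmorphM/=.
by rewrite -(ipC Sf Sh).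
Qed.

Lemma ip0l f : S f -> ip 0 f = 0.
Proof. by move=> Sf; rewrite -(scale0r 0) ipZl ?mul0r. Qed.

Lemma ipNl f g : S f -> S g -> ip (- f) g = - ip f g.
Proof. by move=> Sf Sg; rewrite -scaleN1r ipZl// mulN1r. Qed.

Lemma ipNr f g : S f -> S g -> ip f (- g) = - ip f g.
Proof. by move=> Sf Sg; rewrite -scaleN1r ipZr// rmorphN rmorph1 mulN1r. Qed.

Lemma ipBl f g h : S f -> S g -> S h -> ip (f - g) h = ip f h - ip g h.
Proof. by move=> *; rewrite ipDl ?ipNl//; exact: SN. Qed.

Lemma ipBr f g h : S f -> S g -> S h -> ip h (f - g) = ip h f - ip h g.
Proof. by move=> *; rewrite ipDr ?ipNr//; exact: SN. Qed.

Lemma ip_suml (I : Type) (s : seq I) (P : pred I) (F : I -> V) h :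
  (forall i, S (F i)) -> S h ->
  ip (\sum_(i <- s | P i) F i) h = \sum_(i <- s | P i) ip (F i) h.
Proof.
move=> SF Sh; elim: s => [|i s IH]; first by rewrite !big_nil ip0l.
rewrite !big_cons; case: ifP => // _; rewrite ipDl ?IH//; exact: spanS.
Qed.

Lemma ip_sumr (I : Type) (s : seq I) (P : pred I) (F : I -> V) h :
  (forall i, S (F i)) -> S h ->
  ip h (\sum_(i <- s | P i) F i) = \sum_(i <- s | P i) ip h (F i).
Proof.
move=> SF Sh; rewrite (ipC (spanS s P SF) Sh) ip_suml// rmorph_sum/=.

by apply: eq_bigr => i _; rewrite -(ipC (SF i) Sh).
Qed.

Lemma ipff f : S f -> ip f f = (nsq f)%:C.
Proof.
move=> Sf; apply: complexP => //=.
by have /(congr1 (@complex.Im R)) := ipC Sf Sf; rewrite cImJ => ?; lra.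
Qed.

Lemma nsq_ge0 f : S f -> 0 <= nsq f.
Proof. exact: ip_ge0. Qed.

Lemma nsqDE f g : S f -> S g -> nsq (f + g) = nsq f + nsq g + 2 * complex.Re (ip f g).
Proof.
move=> Sf Sg; rewrite /nsq ipDl ?ipDr ?(ipC Sf Sg)//; last exact: SD.
by rewrite !cReD cReJ; ring.
Qed.

Lemma nsqZ (a : R[i]) f : S f -> nsq (a *: f) = sqnormc a * nsq f.
Proof.
move=> Sf; rewrite /nsq ipZl ?ipZr//; last exact: SZ.
by rewrite mulrA mulcJ cReM /= mul0r subr0.
Qed.

Lemma nsqN f : S f -> nsq (- f) = nsq f.
Proof. by move=> Sf; rewrite -scaleN1r nsqZ// sqnormcN (sqnormc_real 1) expr1n mul1r. Qed.

Lemma cauchy_schwarz f g : S f -> S g -> sqnormc (ip f g) <= nsq f * nsq g.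
Proof.
move=> Sf Sg; set t := ip f g.
(* This is [nsq (f - x t g) >= 0] for real x, with t = [ip f g]. *)
have Q (x : R) : 0 <= nsq f - 2 * x * sqnormc t + x ^+ 2 * sqnormc t * nsq g.
  have SZg : S ((- (x%:C * t)) *: g) by exact: SZ.
  have := nsq_ge0 (SD Sf SZg); rewrite nsqDE// nsqZ// ipZr// -/t.
  rewrite sqnormcN sqnormcM sqnormc_real rmorphN mulNr cReN rmorphM/= JrealC.
  rewrite -[x%:C * _ * t]mulrA [_^* * t]mulrC mulcJ /= mul0r subr0.
  by move=> h; apply: le_trans h _; lra.
have gg := nsq_ge0 Sg; have ff := nsq_ge0 Sf; have tt := sqnormc_ge0 t.
have [g0|g0] := eqVneq (nsq g) 0.
  rewrite g0 mulr0 leNgt; apply/negP => t0.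
  (* When [nsq g] = 0, Q is affine in x with negative slope; this x makes it equal to - [nsq f] -
     2. *)
  have := Q ((nsq f + 1) / sqnormc t); rewrite g0 mulr0 addr0 -mulrA divfK ?gt_eqF//.
  lra.
have g1 : 0 < nsq g by rewrite lt_def g0.
have := Q (nsq g)^-1; rewrite -(pmulr_lge0 _ g1).
have -> : (nsq f - 2 * (nsq g)^-1 * sqnormc t + (nsq g)^-1 ^+ 2 * sqnormc t * nsq g)
  * nsq g = nsq f * nsq g - sqnormc t by field.
by rewrite subr_ge0.
Qed.

Lemma nsqD_le f g : S f -> S g -> nsq (f + g) <= 2 * (nsq f + nsq g).
Proof.
move=> Sf Sg.
have := nsq_ge0 (SB Sf Sg); rewrite !nsqDE//; last exact: SN.
by rewrite nsqN// ipNr// cReN; lra.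
Qed.

Lemma nsqB_le f g : S f -> S g -> nsq (f - g) <= 2 * (nsq f + nsq g).
Proof. by move=> Sf Sg; have := nsqD_le Sf (SN Sg); rewrite nsqN. Qed.

Lemma ip_null f g : S f -> S g -> nsq f = 0 -> ip f g = 0.
Proof.
move=> Sf Sg f0; apply: sqnormc_eq0; apply/eqP; rewrite eq_le sqnormc_ge0 andbT.
by have := cauchy_schwarz Sf Sg; rewrite f0 mul0r.
Qed.

Section orthonormal.
Variables (I : eqType) (e : I -> V).
Hypothesis Se : forall i, S (e i).
Hypothesis ipe : forall i j, ip (e i) (e j) = (i == j)%:R.

Local Notation proj := (proj ip e).

Lemma Scomb (s : seq I) (c : I -> R[i]) : S (\sum_(i <- s) c i *: e i).
Proof. by apply: spanS => i; exact: SZ. Qed.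

Lemma Sproj s f : S (proj s f). Proof. exact: Scomb. Qed.

Lemma ip_comb (s : seq I) (c : I -> R[i]) j : uniq s ->
  ip (\sum_(i <- s) c i *: e i) (e j) = if j \in s then c j else 0.
Proof.
move=> us; rewrite ip_suml//; last by move=> i; exact: SZ.
rewrite (eq_bigr (fun i => if i == j then c i else 0)); last first.
  move=> i _; rewrite ipZl// ipe.
  by case: (i == j); rewrite ?mulr1 ?mulr0.
rewrite -big_mkcond/=; case: ifPn => js.
  by rewrite (big_rem j)//= eqxx big1_seq ?addr0// => i /andP[/eqP ->]; rewrite mem_rem_uniqF.
by rewrite big1_seq// => i /andP[/eqP ->]; rewrite (negbTE js).
Qed.

Lemma nsq_comb (s : seq I) (c : I -> R[i]) : uniq s ->
  nsq (\sum_(i <- s) c i *: e i) = \sum_(i <- s) sqnormc (c i).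
Proof.
move=> us; rewrite /nsq ip_sumr; [|by move=> i; exact: SZ|exact: Scomb].
rewrite cRe_sum; apply: eq_big_seq => i is_; rewrite ipZr//; last exact: Scomb.
by rewrite ip_comb// is_ mulrC mulcJ.
Qed.

Lemma ip_projr s f g : S f -> S g ->
  ip f (proj s g) = \sum_(i <- s) ip f (e i) * (ip g (e i))^*.
Proof.
move=> Sf Sg; rewrite ip_sumr//; last by move=> i; exact: SZ.
by apply: eq_bigr => i _; rewrite ipZr// mulrC.
Qed.

Lemma nsq_proj s f : uniq s -> S f ->
  nsq f = \sum_(i <- s) sqnormc (ip f (e i)) + nsq (f - proj s f).
Proof.
move=> us Sf; have SP := Sproj s f.
rewrite nsqDE//; last exact: SN.
rewrite nsqN// ipNr// cReN nsq_comb// ip_projr// cRe_sum.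
rewrite [X in - X](eq_bigr (fun i => sqnormc (ip f (e i)))); first by ring.
by move=> i _; rewrite mulcJ.
Qed.

Lemma bessel s f : uniq s -> S f -> \sum_(i <- s) sqnormc (ip f (e i)) <= nsq f.
Proof.
move=> us Sf; rewrite (nsq_proj us Sf) lerDl.
by apply: nsq_ge0; apply: SB => //; exact: Sproj.
Qed.

End orthonormal.
End inner_product.

(** * Limits of complex sequences along a filter *)

Definition cvgc (R : realType) (F : set_system nat) (z : nat -> R[i]) (l : R[i]) :=
  forall eps : R, 0 < eps -> F [set n | sqnormc (z n - l) < eps].

Section cvgc.
Variables (R : realType) (F : set_system nat).
Context {FF : ProperFilter F}.

Lemma cvgc_cst (l : R[i]) : cvgc F (fun=> l) l.
Proof.
move=> eps e0; rewrite (_ : mkset _ = setT); first exact: filterT.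
by apply/seteqP; split => // n _; rewrite /= subrr sqnormc0.
Qed.

Lemma cvgcD (z w : nat -> R[i]) k l :
  cvgc F z k -> cvgc F w l -> cvgc F (fun n => z n + w n) (k + l).
Proof.
move=> hz hw eps e0.
have e4 : 0 < eps / 4 by lra.
apply: filterS (filterI (hz _ e4) (hw _ e4)) => n /= [h1 h2].
have -> : z n + w n - (k + l) = (z n - k) + (w n - l) by ring.
have := sqnormcD (z n - k) (w n - l); lra.
Qed.

Lemma cvgcZ (a : R[i]) (z : nat -> R[i]) l :
  cvgc F z l -> cvgc F (fun n => a * z n) (a * l).
Proof.
move=> hz eps e0; have a0 := sqnormc_ge0 a.
have e1 : 0 < eps / (sqnormc a + 1) by rewrite divr_gt0//; lra.
apply: filterS (hz _ e1) => n /=; rewrite -mulrBr sqnormcM ltr_pdivlMr; last lra.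
have := sqnormc_ge0 (z n - l); nra.
Qed.

Lemma cvgc_sum (I : eqType) (s : seq I) (z : I -> nat -> R[i]) (l : I -> R[i]) :
  (forall i, i \in s -> cvgc F (z i) (l i)) ->
  cvgc F (fun n => \sum_(i <- s) z i n) (\sum_(i <- s) l i).
Proof.
elim: s => [_|i s IH h].
  by under eq_fun do rewrite big_nil; rewrite big_nil; exact: cvgc_cst.
under eq_fun do rewrite big_cons; rewrite big_cons; apply: cvgcD.
  by apply: h; rewrite mem_head.
by apply: IH => j js; apply: h; rewrite inE js orbT.
Qed.

Lemma cvgc_unique (z : nat -> R[i]) k l : cvgc F z k -> cvgc F z l -> k = l.
Proof.
move=> hk hl; apply/eqP; rewrite -subr_eq0; apply/eqP/sqnormc_eq0/eqP.
rewrite eq_le sqnormc_ge0 andbT leNgt; apply/negP => e0.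
have e4 : 0 < sqnormc (k - l) / 4 by lra.
have [n [/= h1 h2]] := filter_ex (filterI (hk _ e4) (hl _ e4)).
have := sqnormcD (z n - l) (- (z n - k)); rewrite sqnormcN.
have -> : z n - l + - (z n - k) = k - l by ring.
lra.
Qed.

Lemma cvgc_near (z w : nat -> R[i]) l :
  F [set n | z n = w n] -> cvgc F w l -> cvgc F z l.
Proof. by move=> h hw eps /hw; move: h; apply: filterS2 => n /= ->. Qed.

Lemma cvgc_sqnormc_le (z : nat -> R[i]) l (B : R) :
  (forall n, sqnormc (z n) <= B) -> cvgc F z l -> sqnormc l <= B.
Proof.
move=> hB hz; apply/ler_addgt0Pr => eps e0.
(* With |z_n| <= B + 1 and d <= 1 one has (|z_n| + d)^2 <= B + 2 (B + 2) d, and this d brings the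
   excess down to eps. *)
have d0 : 0 < Num.min 1 (eps / (2 * (B + 2))) .
  by rewrite lt_min ltr01 divr_gt0//; have := hB 0%N; have := sqnormc_ge0 (z 0%N); lra.
have B0 : 0 <= B := le_trans (sqnormc_ge0 _) (hB 0%N).
have h2 := hz _ (exprn_gt0 2 d0); have [n /= h] := filter_ex h2.
set d := Num.min _ _ in d0 h h2; have d1 : d <= 1 by rewrite ge_min lexx.
have de : d * (2 * (B + 2)) <= eps.
  by rewrite -ler_pdivlMr ?ge_min ?lexx ?orbT//; lra.
have hc : cabs (l - z n) <= d.
  rewrite -cabsN opprB -(@ler_pXn2r _ 2) ?nnegrE ?cabs_ge0 ?(ltW d0)// cabs_sqr.
  exact: ltW.
have hz1 : cabs (z n) <= B + 1.
  rewrite -(@ler_pXn2r _ 2) ?nnegrE ?cabs_ge0 ?addr_ge0// cabs_sqr.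
  by apply: le_trans (hB n) _; nra.
have hzB : cabs (z n) ^+ 2 <= B by rewrite cabs_sqr.
have := cabsD (z n) (l - z n); rewrite addrC subrK => hl.
have c0 := cabs_ge0 l; have c1 := cabs_ge0 (z n).
rewrite -cabs_sqr; have : cabs l <= cabs (z n) + d by lra.
nra.
Qed.

End cvgc.

(** The limit is the supremum of those a that lie below the sequence F-almost always. Above it, the
    ultrafilter property turns not being in F into the complement being in F. *)
Lemma ultra_bounded_cvg (R : realType) (F : set_system nat) (x : nat -> R) (B : R) :
  UltraFilter F -> (forall n, `|x n| <= B) ->
  exists l, forall eps : R, 0 < eps -> F [set n | `|x n - l| < eps].
Proof.
move=> UF hB; have FF : ProperFilter F := @ultra_proper _ _ UF.
pose E := [set a : R | F [set n | a <= x n]].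
have EB : E (- B).
  rewrite /E/= (_ : mkset _ = setT); first exact: filterT.
  by apply/seteqP; split => // n _ /=; have := hB n; rewrite ler_norml => /andP[].
have ubE : ubound E B.
  move=> a /= /filter_ex[n /= h]; have := hB n; rewrite ler_norml => /andP[_].
  exact: le_trans.
have sE : has_sup E by split; [exists (- B)|exists B].
exists (sup E) => eps e0.
have [a Ea ha] := sup_adherent e0 sE.
have nE : ~ E (sup E + eps).
  by move=> /(ub_le_sup sE.2); rewrite leNgt ltrDl e0.
have [//|] := in_ultra_setVsetC [set n | sup E + eps <= x n] UF.
move=> hF; apply: filterS (filterI Ea hF) => n /= [h1 /negP]; rewrite -ltNge => h2.
by rewrite ltr_norml; apply/andP; split; lra.
Qed.

Lemma ultra_bounded_cvgc (R : realType) (F : set_system nat) (z : nat -> R[i]) (B : R) :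
  UltraFilter F -> (forall n, sqnormc (z n) <= B) -> exists l, cvgc F z l.
Proof.
move=> UF hB; have FF : ProperFilter F := @ultra_proper _ _ UF.
have hb n : cabs (z n) <= B + 1.
  rewrite -(@ler_pXn2r _ 2) ?nnegrE ?cabs_ge0//; last first.
    by rewrite addr_ge0//; exact: le_trans (sqnormc_ge0 _) (hB 0%N).
  rewrite cabs_sqr (le_trans (hB n))//.
  have := le_trans (sqnormc_ge0 _) (hB 0%N); nra.
have [a ha] := ultra_bounded_cvg UF (fun n => le_trans (Re_le_cabs (z n)) (hb n)).
have [b hb'] := ultra_bounded_cvg UF (fun n => le_trans (Im_le_cabs (z n)) (hb n)).
exists (a +i* b) => eps e0.
have e1 : 0 < Num.sqrt (eps / 2) by rewrite sqrtr_gt0; lra.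
apply: filterS (filterI (ha _ e1) (hb' _ e1)) => n /= [h1 h2].
have sq (x : R) : `|x| < Num.sqrt (eps / 2) -> x ^+ 2 < eps / 2.
  move=> h; rewrite -(real_normK (num_real x)) -[ltRHS]sqr_sqrtr; last lra.
  by rewrite ltrXn2r ?nnegrE ?sqrtr_ge0// ?h.
rewrite /sqnormc cReD cImD cReN cImN /=.
by have := sq _ h1; have := sq _ h2; lra.
Qed.

(** Completeness of the space enters only through [basis_riesz], the Riesz-Fischer property, and
    density of the span only through [basis_total]. The finite sets [Z n] fix the order of summation
    and serve later as the Galerkin index sets. *)
Record hilbert_basis (R : realType) (V : lmodType R[i]) (S : V -> Prop)
    (ip : V -> V -> R[i]) (I : choiceType) (e : I -> V) (Z : nat -> {fset I}) : Prop :=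
  HilbertBasis {
  basisS : forall i, S (e i);
  basis_ip : forall i j, ip (e i) (e j) = (i == j)%:R;
  basis_mono : forall m n, (m <= n)%N -> {subset Z m <= Z n};
  basis_exh : forall i, exists n, i \in Z n;
  basis_total : forall f, S f -> (forall i, ip f (e i) = 0) -> nsq ip f = 0;
  basis_riesz : forall (c : I -> R[i]) B,
    (forall n, \sum_(i <- Z n) sqnormc (c i) <= B) ->
    exists2 f, S f & forall eps : R, 0 < eps -> exists N, forall n, (N <= n)%N ->
      nsq ip (f - \sum_(i <- Z n) c i *: e i) < eps }.

(** A chosen vector with the prescribed coefficients, 0 if there is none. The choice is neither
    unique nor linear in [c]. *)
Definition riesz (R : realType) (V : lmodType R[i]) (S : V -> Prop)
    (ip : V -> V -> R[i]) (I : choiceType) (e : I -> V) (c : I -> R[i]) : V :=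
  xget 0 [set f | S f /\ forall i, ip f (e i) = c i].

Section hilbert_basis.
Variables (R : realType) (V : lmodType R[i]) (S : V -> Prop) (ip : V -> V -> R[i]).
Variables (I : choiceType) (e : I -> V) (Z : nat -> {fset I}).
Hypothesis H : inner_space S ip.
Hypothesis HB : hilbert_basis S ip e Z.
Local Notation nsq := (nsq ip).
Local Notation proj := (proj ip e).
Let Se := basisS HB.
Let ipe := basis_ip HB.

Lemma nsq_basis i : nsq (e i) = 1.
Proof. by rewrite /nsq ipe eqxx. Qed.

Lemma lim_coef f (c : I -> R[i]) : S f ->
  (forall eps : R, 0 < eps -> exists N, forall n, (N <= n)%N ->
    nsq (f - \sum_(i <- Z n) c i *: e i) < eps) ->
  forall i, ip f (e i) = c i.
Proof.
move=> Sf hf i.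
apply/eqP; rewrite -subr_eq0; apply/eqP/sqnormc_eq0/eqP.
rewrite eq_le sqnormc_ge0 andbT leNgt; apply/negP => e0.
have [N hN] := hf _ e0; have [m im] := basis_exh HB i.
have := hN _ (leq_maxl N m); set n := maxn N m => h.
have iZ : i \in Z n by apply: (basis_mono HB) im; exact: leq_maxr.
pose g := \sum_(j <- Z n) c j *: e j.
have Sg : S g by exact: (Scomb H Se).
have := cauchy_schwarz H (SB H Sf Sg) (Se i); rewrite nsq_basis mulr1.
by rewrite (ipBl H)// (ip_comb H Se ipe)// iZ leNgt h.
Qed.

Lemma riesz_coef (c : I -> R[i]) B : (forall n, \sum_(i <- Z n) sqnormc (c i) <= B) ->
  exists2 f, S f & forall i, ip f (e i) = c i.
Proof.
by move=> hB; have [f Sf hf] := basis_riesz HB hB; exists f => //; exact: lim_coef.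
Qed.

Lemma rieszP (c : I -> R[i]) B : (forall n, \sum_(i <- Z n) sqnormc (c i) <= B) ->
  S (riesz S ip e c) /\ forall i, ip (riesz S ip e c) (e i) = c i.
Proof.
by move=> hB; have [f Sf hf] := riesz_coef hB; apply: (@xgetPex _ 0 [set f | S f /\ _]); exists f.
Qed.

(** By Bessel's inequality the coefficients of f satisfy the hypothesis of [basis_riesz]; the vector
    it returns has the same coefficients, hence differs from f by a null vector by totality. *)
Lemma proj_cvg f : S f -> forall eps : R, 0 < eps ->
  exists N, forall n, (N <= n)%N -> nsq (f - proj (Z n) f) < eps.
Proof.
move=> Sf eps e0.
have hB n : \sum_(i <- Z n) sqnormc (ip f (e i)) <= nsq f by exact: (bessel H).
have [g Sg hg] := basis_riesz HB hB.
have [N hN] := hg (eps / 2) (divr_gt0 e0 (ltr0Sn R 1)).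
have gf i : ip (f - g) (e i) = 0.
  by rewrite (ipBl H)// (lim_coef Sg hg) subrr.
have fg0 := basis_total HB (SB H Sf Sg) gf.
exists N => n /hN h; have SP : S (proj (Z n) f) by exact: (Sproj H Se).
have -> : f - proj (Z n) f = (f - g) + (g - proj (Z n) f) by rewrite addrA subrK.
apply: le_lt_trans (nsqD_le H _ _) _; [exact: (SB H)|exact: (SB H)|].
by rewrite fg0 add0r; move: h; rewrite -/(proj _ _); lra.
Qed.

Lemma nsq_le_coef f B : S f ->
  (forall n, \sum_(i <- Z n) sqnormc (ip f (e i)) <= B) -> nsq f <= B.
Proof.
move=> Sf hB; apply/ler_addgt0Pr => eps e0.
have [N hN] := proj_cvg Sf e0.
have := hN N (leqnn _); rewrite (nsq_proj H Se ipe (fset_uniq (Z N)) Sf) => h.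
by rewrite lerD// ltW.
Qed.

Lemma eq_coef f g : S f -> S g -> (forall i, ip f (e i) = ip g (e i)) -> nsq (f - g) = 0.
Proof.
move=> Sf Sg fg; apply: (basis_total HB); first exact: (SB H).
by move=> i; rewrite (ipBl H)// fg subrr.
Qed.

(* Boundedness and coordinatewise convergence amount to weak convergence. *)
Lemma weak_cvg (F : set_system nat) (FF : ProperFilter F) (f_ : nat -> V) f B h :
  (forall n, S (f_ n)) -> S f -> S h -> (forall n, nsq (f_ n) <= B) ->
  (forall i, cvgc F (fun n => ip (f_ n) (e i)) (ip f (e i))) ->
  cvgc F (fun n => ip (f_ n) h) (ip f h).
Proof.
move=> Sf_ Sf Sh hB hc eps e0.
have B0 : 0 <= B := le_trans (nsq_ge0 H (Sf_ 0%N)) (hB 0%N).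
have f0 := nsq_ge0 H Sf.
pose K := 2 * (B + nsq f) + 1.
have K0 : 0 < K by rewrite /K; lra.
have [N hN] := proj_cvg Sh (divr_gt0 e0 (mulr_gt0 (ltr0Sn R 3) K0)).
have {}hN := hN N (leqnn N).
have SP : S (proj (Z N) h) by exact: (Sproj H Se).
have hP : cvgc F (fun n => ip (f_ n) (proj (Z N) h)) (ip f (proj (Z N) h)).
  rewrite (ip_projr H Se)//; under eq_fun do rewrite (ip_projr H Se)//.
  apply: cvgc_sum => i _; rewrite mulrC; under eq_fun do rewrite mulrC.
  exact: cvgcZ.
have e4 : 0 < eps / 4 by lra.
apply: filterS (hP _ e4) => n /= hn.
have -> : ip (f_ n) h - ip f h =
    (ip (f_ n) (proj (Z N) h) - ip f (proj (Z N) h)) + ip (f_ n - f) (h - proj (Z N) h).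
  have SD := SB H Sh SP.
  rewrite (ipBl H)// !(ipBr H)//; ring.
apply: le_lt_trans (sqnormcD _ _) _.
have Sfn := SB H (Sf_ n) Sf; have ShP := SB H Sh SP.
have h1 : nsq (f_ n - f) <= K.
  apply: le_trans (nsqB_le H (Sf_ n) Sf) _; have := hB n; rewrite /K; lra.
have h2 := cauchy_schwarz H Sfn ShP.
have : nsq (f_ n - f) * nsq (h - proj (Z N) h) <= K * (eps / (4 * K)).
  by apply: ler_pM; rewrite ?(nsq_ge0 H)// ltW.
have -> : K * (eps / (4 * K)) = eps / 4 by field; rewrite gt_eqF.
lra.
Qed.

End hilbert_basis.

Lemma fset_sum_supp (R : numDomainType) (I : choiceType) (s t : {fset I}) (F : I -> R) :
  (forall i, 0 <= F i) -> (forall i, i \notin t -> F i = 0) ->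
  \sum_(i <- s) F i <= \sum_(i <- t) F i.
Proof.
move=> F0 Ft; have -> : \sum_(i <- s) F i = \sum_(i <- s | i \in t) F i.
  rewrite [RHS]big_mkcond; apply: eq_bigr => i _.
  by case: ifPn => // /Ft.
have -> : \sum_(i <- s | i \in t) F i = \sum_(i <- t | i \in s) F i.
  rewrite -big_filter -[RHS]big_filter; apply: perm_big; apply: uniq_perm.
  - by rewrite filter_uniq ?fset_uniq.
  - by rewrite filter_uniq ?fset_uniq.
  - by move=> i; rewrite !mem_filter andbC.
rewrite big_mkcond; apply: ler_sum => i _; case: ifP => // _; exact: F0.
Qed.

Lemma fset_sum_sub (R : numDomainType) (I : choiceType) (s t : {fset I}) (F : I -> R) :
  (forall i, 0 <= F i) -> {subset s <= t} -> \sum_(i <- s) F i <= \sum_(i <- t) F i.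
Proof.
move=> F0 st.
have -> : \sum_(i <- s) F i = \sum_(i <- s) (if i \in s then F i else 0).
  by apply: eq_big_seq => i ->.
apply: le_trans (_ : _ <= \sum_(i <- t) (if i \in s then F i else 0)) _; last first.
  by apply: ler_sum => i _; case: ifP => // _; exact: F0.
apply: fset_sum_supp => i; first by case: ifP.
by case: ifPn => // is_; rewrite st.
Qed.

(** * The abstract Galerkin argument *)

Section galerkin.
Variables (R : realType) (V : lmodType R[i]) (S : V -> Prop) (ip : V -> V -> R[i]).
Variables (I : choiceType) (e : I -> V) (Z : nat -> {fset I}).
Hypothesis H : inner_space S ip.
Hypothesis HB : hilbert_basis S ip e Z.
Local Notation nsq := (nsq ip).
Local Notation riesz := (riesz S ip e).
Let Se := basisS HB.
Let ipe := basis_ip HB.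
Variables (Q : V -> V) (M : R) (xi : bool -> I -> R) (kap : I -> R[i]).
Hypothesis QS : forall f, S f -> S (Q f).
Hypothesis Qsym : forall f g, S f -> S g -> ip (Q f) g = ip f (Q g).
Hypothesis Q_ge0 : forall f, S f -> 0 <= complex.Re (ip (Q f) f).
Hypothesis Q_bounded : forall f, S f -> nsq (Q f) <= M * nsq f.
Hypothesis M0 : 0 <= M.

(** The symbol of 1 - Laplacian: [xi false j] and [xi true j] are the two components of the j-th
    frequency, so weighted square sums are squared H^1 norms. *)
Definition weight (j : I) : R := 1 + (xi false j ^+ 2 + xi true j ^+ 2).

Hypothesis kap_lim : forall eps : R, 0 < eps -> exists m, forall j, j \notin Z m ->
  sqnormc ((weight j)%:C * kap j - 1) <= eps.

Definition grad_coef (b : bool) (c : I -> R[i]) (j : I) : R[i] := (0 +i* xi b j) * c j.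

Definition grad_fun b c := riesz (grad_coef b c).

(** The coefficients of u - L_per(q grad u) in terms of those of u: [Q] stands for multiplication by
    q, the factor i xi_b for the divergence, and [kap] for convolution with the kernel. *)
Definition galerkin_op (c : I -> R[i]) (j : I) : R[i] :=
  c j - kap j * \sum_(b : bool) (0 +i* xi b j) * ip (Q (grad_fun b c)) (e j).

(** A bound on the squared H^1 norm by finite sums, which avoids infinite sums and extended reals in
    the abstract argument. *)
Definition wbounded (c : I -> R[i]) (B : R) :=
  forall n, \sum_(j <- Z n) weight j * sqnormc (c j) <= B.

Let A := galerkin_op.

Lemma weight_ge1 j : 1 <= weight j.
Proof. by rewrite lerDl addr_ge0 ?sqr_ge0. Qed.

Lemma weight_ge0 j : 0 <= weight j.
Proof. exact: le_trans (weight_ge1 j). Qed.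

Lemma wsq_ge0 c j : 0 <= weight j * sqnormc (c j).
Proof. by rewrite mulr_ge0 ?weight_ge0 ?sqnormc_ge0. Qed.

Lemma grad_coef_le b c j : sqnormc (grad_coef b c j) <= weight j * sqnormc (c j).
Proof.
rewrite sqnormcM sqnormci ler_wpM2r ?sqnormc_ge0// /weight.
by case: b; have := sqr_ge0 (xi false j); have := sqr_ge0 (xi true j); lra.
Qed.

Lemma grad_coef_bounded b c B : wbounded c B ->
  forall n, \sum_(j <- Z n) sqnormc (grad_coef b c j) <= B.
Proof.
by move=> hB n; apply: le_trans (hB n); apply: ler_sum => j _; exact: grad_coef_le.
Qed.

Lemma grad_funP b c B : wbounded c B -> [/\ S (grad_fun b c),
  forall j, ip (grad_fun b c) (e j) = grad_coef b c j & nsq (grad_fun b c) <= B].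
Proof.
move=> hB; have [h1 h2] := rieszP H HB (grad_coef_bounded b hB); split => //.
apply: (nsq_le_coef H HB) => // n.
by under eq_bigr do rewrite h2; exact: grad_coef_bounded.
Qed.

Lemma eq_coef_ip f g h : S f -> S g -> S h ->
  (forall i, ip f (e i) = ip g (e i)) -> ip f h = ip g h.
Proof.
move=> Sf Sg Sh fg; apply/eqP; rewrite -subr_eq0 -(ipBl H)//; apply/eqP.
by apply: (ip_null H) => //; [exact: (SB H)|exact: (eq_coef H HB)].
Qed.

(** Frees the operator from the choice made by [riesz]. [Q] is not assumed to respect null vectors;
    symmetry moves it onto the basis vector, and two vectors with equal coefficients have equal
    products with everything. *)
Lemma galerkin_opE c j (g : bool -> V) : (forall b, S (g b)) ->
  (forall b i, ip (g b) (e i) = grad_coef b c i) ->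
  A c j = c j - kap j * \sum_(b : bool) (0 +i* xi b j) * ip (Q (g b)) (e j).
Proof.
move=> Sg hg; rewrite /A /galerkin_op; congr (_ - _ * _).
apply: eq_bigr => b _; congr (_ * _).
have h : S (grad_fun b c) /\ forall i, ip (grad_fun b c) (e i) = grad_coef b c i.
  apply: (@xgetPex _ 0 [set f | S f /\ forall i, ip f (e i) = grad_coef b c i]).
  by exists (g b).
have [h1 h2] := h.
rewrite !Qsym//; apply: eq_coef_ip => //; first exact: QS.
by move=> i; rewrite h2 hg.
Qed.

(** As [riesz] is not linear, the combination of the chosen gradients is fed to [galerkin_opE] as
    another admissible gradient. *)
Lemma galerkin_op_lin a c c' B B' j : wbounded c B -> wbounded c' B' ->
  A (fun i => a * c i + c' i) j = a * A c j + A c' j.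
Proof.
move=> hB hB'.
pose g b := a *: grad_fun b c + grad_fun b c'.
have Sg b : S (grad_fun b c) by have [] := grad_funP b hB.
have Sg' b : S (grad_fun b c') by have [] := grad_funP b hB'.
have SaZ b : S (a *: grad_fun b c) by exact: (innerZ H).
rewrite (@galerkin_opE _ _ g); last 2 first.
- by move=> b; apply: (innerD H).
- move=> b i; rewrite (inner_ipD H)// (inner_ipZ H)//.
  have [_ -> _] := grad_funP b hB; have [_ -> _] := grad_funP b hB'.
  by rewrite /grad_coef; ring.
rewrite /A /galerkin_op !big_bool /g /=.
have E b : ip (Q (a *: grad_fun b c + grad_fun b c')) (e j) =
    a * ip (Q (grad_fun b c)) (e j) + ip (Q (grad_fun b c')) (e j).
  have SQe := QS (Se j).
  rewrite Qsym//; last exact: (innerD H).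
  by rewrite (inner_ipD H)// (inner_ipZ H)// -!Qsym.
by rewrite !E; ring.
Qed.

(** Outside some [Z m] the value is within distance 1 of 1, hence at most 2 (1 + 1) in square; the
    finitely many other values are simply added. *)
Lemma wkap_bounded : exists2 K, 0 < K & forall j, sqnormc ((weight j)%:C * kap j) <= K.
Proof.
have [m hm] := kap_lim ltr01.
exists (4 + \sum_(j <- Z m) sqnormc ((weight j)%:C * kap j)).
  by rewrite ltr_wpDr// sumr_ge0// => j _; exact: sqnormc_ge0.
move=> j; have [jZ|/hm h] := boolP (j \in Z m).
  rewrite (big_fsetD1 j)//= addrCA lerDl addr_ge0// sumr_ge0// => i _; exact: sqnormc_ge0.
apply: (@le_trans _ _ 4); last by rewrite lerDl sumr_ge0// => i _; exact: sqnormc_ge0.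
rewrite -(subrK 1 (_ * _)); apply: le_trans (sqnormcD _ _) _.
by rewrite (sqnormc_real 1) expr1n; lra.
Qed.

(** One factor [weight] comes from the norm, a second one from |xi_b|^2; together they are absorbed
    by |kap|^2, which leaves the L^2 norms of the [Q]-images of the gradient components. *)
Lemma galerkin_op_bounded : exists2 K, 0 < K &
  forall c B, wbounded c B -> wbounded (A c) (K * B).
Proof.
have [K K0 hK] := wkap_bounded.
exists (2 + 8 * K * M); first by have := mulr_ge0 (ltW K0) M0; lra.
move=> c B hB n.
pose p b j := ip (Q (grad_fun b c)) (e j).
have h j : weight j * sqnormc (A c j) <= 2 * (weight j * sqnormc (c j)) +
    4 * K * (sqnormc (p false j) + sqnormc (p true j)).
  have w0 := weight_ge0 j.
  apply: le_trans (ler_wpM2l w0 (sqnormcD _ _)) _.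
  rewrite sqnormcN sqnormcM big_bool /=.
  have h1 := sqnormcD ((0 +i* xi true j) * p true j) ((0 +i* xi false j) * p false j).
  rewrite [X in _ <= 2 * (X + _)]sqnormcM [X in _ <= 2 * (_ + X)]sqnormcM !sqnormci in h1.
  have h2 := hK j; rewrite sqnormcM sqnormc_real in h2.
  have p1 := sqnormc_ge0 (p true j); have p2 := sqnormc_ge0 (p false j).
  set u := sqnormc (_ + _) in h1 *.
  have hu : u <= 2 * (weight j * (sqnormc (p false j) + sqnormc (p true j))).
    apply: le_trans h1 _; rewrite /weight.
    have := sqr_ge0 (xi false j); have := sqr_ge0 (xi true j); nra.
  have k0 := sqnormc_ge0 (kap j).
  rewrite mulrCA mulrDr mulrDr lerD2l.
  have : weight j * (sqnormc (kap j) * u) <= 2 * K * (sqnormc (p false j) + sqnormc (p true j)).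
    apply: le_trans (_ : weight j ^+ 2 * sqnormc (kap j) *
       (2 * (sqnormc (p false j) + sqnormc (p true j))) <= _).
      rewrite expr2 -!mulrA ler_wpM2l// mulrCA.
      by rewrite ler_wpM2l// mulrCA.
    by rewrite mulrCA -[leRHS]mulrA ler_wpM2l// ler_wpM2r// addr_ge0.
  lra.
apply: le_trans (ler_sum _ (fun j _ => h j)) _.
rewrite big_split/= -!mulr_sumr big_split/=.
have hp b : \sum_(j <- Z n) sqnormc (p b j) <= M * B.
  have [Sg _ hg] := grad_funP b hB.
  apply: le_trans (bessel H Se ipe (fset_uniq _) (QS Sg)) _.
  by apply: le_trans (Q_bounded Sg) _; rewrite ler_wpM2l.
rewrite [leRHS]mulrDl; apply: lerD; first by rewrite ler_wpM2l// hB.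
have -> : 8 * K * M * B = 4 * K * (M * B + M * B) by ring.
by rewrite ler_wpM2l ?mulr_ge0 ?(ltW K0)// lerD.
Qed.

(** Lower semicontinuity of the norm under weak limits: pairing the finite sums with their limit g
    and Cauchy-Schwarz give (nsq g)^2 <= B nsq g. *)
Lemma wbounded_lim (F : set_system nat) (FF : ProperFilter F) (c_ : nat -> I -> R[i]) c B :
  (forall n, wbounded (c_ n) B) -> (forall j, cvgc F (c_ ^~ j) (c j)) -> wbounded c B.
Proof.
move=> hB hc n.
have hw j : cvgc F (fun m => (Num.sqrt (weight j))%:C * c_ m j)
    ((Num.sqrt (weight j))%:C * c j) by exact: cvgcZ.
have sqE z j : sqnormc ((Num.sqrt (weight j))%:C * z) = weight j * sqnormc z.
  by rewrite sqnormcM sqnormc_real sqr_sqrtr// weight_ge0.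
apply/ler_addgt0Pr => eps e0.
have B0 : 0 <= B.
  by apply: le_trans (hB 0%N n); rewrite sumr_ge0// => j _; exact: wsq_ge0.
pose f m := \sum_(j <- Z n) ((Num.sqrt (weight j))%:C * c_ m j) *: e j.
pose g := \sum_(j <- Z n) ((Num.sqrt (weight j))%:C * c j) *: e j.
have Sf m : S (f m) by exact: (Scomb H Se).
have Sg : S g by exact: (Scomb H Se).
have nf m : nsq (f m) <= B.
  by rewrite /f (nsq_comb H Se ipe)//; under eq_bigr do rewrite sqE; exact: hB.
have hip : cvgc F (fun m => ip (f m) g) (ip g g).
  apply: (weak_cvg H HB _ Sf Sg Sg nf) => i.
  rewrite (ip_comb H Se ipe)//; under eq_fun do rewrite (ip_comb H Se ipe)//.
  by case: (i \in Z n); [exact: hw|exact: cvgc_cst].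
have ng : nsq g = \sum_(j <- Z n) weight j * sqnormc (c j).
  by rewrite /g (nsq_comb H Se ipe)//; under eq_bigr do rewrite sqE.
rewrite -ng; have g0 := nsq_ge0 H Sg.
have : sqnormc (ip g g) <= B * nsq g.
  apply: cvgc_sqnormc_le hip => m.
  by apply: le_trans (cauchy_schwarz H (Sf m) Sg) _; rewrite ler_wpM2r.
rewrite (ipff H Sg) sqnormc_real => h.
have [->|gn] := eqVneq (nsq g) 0; first by rewrite addr_ge0// ltW.
have gp : 0 < nsq g by rewrite lt_def gn.
have : nsq g <= B by rewrite -(ler_pM2r gp) -expr2.
lra.
Qed.

(** Moving [Q] onto [e j] turns each coefficient into a pairing of the gradient with a fixed vector,
    which is continuous under weak convergence. *)
Lemma galerkin_op_lim (F : set_system nat) (FF : ProperFilter F)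
    (c_ : nat -> I -> R[i]) c B :
  (forall n, wbounded (c_ n) B) -> (forall j, cvgc F (c_ ^~ j) (c j)) ->
  forall j, cvgc F (fun n => A (c_ n) j) (A c j).
Proof.
move=> hB hc j; have hcB := wbounded_lim FF hB hc.
rewrite /A /galerkin_op; apply: cvgcD; first exact: hc.
have hb b : cvgc F (fun n => ip (Q (grad_fun b (c_ n))) (e j))
    (ip (Q (grad_fun b c)) (e j)).
  have [S1 h1 n1] := grad_funP b hcB.
  have S2 n : S (grad_fun b (c_ n)) by have [] := grad_funP b (hB n).
  rewrite Qsym//; rewrite (_ : (fun n => _) = (fun n => ip (grad_fun b (c_ n)) (Q (e j)))).
    apply: (weak_cvg H HB _ S2 S1 (QS (Se j)) (B := B)).
      by move=> n; have [] := grad_funP b (hB n).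
    move=> i; rewrite h1; under eq_fun => n do have [_ -> _] := grad_funP b (hB n).
    exact: cvgcZ.
  by apply/funext => n; rewrite Qsym.
under eq_fun do rewrite -mulNr; rewrite -mulNr; apply: cvgcZ.
by rewrite big_bool; under eq_fun do rewrite big_bool; apply: cvgcD; exact: cvgcZ.
Qed.

Definition supported (N : nat) (c : I -> R[i]) := forall j, j \notin Z N -> c j = 0.

Lemma supported_wbounded N c : supported N c ->
  wbounded c (\sum_(j <- Z N) weight j * sqnormc (c j)).
Proof.
move=> hc n; apply: fset_sum_supp => j; first exact: wsq_ge0.
by move=> /hc ->; rewrite sqnormc0 mulr0.
Qed.

Let hbs := supported_wbounded.

Lemma wbounded0 : wbounded (fun=> 0) 0.
Proof. by move=> n; rewrite big1// => j _; rewrite sqnormc0 mulr0. Qed.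

Lemma galerkin_op0 j : A (fun=> 0) j = 0.
Proof.
have := galerkin_op_lin 1 j wbounded0 wbounded0.
under eq_fun do rewrite mulr0 addr0.
by rewrite mul1r -[X in X = _]addr0 => /addrI.
Qed.

Lemma galerkin_opZ a c B j : wbounded c B -> A (fun i => a * c i) j = a * A c j.
Proof.
move=> hB; have := galerkin_op_lin a j hB wbounded0.
by under eq_fun do rewrite addr0; rewrite galerkin_op0 addr0.
Qed.

(** The quantity inside the first modulus is the operator tested with c. As conj(i xi) = - i xi, the
    minus sign of [galerkin_op] is absorbed in the conjugated gradient coefficient; replacing weight
    times kap by 1 leaves the energy plus the products of [Q] with the gradient, whose real part is
    nonnegative, and the second sum bounds the replacement error. *)
Lemma galerkin_energy N c : supported N c ->
  \sum_(j <- Z N) weight j * sqnormc (c j) <=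
  cabs (\sum_(j <- Z N) (weight j)%:C * (c j)^* * A c j) +
  \sum_(j <- Z N) cabs ((weight j)%:C * kap j - 1) *
    (\sum_(b : bool) cabs (ip (Q (grad_fun b c)) (e j)) * cabs (grad_coef b c j)).
Proof.
move=> hc; have hB := hbs hc.
pose p b j := ip (Q (grad_fun b c)) (e j).
pose y b j := p b j * (grad_coef b c j)^*.
have E j : (weight j)%:C * (c j)^* * A c j = (weight j * sqnormc (c j))%:C +
    \sum_(b : bool) y b j + ((weight j)%:C * kap j - 1) * \sum_(b : bool) y b j.
  rewrite [(_ * sqnormc _)%:C]rmorphM /= -mulcJ /A /galerkin_op !big_bool /y /grad_coef.
  rewrite !rmorphM /=.
  have J b : (0 +i* xi b j : R[i])^* = - (0 +i* xi b j).
    by apply: complexP; rewrite ?cReJ ?cImJ ?cReN ?cImN /= ?oppr0.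
  by rewrite !J /p; ring.
(* The gradient has no modes outside [Z N], so the truncated sum is already the full inner product,
   although the [Q]-image has modes everywhere. *)
have P b : \sum_(j <- Z N) y b j = ip (Q (grad_fun b c)) (grad_fun b c).
  have [Sg hg _] := grad_funP b hB.
  have SQ := QS Sg; have SP := Sproj H Se (Z N) (grad_fun b c).
  have h0 : nsq (proj ip e (Z N) (grad_fun b c) - grad_fun b c) = 0.
    apply: (eq_coef H HB) => // i; rewrite (ip_comb H Se ipe)// hg.
    by case: ifPn => // /hc; rewrite /grad_coef => ->; rewrite mulr0.
  transitivity (ip (Q (grad_fun b c)) (proj ip e (Z N) (grad_fun b c))).
    by rewrite (ip_projr H Se)//; apply: eq_bigr => j _; rewrite hg.
  apply/eqP; rewrite -subr_eq0 -(ipBr H)//; apply/eqP.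
  rewrite (inner_ipC H) ?(ip_null H)//; [by rewrite rmorph0|exact: (SB H)..].
rewrite (eq_bigr _ (fun j _ => E j)) !big_split /=.
set Y := \sum_(i <- Z N) \sum_b y b i.
have Y0 : 0 <= complex.Re Y.
  rewrite /Y exchange_big big_bool /= !P cReD addr_ge0//; apply: Q_ge0.
    by have [] := grad_funP true hB.
  by have [] := grad_funP false hB.
set r := \sum_(i <- Z N) _ * \sum_b y b i.
have rle : cabs r <= \sum_(j <- Z N) cabs ((weight j)%:C * kap j - 1) *
    (\sum_(b : bool) cabs (p b j) * cabs (grad_coef b c j)).
  apply: le_trans (cabs_sum _ _ _) _; apply: ler_sum => j _.
  rewrite cabsM ler_wpM2l ?cabs_ge0//; apply: le_trans (cabs_sum _ _ _) _.
  by apply: ler_sum => b _; rewrite cabsM cabsJ.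
apply: le_trans (lerD (lexx _) rle).
rewrite -rmorph_sum /=; set E0 := \sum_(j <- Z N) _.
have := Re_le_cabs (E0%:C + Y + r); have := Re_le_cabs r.
rewrite !cReD /= !ler_norml => /andP[h1 h2] /andP[h3 h4]; lra.
Qed.

Lemma cvgc_cabs (F : set_system nat) (z : nat -> R[i]) (eps : R) :
  ProperFilter F -> cvgc F z 0 -> 0 < eps -> F [set n | cabs (z n) < eps].
Proof.
move=> FF hz e0; apply: filterS (hz _ (exprn_gt0 2 e0)) => n /=.
by rewrite subr0 -cabs_sqr => h; rewrite -(@ltr_pXn2r _ 2) ?nnegrE ?cabs_ge0 ?(ltW e0).
Qed.

Hypothesis A_inj : forall c B, wbounded c B -> (forall j, A c j = 0) -> forall j, c j = 0.

(* Otherwise normalized Galerkin vectors with vanishing residuals would converge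
   weakly to an element of the kernel, hence to 0, and the energy identity,
   in which the indefinite part only involves finitely many modes up to a
   small error, would force their norms to tend to 0. *)
Lemma galerkin_stability : exists2 N0 : nat, (0 < N0)%N & exists2 C : R, 0 < C &
  forall N c, (N0 <= N)%N -> supported N c ->
  \sum_(j <- Z N) weight j * sqnormc (c j) <=
  C * \sum_(j <- Z N) weight j * sqnormc (A c j).
Proof.
apply: contrapT => nex.
have ex (n : nat) : exists Nc : nat * (I -> R[i]), [/\ (n <= Nc.1)%N, supported Nc.1 Nc.2,
    \sum_(j <- Z Nc.1) weight j * sqnormc (Nc.2 j) = 1 &
    n%:R * \sum_(j <- Z Nc.1) weight j * sqnormc (A Nc.2 j) <= 1].
  apply: contrapT => nn; apply: nex; exists n.+1 => //.
  exists n.+1%:R => // N c hN hc.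
  rewrite leNgt; apply/negP => hlt; apply: nn.
  set E := \sum_(j <- Z N) weight j * sqnormc (c j) in hlt.
  have F0 : 0 <= \sum_(j <- Z N) weight j * sqnormc (A c j).
    by apply: sumr_ge0 => j _; exact: wsq_ge0.
  have E0 : 0 < E by apply: le_lt_trans hlt; rewrite mulr_ge0.
  (* Homogeneity normalizes a violating vector to energy 1; its residual is then at most 1/n. *)
  pose a : R := (Num.sqrt E)^-1.
  have a2 : a ^+ 2 = E^-1 by rewrite exprVn sqr_sqrtr// ltW.
  have Aa j := galerkin_opZ (a%:C) j (hbs hc).
  exists (N, fun j => a%:C * c j); split => /=.
  - exact: leq_trans (leqnSn _) hN.
  - by move=> j /hc ->; rewrite mulr0.
  - under eq_bigr do rewrite sqnormcM sqnormc_real mulrCA.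
    by rewrite -mulr_sumr a2 mulVf// gt_eqF.
  - under eq_bigr do rewrite Aa sqnormcM sqnormc_real mulrCA.
    rewrite -mulr_sumr a2 mulrCA mulrC ler_pdivrMr// mul1r.
    apply: le_trans (ltW hlt); rewrite ler_wpM2r// ler_nat//.
have [f hf] := choice ex.
pose N_ n := (f n).1; pose c_ n := (f n).2.
have hN n : (n <= N_ n)%N by have [] := hf n.
have hc n : supported (N_ n) (c_ n) by have [] := hf n.
have h1 n : \sum_(j <- Z (N_ n)) weight j * sqnormc (c_ n j) = 1 by have [] := hf n.
have hA n : n%:R * \sum_(j <- Z (N_ n)) weight j * sqnormc (A (c_ n) j) <= 1.
  by have [] := hf n.
have hB n : wbounded (c_ n) 1 by rewrite -(h1 n); exact: hbs.
(* Along a free ultrafilter every bounded coefficient converges, so no diagonal extraction of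
   subsequences is needed. *)
have [F [UF Foo]] := @ultraFilterLemma nat \oo _.
have FF : ProperFilter F := @ultra_proper _ _ UF.
have Fge m : F [set n | (m <= n)%N] by apply: Foo; exact: nbhs_infty_ge.
have cb j n : sqnormc (c_ n j) <= 1.
  have [m jm] := basis_exh HB j.
  apply: le_trans (hB n m); rewrite (big_fsetD1 j)//=.
  apply: ler_wpDr; first by apply: sumr_ge0 => i _; exact: wsq_ge0.
  by rewrite ler_peMl ?sqnormc_ge0 ?weight_ge1.
have [c hcv] := choice (fun j => ultra_bounded_cvgc UF (cb j)).
have Alim FF := galerkin_op_lim FF hB hcv.
have A0 j : A c j = 0.
  apply: (@cvgc_unique _ F FF (fun n => A (c_ n) j) _ _ (Alim FF j)) => eps e0.
  have [m jm] := basis_exh HB j.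
  have [K hK] : exists K : nat, eps^-1 < K%:R.
    by exists (Num.bound eps^-1); apply: archi_boundP; rewrite invr_ge0 ltW.
  apply: filterS (filterI (Fge m) (Fge K)) => n /= [mn Kn].
  rewrite subr0; have jn : j \in Z (N_ n).
    by apply: (basis_mono HB) jm; exact: leq_trans mn (hN n).
  have K0 : 0 < K%:R :> R by apply: le_lt_trans hK; rewrite invr_ge0 ltW.
  have : K%:R * sqnormc (A (c_ n) j) <= 1.
    apply: le_trans (hA n); apply: ler_pM => //; rewrite ?sqnormc_ge0 ?ler_nat//.
    rewrite (big_fsetD1 j)//=.
    apply: ler_wpDr; first by apply: sumr_ge0 => i _; exact: wsq_ge0.
    by rewrite ler_peMl ?sqnormc_ge0 ?weight_ge1.
  rewrite mulrC -ler_pdivlMr// mul1r => h; apply: le_lt_trans h _.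
  by rewrite -[ltRHS]invrK ltf_pV2 ?posrE// invr_gt0.
have c0 j : c j = 0 := A_inj (wbounded_lim FF hB hcv) A0 j.
have [K K0 hK] := wkap_bounded.
(* With this eta the modes outside [Z m] contribute at most (eta / 2) 2 (M + 1) = 1/16 to the
   error. *)
pose eta : R := (16 * (M + 1))^-1.
have M1 : 0 < M + 1 by rewrite ltr_wpDl.
have eta0 : 0 < eta by rewrite invr_gt0 mulr_gt0.
have [m hm] := kap_lim (exprn_gt0 2 eta0).
pose k j := cabs ((weight j)%:C * kap j - 1).
have pb b n : nsq (Q (grad_fun b (c_ n))) <= M.
  have [Sg _ hg] := grad_funP b (hB n).
  by apply: le_trans (Q_bounded Sg) _; rewrite -[leRHS]mulr1 ler_wpM2l.
pose err n j := \sum_(b : bool) cabs (ip (Q (grad_fun b (c_ n))) (e j)) *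
   cabs (grad_coef b (c_ n) j).
have err_ge0 n j : 0 <= err n j.
  by apply: sumr_ge0 => b _; rewrite mulr_ge0 ?cabs_ge0.
(* tail of the error *)
have tail n : \sum_(j <- Z (N_ n)) k j * err n j <=
    \sum_(j <- Z m) k j * err n j + 1 / 16.
  pose t j := (eta / 2) * \sum_(b : bool) (sqnormc (ip (Q (grad_fun b (c_ n))) (e j)) +
    sqnormc (grad_coef b (c_ n) j)).
  have t0 j : 0 <= t j.
    rewrite mulr_ge0 ?divr_ge0 ?(ltW eta0)// sumr_ge0// => b _.
    by rewrite addr_ge0 ?sqnormc_ge0.
  have kt j : j \notin Z m -> k j * err n j <= t j.
    move=> /hm; rewrite -cabs_sqr -/(k j) ler_pXn2r ?nnegrE ?cabs_ge0 ?(ltW eta0)// => kj.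
    apply: le_trans (ler_wpM2r (err_ge0 n j) kj) _.
    rewrite /t -mulrA ler_wpM2l ?(ltW eta0)// mulr_sumr; apply: ler_sum => b _.
    rewrite -!cabs_sqr.
    have := sqr_ge0 (cabs (ip (Q (grad_fun b (c_ n))) (e j)) -
      cabs (grad_coef b (c_ n) j)); rewrite sqrrB mulr2n; lra.
  have st : \sum_(j <- Z (N_ n)) t j <= 1 / 16.
    rewrite -mulr_sumr exchange_big /=; under eq_bigr do rewrite big_split /=.
    rewrite big_bool /=.
    have q b : \sum_(i <- Z (N_ n)) sqnormc (ip (Q (grad_fun b (c_ n))) (e i)) <= M.
      have [Sg _ _] := grad_funP b (hB n).
      exact: le_trans (bessel H Se ipe (fset_uniq _) (QS Sg)) (pb b n).
    have g b := grad_coef_bounded b (hB n) (N_ n).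
    apply: le_trans (_ : _ <= eta / 2 * (2 * (M + 1))) _.
      rewrite ler_wpM2l ?divr_ge0 ?(ltW eta0)//.
      have := q true; have := q false; have := g true; have := g false; lra.
    have -> : eta / 2 * (2 * (M + 1)) = 1 / 16.
      by rewrite /eta; field; rewrite gt_eqF.
    exact: lexx.
  have ke0 j : 0 <= k j * err n j by rewrite mulr_ge0 ?cabs_ge0.
  apply: le_trans (_ : _ <= \sum_(j <- Z (N_ n)) ((if j \in Z m then k j * err n j else 0) + t j)) _.
    apply: ler_sum => j _; case: ifPn => jm; first by rewrite lerDl.
    by rewrite add0r kt.
  rewrite big_split /= lerD//.
  apply: le_trans (_ : _ <= \sum_(j <- Z m) (if j \in Z m then k j * err n j else 0)) _.
    by apply: fset_sum_supp => j; [case: ifP|move/negbTE => ->].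
  by apply: ler_sum => j _; case: ifP.
(* On the fixed finite set [Z m] the gradient coefficients tend to 0, because the weak limit is 0,
   while the [Q]-images stay bounded. *)
have head : cvgc F (fun n => (\sum_(j <- Z m) k j * err n j)%:C) 0.
  rewrite [X in cvgc _ _ X](_ : 0 = \sum_(j <- Z m) (0 : R[i])); last by rewrite big1.
  under eq_fun do rewrite rmorph_sum /=.
  apply: cvgc_sum => j _.
  rewrite [X in cvgc _ _ X](_ : 0 = (k j)%:C * (0 + 0)); last by rewrite addr0 mulr0.
  under eq_fun do rewrite rmorphM /=; apply: cvgcZ.
  under eq_fun do rewrite /err big_bool /= rmorphD /=.
  have hb b : cvgc F (fun n => (cabs (ip (Q (grad_fun b (c_ n))) (e j)) *
      cabs (grad_coef b (c_ n) j))%:C) 0.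
    move=> eps e0.
    have hcj : cvgc F (fun n => grad_coef b (c_ n) j) 0.
      by rewrite -(mulr0 (0 +i* xi b j)) -(c0 j); exact: cvgcZ.
    have e1 : 0 < eps / (M + 1) by rewrite divr_gt0//; lra.
    apply: filterS (hcj _ e1) => n /=; rewrite !subr0 sqnormc_real exprMn !cabs_sqr.
    rewrite ltr_pdivlMr; last lra.
    have [Sg _ _] := grad_funP b (hB n).
    have := cauchy_schwarz H (QS Sg) (Se j); rewrite (nsq_basis HB) mulr1.
    move=> /le_trans/(_ (pb b n)).
    have := sqnormc_ge0 (ip (Q (grad_fun b (c_ n))) (e j)).
    have := sqnormc_ge0 (grad_coef b (c_ n) j); nra.
  by apply: cvgcD; exact: hb.
(* For n >= 16 the tested residual is at most 1/2 + 1/32 by Young's inequality, and the error below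
   1/16 + 1/16. The energy 1 would be smaller than 21/32. *)
have e16 : 0 < 1 / 16 :> R by lra.
have [n /= [hn1 hn2]] := filter_ex (filterI (cvgc_cabs FF head e16) (Fge 16%N)).
rewrite cabs_real in hn1.
have := galerkin_energy (hc n); rewrite h1 => hen.
have hs : cabs (\sum_(j <- Z (N_ n)) (weight j)%:C * (c_ n j)^* * A (c_ n) j) <= 17 / 32.
  apply: le_trans (cabs_sum _ _ _) _.
  apply: le_trans (_ : _ <= \sum_(j <- Z (N_ n)) (2^-1 * (weight j * sqnormc (c_ n j)) +
      2^-1 * (weight j * sqnormc (A (c_ n) j)))) _.
    apply: ler_sum => j _; rewrite !cabsM cabs_real cabsJ ger0_norm ?weight_ge0//.
    rewrite -!cabs_sqr.
    have := sqr_ge0 (cabs (c_ n j) - cabs (A (c_ n) j)); have := weight_ge0 j.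
    move=> w0 /(mulr_ge0 w0); rewrite sqrrB mulr2n; lra.
  rewrite big_split /= -!mulr_sumr h1.
  have F0 : 0 <= \sum_(j <- Z (N_ n)) weight j * sqnormc (A (c_ n) j).
    by apply: sumr_ge0 => j _; exact: wsq_ge0.
  have : 16%:R * \sum_(j <- Z (N_ n)) weight j * sqnormc (A (c_ n) j) <= 1.
    by apply: le_trans (hA n); rewrite ler_wpM2r// ler_nat.
  lra.
have := tail n; have := ler_norm (\sum_(j <- Z m) k j * err n j).
rewrite -/(k _) in hen; rewrite /k /err in hn1 *; lra.
Qed.

Lemma galerkin_op_sum (K : Type) (s : seq K) (a : K -> R[i]) (d : K -> I -> R[i])
    (B : K -> R) j : (forall k, wbounded (d k) (B k)) ->
  A (fun i => \sum_(k <- s) a k * d k i) j = \sum_(k <- s) a k * A (d k) j /\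
  exists B', wbounded (fun i => \sum_(k <- s) a k * d k i) B'.
Proof.
move=> hd; elim: s => [|k s [IH [B' hB']]].
  under eq_fun do rewrite big_nil; rewrite big_nil galerkin_op0; split => //.
  by exists 0; exact: wbounded0.
under eq_fun do rewrite big_cons; rewrite big_cons (galerkin_op_lin _ _ (hd k) hB') IH.
split => //; exists (2 * (sqnormc (a k) * B k + B')) => n.
apply: le_trans (_ : _ <= \sum_(i <- Z n) 2 * (sqnormc (a k) * (weight i * sqnormc (d k i)) +
   weight i * sqnormc (\sum_(k <- s) a k * d k i))) _.
  apply: ler_sum => i _; have := sqnormcD (a k * d k i) (\sum_(k <- s) a k * d k i).
  rewrite sqnormcM => h; apply: le_trans (ler_wpM2l (weight_ge0 i) h) _.
  by rewrite mulrCA mulrDr mulrCA.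
rewrite -mulr_sumr ler_wpM2l// big_split lerD//= -mulr_sumr.
by apply: ler_wpM2l; [exact: sqnormc_ge0|exact: hd].
Qed.

(** In the basis of [Z N] this is a square linear system, and the stability bound says that its
    kernel is trivial. *)
Lemma galerkin_solvable N (C : R) :
  (forall c, supported N c -> \sum_(j <- Z N) weight j * sqnormc (c j) <=
     C * \sum_(j <- Z N) weight j * sqnormc (A c j)) ->
  forall G : I -> R[i], exists2 c, supported N c & forall j, j \in Z N -> A c j = G j.
Proof.
move=> hstab G.
pose n := #|` Z N|; pose s : seq I := Z N.
have nthZ (a : 'I_n) : exists i, i \in s /\ index i s = a.
  have [i0 _] : exists i0 : I, true.
    by move: a; rewrite /n /s; case: (enum_fset (Z N)) => [[]//|x ? _]; exists x.
  exists (nth i0 s a); rewrite mem_nth ?index_uniq ?fset_uniq//; exact: ltn_ord.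
have [t ht] := choice nthZ.
pose d (b : 'I_n) (i : I) : R[i] := (i == t b)%:R.
have tZ b : t b \in Z N by have [] := ht b.
have sd b : supported N (d b).
  by move=> i iN; rewrite /d; case: eqP => // E; rewrite E tZ in iN.
pose cf (v : 'cV[R[i]]_n) i := \sum_(b <- enum 'I_n) v b 0 * d b i.
have scf v : supported N (cf v).
  by move=> i iN; rewrite /cf big1// => b _; rewrite sd ?mulr0.
have cft v b : cf v (t b) = v b 0.
  rewrite /cf big_enum (bigD1 b)//= /d eqxx mulr1 big1 ?addr0// => a ab.
  case: eqP => [E|_]; last by rewrite mulr0.
  have [_ ha] := ht a; have [_ hb] := ht b.
  by case/eqP: ab; apply: val_inj; rewrite /= -ha -hb E.
pose Mx := \matrix_(a < n, b < n) A (d b) (t a).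
have Acf v a : A (cf v) (t a) = (Mx *m v) a 0.
  have [-> _] := @galerkin_op_sum 'I_n (enum 'I_n) (fun b => v b 0) d _ (t a)
    (fun b => hbs (sd b)).
  by rewrite big_enum mxE; apply: eq_bigr => b _; rewrite !mxE mulrC.
have Zt i : i \in Z N -> exists a, i = t a.
  move=> iN; have lt : (index i s < n)%N by rewrite /n -/s index_mem.
  exists (Ordinal lt); have [ts /= hi] := ht (Ordinal lt).
  by have := congr1 (nth i s) hi; rewrite !nth_index.
have Munit : Mx \in unitmx.
  (* A row in the left kernel of the transpose is, transposed, a solution of the homogeneous
     Galerkin system. *)
  rewrite -unitmx_tr -row_free_unit -kermx_eq0; apply/eqP/row_matrixP => a.
  rewrite row0; set r := row a _.
  have rM : r *m Mx^T = 0 by apply/sub_kermxP; exact: row_sub.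
  have Mr : Mx *m r^T = 0 by rewrite -[LHS]trmxK trmx_mul trmxK rM trmx0.
  have cr0 i : cf r^T i = 0.
    have [iN|/scf->//] := boolP (i \in Z N).
    have := hstab _ (scf r^T).
    rewrite [X in _ <= C * X]big1_seq ?mulr0; last first.
      by move=> j /andP[_ /Zt[b ->]]; rewrite Acf Mr mxE sqnormc0 mulr0.
    rewrite (big_fsetD1 i)//= => h; apply: sqnormc_eq0; apply/eqP.
    rewrite eq_le sqnormc_ge0 andbT.
    have h' : 0 <= \sum_(j <- (Z N `\ i)%fset) weight j * sqnormc (cf r^T j).
      by apply: sumr_ge0 => j _; exact: wsq_ge0.
    have := weight_ge1 i; have := sqnormc_ge0 (cf r^T i); nra.
  by apply/rowP => b; have := cft r^T b; rewrite cr0 [r^T _ _]mxE => <-; rewrite [RHS]mxE.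
exists (cf (invmx Mx *m \col_a G (t a))); first exact: scf.
by move=> j /Zt[a ->]; rewrite Acf mulmxA mulmxV// mul1mx mxE.
Qed.

(** Stability bounds the Galerkin solutions uniformly, so a coefficientwise limit exists; each
    equation holds along the sequence from some index on and passes to the limit by
    [galerkin_op_lim]. *)
Lemma galerkin_op_surj G B : wbounded G B ->
  exists c, (exists B', wbounded c B') /\ forall j, A c j = G j.
Proof.
move=> hG; have [N0 _ [C C0 hstab]] := galerkin_stability.
have ex n : exists c, supported (N0 + n) c /\
    forall j, j \in Z (N0 + n) -> A c j = G j.
  have [c h1 h2] := galerkin_solvable (fun c => hstab _ c (leq_addr n N0)) G.
  by exists c.
have [c_ hc] := choice ex.
have hB n : wbounded (c_ n) (C * B).
  have [h1 h2] := hc n; move=> m; apply: le_trans (hbs h1 m) _.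
  apply: le_trans (hstab _ _ (leq_addr n N0) h1) _; rewrite ler_wpM2l ?(ltW C0)//.
  rewrite (eq_big_seq (fun j => weight j * sqnormc (G j))); first exact: hG.
  by move=> j jZ; rewrite h2.
have [F [UF Foo]] := @ultraFilterLemma nat \oo _.
have FF : ProperFilter F := @ultra_proper _ _ UF.
have cb j n : sqnormc (c_ n j) <= C * B.
  have [m jm] := basis_exh HB j.
  apply: le_trans (hB n m); rewrite (big_fsetD1 j)//=.
  apply: ler_wpDr; first by apply: sumr_ge0 => i _; exact: wsq_ge0.
  by rewrite ler_peMl ?sqnormc_ge0 ?weight_ge1.
have [c hcv] := choice (fun j => ultra_bounded_cvgc UF (cb j)).
exists c; split; first by exists (C * B); exact: wbounded_lim hB hcv.
move=> j; apply: (@cvgc_unique _ F FF (fun n => A (c_ n) j) _ _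
  (galerkin_op_lim FF hB hcv j)).
apply: (cvgc_near (w := fun=> G j)); last exact: cvgc_cst.
have [m jm] := basis_exh HB j.
have : F [set n | (m <= n)%N] by apply: Foo; exact: nbhs_infty_ge.
apply: filterS => n /= mn; apply: (hc n).2.
by apply: (basis_mono HB) jm; exact: leq_trans mn (leq_addl _ _).
Qed.

End galerkin.

(** * Complex-valued integrals and square-integrable functions *)

Definition cintegrable (R : realType) (A : set (R * R)) (f : R * R -> R[i]) :=
  (leb2 R).-integrable A (fun x => (complex.Re (f x))%:E) /\
  (leb2 R).-integrable A (fun x => (complex.Im (f x))%:E).

Section cint.
Variables (R : realType) (A : set (RR R)).
Hypothesis mA : measurable A.
Implicit Types f g : R * R -> R[i].

(** The real and imaginary parts of complex multiples and sums are real combinations of this shape,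
    so complex linearity reduces to this lemma. *)
Lemma integrable_lin (a b : R) (f g : R * R -> R) :
  (leb2 R).-integrable A (EFin \o f) -> (leb2 R).-integrable A (EFin \o g) ->
  (leb2 R).-integrable A (fun x => (a * f x + b * g x)%:E) /\
  \int[leb2 R]_(x in A) (a * f x + b * g x) =
    a * \int[leb2 R]_(x in A) f x + b * \int[leb2 R]_(x in A) g x.
Proof.
move=> hf hg.
have h1 : (leb2 R).-integrable A (EFin \o (fun x => a * f x)).
  rewrite (_ : _ \o _ = fun x => (a%:E * (EFin \o f) x)%E).
    exact: (integrableZl mA a hf).
  by apply/funext => x /=; rewrite EFinM.
have h2 : (leb2 R).-integrable A (EFin \o (fun x => b * g x)).
  rewrite (_ : _ \o _ = fun x => (b%:E * (EFin \o g) x)%E).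
    exact: (integrableZl mA b hg).
  by apply/funext => x /=; rewrite EFinM.
split; last by rewrite RintegralD// !RintegralZl.
rewrite (_ : (fun x => _) = ((EFin \o (fun x => (a * f x)%R)) \+ (EFin \o (fun x => (b * g x)%R)))%E).
  exact: (integrableD mA h1 h2).
by apply/funext => x /=; rewrite EFinD.
Qed.

Lemma cintegrableD f g : cintegrable A f -> cintegrable A g ->
  cintegrable A (fun x => f x + g x).
Proof.
move=> [f1 f2] [g1 g2]; split.
- have [h _] := integrable_lin 1 1 f1 g1.
  by under eq_fun do rewrite cReD -[X in X + _]mul1r -[X in _ + X]mul1r.
- have [h _] := integrable_lin 1 1 f2 g2.
  by under eq_fun do rewrite cImD -[X in X + _]mul1r -[X in _ + X]mul1r.
Qed.

Lemma cintegrableZ (a : R[i]) f : cintegrable A f -> cintegrable A (fun x => a * f x).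
Proof.
move=> [f1 f2]; split.
- have [h _] := integrable_lin (complex.Re a) (- complex.Im a) f1 f2.
  by under eq_fun do rewrite cReM -mulNr.
- have [h _] := integrable_lin (complex.Re a) (complex.Im a) f2 f1.
  by under eq_fun do rewrite cImM.
Qed.

Lemma cintD f g : cintegrable A f -> cintegrable A g ->
  cint A (fun x => f x + g x) = cint A f + cint A g.
Proof.
move=> [f1 f2] [g1 g2]; apply: complexP => /=.
- have [_ h] := integrable_lin 1 1 f1 g1.
  by under eq_Rintegral do rewrite cReD -[X in X + _]mul1r -[X in _ + X]mul1r; rewrite h !mul1r.
- have [_ h] := integrable_lin 1 1 f2 g2.
  by under eq_Rintegral do rewrite cImD -[X in X + _]mul1r -[X in _ + X]mul1r; rewrite h !mul1r.
Qed.

Lemma cintZ (a : R[i]) f : cintegrable A f -> cint A (fun x => a * f x) = a * cint A f.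
Proof.
move=> [f1 f2]; apply: complexP; rewrite ?cReM ?cImM/=.
- have [_ h] := integrable_lin (complex.Re a) (- complex.Im a) f1 f2.
  by under eq_Rintegral do rewrite cReM -mulNr; rewrite h mulNr.
- have [_ h] := integrable_lin (complex.Re a) (complex.Im a) f2 f1.
  by under eq_Rintegral do rewrite cImM; rewrite h.
Qed.

Lemma cint0 : cint A (fun=> 0) = 0.
Proof.
by apply: complexP; rewrite /cint /=; rewrite /Rintegral integral0.
Qed.

Lemma eq_cint f g : (forall x, A x -> f x = g x) -> cint A f = cint A g.
Proof.
by move=> h; apply: complexP => /=; apply: eq_Rintegral => x; rewrite inE => /h ->.
Qed.

Lemma cint_conj f : cintegrable A f -> cint A (fun x => (f x)^*) = (cint A f)^*.
Proof.
move=> [f1 f2]; apply: complexP; rewrite ?cReJ ?cImJ /=.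
  by under eq_Rintegral do rewrite cReJ.
have [_ h] := integrable_lin (-1) 0 f2 f2.
rewrite -[RHS]addr0 -mulN1r -[X in _ + X](mul0r (\int[leb2 R]_(x in A) complex.Im (f x))) -h.
by apply: eq_Rintegral => x _; rewrite cImJ mulN1r mul0r addr0.
Qed.

Lemma cmeasurableD f g : cmeasurable A f -> cmeasurable A g ->
  cmeasurable A (fun x => f x + g x).
Proof.
move=> [f1 f2] [g1 g2]; split.
- by under eq_fun do rewrite cReD; exact: measurable_funD.
- by under eq_fun do rewrite cImD; exact: measurable_funD.
Qed.

Lemma cmeasurableM f g : cmeasurable A f -> cmeasurable A g ->
  cmeasurable A (fun x => f x * g x).
Proof.
move=> [f1 f2] [g1 g2]; split.
- by under eq_fun do rewrite cReM; apply: measurable_funB; exact: measurable_funM.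
- by under eq_fun do rewrite cImM; apply: measurable_funD; exact: measurable_funM.
Qed.

Lemma cmeasurable_cst (a : R[i]) : cmeasurable A (fun=> a).
Proof. by split; exact: measurable_cst. Qed.

Lemma cmeasurableJ f : cmeasurable A f -> cmeasurable A (fun x => (f x)^*).
Proof.
move=> [f1 f2]; split; first by under eq_fun do rewrite cReJ.
by under eq_fun do rewrite cImJ; exact: measurable_funN.
Qed.

Lemma cmeasurableN f : cmeasurable A f -> cmeasurable A (fun x => - f x).
Proof.
move=> [f1 f2]; split.
- by under eq_fun do rewrite cReN; exact: measurable_funN.
- by under eq_fun do rewrite cImN; exact: measurable_funN.
Qed.

Lemma cmeasurable_sum (I : Type) (s : seq I) (F : I -> R * R -> R[i]) :
  (forall i, cmeasurable A (F i)) -> cmeasurable A (fun x => \sum_(i <- s) F i x).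
Proof.
move=> h; elim: s => [|i s IH].
  by under eq_fun do rewrite big_nil; exact: cmeasurable_cst.
by under eq_fun do rewrite big_cons; exact: cmeasurableD.
Qed.

Lemma measurable_sqnormc f : cmeasurable A f -> measurable_fun A (fun x => sqnormc (f x)).
Proof.
by move=> [f1 f2]; apply: measurable_funD; exact: measurable_funX.
Qed.

Lemma measurable_Esqnormc f :
  cmeasurable A f -> measurable_fun A (fun x => (sqnormc (f x))%:E).
Proof. by move=> h; apply/measurable_EFinP; exact: measurable_sqnormc. Qed.

Lemma cmeasurable_real (f : R * R -> R) :
  measurable_fun A f -> cmeasurable A (fun x => (f x)%:C).
Proof. by move=> h; split => //=; exact: measurable_cst. Qed.

Lemma sqnormc_integrable f : L2 A f ->
  (leb2 R).-integrable A (EFin \o (fun x => sqnormc (f x))).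
Proof.
move=> [mf hf]; apply/integrableP; split; first exact: measurable_Esqnormc.
by under eq_integral do rewrite gee0_abs ?lee_fin ?sqnormc_ge0//.
Qed.

Lemma integrable_dominated (f g : R * R -> R) : measurable_fun A f ->
  (forall x, A x -> `|f x| <= g x) -> (leb2 R).-integrable A (EFin \o g) ->
  (leb2 R).-integrable A (EFin \o f).
Proof.
move=> mf h; apply: le_integrable => //; first exact/measurable_EFinP.
by move=> x Ax /=; rewrite lee_fin; apply: le_trans (h x Ax) (ler_norm _).
Qed.

Lemma cintegrable_dominated f (g : R * R -> R) : cmeasurable A f ->
  (forall x, A x -> cabs (f x) <= g x) -> (leb2 R).-integrable A (EFin \o g) ->
  cintegrable A f.
Proof.
move=> [f1 f2] h hg; split.
- apply: (integrable_dominated f1 _ hg) => x Ax.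
  exact: le_trans (Re_le_cabs _) (h x Ax).
- apply: (integrable_dominated f2 _ hg) => x Ax.
  exact: le_trans (Im_le_cabs _) (h x Ax).
Qed.

Lemma L2_dominated f (g : R * R -> R) : cmeasurable A f ->
  (forall x, A x -> sqnormc (f x) <= g x) -> (leb2 R).-integrable A (EFin \o g) ->
  L2 A f.
Proof.
move=> mf h hg; split => //.
have : (leb2 R).-integrable A (EFin \o (fun x => sqnormc (f x))).
  apply: (integrable_dominated (measurable_sqnormc mf) _ hg) => x Ax.
  by rewrite ger0_norm ?sqnormc_ge0 ?h.
move=> /integrableP[_]; under eq_integral do rewrite gee0_abs ?lee_fin ?sqnormc_ge0//.
by [].
Qed.

Lemma L2_D f g : L2 A f -> L2 A g -> L2 A (fun x => f x + g x).
Proof.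
move=> hf hg; have [h _] := integrable_lin 2 2 (sqnormc_integrable hf) (sqnormc_integrable hg).
apply: (L2_dominated _ _ h); first exact: cmeasurableD hf.1 hg.1.
by move=> x _; rewrite -mulrDr sqnormcD.
Qed.

Lemma L2_bounded_mul f g (C : R) : cmeasurable A g ->
  (forall x, A x -> sqnormc (g x) <= C) -> L2 A f -> L2 A (fun x => g x * f x).
Proof.
move=> mg gC hf; have [h _] := integrable_lin C 0 (sqnormc_integrable hf) (sqnormc_integrable hf).
apply: (L2_dominated _ _ h); first exact: cmeasurableM mg hf.1.
by move=> x Ax; rewrite mul0r addr0 sqnormcM ler_wpM2r ?sqnormc_ge0 ?gC.
Qed.

Lemma L2_Z (a : R[i]) f : L2 A f -> L2 A (fun x => a * f x).
Proof.
by apply: (@L2_bounded_mul f (fun=> a) (sqnormc a)) => //; exact: cmeasurable_cst.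
Qed.

Lemma L2_J f : L2 A f -> L2 A (fun x => (f x)^*).
Proof.
move=> [mf hf]; split; first exact: cmeasurableJ.
by under eq_integral do rewrite sqnormcJ.
Qed.

Lemma L2_0 : L2 A (fun=> 0).
Proof.
split; first exact: cmeasurable_cst.
by under eq_integral do rewrite sqnormc0; rewrite integral0.
Qed.

Lemma L2_mul f g : L2 A f -> L2 A g -> cintegrable A (fun x => f x * g x).
Proof.
move=> hf hg.
have [h _] := integrable_lin 2^-1 2^-1 (sqnormc_integrable hf) (sqnormc_integrable hg).
apply: (cintegrable_dominated _ _ h); first exact: cmeasurableM hf.1 hg.1.
move=> x _; rewrite cabsM -!cabs_sqr.
have := sqr_ge0 (cabs (f x) - cabs (g x)); rewrite sqrrB mulr2n; lra.
Qed.

Definition ip2 f g := cint A (fun x => f x * (g x)^*).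

Lemma L2_inner : inner_space (L2 A) ip2.
Proof.
have ipi f g : L2 A f -> L2 A g -> cintegrable A (fun x => f x * (g x)^*).
  by move=> hf hg; apply: L2_mul => //; exact: L2_J.
split.
- exact: L2_0.
- exact: L2_D.
- exact: L2_Z.
- move=> f g h hf hg hh; rewrite -cintD; [|exact: ipi..].
  by apply: eq_cint => x _; rewrite mulrDl.
- move=> a f g hf hg; rewrite -cintZ; last exact: ipi.
  by apply: eq_cint => x _; rewrite mulrA.
- move=> f g hf hg; rewrite -cint_conj; last exact: ipi.
  by apply: eq_cint => x _; rewrite rmorphM /= conjCK mulrC.
- move=> f hf; apply: Rintegral_ge0 => x _.
  by rewrite mulcJ /= sqnormc_ge0.
Qed.

Lemma nsq_L2 f : nsq ip2 f = \int[leb2 R]_(x in A) sqnormc (f x).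
Proof. by rewrite /nsq /ip2 /cint /=; under eq_Rintegral do rewrite mulcJ. Qed.

Lemma EFin_nsq f : L2 A f ->
  ((nsq ip2 f)%:E = \int[leb2 R]_(x in A) (sqnormc (f x))%:E)%E.
Proof.
move=> hf; rewrite nsq_L2 /Rintegral fineK//.
exact: integrable_fin_num (sqnormc_integrable hf).
Qed.

End cint.

(** * Almost everywhere limits and limits in L^2 *)

#[global] Instance ae_leb2_filter (R : realType) : Filter (almost_everywhere (leb2 R)).
Proof. exact: ae_filter_ringOfSetsType. Qed.

Lemma cauchy_real_cvg (R : realType) (u : nat -> R) :
  (forall eps : R, 0 < eps -> exists n, forall m, (n <= m)%N -> `|u m - u n| <= eps) ->
  cvgn u.
Proof.
move=> h; apply: cauchy_cvg; apply: cauchy_exP => e e0.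
have [n hn] := h (e / 2) (divr_gt0 e0 (ltr0Sn R 1)).
exists (u n); apply: filterS (nbhs_infty_ge n) => m /= nm.
rewrite /ball /= distrC; apply: le_lt_trans (hn m nm) _.
by rewrite ltr_pdivrMr//; lra.
Qed.

Lemma cvg_real_cauchy (R : realType) (u : nat -> R) : cvgn u ->
  forall eps : R, 0 < eps -> exists n, forall m, (n <= m)%N -> `|u m - u n| <= eps.
Proof.
move=> /cvgrPdist_le h eps e0.
have [n _ hn] := h _ (divr_gt0 e0 (ltr0Sn R 1)); exists n => m nm.
have h1 := hn _ (leqnn n : [set k | (n <= k)%N] n); have h2 := hn _ nm.
have -> : u m - u n = (limn u - u n) - (limn u - u m) by ring.
by apply: le_trans (ler_normB _ _) _; rewrite /= in h1 h2; lra.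
Qed.

(** The Cauchy criterion with tolerances 1/(k+1) uses only countable unions and intersections. *)
Lemma measurable_cvg_set d (T : measurableType d) (R : realType) (D : set T)
    (f : nat -> T -> R) : measurable D -> (forall n, measurable_fun D (f n)) ->
  measurable (D `&` [set x | cvgn (f ^~ x)]).
Proof.
move=> mD mf.
pose E (k n m : nat) := D `&` (fun x => `|f m x - f n x|) @^-1` [set` `]-oo, k.+1%:R^-1]].
have mE k n m : measurable (E k n m).
  have mh : measurable_fun D (fun x => `|f m x - f n x|).
    by apply: measurableT_comp => //; exact: measurable_funB.
  by apply: mh => //; exact: measurable_itv.
have -> : D `&` [set x | cvgn (f ^~ x)] =
    D `&` \bigcap_k \bigcup_n \bigcap_(m in [set m | (n <= m)%N]) E k n m.
  apply/seteqP; split => x [Dx h]; split => //=.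
    move=> k _; have k0 : 0 < k.+1%:R^-1 :> R by [].
    have [n hn] := cvg_real_cauchy h k0; exists n => // m /= nm.
    by split => //=; rewrite in_itv /= hn.
  apply: cauchy_real_cvg => eps e0.
  pose k := Num.bound eps^-1.
  have hk : k.+1%:R^-1 <= eps.
    rewrite -[leRHS]invrK lef_pV2 ?posrE ?invr_gt0//.
    apply: ltW; apply: lt_trans (archi_boundP _) _; first by rewrite invr_ge0 ltW.
    by rewrite ltr_nat.
  have [n _ hn] := h k I; exists n => m nm.
  by have [_] := hn m nm; rewrite /= in_itv /= => /le_trans; exact.
apply: measurableI => //; apply: bigcapT_measurable => k.
by apply: bigcupT_measurable => n; apply: bigcap_measurable => [|m _]; [exists n => /=|].
Qed.

(** Off the set of convergence [limn] takes a constant default value, so both pieces are measurable.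
    This is what makes [clim] of measurable functions measurable. *)
Lemma measurable_fun_limn d (T : measurableType d) (R : realType) (D : set T)
    (f : nat -> T -> R) : measurable D -> (forall n, measurable_fun D (f n)) ->
  measurable_fun D (fun x => limn (f ^~ x)).
Proof.
move=> mD mf; pose E := [set x | cvgn (f ^~ x)].
have mE := measurable_cvg_set mD mf.
have -> : D = (D `&` E) `|` (D `\` (D `&` E)).
  by rewrite setDUK// => x [].
have mDE : measurable (D `\` (D `&` E)) by exact: measurableD.
apply/measurable_funU => //; split.
  apply: (@measurable_fun_cvg _ _ _ _ f).
    by move=> n; apply: measurable_funS (mf n) => // x [].
  by move=> x [_ h]; exact: h.
apply: (@eq_measurable_fun _ _ _ _ _ (cst point)); last exact: measurable_cst.
move=> x; rewrite inE => -[Dx nx] /=; rewrite dvgP// => h; exact: nx.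
Qed.

Lemma limn_einf_le (R : realType) (u : (\bar R)^nat) (a : \bar R) :
  (\forall n \near \oo, (u n <= a)%E) -> (limn_einf u <= a)%E.
Proof.
move=> [N _ hN]; rewrite limn_einf_lim; apply: lime_le; first exact: is_cvg_einfs.
apply: nearW => n; apply: le_trans (hN (maxn n N) (leq_maxr _ _)).
by apply: ereal_inf_lbound; exists (maxn n N) => //=; exact: leq_maxl.
Qed.

Section ae.
Variables (R : realType) (A : set (RR R)).
Hypothesis mA : measurable A.
Implicit Types f g : R * R -> R[i].
Local Notation ip := (ip2 A).
Local Notation nsq := (nsq (ip2 A)).

Lemma aeq_sym f g : aeq A f g -> aeq A g f.
Proof. by apply: filterS => x h Ax; rewrite h. Qed.

Lemma aeq_trans g f h : aeq A f g -> aeq A g h -> aeq A f h.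
Proof. by apply: filterS2 => x h1 h2 Ax; rewrite h1// h2. Qed.

Lemma aeq_refl f : aeq A f f.
Proof. exact: aeW. Qed.

Lemma cint_aeq f g : cmeasurable A f -> cmeasurable A g -> aeq A f g ->
  cint A f = cint A g.
Proof.
move=> [f1 f2] [g1 g2] fg; apply: complexP; congr fine; apply: ae_eq_integral => //.
- exact/measurable_EFinP.
- exact/measurable_EFinP.
- by apply: filterS fg => x h Ax; rewrite h.
- exact/measurable_EFinP.
- exact/measurable_EFinP.
- by apply: filterS fg => x h Ax; rewrite h.
Qed.

Lemma L2_aeq f g : cmeasurable A g -> aeq A f g -> L2 A f -> L2 A g.
Proof.
move=> mg fg [mf hf]; split => //.
have -> // : (\int[leb2 R]_(x in A) (sqnormc (g x))%:E = \int[leb2 R]_(x in A) (sqnormc (f x))%:E)%E.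
apply: ge0_ae_eq_integral => //.
- exact: measurable_Esqnormc.
- exact: measurable_Esqnormc.
- by move=> x _; rewrite lee_fin sqnormc_ge0.
- by move=> x _; rewrite lee_fin sqnormc_ge0.
- by apply: filterS fg => x h Ax; rewrite h.
Qed.

Lemma ip2_aeq f f' g g' : L2 A f -> L2 A f' -> L2 A g -> L2 A g' ->
  aeq A f f' -> aeq A g g' -> ip f g = ip f' g'.
Proof.
move=> [mf _] [mf' _] [mg _] [mg' _] hf hg; apply: cint_aeq.
- by apply: cmeasurableM => //; exact: cmeasurableJ.
- by apply: cmeasurableM => //; exact: cmeasurableJ.
- by move: hf hg; apply: filterS2 => x h1 h2 Ax; rewrite h1// h2.
Qed.

Lemma nsq0_aeq f : L2 A f -> nsq f = 0 -> aeq A f (fun=> 0).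
Proof.
move=> Lf f0; have := EFin_nsq mA Lf; rewrite f0 => /esym h.
have : (\int[leb2 R]_(x in A) `|(sqnormc (f x))%:E| = 0)%E.
  by under eq_integral do rewrite gee0_abs ?lee_fin ?sqnormc_ge0//.
move=> /(ae_eq_integral_abs _ mA (measurable_Esqnormc Lf.1)).
by apply: filterS => x h' Ax; have := h' Ax; move=> [] /sqnormc_eq0.
Qed.

Lemma aeq_nsq0 f : cmeasurable A f -> aeq A f (fun=> 0) -> nsq f = 0.
Proof.
move=> mf f0; rewrite /nsq /ip2 (@cint_aeq _ (fun=> 0)) ?cint0//.
- by apply: cmeasurableM => //; exact: cmeasurableJ.
- by apply: filterS f0 => x h Ax; rewrite h// mul0r.
Qed.

Definition ccvgn (z : nat -> R[i]) (l : R[i]) :=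
  (complex.Re (z n) @[n --> \oo] --> complex.Re l) /\
  (complex.Im (z n) @[n --> \oo] --> complex.Im l).

Lemma ccvgn_sqnormc (z : nat -> R[i]) (l a : R[i]) : ccvgn z l ->
  sqnormc (z n - a) @[n --> \oo] --> sqnormc (l - a).
Proof.
move=> [h1 h2]; rewrite /sqnormc !cReD !cImD.
under eq_fun do rewrite !cReD !cImD.
by apply: cvgD; rewrite !expr2; under eq_fun do rewrite expr2; apply: cvgM;
  apply: cvgD => //; exact: cvg_cst.
Qed.

(* By Fatou's lemma, an almost everywhere limit of an L2-Cauchy sequence is
   also its limit in L2. *)
Lemma L2_cauchy_lim (f_ : nat -> R * R -> R[i]) f :
  (forall n, L2 A (f_ n)) -> cmeasurable A f ->
  {ae leb2 R, forall x, A x -> ccvgn (f_ ^~ x) (f x)} ->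
  (forall eps : R, 0 < eps -> exists N, forall m n, (N <= m)%N -> (N <= n)%N ->
    nsq (f_ m - f_ n) <= eps) ->
  L2 A f /\ forall eps : R, 0 < eps -> exists N, forall n, (N <= n)%N ->
    nsq (f - f_ n) <= eps.
Proof.
move=> Lf_ mf hae hc; have H := L2_inner mA.
have main (eps : R) n N : (forall m, (N <= m)%N -> nsq (f_ m - f_ n) <= eps) ->
    (\int[leb2 R]_(x in A) (sqnormc (f x - f_ n x))%:E <= eps%:E)%E.
  move=> hN.
  have Ld m : L2 A (f_ m - f_ n) by exact: (SB H).
  have mD : cmeasurable A (fun x => f x - f_ n x).
    by apply: cmeasurableD => //; apply: cmeasurableN; exact: (Lf_ n).1.
  pose u m x := (sqnormc (f_ m x - f_ n x))%:E.
  have mu m : measurable_fun A (u m) by exact: (measurable_Esqnormc (Ld m).1).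
  have u0 m x : A x -> (0 <= u m x)%E by rewrite lee_fin sqnormc_ge0.
  have -> : (\int[leb2 R]_(x in A) (sqnormc (f x - f_ n x))%:E =
      \int[leb2 R]_(x in A) limn_einf (u ^~ x))%E; last first.
    apply: le_trans (fatou _ mA mu u0) _; apply: limn_einf_le.
    exists N => // m /= Nm; have := EFin_nsq mA (Ld m) => <-.
    by rewrite lee_fin hN.
  apply: ae_eq_integral => //.
  - exact: measurable_Esqnormc.
  - rewrite (_ : (fun x => _) = fun x => (- limn_esup (fun m => - u m x))%E).
      apply: measurableT_comp => //; apply: measurable_fun_limn_esup => m.
      by apply: measurableT_comp.
    by apply/funext => x; rewrite -limn_einfN; congr limn_einf; apply/funext => m; rewrite /comp oppeK.
  - apply: filterS hae => x h Ax; apply/esym.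
    have h' : u m x @[m --> \oo] --> (sqnormc (f x - f_ n x))%:E.
      by apply: cvg_EFin; [exact: nearW|exact: ccvgn_sqnormc (h Ax)].
    by have [] := cvg_limn_einf_sup h'.
have Lfd n (eps : R) N : (forall m, (N <= m)%N -> nsq (f_ m - f_ n) <= eps) ->
    L2 A (f - f_ n).
  move=> /main h; split; last exact: le_lt_trans h (ltry _).
  by apply: cmeasurableD => //; apply: cmeasurableN; exact: (Lf_ n).1.
have [N hN] := hc 1 ltr01.
have Lf : L2 A f.
  have -> : f = (f - f_ N) + f_ N by rewrite subrK.
  by apply: (innerD H) => //; apply: (Lfd N 1 N) => m Nm; exact: hN.
split => // eps e0; have [K hK] := hc _ e0; exists K => n Kn.
have h m : (K <= m)%N -> nsq (f_ m - f_ n) <= eps by move=> Km; exact: hK.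
by rewrite -lee_fin (EFin_nsq mA (Lfd n eps K h)); exact: main h.
Qed.

(** Weighting the k-th squared increment by 4^k leaves integrals of order 4^-k, so the weighted sum
    [h] is finite almost everywhere. Where it is, increments are at most sqrt(h) 2^-k and the
    telescoping series converges. *)
Lemma ae_cvg_fast (g : nat -> R * R -> R) (C : R) :
  (forall k, measurable_fun (A : set (RR R)) (g k)) ->
  (forall k, (\int[leb2 R]_(x in A) ((g k.+1 x - g k x) ^+ 2)%:E <=
     (C * (16 ^- k))%:E)%E) ->
  {ae leb2 R, forall x, A x -> cvgn (g ^~ x)}.
Proof.
move=> mg hg.
pose u (k : nat) x : \bar R := (4 ^+ k * (g k.+1 x - g k x) ^+ 2)%:E.
have mu k : measurable_fun A (u k).
  apply/measurable_EFinP; apply: measurable_funM; first exact: measurable_cst.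
  by apply: measurable_funX; exact: measurable_funB.
have u0 k x : A x -> (0 <= u k x)%E.
  by move=> _; rewrite lee_fin mulr_ge0 ?sqr_ge0 ?exprn_ge0.
have C0 : 0 <= C.
  have := le_trans _ (hg 0%N); rewrite expr0 invr1 mulr1 -lee_fin; apply.
  by apply: integral_ge0 => x _; rewrite lee_fin sqr_ge0.
have iu k : (\int[leb2 R]_(x in A) u k x <= (C * 4 ^- k)%:E)%E.
  rewrite /u; under eq_integral do rewrite EFinM.
  rewrite ge0_integralZl_EFin//; last 2 first.
  - by move=> x _; rewrite lee_fin sqr_ge0.
  - by apply/measurable_EFinP; apply: measurable_funX; exact: measurable_funB.
  apply: le_trans (lee_wpmul2l _ (hg k)) _; first by rewrite lee_fin exprn_ge0.
  rewrite -EFinM lee_fin mulrCA ler_wpM2l//.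
  by rewrite (_ : 16 = 4 * 4)%R ?exprMn; [rewrite invfM mulrA mulfV ?mul1r// expf_neq0|ring].
pose h x := (\big[+%E/0]_(0 <= k <oo) u k x)%E.
have ih : (leb2 R).-integrable A h.
  apply/integrableP; split.
    by apply: ge0_emeasurable_sum => [k x Ax _|k _]; [exact: u0|exact: mu].
  have h0 x : A x -> (0 <= h x)%E by move=> Ax; apply: nneseries_ge0 => k _ _; exact: u0.
  have -> : (\int[leb2 R]_(x in A) `|h x| = \int[leb2 R]_(x in A) h x)%E.
    by apply: eq_integral => x; rewrite inE => Ax; rewrite gee0_abs// h0.
  rewrite integral_nneseries//.
  apply: (@le_lt_trans _ _ (\big[+%E/0]_(0 <= k <oo) (C * 4 ^- k)%:E)%E).
    apply: lee_nneseries => [k *|k *]; last exact: iu.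
    by apply: integral_ge0 => x; exact: u0.
  apply: (@le_lt_trans _ _ (2 * C)%:E); last exact: ltry.
  apply: lime_le; first by apply: is_cvg_nneseries => k _ _; rewrite lee_fin mulr_ge0.
  apply: nearW => n; rewrite sumEFin lee_fin -mulr_sumr mulrC ler_wpM2r//.
  have -> : \sum_(0 <= i < n) 4 ^- i = (4 / 3) * (1 - 4 ^- n) :> R.
    elim: n => [|n IH]; first by rewrite big_geq// expr0 invr1 subrr mulr0.
    by rewrite big_nat_recr//= IH exprS invfM; field; rewrite expf_neq0.
  have : 0 <= (4 : R) ^- n by rewrite invr_ge0 exprn_ge0.
  lra.
have := integrable_ae mA ih; apply: filterS => x hx Ax.
have {}hx := hx Ax.
have hk k : `|g k.+1 x - g k x| <= Num.sqrt (fine (h x)) * 2^-1 ^+ k.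
  have : (u k x <= h x)%E.
    have := @nneseries_lim_ge _ (u ^~ x) xpredT 0%N k.+1 (fun n _ _ => u0 n x Ax).
    apply: le_trans; rewrite big_nat_recr//= leeDr// sume_ge0// => i _; exact: u0.
  rewrite -[in leRHS](fineK hx) lee_fin => hu.
  have f0 : 0 <= fine (h x).
    by apply: le_trans hu; rewrite mulr_ge0 ?sqr_ge0 ?exprn_ge0.
  rewrite -(@ler_pXn2r _ 2) ?nnegrE ?mulr_ge0 ?sqrtr_ge0 ?exprn_ge0//.
  rewrite exprMn sqr_sqrtr// real_normK ?num_real// -exprM mulnC exprM.
  have -> : (2^-1 : R) ^+ 2 = 4^-1 by field.
  rewrite exprVn ler_pdivlMr ?exprn_gt0// mulrC//.
have hs : cvgn (series (telescope (g ^~ x))).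
  apply: normed_cvg; apply: (series_le_cvg _ _ hk).
  - by move=> n.
  - by move=> n; rewrite mulr_ge0 ?sqrtr_ge0 ?exprn_ge0.
  - by apply: is_cvg_geometric_series; rewrite ger0_norm// invf_lt1//; lra.
rewrite (_ : (g ^~ x) = (fun n => g 0%N x + series (telescope (g ^~ x)) n)).
  by apply: is_cvgD => //; exact: is_cvg_cst.
by apply/funext => n; rewrite (eq_sum_telescope (g ^~ x) n).
Qed.

End ae.

Lemma is_derive_mulcl (R : realType) (f : R -> R) (m df t : R) :
  is_derive t 1 f df -> is_derive t 1 (fun t : R => m * f t) (m * df).
Proof. exact: is_deriveZ. Qed.

Lemma is_derive_mull (R : realType) (m t : R) : is_derive t 1 (fun t : R => m * t) m.
Proof. by rewrite -[X in is_derive _ _ _ X]mulr1; apply: is_derive_mulcl. Qed.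

Lemma FTC_oo (R : realType) (f F : R -> R) (a b : R) : a < b ->
  (forall x : R, is_derive x 1 F (f x)) -> continuous f ->
  lebesgue_measure.-integrable (`]a, b[%classic : set (measurableTypeR R)) (EFin \o f) /\
  \int[lebesgue_measure]_(x in (`]a, b[%classic : set (measurableTypeR R))) f x = F b - F a.
Proof.
move=> ab dF cf.
have ic : lebesgue_measure.-integrable (`[a, b]%classic : set (measurableTypeR R)) (EFin \o f).
  apply: continuous_compact_integrable; first exact: segment_compact.
  exact: continuous_subspaceT.
have io : lebesgue_measure.-integrable (`]a, b[%classic : set (measurableTypeR R)) (EFin \o f).
  apply: integrableS ic; rewrite ?measurable_itv//.
  exact: subset_itv_oo_cc.
have cF : continuous F.
  by move=> x; apply: differentiable_continuous; apply/derivable1_diffP; have [] := dF x.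
split => //.
have h := @integral_itv_bndoo R a b (EFin \o f) true false.
rewrite /Rintegral -h; last by case/integrableP: io.
rewrite (@continuous_FTC2 _ f F)//.
- exact: continuous_subspaceT.
- split; first by move=> x _; have [] := dF x.
  + by apply: cvg_at_right_filter; exact: cF.
  + by apply: cvg_at_left_filter; exact: cF.
- by move=> x _; rewrite derive1E; have [_ ->] := dF x.
Qed.

Definition cis (R : realType) (t : R) : R[i] := cos t +i* sin t.

Lemma cexpi (R : realType) (t : R) : cexp (0 +i* t) = cis t.
Proof. by rewrite /cexp /= expR0 mul1r. Qed.

Lemma cisD (R : realType) (s t : R) : cis (s + t) = cis s * cis t.
Proof.
by apply: complexP; rewrite ?cReM ?cImM /= ?cosD ?sinD// addrC mulrC (mulrC (sin t)).
Qed.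

Lemma cisJ (R : realType) (t : R) : (cis t)^* = cis (- t).
Proof. by apply: complexP; rewrite ?cReJ ?cImJ /= ?cosN ?sinN. Qed.

Lemma cis0 (R : realType) : cis (0 : R) = 1.
Proof. by rewrite /cis cos0 sin0. Qed.

Lemma sqnormc_cis (R : realType) (t : R) : sqnormc (cis t) = 1.
Proof. exact: cos2Dsin2. Qed.

Lemma cisNK (R : realType) (t : R) : cis (- t) * cis t = 1.
Proof. by rewrite -cisD addNr cis0. Qed.

Lemma sin_mulpi (R : realType) (m : int) : sin (m%:~R * pi) = 0 :> R.
Proof.
have h (n : nat) : sin (n%:R * pi) = 0 :> R.
  elim: n => [|n IH]; first by rewrite mul0r sin0.
  by rewrite -natr1 mulrDl mul1r sinDpi IH oppr0.
case: m => n; first exact: h.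
by rewrite NegzE mulrNz mulNr sinN (h n.+1) oppr0.
Qed.

Lemma cis_mul2pi (R : realType) (m : int) : cis (m%:~R * (2 * pi)) = 1 :> R[i].
Proof.
have h (n : nat) : cis (n%:R * (2 * pi)) = 1 :> R[i].
  elim: n => [|n IH]; first by rewrite mul0r cis0.
  rewrite -natr1 mulrDl mul1r cisD IH mul1r /cis mulr_natl cos2pi sin2pi//.
case: m => n; first exact: h.
by rewrite NegzE mulrNz mulNr -cisJ (h n.+1) rmorph1.
Qed.

(** * Fourier system on rectangles *)

Definition box (R : realType) (a b : R) : set (R * R) :=
  [set x | (- a < x.1 < a) && (- b < x.2 < b)].

Definition c1int (R : realType) (b : R) (g : R -> R[i]) : R[i] :=
  (\int[lebesgue_measure]_(t in `]- b, b[%classic) complex.Re (g t)) +i*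
  (\int[lebesgue_measure]_(t in `]- b, b[%classic) complex.Im (g t)).

Section product.
Variable R : realType.
Local Notation mu := (@lebesgue_measure R).

Lemma box_setX (a b : R) : box a b = `]- a, a[%classic `*` `]- b, b[%classic.
Proof. by apply/seteqP; split => x /=; rewrite !in_itv /= => /andP. Qed.

Lemma measurable_box (a b : R) : measurable (box a b : set (RR R)).
Proof. by rewrite box_setX; apply: measurableX; exact: measurable_itv. Qed.

(** Both factors are extended by zero to the line, so that Fubini's theorem is applied on the whole
    plane. *)
Lemma integral_prod (I J : set (measurableTypeR R)) (f g : R -> R) :
  measurable I -> measurable J ->
  mu.-integrable I (EFin \o f) -> mu.-integrable J (EFin \o g) ->
  (leb2 R).-integrable (I `*` J : set (RR R)) (fun x => (f x.1 * g x.2)%:E) /\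
  \int[leb2 R]_(x in (I `*` J : set (RR R))) (f x.1 * g x.2) =
    (\int[mu]_(t in I) f t) * (\int[mu]_(t in J) g t).
Proof.
move=> mI mJ hf hg.
pose f' : measurableTypeR R -> R := f \_ I; pose g' : measurableTypeR R -> R := g \_ J.
have pE (k : R -> R) (K : set (measurableTypeR R)) : EFin \o (k \_ K) = (EFin \o k) \_ K.
  by apply/funext => x /=; rewrite !patchE; case: ifP.
have if' : mu.-integrable setT (EFin \o f') by rewrite pE; apply/(integrable_mkcond _ mI).
have ig' : mu.-integrable setT (EFin \o g') by rewrite pE; apply/(integrable_mkcond _ mJ).
pose h (x : RR R) : \bar R := (f' x.1 * g' x.2)%:E.
have hE : (fun x : RR R => (f x.1 * g x.2)%:E) \_ (I `*` J) = h.
  apply/funext => x; rewrite /h /f' /g' !patchE.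
  have -> : (x \in I `*` J) = (x.1 \in I) && (x.2 \in J).
    by apply/idP/andP; rewrite !inE.
  by case: (x.1 \in I); case: (x.2 \in J); rewrite /= ?mul0r ?mulr0.
have mf' : measurable_fun setT f' by apply/measurable_EFinP; case/integrableP: if'.
have mg' : measurable_fun setT g' by apply/measurable_EFinP; case/integrableP: ig'.
have mh : measurable_fun setT h.
  apply/measurable_EFinP; apply: measurable_funM.
    exact: (measurableT_comp mf' measurable_fst).
  exact: (measurableT_comp mg' measurable_snd).
have ih : (leb2 R).-integrable setT h.
  apply/integrable12ltyP => //; rewrite /h /=.
  have hx x : (\int[mu]_y `|(f' x * g' y)%:E| = `|f' x|%:E * \int[mu]_y `|(g' y)%:E|)%E.
    rewrite -ge0_integralZl_EFin//.
      by apply: eq_integral => y _; rewrite /= normrM.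
    by apply: measurableT_comp => //; apply/measurable_EFinP.
  under eq_integral do rewrite hx.
  have [_ ig] := integrableP _ _ _ ig'; have [_ if_] := integrableP _ _ _ if'.
  rewrite ge0_integralZr//; last 2 first.
  - by apply/measurable_EFinP; apply: measurableT_comp.
  - exact: integral_ge0.
  rewrite lte_mul_pinfty//; first exact: integral_ge0.
  by rewrite ge0_fin_numE//; exact: integral_ge0.
have hint : (\int[leb2 R]_x h x = ((\int[mu]_(t in I) f t) * (\int[mu]_(t in J) g t))%:E)%E.
  rewrite -integral12_prod_meas1// /fubini_F /h /=.
  under eq_integral => x _.
    under eq_integral do rewrite EFinM.
    rewrite integralZl//; over.
  have gfin : (\int[mu]_y (g' y)%:E)%E \is a fin_num by exact: integrable_fin_num.
  rewrite -(fineK gfin) integralZr//.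
  have ffin : (\int[mu]_y (f' y)%:E)%E \is a fin_num by exact: integrable_fin_num.
  rewrite -(fineK ffin) -EFinM; congr (_ * _)%:E; rewrite /Rintegral integral_mkcond;
    congr fine; apply: eq_integral => x _; rewrite /f' /g' !patchE; by case: ifP.
split; first by apply/integrable_mkcond; [exact: measurableX|rewrite hE].
rewrite /Rintegral integral_mkcond hE hint//.
Qed.

Definition bcont (g : R -> R[i]) := 
  continuous (fun t => complex.Re (g t)) /\ continuous (fun t => complex.Im (g t)).

Lemma integrable_cont_oo (a b : R) (f : R -> R) : continuous f ->
  mu.-integrable (`]a, b[%classic : set (measurableTypeR R)) (EFin \o f).
Proof.
move=> cf; have ic : mu.-integrable (`[a, b]%classic : set (measurableTypeR R)) (EFin \o f).
  apply: continuous_compact_integrable; first exact: segment_compact.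
  exact: continuous_subspaceT.
by apply: integrableS ic; rewrite ?measurable_itv//; exact: subset_itv_oo_cc.
Qed.

Lemma continuous_cosl (m c : R) : continuous (fun t => cos (m * t + c)).
Proof.
move=> t; apply: (@continuous_comp _ _ _ (fun t => m * t + c) cos); last exact: continuous_cos.
by apply: cvgD; [apply: cvgM; [exact: cvg_cst|exact: cvg_id]|exact: cvg_cst].
Qed.

Lemma continuous_sinl (m c : R) : continuous (fun t => sin (m * t + c)).
Proof.
move=> t; apply: (@continuous_comp _ _ _ (fun t => m * t + c) sin); last exact: continuous_sin.
by apply: cvgD; [apply: cvgM; [exact: cvg_cst|exact: cvg_id]|exact: cvg_cst].
Qed.

Lemma bcont_cis (m : R) : bcont (fun t => cis (m * t)).
Proof.
split; rewrite /cis /=.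
- by under eq_fun do rewrite -[m * _]addr0; exact: continuous_cosl.
- by under eq_fun do rewrite -[m * _]addr0; exact: continuous_sinl.
Qed.

Lemma c1int_cis (m a : R) : 0 < a -> m != 0 -> sin (m * a) = 0 ->
  c1int a (fun t => cis (m * t)) = 0.
Proof.
move=> a0 m0 ma; have aa : - a < a by lra.
apply: complexP; rewrite /c1int /=.
- have dF (t : R) : is_derive t 1 (fun t => m^-1 * sin (m * t)) (cos (m * t)).
    have := is_derive_mulcl (m^-1)
      (is_derive1_comp (f := sin) (is_derive_sin (m * t)) (is_derive_mull m t)).
    by rewrite mulrCA mulVf// mulr1.
  have [_ ->] := FTC_oo aa dF (bcont_cis m).1.
  by rewrite mulrN sinN ma oppr0 mulr0 subrr.
- have dF (t : R) : is_derive t 1 (fun t => - m^-1 * cos (m * t)) (sin (m * t)).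
    have := is_derive_mulcl (- m^-1)
      (is_derive1_comp (f := cos) (is_derive_cos (m * t)) (is_derive_mull m t)).
    by rewrite [X in is_derive _ _ _ X -> _](_ : _ = sin (m * t)) //; field.
  have [_ ->] := FTC_oo aa dF (bcont_cis m).2.
  by rewrite mulrN cosN subrr.
Qed.

Lemma integral_cst_oo (a c : R) : 0 < a ->
  \int[mu]_(t in (`]- a, a[%classic : set (measurableTypeR R))) c = c * (2 * a).
Proof.
move=> a0; rewrite Rintegral_cst ?measurable_itv//; congr (_ * _).
have := @lebesgue_measure_itv R `]- a, a[; rewrite /= lte_fin.
have -> : - a < a by lra.
by rewrite -EFinB => ->; rewrite /=; ring.
Qed.

Lemma c1int1 (a : R) : 0 < a -> c1int a (fun=> 1) = (2 * a)%:C.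
Proof.
by move=> a0; apply: complexP; rewrite /c1int /= integral_cst_oo// ?mul1r ?mul0r.
Qed.

Lemma cint_prod (a b : R) (f g : R -> R[i]) : bcont f ->
  mu.-integrable (`]- b, b[%classic : set (measurableTypeR R)) (fun t => (complex.Re (g t))%:E) ->
  mu.-integrable (`]- b, b[%classic : set (measurableTypeR R)) (fun t => (complex.Im (g t))%:E) ->
  cintegrable (box a b) (fun x => f x.1 * g x.2) /\
  cint (box a b) (fun x => f x.1 * g x.2) = c1int a f * c1int b g.
Proof.
move=> [f1 f2] g1 g2.
have mI (c : R) : measurable (`]- c, c[%classic : set (measurableTypeR R)) by exact: measurable_itv.
have P := fun f g => @integral_prod (`]- a, a[%classic) (`]- b, b[%classic) f g (mI a) (mI b).
have [i11 e11] := P _ _ (integrable_cont_oo _ _ f1) g1.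
have [i22 e22] := P _ _ (integrable_cont_oo _ _ f2) g2.
have [i12 e12] := P _ _ (integrable_cont_oo _ _ f1) g2.
have [i21 e21] := P _ _ (integrable_cont_oo _ _ f2) g1.
rewrite /= in i11 i22 i12 i21 e11 e22 e12 e21.
have mB := measurable_box a b; rewrite box_setX in mB *.
have [j1 E1] := integrable_lin mB 1 (-1) i11 i22.
have [j2 E2] := integrable_lin mB 1 1 i12 i21.
split.
  by split; [move: j1|move: j2]; congr (is_true (_.-integrable _ _)); apply/funext => x;
    rewrite ?cReM ?cImM ?mul1r ?mulN1r.
apply: complexP; rewrite ?cReM ?cImM /cint /c1int /=.
- rewrite -e11 -e22 -[X in X - _]mul1r -[X in _ + X]mulN1r -E1.
  by apply: eq_Rintegral => x _; rewrite cReM mul1r mulN1r.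
- rewrite -e12 -e21 -[X in X + _]mul1r -[X in _ + X]mul1r -E2.
  by apply: eq_Rintegral => x _; rewrite cImM !mul1r.
Qed.

End product.

(** * Functions with vanishing integrals *)

Section null_integrals.
Variable R : realType.
Implicit Types Q E : set (RR R).

Definition rect (a1 b1 a2 b2 : R) : set (R * R) :=
  [set x | (a1 < x.1 < b1) && (a2 < x.2 < b2)].

Lemma rect_setX a1 b1 a2 b2 : rect a1 b1 a2 b2 = `]a1, b1[%classic `*` `]a2, b2[%classic.
Proof. by apply/seteqP; split => x /=; rewrite !in_itv /= => /andP. Qed.

Lemma measurable_rect a1 b1 a2 b2 : measurable (rect a1 b1 a2 b2 : set (RR R)).
Proof. by rewrite rect_setX; apply: measurableX; exact: measurable_itv. Qed.

(** Stable under intersection and generating the Borel sets. A quadrant meets a rectangle in a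
    rectangle with the same upper right corner, which keeps the family to be tested in [rect_null]
    small. *)
Definition quadrants : set (set (RR R)) :=
  [set E | exists x y : R, E = `]x, +oo[%classic `*` `]y, +oo[%classic].

Lemma bigcup_rays : \bigcup_n `](- n%:R), +oo[%classic = [set: R].
Proof.
apply/seteqP; split => // x _; exists (Num.bound `|x|) => //=.
rewrite in_itv /= andbT ltrNl; apply: le_lt_trans (ler_norm _) _.
by rewrite normrN archi_boundP.
Qed.

(** A half-plane is a countable union of quadrants, and preimages of rays generate the preimages of
    all Borel sets of the line. *)
Lemma measurable_quadrants : (@measurable _ (RR R)) `<=` <<s quadrants >>.
Proof.
rewrite measurable_prod_measurableType; apply: smallest_sub.
  exact: smallest_sigma_algebra.
have sG : sigma_algebra setT (<<s quadrants >>) by exact: smallest_sigma_algebra.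
have ray (f : RR R -> R) (A : set (measurableTypeR R)) :
    (forall x : R, <<s quadrants >> (f @^-1` `]x, +oo[%classic)) -> measurable A ->
    <<s quadrants >> (f @^-1` A).
  move=> hf; rewrite RGenOInfty.measurableE => hA.
  suff h : <<s @RGenOInfty.G R >> `<=` image_set_system setT f <<s quadrants >>.
    by have := h _ hA; rewrite /image_set_system /= setTI.
  apply: smallest_sub; first exact: sigma_algebra_image.
  by move=> _ [x ->]; rewrite /image_set_system /= setTI.
have m1 (A : set (measurableTypeR R)) : measurable A -> <<s quadrants >> (fst @^-1` A).
  apply: ray => x.
  have -> : fst @^-1` `]x, +oo[%classic =
      \bigcup_n (`]x, +oo[%classic `*` `](- n%:R), +oo[%classic) :> set (RR R).
    by rewrite -setX_bigcupr bigcup_rays; apply/seteqP; split => y //= [].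
  by case: sG => _ _; apply => n; apply: sub_sigma_algebra; exists x, (- n%:R).
have m2 (A : set (measurableTypeR R)) : measurable A -> <<s quadrants >> (snd @^-1` A).
  apply: ray => x.
  have -> : snd @^-1` `]x, +oo[%classic =
      \bigcup_n (`](- n%:R), +oo[%classic `*` `]x, +oo[%classic) :> set (RR R).
    by rewrite -setX_bigcupl bigcup_rays; apply/seteqP; split => y //= [].
  by case: sG => _ _; apply => n; apply: sub_sigma_algebra; exists (- n%:R), x.
move=> _ [A mA [B mB <-]].
have -> : A `*` B = fst @^-1` A `&` snd @^-1` B by [].
exact: (@measurableI _ (g_sigma_algebraType quadrants)) (m1 A mA) (m2 B mB).
Qed.

(** Sets on which the integral vanishes form a Dynkin system; stability under complement is where
    the vanishing of the total integral enters. *)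
Lemma dynkin_null (G : set (set (RR R))) Q (h : R * R -> R) :
  measurable Q -> (leb2 R).-integrable Q (EFin \o h) -> setI_closed G ->
  (forall E, G E -> measurable E) ->
  (forall E, G E -> (\int[leb2 R]_(x in Q `&` E) (h x)%:E = 0)%E) ->
  (\int[leb2 R]_(x in Q) (h x)%:E = 0)%E ->
  forall E, <<s G >> E -> measurable E /\ (\int[leb2 R]_(x in Q `&` E) (h x)%:E = 0)%E.
Proof.
move=> mQ ih GI Gm G0 Q0; rewrite -setI_closed_g_dynkin_g_sigma_algebra//.
apply: smallest_sub; last by move=> E GE /=; split; [exact: Gm|exact: G0].
split => /=.
- by split; [exact: measurableT|rewrite setIT].
- move=> E [mE E0]; split; first exact: measurableC.
  have : (\int[leb2 R]_(x in (Q `&` E) `|` (Q `&` ~` E)) (h x)%:E = 0)%E.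
    by rewrite -setIUr setUv setIT.
  rewrite integral_setU_EFin ?E0 ?add0e//.
  + exact: measurableI.
  + by apply: measurableI => //; exact: measurableC.
  + rewrite -setIUr setUv setIT; by case/integrableP: ih => /measurable_EFinP.
  + by apply/disj_setPS => x [[_ ?] [_]].
- move=> F tF hF; split; first by apply: bigcupT_measurable => n; have [] := hF n.
  rewrite setI_bigcupr integral_bigcup//.
  + by apply: eseries0 => n _ _; have [] := hF n.
  + exact: trivIset_setIl.
  + by move=> n; apply: measurableI => //; have [] := hF n.
  + apply: integrableS ih => //; last by move=> x [n _ []].
    by apply: bigcupT_measurable => n; apply: measurableI => //; have [] := hF n.
Qed.

(** Rectangles anchored at the corner (b1, b2) suffice: they are the traces of the quadrants, from
    which the Dynkin argument reaches all Borel sets. *)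
Lemma rect_null (a1 b1 a2 b2 : R) (h : R * R -> R) :
  (leb2 R).-integrable (rect a1 b1 a2 b2 : set (RR R)) (EFin \o h) ->
  (forall c1 c2, a1 <= c1 -> c1 < b1 -> a2 <= c2 -> c2 < b2 ->
    \int[leb2 R]_(x in rect c1 b1 c2 b2) h x = 0) ->
  {ae leb2 R, forall x, rect a1 b1 a2 b2 x -> h x = 0}.
Proof.
move=> ih h0; set Q : set (RR R) := rect a1 b1 a2 b2 in ih *.
have mQ : measurable Q := measurable_rect a1 b1 a2 b2.
have rect0 c1 c2 : a1 <= c1 -> a2 <= c2 -> (\int[leb2 R]_(x in rect c1 b1 c2 b2) (h x)%:E = 0)%E.
  move=> c1a c2a; have [cb|bc] := ltP c1 b1; last first.
    rewrite (_ : rect _ _ _ _ = set0) ?integral_set0//.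
    by apply/seteqP; split => // x /=; rewrite /rect /= => /andP[/andP[]]; lra.
  have [cb'|bc] := ltP c2 b2; last first.
    rewrite (_ : rect _ _ _ _ = set0) ?integral_set0//.
    by apply/seteqP; split => // x /=; rewrite /rect /= => /andP[_ /andP[]]; lra.
  have := congr1 (@EFin R) (h0 c1 c2 c1a cb c2a cb'); rewrite /Rintegral fineK//.
  apply: integrable_fin_num; first exact: measurable_rect.
  apply: integrableS ih => //; first exact: measurable_rect.
  by move=> x /=; rewrite /Q /rect /= => /andP[/andP[? ?] /andP[? ?]]; apply/andP; split; lra.
have quad x y : (\int[leb2 R]_(z in Q `&` (`]x, +oo[%classic `*` `]y, +oo[%classic)) (h z)%:E = 0)%E.
  rewrite (_ : _ `&` _ = rect (Num.max a1 x) b1 (Num.max a2 y) b2).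
    by apply: rect0; rewrite le_max lexx.
  apply/seteqP; split => z; rewrite /Q /rect /= !in_itv /= !andbT !gt_max.
    by move=> [/andP[/andP[-> ->] /andP[-> ->]] [-> ->]].
  by move=> /andP[/andP[/andP[-> ->] ->] /andP[/andP[-> ->] ->]].
have Q0 : (\int[leb2 R]_(x in Q) (h x)%:E = 0)%E by exact: rect0.
have main := @dynkin_null quadrants Q h mQ ih _ _ _ Q0.
have {main} all0 E : measurable E -> (\int[leb2 R]_(x in Q `&` E) (h x)%:E = 0)%E.
  move=> /measurable_quadrants /main[]//.
  - move=> _ _ [x [y ->]] [x' [y' ->]]; exists (Num.max x x'), (Num.max y y').
    apply/seteqP; split => z; rewrite /= !in_itv /= !andbT !gt_max.
      by move=> [[-> ->] [-> ->]].
    by move=> [/andP[-> ->] /andP[-> ->]].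
  - by move=> _ [x [y ->]]; apply: measurableX; exact: measurable_itv.
  - by move=> _ [x [y ->]].
have := @integral_ae_eq _ _ _ _ Q mQ (cst 0%E) (EFin \o h) ih _ _.
move=> /(_ (measurable_cst _)) H; have {}H := H _.
have : ae_eq (leb2 R) Q (EFin \o h) (cst 0%E).
  apply: H => E EQ mE; rewrite integral0 -(all0 E mE).
  by congr (integral _ _ _); apply/seteqP; split => [x Ex|x []//]; split => //; exact: EQ.
by apply: filterS => x hx Qx; have := hx Qx; move=> [].
Qed.

End null_integrals.

(** * The Fourier series of the sawtooth function *)

Lemma is_derive_addf (R : realType) (f g : R -> R) (x a b : R) :
  is_derive x 1 f a -> is_derive x 1 g b -> is_derive x 1 (fun t => f t + g t) (a + b).
Proof. exact: is_deriveD. Qed.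

Lemma is_derive_mulf (R : realType) (f g : R -> R) (x a b : R) :
  is_derive x 1 f a -> is_derive x 1 g b ->
  is_derive x 1 (fun t => f t * g t) (f x * b + g x * a).
Proof. exact: is_deriveM. Qed.

Lemma is_derive_invf (R : realType) (f : R -> R) (x a : R) : f x != 0 ->
  is_derive x 1 f a -> is_derive x 1 (fun t => (f t)^-1) (- (f x)^-2 * a).
Proof. exact: is_deriveV. Qed.

Section sawtooth.
Variable R : realType.

(** Partial sums of the Fourier series of (pi - u) / 2 on ]0, 2 pi[. Differences of two translates
    give indicators of intervals. *)
Definition saw (n : nat) (u : R) : R := \sum_(1 <= k < n.+1) k%:R^-1 * sin (k%:R * u).

Lemma saw_derive (n : nat) (u : R) :
  is_derive u 1 (saw n) (\sum_(1 <= k < n.+1) cos (k%:R * u)).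
Proof.
elim: n => [|n IH].
  rewrite big_geq// (_ : saw 0 = cst 0); first exact: is_derive_cst.
  by apply/funext => t; rewrite /saw big_geq.
rewrite big_nat_recr//=.
rewrite (_ : saw n.+1 = saw n \+ (fun u => n.+1%:R^-1 * sin (n.+1%:R * u))); last first.
  by apply/funext => t; rewrite /saw big_nat_recr.
apply: is_deriveD.
have := is_derive_mulcl (n.+1%:R^-1)
  (is_derive1_comp (f := sin) (is_derive_sin (n.+1%:R * u)) (is_derive_mull n.+1%:R u)).
by rewrite mulrCA mulVf ?mulr1// pnatr_eq0.
Qed.

(** The closed form of the Dirichlet kernel: the left-hand side telescopes by the addition
    formulas. *)
Lemma dirichlet (n : nat) (u : R) :
  2 * sin (u / 2) * \sum_(1 <= k < n.+1) cos (k%:R * u) =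
  sin ((n%:R + 2^-1) * u) - sin (u / 2).
Proof.
elim: n => [|n IH].
  by rewrite big_geq// mulr0 add0r mulrC subrr.
rewrite big_nat_recr//= mulrDr IH.
have -> : (n%:R + 2^-1) * u = n.+1%:R * u - u / 2 by rewrite -natr1; field.
have -> : (n.+1%:R + 2^-1) * u = n.+1%:R * u + u / 2 by field.
rewrite sinB sinD; ring.
Qed.

(** With N = n + 1/2, the error [saw n t] - (pi - t) / 2 has derivative sin(N t) / (2 sin(t / 2)),
    which does not decay in N. The added cosine is the boundary term of one integration by parts; it
    cancels this derivative up to order 1/N. *)
Let aux (n : nat) (t : R) := saw n t - (pi - t) / 2 +
  cos ((n%:R + 2^-1) * t) * ((n%:R + 2^-1) * (2 * sin (t / 2)))^-1.

Lemma saw_aux_derive (n : nat) (t : R) : sin (t / 2) != 0 ->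
  is_derive t 1 (aux n) (- (cos ((n%:R + 2^-1) * t) * cos (t / 2)) /
    ((n%:R + 2^-1) * (4 * sin (t / 2) ^+ 2))).
Proof.
move=> s0; set N := n%:R + 2^-1.
have N0 : N != 0 by rewrite gt_eqF// ltr_wpDl.
have d1 : is_derive t 1 (fun t => cos (N * t)) (- sin (N * t) * N).
  exact: (is_derive1_comp (f := cos) (is_derive_cos (N * t)) (is_derive_mull N t)).
have dh : is_derive t 1 (fun t : R => t / 2) (2^-1).
  by under eq_fun do rewrite mulrC; exact: is_derive_mull.
have d2 : is_derive t 1 (fun t : R => sin (t / 2)) (cos (t / 2) * 2^-1).
  exact: (@is_derive1_comp _ sin (fun t : R => t / 2) t _ _ (is_derive_sin (t / 2)) dh).
have d3 : is_derive t 1 (fun t : R => N * (2 * sin (t / 2))) (N * (2 * (cos (t / 2) * 2^-1))).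
  by do 2 apply: is_derive_mulcl.
have n3 : N * (2 * sin (t / 2)) != 0 by rewrite !mulf_neq0.
have d4 := @is_derive_invf _ (fun t : R => N * (2 * sin (t / 2))) t _ n3 d3.
have d5 := is_derive_mulf d1 d4.
have d6 : is_derive t 1 (fun t : R => - ((pi - t) / 2)) (2^-1).
  have -> : (fun t : R => - ((pi - t) / 2)) = (fun t : R => t / 2 + (cst (- (pi / 2)) t)).
    by apply/funext => x /=; field.
  rewrite -[X in is_derive _ _ _ X]addr0; exact: is_derive_addf.
have := is_derive_addf (is_derive_addf (saw_derive n t) d6) d5.
move=> h; apply: is_derive_eq h _.
have D : \sum_(1 <= k < n.+1) cos (k%:R * t) = (sin (N * t) - sin (t / 2)) / (2 * sin (t / 2)).
  by rewrite -dirichlet mulrAC mulfV ?mul1r// mulf_neq0.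
rewrite D; field.
by rewrite s0 N0.
Qed.

(** By the mean value theorem on [u, pi]: [aux] vanishes at pi, its derivative is of order 1/N while
    sin(t / 2) stays away from 0, and the cosine term added in [aux] is itself of order 1/N. *)
Lemma saw_bound (u : R) : 0 < u -> u <= pi ->
  exists2 K : R, 0 < K & forall n, `|saw n u - (pi - u) / 2| <= K / (n%:R + 2^-1).
Proof.
move=> u0 upi; have pi0 := pi_gt0 R.
have s0 : 0 < sin (u / 2) by apply: sin_gt0_pi; lra.
have sge (t : R) : u <= t -> t <= pi -> sin (u / 2) <= sin (t / 2).
  rewrite le_eqVlt => /orP[/eqP ->//|ut] tpi; apply: ltW.
  by rewrite ltr_sin ?in_itv /=; lra.
set s := sin (u / 2) in s0 sge.
exists (pi / (4 * s ^+ 2) + (2 * s)^-1).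
  by rewrite addr_gt0// ?divr_gt0 ?invr_gt0 ?mulr_gt0 ?exprn_gt0.
move=> n; set N := n%:R + 2^-1; have N0 : 0 < N by rewrite ltr_wpDl.
(* N is a half-integer, so cos(N pi) = 0, and every sine in [saw n pi] vanishes. *)
have auxpi : aux n pi = 0.
  rewrite /aux subrr mul0r subr0 -/N.
  have -> : cos (N * pi) = 0.
    by rewrite /N mulrDl [2^-1 * _]mulrC cosDpihalf (sin_mulpi R n) oppr0.
  rewrite mul0r addr0 /saw big1// => k _.
  by rewrite (sin_mulpi R k) mulr0.
have daux (t : R) : u <= t -> t <= pi -> is_derive t 1 (aux n)
   (- (cos (N * t) * cos (t / 2)) / (N * (4 * sin (t / 2) ^+ 2))).
  by move=> ut tpi; apply: saw_aux_derive; rewrite gt_eqF// (lt_le_trans s0)// sge.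
have ab : `|aux n u| <= pi / (4 * s ^+ 2) / N.
  have [||c /[!in_itv]/= /andP[uc cpi] hc] := @MVT_segment _ (aux n)
    (fun t => - (cos (N * t) * cos (t / 2)) / (N * (4 * sin (t / 2) ^+ 2))) _ _ upi.
  - by move=> t /[!in_itv]/= /andP[ut tpi]; apply: daux; exact: ltW.
  - apply: derivable_within_continuous => t /[!in_itv]/= /andP[ut tpi].
    by have [] := daux t ut tpi.
  move: hc; rewrite auxpi sub0r => hc; rewrite -normrN hc.
  have sc := sge c uc cpi; have c0 : 0 < sin (c / 2) := lt_le_trans s0 sc.
  rewrite normrM (@ger0_norm _ (pi - u)); last lra.
  rewrite normrM normrN normrM normfV.
  have D0 : 0 < N * (4 * sin (c / 2) ^+ 2) by rewrite !mulr_gt0 ?exprn_gt0.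
  rewrite (ger0_norm (ltW D0)).
  have h1 : `|cos (N * c)| * `|cos (c / 2)| <= 1.
    by rewrite mulr_ile1// cos_max.
  have h2 : (N * (4 * sin (c / 2) ^+ 2))^-1 <= (N * (4 * s ^+ 2))^-1.
    rewrite lef_pV2 ?posrE// ?mulr_gt0 ?exprn_gt0// !ler_pM2l//.
    by rewrite ler_pXn2r ?nnegrE ?(ltW s0) ?(ltW c0).
  apply: le_trans (_ : 1 * (N * (4 * s ^+ 2))^-1 * pi <= _).
    apply: ler_pM; [|lra| |lra].
      by rewrite mulr_ge0 ?mulr_ge0 ?invr_ge0 ?(ltW D0).
    by apply: ler_pM; rewrite ?mulr_ge0 ?invr_ge0 ?(ltW D0).
  by rewrite le_eqVlt; apply/orP; left; apply/eqP; field; rewrite !gt_eqF.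
have -> : saw n u - (pi - u) / 2 = aux n u - cos (N * u) * (N * (2 * s))^-1.
  by rewrite /aux -/N -/s addrK.
apply: le_trans (ler_normB _ _) _; rewrite [leRHS]mulrDl; apply: lerD ab _.
rewrite normrM normfV (@ger0_norm _ (N * _)); last by rewrite !mulr_ge0 ?ltW.
rewrite invfM [N^-1 * _]mulrC -[leRHS]mul1r ler_wpM2r ?cos_max//.
by rewrite mulr_ge0 ?invr_ge0 ?mulr_ge0 ?ltW.
Qed.

Lemma cvg_harmonic_bound (x : nat -> R) (l K : R) :
  (forall n, `|x n - l| <= K / (n%:R + 2^-1)) -> x n @[n --> \oo] --> l.
Proof.
move=> h; apply/cvgrPdist_le => eps e0.
have K0 : 0 <= K.
  have := le_trans (normr_ge0 _) (h 0%N); rewrite pmulr_lge0// invr_gt0; lra.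
exists (Num.bound (K / eps)) => // n /= hn; rewrite distrC; apply: le_trans (h n) _.
have h1 : K / eps < n%:R.
  apply: lt_le_trans (archi_boundP _) _; first by rewrite divr_ge0// ltW.
  by rewrite ler_nat.
rewrite ler_pdivrMr; last by rewrite ltr_wpDl.
by move: h1; rewrite ltr_pdivrMr// => h1; nra.
Qed.

Lemma sawN n u : saw n (- u) = - saw n u.
Proof. by rewrite /saw -sumrN; apply: eq_bigr => k _; rewrite mulrN sinN mulrN. Qed.

Lemma saw_period n u : saw n (u - 2 * pi) = saw n u.
Proof.
apply: eq_bigr => k _; congr (_ * _).
have /(congr1 (@complex.Im R)) := cis_mul2pi R (- k%:Z).
have /(congr1 (@complex.Re R)) := cis_mul2pi R (- k%:Z).
rewrite /cis /= => hc hs.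
have -> : k%:R * (u - 2 * pi) = k%:R * u + (- k%:Z)%:~R * (2 * pi) by rewrite mulrNz; ring.
by rewrite sinD hc hs mulr1 mulr0 addr0.
Qed.

Lemma saw_cvg u : 0 < u -> u < 2 * pi -> saw n u @[n --> \oo] --> (pi - u) / 2.
Proof.
move=> u0 u2pi; have [upi|piu] := leP u pi.
  by have [K _ hK] := saw_bound u0 upi; apply: cvg_harmonic_bound hK.
have [||K _ hK] := @saw_bound (2 * pi - u); [lra|lra|].
apply: (@cvg_harmonic_bound _ _ K) => n; apply: le_trans (hK n).
have -> : saw n (2 * pi - u) = - saw n u by rewrite -opprB sawN saw_period.
by rewrite -normrN (_ : - (saw n u - (pi - u) / 2) = - saw n u - (pi - (2 * pi - u)) / 2)//; field.
Qed.

Lemma saw_cvgN u : - (2 * pi) < u -> u < 0 -> saw n u @[n --> \oo] --> - (pi + u) / 2.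
Proof.
move=> u1 u2; have Nu1 : 0 < - u by lra.
have Nu2 : - u < 2 * pi by lra.
have := cvgN (saw_cvg Nu1 Nu2); rewrite opprK -mulNr => /(_ _) h.
by rewrite (_ : (fun n => saw n u) = - (fun n => saw n (- u)))//; apply/funext => n;
  rewrite /= [RHS]/GRing.opp /= sawN opprK.
Qed.

(* The partial Fourier sums of the indicator of ]a, b[ with period 2 L. *)
Definition saw_indic (L a b : R) (n : nat) (t : R) : R :=
  pi^-1 * (saw n ((t - a) * pi / L) - saw n ((t - b) * pi / L)) + (b - a) / (2 * L).

(** The linear parts of the two sawtooths combine to minus the mean value (b - a) / (2 L), which is
    added back; what remains is the jump pi between a and b. *)
Lemma saw_indic_cvg (L a b t : R) : 0 < L -> - L <= a -> a < b -> b <= L ->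
  - L < t < L -> t != a -> t != b ->
  saw_indic L a b n t @[n --> \oo] --> (if a < t < b then 1 else 0 : R).
Proof.
move=> L0 La ab bL /andP[tL1 tL2] ta tb; have pi0 := pi_gt0 R.
pose l (c : R) := if c < t then (pi - (t - c) * pi / L) / 2 else - (pi + (t - c) * pi / L) / 2.
have h c : - L <= c -> c <= L -> t != c -> saw n ((t - c) * pi / L) @[n --> \oo] --> l c.
  move=> c1 c2 tc; rewrite /l; case: ltP => [ct|].
    apply: saw_cvg; first by rewrite divr_gt0// mulr_gt0//; lra.
    by rewrite ltr_pdivrMr// mulrAC ltr_pM2r//; lra.
  rewrite le_eqVlt (negbTE tc) /= => ct; apply: saw_cvgN.
    by rewrite ltr_pdivlMr// mulNr mulrAC -mulNr ltr_pM2r//; lra.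
  by rewrite ltr_pdivrMr// mul0r pmulr_llt0//; lra.
have La' : a <= L by lra.
have Lb' : - L <= b by lra.
have hh := cvgD (cvgM (cvg_cst (pi^-1 : R)) (cvgB (h a La La' ta) (h b Lb' bL tb))) (cvg_cst ((b - a) / (2 * L))).
rewrite (_ : (if _ then 1 else 0) = pi^-1 * (l a - l b) + (b - a) / (2 * L)); first exact: hh.
rewrite /l; move: (@pi R) pi0 => p p0.
case: (ltP a t) => at_ /=; case: (ltP b t) => bt.
- by rewrite ltNge (ltW bt) /=; field; rewrite (gt_eqF L0) (gt_eqF p0).
- by rewrite lt_neqAle tb bt /=; field; rewrite (gt_eqF L0) (gt_eqF p0).
- by exfalso; lra.
- by field; rewrite (gt_eqF L0) (gt_eqF p0).
Qed.

End sawtooth.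

(** * Cauchy criteria for orthonormal sums *)

Lemma fset_sum_split (V : zmodType) (I : choiceType) (s t : {fset I}) (F : I -> V) :
  {subset s <= t} ->
  \sum_(i <- t) F i = \sum_(i <- s) F i + \sum_(i <- t) (if i \in s then 0 else F i).
Proof.
move=> st; have -> : \sum_(i <- s) F i = \sum_(i <- t) (if i \in s then F i else 0).
  rewrite -big_mkcond /= -[RHS]big_filter; apply: perm_big; apply: uniq_perm.
  - exact: fset_uniq.
  - by rewrite filter_uniq ?fset_uniq.
  - by move=> i; rewrite mem_filter; apply/idP/andP => [is_|[]//]; split => //; exact: st.
by rewrite -big_split; apply: eq_bigr => i _ /=; case: ifP; rewrite ?addr0 ?add0r.
Qed.

Lemma orthonormal_nsqB (R : realType) (V : lmodType R[i]) (S : V -> Prop)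
    (ip : V -> V -> R[i]) (H : inner_space S ip) (I : choiceType) (e : I -> V)
    (Se : forall i, S (e i)) (ipe : forall i j, ip (e i) (e j) = (i == j)%:R)
    (c : I -> R[i]) (s t : {fset I}) : {subset s <= t} ->
  nsq ip (\sum_(i <- t) c i *: e i - \sum_(i <- s) c i *: e i) =
  \sum_(i <- t) sqnormc (c i) - \sum_(i <- s) sqnormc (c i).
Proof.
move=> st.
rewrite (fset_sum_split (fun i => c i *: e i) st) addrC addKr.
rewrite (fset_sum_split (fun i => sqnormc (c i)) st) addrC addKr.
rewrite (eq_bigr (fun i => (if i \in s then 0 else c i) *: e i)); last first.
  by move=> i _; case: ifP; rewrite ?scale0r.
rewrite (nsq_comb H Se ipe)//; apply: eq_bigr => i _.
by case: ifP; rewrite ?sqnormc0.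
Qed.

Lemma bounded_partial_sums_cauchy (R : realType) (I : choiceType) (s : nat -> {fset I})
    (F : I -> R) (B : R) : (forall i, 0 <= F i) ->
  (forall m n, (m <= n)%N -> {subset s m <= s n}) ->
  (forall n, \sum_(i <- s n) F i <= B) ->
  forall eps : R, 0 < eps -> exists N, forall m, (N <= m)%N ->
    \sum_(i <- s m) F i - \sum_(i <- s N) F i <= eps.
Proof.
move=> F0 hs hB eps e0; pose T n := \sum_(i <- s n) F i.
have Tm : {homo T : m n / (m <= n)%N >-> m <= n}.
  by move=> m n mn; apply: fset_sum_sub => //; exact: hs.
have cT : cvgn T by apply: nondecreasing_is_cvgn => //; exists B => _ [n _ <-]; exact: hB.
have [N hN] := cvg_real_cauchy cT e0; exists N => m Nm.
exact: le_trans (ler_norm _) (hN m Nm).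
Qed.

Lemma orthonormal_cauchy (R : realType) (V : lmodType R[i]) (S : V -> Prop)
    (ip : V -> V -> R[i]) (H : inner_space S ip) (I : choiceType) (e : I -> V)
    (Se : forall i, S (e i)) (ipe : forall i j, ip (e i) (e j) = (i == j)%:R)
    (s : nat -> {fset I}) (c : I -> R[i]) (B : R) :
  (forall m n, (m <= n)%N -> {subset s m <= s n}) ->
  (forall n, \sum_(i <- s n) sqnormc (c i) <= B) ->
  forall eps : R, 0 < eps -> exists N, forall m n, (N <= m)%N -> (N <= n)%N ->
    nsq ip (\sum_(i <- s m) c i *: e i - \sum_(i <- s n) c i *: e i) <= eps.
Proof.
move=> hs hB eps e0.
have [N hN] := bounded_partial_sums_cauchy (fun i => sqnormc_ge0 (c i)) hs hB e0.
have SS n : S (\sum_(i <- s n) c i *: e i) by exact: (Scomb H Se).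
have main m n : (N <= m)%N -> (m <= n)%N ->
    nsq ip (\sum_(i <- s n) c i *: e i - \sum_(i <- s m) c i *: e i) <= eps.
  move=> Nm mn; rewrite (orthonormal_nsqB H Se ipe) ?hs//; last exact: hs.
  apply: le_trans (hN n (leq_trans Nm mn)); rewrite lerD2l lerN2.
  by apply: fset_sum_sub; [move=> i; exact: sqnormc_ge0|exact: hs].
exists N => m n Nm Nn; have [mn|nm] := leqP m n; last by apply: main => //; exact: ltnW.
by rewrite -(nsqN H) ?opprB ?main//; exact: (SB H).
Qed.

(** * Orthogonality of the quasi-periodic exponentials on multiples of the period cell *)

Section fourier.
Variables (R : realType) (alpha r : R).
Hypothesis r0 : 0 < r.
Let pi0 : 0 < (pi : R) := pi_gt0 R.

Definition xi (b : bool) (j : int * int) : R :=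
  if b then j.2%:~R * pi / r else j.1%:~R + alpha.

Definition phic : R := (Num.sqrt (4 * pi * r))^-1.

Lemma phic_gt0 : 0 < phic.
Proof. by rewrite invr_gt0 sqrtr_gt0 !mulr_gt0. Qed.

Lemma phicE : phic ^+ 2 * (4 * pi * r) = 1.
Proof.
by rewrite exprVn sqr_sqrtr ?mulVf// ?gt_eqF ?mulr_gt0// mulr_ge0 ?mulr_ge0 ?ltW.
Qed.

Local Notation phi := (phij alpha r).

Lemma phijE j x : phi j x = phic%:C * (cis (xi false j * x.1) * cis (xi true j * x.2)).
Proof. by rewrite /phij cexpi cisD. Qed.

Lemma continuous_measurable_linear (m1 m2 : R) (f : R -> R) : continuous f ->
  measurable_fun [set: R * R] (fun x : R * R => f (m1 * x.1 + m2 * x.2)).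
Proof.
move=> cf; apply: (@measurableT_comp _ _ _ _ _ _ f _ (fun x : R * R => m1 * x.1 + m2 * x.2)).
  exact: continuous_measurable_fun.
apply: measurable_funD; apply: measurable_funM; try exact: measurable_cst.
  exact: measurable_fst.
exact: measurable_snd.
Qed.

Lemma cmeasurable_cis (m1 m2 : R) : cmeasurable [set: R * R]
  (fun x => cis (m1 * x.1 + m2 * x.2)).
Proof.
by split; apply: continuous_measurable_linear; [exact: continuous_cos|exact: continuous_sin].
Qed.

Lemma cmeasurable_sub (A : set (R * R)) (f : R * R -> R[i]) :
  cmeasurable setT f -> cmeasurable A f.
Proof. by move=> [h1 h2]; split; exact: measurable_funTS. Qed.

Lemma cmeasurable_phij A j : cmeasurable A (phi j).
Proof.
apply: cmeasurable_sub; rewrite (_ : phi j =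
  (fun x => phic%:C * cis (xi false j * x.1 + xi true j * x.2))).
  apply: (@cmeasurableM _ setT); last exact: cmeasurable_cis.
  exact: (@cmeasurable_cst _ setT).
by apply/funext => x; rewrite phijE cisD.
Qed.

Lemma phijM j l x : phi j x * (phi l x)^* = (phic ^+ 2)%:C *
  (cis ((xi false j - xi false l) * x.1) * cis ((xi true j - xi true l) * x.2)).
Proof.
rewrite !phijE !rmorphM /= !cisJ JrealC !mulrBl !cisD; ring.
Qed.

Lemma sqnormc_phij j x : sqnormc (phi j x) = phic ^+ 2.
Proof. by rewrite phijE !sqnormcM !sqnormc_cis sqnormc_real !mulr1. Qed.

Section bigbox.
Variable M : nat.
Hypothesis M0 : (0 < M)%N.
Local Notation B := (box (M%:R * pi) (M%:R * r)).
Let mB : measurable (B : set (RR R)) := measurable_box _ _.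
Let a0 : 0 < M%:R * pi :> R. Proof. by rewrite mulr_gt0 ?ltr0n. Qed.
Let b0 : 0 < M%:R * r. Proof. by rewrite mulr_gt0 ?ltr0n. Qed.

(** The shift alpha cancels in the product, and every frequency difference times the half-length is
    an integer multiple of pi, so a nonzero difference integrates to 0. The factor M^2 counts the
    cells in the box. *)
Lemma cint_phij j l : cintegrable B (fun x => phi j x * (phi l x)^*) /\
  cint B (fun x => phi j x * (phi l x)^*) = (M%:R ^+ 2 * (j == l)%:R)%:C.
Proof.
have [i1 i2] := bcont_cis (xi true j - xi true l).
have [ii ei] := cint_prod (M%:R * pi) (bcont_cis (xi false j - xi false l))
  (integrable_cont_oo (- (M%:R * r)) (M%:R * r) i1)
  (integrable_cont_oo (- (M%:R * r)) (M%:R * r) i2).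
have -> : (fun x => phi j x * (phi l x)^*) = (fun x => (phic ^+ 2)%:C *
  (cis ((xi false j - xi false l) * x.1) * cis ((xi true j - xi true l) * x.2))).
  by apply/funext => x; exact: phijM.
split; first exact: (cintegrableZ mB).
rewrite (cintZ mB)// ei.
have [->|jl] := eqVneq j l.
  rewrite !subrr.
  have e1 : (fun t : R => cis (0 * t)) = fun=> 1 by apply/funext => t; rewrite mul0r cis0.
  rewrite e1 !c1int1// -!rmorphM /=; congr (_%:C).
  transitivity (M%:R ^+ 2 * (phic ^+ 2 * (4 * pi * r))); last by rewrite phicE mulr1n.
  by move: (@pi R) => p; ring.
rewrite mulr0; have [j1|j1] := eqVneq j.1 l.1; last first.
  have x1 : xi false j - xi false l = (j.1 - l.1)%:~R by rewrite /xi intrB; ring.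
  rewrite (@c1int_cis _ _ (M%:R * pi))// ?mul0r ?mulr0//.
    by rewrite x1 intr_eq0 subr_eq0.
  by rewrite x1 mulrA (_ : _ * M%:R = ((j.1 - l.1) * M%:Z)%:~R) ?sin_mulpi// intrM.
have j2 : j.2 != l.2.
  by apply: contraNneq jl => j2; rewrite (surjective_pairing j) j1 j2 -surjective_pairing.
have x2 : xi true j - xi true l = (j.2 - l.2)%:~R * pi / r by rewrite /xi intrB; ring.
rewrite (@c1int_cis _ _ (M%:R * r))// ?mulr0//.
  rewrite x2 mulf_neq0 ?invr_eq0 ?(gt_eqF r0)// mulf_neq0 ?(gt_eqF pi0)//.
  by rewrite intr_eq0 subr_eq0.
rewrite x2 (_ : _ * (M%:R * r) = ((j.2 - l.2) * M%:Z)%:~R * pi) ?sin_mulpi// intrM.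
by move: (@pi R) => p; field; rewrite gt_eqF.
Qed.

Lemma L2_cst (a : R[i]) : L2 B (fun=> a).
Proof.
have [[h _] _] := cint_phij (0, 0) (0, 0).
have [h' _] := integrable_lin mB (sqnormc a / phic ^+ 2) 0 h h.
apply: (L2_dominated mB _ _ h'); first exact: cmeasurable_cst.
move=> x _; rewrite mul0r addr0 mulcJ /= sqnormc_phij divfK//.
by rewrite expf_neq0// gt_eqF// phic_gt0.
Qed.

Lemma L2_bounded f (C : R) : cmeasurable B f -> (forall x, B x -> sqnormc (f x) <= C) ->
  L2 B f.
Proof.
move=> mf hf; have -> : f = (fun x => f x * (fun=> 1) x) by apply/funext => x; rewrite mulr1.
by apply: (L2_bounded_mul mB) hf _ => //; exact: L2_cst.
Qed.

Lemma L2_phij j : L2 B (phi j).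
Proof.
by apply: (@L2_bounded _ (phic ^+ 2)) => [|x _]; [exact: cmeasurable_phij|rewrite sqnormc_phij].
Qed.

Let H := L2_inner mB.
Let e j := (M%:R^-1 : R)%:C *: phi j.

Lemma nsq_phij_sumB (c : int * int -> R[i]) (s t : {fset int * int}) : {subset s <= t} ->
  nsq (ip2 B) (\sum_(j <- t) c j *: phi j - \sum_(j <- s) c j *: phi j) =
  M%:R ^+ 2 * (\sum_(j <- t) sqnormc (c j) - \sum_(j <- s) sqnormc (c j)).
Proof.
move=> st; have Mn : M%:R != 0 :> R by rewrite pnatr_eq0 -lt0n.
have Se j : L2 B (e j) by apply: (innerZ H); exact: L2_phij.
have ipe i j : ip2 B (e i) (e j) = (i == j)%:R.
  have hi := L2_phij i; have hj := L2_phij j.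
  rewrite (inner_ipZ H)//; rewrite (ipZr H)// JrealC {1}/ip2 (cint_phij i j).2.
  rewrite -!rmorphM /= mulrA mulrA -expr2 exprVn mulVf ?expf_neq0// mul1r.
  by case: (i == j).
have E s' : \sum_(j <- s') c j *: phi j = \sum_(j <- s') (c j * M%:R%:C) *: e j.
  apply: eq_bigr => j _; rewrite /e scalerA -mulrA -rmorphM /= mulfV//.
  by rewrite mulr1.
rewrite !E (orthonormal_nsqB H Se ipe _ st) mulrBr !mulr_sumr.
by congr (_ - _); apply: eq_bigr => j _; rewrite sqnormcM sqnormc_real mulrC.
Qed.

End bigbox.

Lemma OmegaE : Omega r = box (1%:R * pi) (1%:R * r).
Proof. by rewrite !mul1r. Qed.

Lemma measurable_Omega : measurable (Omega r : set (RR R)).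
Proof. by rewrite OmegaE; exact: measurable_box. Qed.

Lemma ip2_phij j l : ip2 (Omega r) (phi j) (phi l) = (j == l)%:R.
Proof.
rewrite /ip2 OmegaE (cint_phij (ltnSn 0) j l).2 expr1n mul1r.
by case: (j == l).
Qed.

End fourier.

Lemma finite_Z2N N : finite_set (Z2N N).
Proof.
pose A := [set (i%:Z - N%:Z) | i in `I_(2 * N).+1].
have fA : finite_set A by apply: finite_image; exact: finite_II.
apply: (@sub_finite_set _ _ (A `*` A)); last exact: finite_setX.
have h (k : int) : - N%:Z < k *+ 2 -> k *+ 2 <= N%:Z -> A k.
  move=> h1 h2; exists (absz (k + N%:Z)) => /=; last by rewrite gez0_abs; lia.
  lia.
by move=> j /and4P[h1 h2 h3 h4]; split; apply: h.
Qed.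

Definition ZN (N : nat) : {fset int * int} := fset_set (Z2N N).

Lemma in_ZN N j : (j \in ZN N) =
  [&& - N%:Z < j.1 *+ 2, j.1 *+ 2 <= N%:Z, - N%:Z < j.2 *+ 2 & j.2 *+ 2 <= N%:Z].
Proof.
rewrite in_fset_set; last exact: finite_Z2N.
by apply/idP/idP => [/set_mem//|h]; exact/mem_set.
Qed.

Lemma ZN_mono m n : (m <= n)%N -> {subset ZN m <= ZN n}.
Proof. by move=> mn j; rewrite !in_ZN; lia. Qed.

Lemma ZN_exh j : exists n, j \in ZN n.
Proof. by exists ((absz j.1 + absz j.2).*2.+1)%N; rewrite in_ZN; lia. Qed.

(** * Summation of square-summable Fourier series on the whole plane *)

Section riesz_fischer.
Variables (R : realType) (alpha r : R).
Hypothesis r0 : 0 < r.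
Local Notation phi := (phij alpha r).

Definition partial_sum (c : int * int -> R[i]) (n : nat) : R * R -> R[i] :=
  \sum_(j <- ZN n) c j *: phi j.

Lemma partial_sumE c n x : partial_sum c n x = \sum_(j <- ZN n) c j * phi j x.
Proof. by rewrite /partial_sum fct_sumE. Qed.

Lemma cmeasurable_partial_sum A c n : cmeasurable A (partial_sum c n).
Proof.
apply: cmeasurable_sub; rewrite (_ : partial_sum c n = fun x => \sum_(j <- ZN n) c j * phi j x).
  apply: (@cmeasurable_sum _ setT) => j; apply: (@cmeasurableM _ setT).
    exact: (@cmeasurable_cst _ setT).
  exact: cmeasurable_phij.
by apply/funext => x; exact: partial_sumE.
Qed.

Lemma phij_quasi_periodic j (x : R * R) :
  phi j (x.1 + 2 * pi, x.2) = cis (2 * pi * alpha) * phi j x.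
Proof.
rewrite !phijE /= mulrDr cisD.
have -> : xi alpha r false j * (2 * pi) = j.1%:~R * (2 * pi) + 2 * pi * alpha by rewrite /xi; ring.
by rewrite cisD cis_mul2pi; ring.
Qed.

Lemma partial_sum_quasi_periodic c n (x : R * R) :
  partial_sum c n (x.1 + 2 * pi, x.2) = cis (2 * pi * alpha) * partial_sum c n x.
Proof.
rewrite !partial_sumE mulr_sumr; apply: eq_bigr => j _.
by rewrite phij_quasi_periodic mulrCA.
Qed.

Lemma box_bigcup (x : R * R) : exists2 M : nat, (0 < M)%N & box (M%:R * pi) (M%:R * r) x.
Proof.
have pi0 := pi_gt0 R.
pose a := `|x.1| / pi + `|x.2| / r.
have a0 : 0 <= a by rewrite addr_ge0// divr_ge0// ltW.
pose M := (Num.bound a).+1; have aM : a < M%:R.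
  by apply: lt_trans (archi_boundP a0) _; rewrite ltr_nat.
exists M => //; rewrite /box /=.
have h1 : `|x.1| < M%:R * pi.
  rewrite -ltr_pdivrMr//; apply: le_lt_trans aM; rewrite /a lerDl divr_ge0// ltW//.
have h2 : `|x.2| < M%:R * r.
  rewrite -ltr_pdivrMr//; apply: le_lt_trans aM; rewrite /a lerDr divr_ge0// ltW//.
by rewrite -!ltr_norml h1 h2.
Qed.

(* The limit is taken along a subsequence of the partial sums that converges
   almost everywhere on the whole plane, so that quasi-periodicity is inherited. *)
Lemma riesz_fischer (c : int * int -> R[i]) (B : R) :
  (forall n, \sum_(j <- ZN n) sqnormc (c j) <= B) ->
  exists U : R * R -> R[i], [/\ cmeasurable setT U,
    forall M : nat, (0 < M)%N -> L2 (box (M%:R * pi) (M%:R * r)) U /\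
      forall eps : R, 0 < eps -> exists N, forall n, (N <= n)%N ->
        nsq (ip2 (box (M%:R * pi) (M%:R * r))) (U - partial_sum c n) <= eps &
    quasi_periodic alpha U].
Proof.
move=> hB.
have sq0 j : 0 <= sqnormc (c j) := sqnormc_ge0 (c j).
have C := bounded_partial_sums_cauchy sq0 ZN_mono hB.
have e16 (k : nat) : 0 < (16 : R) ^- k by rewrite invr_gt0 exprn_gt0.
have [K hK] := choice (fun k => C _ (e16 k)).
(* The maximum makes the subsequence monotone, at least k, and far enough out for the tails to be at
   most 16^-k, the rate that [ae_cvg_fast] requires. *)
pose nk k := (\max_(i < k.+1) maxn i (K i))%N.
have nkm k : (nk k <= nk k.+1)%N by rewrite /nk [X in (_ <= X)%N]big_ord_recr leq_maxl.
have Knk k : (maxn k (K k) <= nk k)%N by rewrite /nk big_ord_recr leq_maxr.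
have nkge k : (k <= nk k)%N := leq_trans (leq_maxl _ _) (Knk k).
have {}Knk k : (K k <= nk k)%N := leq_trans (leq_maxr _ _) (Knk k).
pose g k := partial_sum c (nk k).
have nkmono k l : (k <= l)%N -> (nk k <= nk l)%N.
  exact: (homo_leq leqnn leq_trans nkm).
have T (k l : nat) : (k <= l)%N ->
    \sum_(j <- ZN (nk l)) sqnormc (c j) - \sum_(j <- ZN (nk k)) sqnormc (c j) <= 16 ^- k.
  move=> kl; apply: le_trans (hK k (nk l) (leq_trans (Knk k) (nkmono k l kl))).
  by rewrite lerD2l lerN2; apply: fset_sum_sub => //; apply: ZN_mono.
have gM M (M0 : (0 < M)%N) k l : (k <= l)%N ->
    nsq (ip2 (box (M%:R * pi) (M%:R * r))) (g l - g k) <= M%:R ^+ 2 * 16 ^- k.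
  move=> kl; rewrite (nsq_phij_sumB alpha r0 M0); last by apply: ZN_mono; exact: nkmono.
  by rewrite ler_wpM2l ?exprn_ge0 ?T.
have mg A k : cmeasurable A (g k) by exact: cmeasurable_partial_sum.
have L2g M (M0 : (0 < M)%N) k : L2 (box (M%:R * pi) (M%:R * r)) (g k).
  apply: (spanS (L2_inner (measurable_box _ _))) => j.
  by apply: (innerZ (L2_inner (measurable_box _ _))); exact: L2_phij.
have aeM M (M0 : (0 < M)%N) : {ae leb2 R, forall x, box (M%:R * pi) (M%:R * r) x ->
    cvgn (fun k => complex.Re (g k x)) /\ cvgn (fun k => complex.Im (g k x))}.
  have mB := measurable_box (M%:R * pi) (M%:R * r).
  have I k : (\int[leb2 R]_(x in box (M%:R * pi) (M%:R * r)) (sqnormc (g k.+1 x - g k x))%:E <=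
      (M%:R ^+ 2 * 16 ^- k)%:E)%E.
    have Ld : L2 (box (M%:R * pi) (M%:R * r)) (g k.+1 - g k).
      by apply: (SB (L2_inner mB)); exact: L2g.
    by rewrite -(EFin_nsq mB Ld) lee_fin gM.
  have J (P : R[i] -> R) : (forall z, P z ^+ 2 <= sqnormc z) ->
      (forall z w, P (z - w) = P z - P w) -> (forall k, measurable_fun (box (M%:R * pi) (M%:R * r)) (fun x => P (g k x))) ->
      {ae leb2 R, forall x, box (M%:R * pi) (M%:R * r) x -> cvgn (fun k => P (g k x))}.
    move=> Psq PB Pm; apply: (ae_cvg_fast mB Pm (C := M%:R ^+ 2)) => k.
    apply: le_trans (I k); apply: ge0_le_integral => //.
    - by move=> x _; rewrite lee_fin sqr_ge0.
    - by apply/measurable_EFinP; apply: measurable_funX; apply: measurable_funB; exact: Pm.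
    - apply: measurable_Esqnormc; apply: cmeasurableD; first exact: mg.
      by apply: cmeasurableN; exact: mg.
    - by move=> x _; rewrite lee_fin -PB.
  have J1 := J (@complex.Re R) _ _ (fun k => (mg _ k).1).
  have J2 := J (@complex.Im R) _ _ (fun k => (mg _ k).2).
  apply: filterS2 (J1 _ _) (J2 _ _) => [x h1 h2 Bx| z | z w | z | z w].
  - by split; [exact: h1|exact: h2].
  - by rewrite lerDl sqr_ge0.
  - by rewrite cReD cReN.
  - by rewrite lerDr sqr_ge0.
  - by rewrite cImD cImN.
pose U x := clim (fun k => g k x).
have mU : cmeasurable setT U.
  by split; apply: measurable_fun_limn => // k; [exact: (mg _ k).1|exact: (mg _ k).2].
have aeU : {ae leb2 R, forall x, ccvgn (fun k => g k x) (U x)}.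
  (* Countably many boxes cover the plane, so the exceptional sets unite to a null set. *)
  have : {ae leb2 R, forall x (M : nat), (0 < M)%N -> box (M%:R * pi) (M%:R * r) x ->
      cvgn (fun k => complex.Re (g k x)) /\ cvgn (fun k => complex.Im (g k x))}.
    apply: ae_foralln => M; have [->|M0] := posnP M; first exact: aeW.
    by apply: filterS (aeM M M0) => x h _; exact: h.
  by apply: filterS => x h; have [M M0 Bx] := box_bigcup x; have [h1 h2] := h M M0 Bx.
exists U; split => //.
- move=> M M0; have mB := measurable_box (M%:R * pi) (M%:R * r).
  have H := L2_inner mB.
  have Cg (eps : R) : 0 < eps -> exists N, forall m n, (N <= m)%N -> (N <= n)%N ->
      nsq (ip2 (box (M%:R * pi) (M%:R * r))) (partial_sum c m - partial_sum c n) <= eps.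
    move=> e0; have e1 : 0 < eps / M%:R ^+ 2 by rewrite divr_gt0// exprn_gt0// ltr0n.
    have [N hN] := C _ e1.
    have main m n : (N <= m)%N -> (m <= n)%N ->
       nsq (ip2 (box (M%:R * pi) (M%:R * r))) (partial_sum c n - partial_sum c m) <= eps.
      move=> Nm mn; rewrite (nsq_phij_sumB alpha r0 M0); last exact: ZN_mono.
      rewrite mulrC -ler_pdivlMr ?exprn_gt0 ?ltr0n//.
      apply: le_trans (hN n (leq_trans Nm mn)); rewrite lerD2l lerN2.
      by apply: fset_sum_sub => //; exact: ZN_mono.
    have Lp n : L2 (box (M%:R * pi) (M%:R * r)) (partial_sum c n).
      by apply: (spanS H) => j; apply: (innerZ H); exact: L2_phij.
    exists N => m n Nm Nn; have [mn|nm] := leqP m n; last by apply: main => //; exact: ltnW.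
    by rewrite -(nsqN H) ?opprB ?main//; exact: (SB H).
  have aeB : {ae leb2 R, forall x, box (M%:R * pi) (M%:R * r) x -> ccvgn (g ^~ x) (U x)}.
    by apply: filterS aeU => x h _.
  have [|LU hU] := L2_cauchy_lim mB (L2g M M0) (cmeasurable_sub _ mU) aeB.
    move=> eps /Cg[N hN]; exists N => m n Nm Nn.
    by apply: hN; exact: leq_trans (nkge _).
  split; first exact: LU.
  move=> eps e0.
  have e4 : 0 < eps / 4 by lra.
  have [N1 hN1] := hU _ e4; have [N2 hN2] := Cg _ e4.
  exists N2 => n N2n.
  have Lp n' : L2 (box (M%:R * pi) (M%:R * r)) (partial_sum c n').
    by apply: (spanS H) => j; apply: (innerZ H); exact: L2_phij.
  pose k := maxn N1 N2.
  have -> : U - partial_sum c n = (U - g k) + (g k - partial_sum c n) by rewrite addrA subrK.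
  have S1 := SB H LU (L2g M M0 k); have S2 := SB H (L2g M M0 k) (Lp n).
  apply: le_trans (nsqD_le H S1 S2) _.
  have N2k : (N2 <= nk k)%N := leq_trans (leq_maxr N1 N2) (nkge k).
  apply: (@le_trans _ _ (2 * (eps / 4 + eps / 4))); last by lra.
  apply: ler_wpM2l; first by [].
  by apply: lerD; [exact: hN1 (leq_maxl _ _)|exact: hN2 N2k N2n].
- apply: filterS aeU => x [h1 h2].
  have cE : cexp (0 +i* (2 * pi * alpha)) = cis (2 * pi * alpha) by rewrite cexpi.
  rewrite cE /U /clim; set a := cis _.
  have E k : g k (x.1 + 2 * pi, x.2) = a * g k x by exact: partial_sum_quasi_periodic.
  apply: complexP; rewrite ?cReM ?cImM /=; apply/cvg_lim => //.
  + under eq_fun do rewrite E cReM.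
    by apply: cvgB; apply: cvgM => //; exact: cvg_cst.
  + under eq_fun do rewrite E cImM.
    by apply: cvgD; apply: cvgM => //; exact: cvg_cst.
Qed.

End riesz_fischer.

(** * Fourier coefficients of the indicator of an interval *)

Lemma ae_fst_neq (R : realType) (a : R) : {ae leb2 R, forall x, x.1 != a}.
Proof.
exists ([set a] `*` setT : set (RR R)); split.
- by apply: measurableX => //; exact: measurable_set1.
- have h : lebesgue_measure ([set a] : set (measurableTypeR R)) = 0%E := lebesgue_measure_set1 a.
  have m1 : measurable ([set a] : set (measurableTypeR R)) := measurable_set1 a.
  transitivity (lebesgue_measure ([set a] : set (measurableTypeR R)) * lebesgue_measure (setT : set (measurableTypeR R)))%E.
    exact: product_measure1E.
  by rewrite h mul0e.
- by move=> x /= /negP/negPn/eqP ->.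
Qed.

Lemma ae_snd_neq (R : realType) (a : R) : {ae leb2 R, forall x, x.2 != a}.
Proof.
exists (setT `*` [set a] : set (RR R)); split.
- by apply: measurableX => //; exact: measurable_set1.
- have h : lebesgue_measure ([set a] : set (measurableTypeR R)) = 0%E := lebesgue_measure_set1 a.
  have m1 : measurable ([set a] : set (measurableTypeR R)) := measurable_set1 a.
  transitivity (lebesgue_measure (setT : set (measurableTypeR R)) * lebesgue_measure ([set a] : set (measurableTypeR R)))%E.
    exact: product_measure1E.
  by rewrite h mule0.
- by move=> x /= /negP/negPn/eqP ->.
Qed.

(** The integers of modulus at most n, built so that a symmetric sum unrolls by the pair n, -n. This
    is the order of summation in [green]. *)
Fixpoint symz (n : nat) : {fset int} :=
  if n is m.+1 then (n%:Z |` ((- n%:Z) |` symz m))%fset else [fset 0]%fset.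

Lemma in_symz n k : (k \in symz n) = (absz k <= n)%N.
Proof.
elim: n => [|n IH]; first by rewrite /= inE; lia.
by rewrite /= !inE IH; lia.
Qed.

Lemma symz_mono m n : (m <= n)%N -> {subset symz m <= symz n}.
Proof. by move=> mn k; rewrite !in_symz => /leq_trans; apply. Qed.

Lemma sum_symz_recr (V : zmodType) n (F : int -> V) :
  \sum_(k <- symz n.+1) F k = F n.+1%:Z + F (- n.+1%:Z) + \sum_(k <- symz n) F k.
Proof.
rewrite /= big_fsetU1 /=; last by rewrite !inE in_symz; lia.
by rewrite big_fsetU1 /= ?addrA//; rewrite in_symz; lia.
Qed.

Section saw_coef.
Variables (R : realType) (L a b : R).
Hypothesis L0 : 0 < L.

(** The Fourier coefficient (1 / (2 L)) times the integral over ]a, b[ of exp(- i k pi t / L). *)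
Definition saw_coef (k : int) : R[i] :=
  if k == 0 then ((b - a) / (2 * L))%:C else
  (0 +i* (- (2 * pi * k%:~R)^-1)) *
    (cis (- (k%:~R * pi / L * a)) - cis (- (k%:~R * pi / L * b))).

Lemma saw_coef_sum n t : \sum_(k <- symz n) saw_coef k * cis (k%:~R * pi / L * t) =
  (saw_indic L a b n t)%:C.
Proof.
elim: n => [|n IH].
  rewrite /= big_seq_fset1 /saw_coef eqxx mul0r mul0r mul0r cis0 mulr1.
  by rewrite /saw_indic /saw !big_geq// subrr mulr0 add0r.
rewrite sum_symz_recr IH /saw_coef.
have -> : (n.+1%:Z == 0) = false by lia.
have -> : (- n.+1%:Z == 0) = false by lia.
have pi0 := lt0r_neq0 (pi_gt0 R).
have n0 : n.+1%:R != 0 :> R by rewrite pnatr_eq0.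
have -> : saw_indic L a b n.+1 t = pi^-1 * n.+1%:R^-1 *
   (sin (n.+1%:R * ((t - a) * pi / L)) - sin (n.+1%:R * ((t - b) * pi / L))) +
   saw_indic L a b n t.
  have sn c : saw n.+1 c = saw n c + n.+1%:R^-1 * sin (n.+1%:R * c).
    by rewrite /saw big_nat_recr.
  rewrite /saw_indic !sn; move: (saw n _) (saw n _) (sin _) (sin _) => A B s s'.
  by move: (pi^-1) (n.+1%:R^-1) ((b - a) / _) => p k q; ring.
have CD (x y : R) : (x + y)%:C = x%:C + y%:C by exact: rmorphD.
rewrite [RHS]CD; congr (_ + _); rewrite mulrNz.
set p := (_%:~R * pi / L); have pE : p = n.+1%:R * pi / L by [].
have E c : n.+1%:R * ((t - c) * pi / L) = p * t - p * c.
  by rewrite pE; move: (@pi R) => q; ring.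
rewrite !E; have -> : - n.+1%:~R * pi / L = - p by rewrite pE !mulNr.
rewrite (_ : n.+1%:~R = n.+1%:R)// !mulNr !opprK mulrN invrN opprK.
move: (p * t) (p * a) (p * b) => x u v.
move: (n.+1%:R : R) n0 (@pi R) pi0 => N N0 q q0.
rewrite !sinB /cis; apply: complexP;
  rewrite ?cReM ?cImM ?cReD ?cImD ?cReN ?cImN /= ?cosN ?sinN ?cReM ?cImM /=.
- move: (cos x) (sin x) (cos u) (sin u) (cos v) (sin v) => a1 a2 a3 a4 a5 a6.
  by field; rewrite q0 N0.
- move: (cos x) (sin x) (cos u) (sin u) (cos v) (sin v) => a1 a2 a3 a4 a5 a6.
  by field; rewrite q0 N0.
Qed.

(** For |k| = N the squared modulus is at most 1 / (pi N)^2 <= 1 / (4 N^2), as pi >= 2. The term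
    1/(n+1) subtracted in the induction makes the sum telescope, since 1 / (2 N^2) <= 1/N -
    1/(N+1). *)
Lemma saw_coef_bounded n : \sum_(k <- symz n) sqnormc (saw_coef k) <=
  sqnormc (saw_coef 0) + 2.
Proof.
suff h : \sum_(k <- symz n) sqnormc (saw_coef k) <= sqnormc (saw_coef 0) + 2 - n.+1%:R^-1.
  by apply: le_trans h _; rewrite lerBlDr lerDl invr_ge0.
elim: n => [|n IH].
  by rewrite /= big_seq_fset1 invr1; lra.
rewrite sum_symz_recr.
have b1 (k : int) : (absz k = n.+1)%N -> sqnormc (saw_coef k) <= (4 * n.+1%:R ^+ 2)^-1.
  move=> kn; have k0 : k != 0 by apply/eqP => k0; rewrite k0 in kn.
  rewrite /saw_coef (negbTE k0) sqnormcM sqnormci.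
  have h := sqnormcD (cis (- (k%:~R * pi / L * a))) (- cis (- (k%:~R * pi / L * b))).
  rewrite sqnormcN !sqnormc_cis in h.
  have k2 : (k%:~R : R) ^+ 2 = n.+1%:R ^+ 2.
    by rewrite -kn -(real_normK (num_real (k%:~R : R))) -intr_norm -abszE.
  have pi2 : (2 : R) <= pi by exact: pi_ge2.
  have pp : 4 <= (pi : R) ^+ 2 by nra.
  rewrite sqrrN exprVn !exprMn k2.
  have n0 : 0 < n.+1%:R ^+ 2 :> R by rewrite exprn_gt0.
  apply: le_trans (_ : (2 ^+ 2 * pi ^+ 2 * n.+1%:R ^+ 2)^-1 * 4 <= _).
    by rewrite ler_wpM2l ?invr_ge0 ?mulr_ge0 ?sqr_ge0//; lra.
  move: (pi ^+ 2) pp (n.+1%:R ^+ 2) n0 => q qq N2 N20.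
  have -> : (2 ^+ 2 * q * N2)^-1 * 4 = (q * N2)^-1.
    by field; rewrite !gt_eqF//; lra.
  rewrite lef_pV2 ?posrE ?mulr_gt0//; last by lra.
  by rewrite ler_pM2r.
have h1 := b1 n.+1%:Z erefl; have h2 := b1 (- n.+1%:Z) (abszN _).
have n1 : 0 < n.+1%:R :> R by [].
have h3 : 2 * (4 * n.+1%:R ^+ 2)^-1 <= n.+1%:R^-1 - n.+2%:R^-1 :> R.
  rewrite -[n.+2%:R]natr1; have n2 : 1 <= n.+1%:R :> R by rewrite ler1n.
  move: (n.+1%:R : R) n1 n2 => N N0 N1.
  have -> : 2 * (4 * N ^+ 2)^-1 = (2 * N ^+ 2)^-1 by field; rewrite gt_eqF.
  have -> : N^-1 - (N + 1)^-1 = (N * (N + 1))^-1 by field; rewrite !gt_eqF//; lra.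
  rewrite lef_pV2 ?posrE ?mulr_gt0 ?exprn_gt0//; last by lra.
  by nra.
move: IH h1 h2 h3; clear.
move: (\sum_(k <- symz n) _) (sqnormc (saw_coef n.+1)) (sqnormc (saw_coef (- n.+1%:Z))) => X Y Z.
move: (sqnormc _) ((4 * _)^-1) (n.+1%:R^-1) (n.+2%:R^-1) => c0 c1 c2 c3; lra.
Qed.

End saw_coef.

Lemma cint_sub (R : realType) (A B : set (R * R)) (f : R * R -> R[i]) : B `<=` A ->
  (forall x, A x -> ~ B x -> f x = 0) -> cint A f = cint B f.
Proof.
move=> BA f0; have h (g : R[i] -> R) : g 0 = 0 ->
    \int[leb2 R]_(x in A) g (f x) = \int[leb2 R]_(x in B) g (f x).
  move=> g0; rewrite /Rintegral integral_mkcond [in RHS]integral_mkcond.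
  congr (fine (integral _ _ _)); apply/funext => x; rewrite !patchE.
  have [/set_mem Ax|nA] := boolP (x \in A); have [xB|nB] := boolP (x \in B) => //.
  - by rewrite f0 ?g0//; move: nB; rewrite notin_setE.
  - by move: nA; rewrite notin_setE => /(_ (BA _ (set_mem xB))).
by rewrite /cint !h.
Qed.

(** * Completeness of the Fourier system *)

Section fourier_basis.
Variables (R : realType) (alpha r : R).
Hypothesis r0 : 0 < r.
Local Notation phi := (phij alpha r).
Local Notation O := (Omega r).
Local Notation ip := (ip2 O).
Local Notation nsq := (nsq (ip2 O)).
Let mO : measurable (O : set (RR R)) := measurable_Omega r.
Let H : inner_space (L2 O) ip := L2_inner mO.

Lemma L2_Omega_bounded f (C : R) : cmeasurable O f ->
  (forall x, O x -> sqnormc (f x) <= C) -> L2 O f.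
Proof. by rewrite OmegaE; exact: (L2_bounded alpha r0 (ltnSn 0)). Qed.

Lemma L2_phij_Omega j : L2 O (phi j).
Proof. by rewrite OmegaE; exact: (L2_phij alpha r0 (ltnSn 0)). Qed.

Let Lphi := L2_phij_Omega.

(** Orthogonality passes to almost everywhere limits of L^2-Cauchy sequences; this is how indicators
    enter the closed span of the exponentials. *)
Lemma ip_lim0 f (g_ : nat -> R * R -> R[i]) g : L2 O f -> (forall n, L2 O (g_ n)) ->
  cmeasurable O g -> {ae leb2 R, forall x, O x -> ccvgn (g_ ^~ x) (g x)} ->
  (forall eps : R, 0 < eps -> exists N, forall m n, (N <= m)%N -> (N <= n)%N ->
    nsq (g_ m - g_ n) <= eps) ->
  (forall n, ip f (g_ n) = 0) -> L2 O g /\ ip f g = 0.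
Proof.
move=> Lf Lg_ mg hae hc h0; have [Lg hg] := L2_cauchy_lim mO Lg_ mg hae hc.
split; first exact: Lg.
apply: sqnormc_eq0; apply/eqP; rewrite eq_le sqnormc_ge0 andbT leNgt; apply/negP => e0.
have f0 := nsq_ge0 H Lf.
have e1 : 0 < sqnormc (ip f g) / (nsq f + 1) / 2.
  by rewrite divr_gt0// divr_gt0//; lra.
have [N /(_ N (leqnn N)) hN] := hg _ e1.
have := cauchy_schwarz H Lf (SB H Lg (Lg_ N)).
rewrite (ipBr H)// h0 subr0 leNgt => /negP; apply.
apply: (@le_lt_trans _ _ ((nsq f + 1) * (sqnormc (ip f g) / (nsq f + 1) / 2))).
  by apply: ler_pM => //; [exact: (nsq_ge0 H (SB H Lg (Lg_ N)))|lra].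
rewrite mulrA mulrCA mulfV ?mulr1; last by rewrite gt_eqF//; lra.
by rewrite ltr_pdivrMr//; move: (sqnormc _) e0 => t t0; lra.
Qed.

Lemma nsq_le f g : L2 O f -> L2 O g -> (forall x, O x -> sqnormc (f x) <= sqnormc (g x)) ->
  nsq f <= nsq g.
Proof.
move=> Lf Lg h; rewrite !nsq_L2//.
by apply: le_Rintegral => //; exact: sqnormc_integrable.
Qed.

Definition ind (a b t : R) : R := if a < t < b then 1 else 0.

Lemma ind_out a b t : (a < t < b) = false -> ind a b t = 0.
Proof. by rewrite /ind => ->. Qed.

Lemma measurable_ind a b : measurable_fun [set: R] (ind a b).
Proof.
rewrite (_ : ind a b = \1_(`]a, b[%classic)); last first.
  by apply/funext => t; rewrite indicE /ind mem_setE in_itv /=; case: ifP.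
by apply: measurable_indic; exact: measurable_itv.
Qed.

Lemma ind_sq a b t : ind a b t ^+ 2 <= 1.
Proof. by rewrite /ind; case: ifP; rewrite ?expr1n ?expr0n. Qed.

Lemma cmeasurable_ind1 a b : cmeasurable O (fun x => (ind a b x.1)%:C).
Proof.
apply: cmeasurable_real; apply: measurable_funTS.
exact: (measurableT_comp (measurable_ind a b) measurable_fst).
Qed.

Lemma cmeasurable_ind2 a b : cmeasurable O (fun x => (ind a b x.2)%:C).
Proof.
apply: cmeasurable_real; apply: measurable_funTS.
exact: (measurableT_comp (measurable_ind a b) measurable_snd).
Qed.

Lemma cmeasurable_cisl (m : R) (i : bool) :
  cmeasurable O (fun x => cis (m * (if i then x.2 else x.1))).
Proof.
apply: cmeasurable_sub; case: i.
- have := cmeasurable_cis 0 m.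
  by under eq_fun do rewrite mul0r add0r.
- have := cmeasurable_cis m 0.
  by under eq_fun do rewrite mul0r addr0.
Qed.

Lemma saw_ccvgn L a b t : 0 < L -> - L <= a -> a < b -> b <= L ->
  - L < t < L -> t != a -> t != b ->
  saw_indic L a b n t @[n --> \oo] --> ind a b t.
Proof. exact: saw_indic_cvg. Qed.

Lemma ccvgnM_real (z w : R[i]) (x_ : nat -> R) (l : R) : x_ n @[n --> \oo] --> l ->
  ccvgn (fun n => z * (x_ n)%:C * w) (z * l%:C * w).
Proof.
move=> hx; have E (y : R) : z * y%:C * w = y%:C * (z * w) by ring.
split.
- under eq_fun do rewrite E cReM /= mul0r subr0.
  by rewrite E cReM /= mul0r subr0; apply: cvgM => //; exact: cvg_cst.
- under eq_fun do rewrite E cImM /= mul0r addr0.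
  by rewrite E cImM /= mul0r addr0; apply: cvgM => //; exact: cvg_cst.
Qed.

Section orthogonal.
Variable f : R * R -> R[i].
Hypothesis Lf : L2 O f.
Hypothesis f0 : forall j, ip f (phi j) = 0.
Let c0 : phic r != 0 := lt0r_neq0 (phic_gt0 r0).

(** Summation in x1 only, with the second frequency fixed: exp(i alpha x1) times the sawtooth
    approximation of the indicator is a finite combination of the basis functions. *)
Lemma orthogonal_strip (a b : R) (l : int) : - pi <= a -> a < b -> b <= pi ->
  ip f (fun x => cis (alpha * x.1) * (ind a b x.1)%:C * cis (xi alpha r true (0, l) * x.2)) = 0.
Proof.
move=> pa ab bp; have pi0 := pi_gt0 R.
pose d k := saw_coef pi a b k * ((phic r)^-1)%:C.
pose g_ n : R * R -> R[i] := \sum_(k <- symz n) d k *: phi (k, l).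
have gE n x : g_ n x = cis (alpha * x.1) * (saw_indic pi a b n x.1)%:C *
    cis (xi alpha r true (0, l) * x.2).
  rewrite /g_ fct_sumE -saw_coef_sum// mulr_sumr mulr_suml; apply: eq_bigr => k _.
  rewrite [LHS]/GRing.scale /= [LHS](_ : _ = d k * phi (k, l) x)// phijE /d /xi /= mulrDl cisD.
  rewrite mulfK ?(lt0r_neq0 pi0)//.
  have -> : saw_coef pi a b k * (phic r)^-1%:C * ((phic r)%:C * (cis (k%:~R * x.1) *
      cis (alpha * x.1) * cis (l%:~R * pi / r * x.2))) =
      ((phic r)^-1 * phic r)%:C * (saw_coef pi a b k * (cis (k%:~R * x.1) *
      cis (alpha * x.1) * cis (l%:~R * pi / r * x.2))) by rewrite rmorphM /=; ring.
  rewrite mulVf// mul1r; ring.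
refine (proj2 (@ip_lim0 f g_ _ Lf _ _ _ _ _)) => //.
- by move=> n; apply: (spanS H) => k; apply: (innerZ H); exact: Lphi.
- apply: cmeasurableM; last exact: (cmeasurable_cisl _ true).
  by apply: cmeasurableM; [exact: (cmeasurable_cisl _ false)|exact: cmeasurable_ind1].
- move: (ae_fst_neq a) (ae_fst_neq b); apply: filterS2 => x xa xb /andP[x1 _].
  rewrite (_ : g_ ^~ x = fun n => cis (alpha * x.1) * (saw_indic pi a b n x.1)%:C *
    cis (xi alpha r true (0, l) * x.2)); last by apply/funext => n; exact: gE.
  by apply: ccvgnM_real; exact: saw_ccvgn.
- apply: (orthonormal_cauchy H _ _ symz_mono) => //.
  + by move=> i j; rewrite ip2_phij// xpair_eqE eqxx andbT.
  + move=> n; under eq_bigr do rewrite sqnormcM mulrC.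
    rewrite -mulr_sumr; apply: ler_wpM2l; first exact: sqnormc_ge0.
    exact: saw_coef_bounded.
- move=> n; rewrite (ip_sumr H)//; last by move=> k; apply: (innerZ H); exact: Lphi.
  by rewrite big1// => k _; rewrite (ipZr H)// f0 mulr0.
Qed.

(** Now the second exponential is summed to an indicator in x2, using as building blocks the
    functions already known to be orthogonal to f. *)
Lemma orthogonal_rect (a b c d : R) :
  - pi <= a -> a < b -> b <= pi -> - r <= c -> c < d -> d <= r ->
  ip f (fun x => cis (alpha * x.1) * (ind a b x.1)%:C * (ind c d x.2)%:C) = 0.
Proof.
move=> pa ab bp rc cd dr.
pose s l x := cis (alpha * x.1) * (ind a b x.1)%:C * cis (xi alpha r true (0, l) * x.2).
have ms l : cmeasurable O (s l).
  apply: cmeasurableM; last exact: (cmeasurable_cisl _ true).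
  by apply: cmeasurableM; [exact: (cmeasurable_cisl _ false)|exact: cmeasurable_ind1].
have Ls l : L2 O (s l).
  apply: (@L2_Omega_bounded _ 1) => // x _.
  by rewrite !sqnormcM !sqnormc_cis sqnormc_real mul1r mulr1 ind_sq.
pose g_ n : R * R -> R[i] := \sum_(k <- symz n) saw_coef r c d k *: s k.
(* The blocks [s k] carry an indicator in x1 and are not multiples of basis functions. Without it
   the sums become orthonormal sums [h_], whose differences dominate those of [g_] pointwise and are
   Cauchy in L^2. *)
pose dl k := saw_coef r c d k * ((phic r)^-1)%:C.
pose h_ n : R * R -> R[i] := \sum_(k <- symz n) dl k *: phi (0, k).
have Lg n : L2 O (g_ n) by apply: (spanS H) => k; apply: (innerZ H); exact: Ls.
have Lh n : L2 O (h_ n) by apply: (spanS H) => k; apply: (innerZ H); exact: Lphi.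
have gE n x : g_ n x = cis (alpha * x.1) * (ind a b x.1)%:C * (saw_indic r c d n x.2)%:C * 1.
  rewrite /g_ fct_sumE -saw_coef_sum// mulr1 mulr_sumr; apply: eq_bigr => k _.
  by rewrite [LHS]/GRing.scale /= [LHS](_ : _ = saw_coef r c d k * s k x)// /s /xi /= mulrCA.
have hE n x : h_ n x = cis (alpha * x.1) * (saw_indic r c d n x.2)%:C.
  rewrite /h_ fct_sumE -saw_coef_sum// mulr_sumr; apply: eq_bigr => k _.
  rewrite [LHS]/GRing.scale /= [LHS](_ : _ = dl k * phi (0, k) x)// phijE /dl /xi /= add0r.
  have -> (z u v : R[i]) : z * (phic r)^-1%:C * ((phic r)%:C * (u * v)) =
      ((phic r)^-1 * phic r)%:C * (u * (z * v)) by rewrite rmorphM /=; ring.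
  by rewrite mulVf// mul1r.
have hcauchy := @orthonormal_cauchy _ _ _ _ H _ (fun k => phi (0, k)) _ _ symz dl
   ((sqnormc (saw_coef r c d 0) + 2) * sqnormc ((phic r)^-1)%:C) symz_mono _.
rewrite (_ : (fun x => _) =
  (fun x => cis (alpha * x.1) * (ind a b x.1)%:C * (ind c d x.2)%:C * 1)); last first.
  by apply/funext => x; rewrite mulr1.
refine (proj2 (@ip_lim0 f g_ _ Lf Lg _ _ _ _)).
- refine (@cmeasurableM _ _ _ _ _ (cmeasurable_cst _ 1)).
  apply: cmeasurableM; last exact: cmeasurable_ind2.
  by apply: cmeasurableM; [exact: (cmeasurable_cisl _ false)|exact: cmeasurable_ind1].
- move: (ae_snd_neq c) (ae_snd_neq d); apply: filterS2 => x xc xd /andP[_ x2].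
  rewrite (_ : g_ ^~ x = fun n => cis (alpha * x.1) * (ind a b x.1)%:C *
    (saw_indic r c d n x.2)%:C * 1); last by apply/funext => n; exact: gE.
  by apply: ccvgnM_real; exact: saw_ccvgn.
- move=> eps e0; have [] := hcauchy _ _ _ _ e0.
  + by move=> k; exact: Lphi.
  + by move=> i j; rewrite ip2_phij// xpair_eqE eqxx.
  + move=> n; under eq_bigr do rewrite sqnormcM.
    rewrite -mulr_suml; apply: ler_wpM2r; first exact: sqnormc_ge0.
    exact: saw_coef_bounded.
  move=> N hN; exists N => m n Nm Nn; apply: le_trans (hN m n Nm Nn).
  refine (nsq_le (SB H (Lg m) (Lg n)) (SB H (Lh m) (Lh n)) _) => x Ox.
  rewrite [(g_ m - g_ n) x](_ : _ = g_ m x - g_ n x)// [X in _ <= sqnormc X](_ : _ = h_ m x - h_ n x)//.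
  rewrite !gE !hE !mulr1 -!mulrBr -rmorphB /= !sqnormcM sqnormc_cis !mul1r !sqnormc_real.
  by apply: ler_piMl; [exact: sqr_ge0|exact: ind_sq].
- move=> n; rewrite (ip_sumr H)//; last by move=> k; apply: (innerZ H); exact: Ls.
  by rewrite big1// => k _; rewrite (ipZr H)//; rewrite orthogonal_strip// mulr0.
Qed.

(** Multiplying f by exp(- i alpha x1) gives a function whose integrals over the rectangles anchored
    at (pi, r) all vanish, so [rect_null] applies. *)
Lemma orthogonal_null : nsq f = 0.
Proof.
pose F x := f x * cis (- alpha * x.1).
have LF : L2 O F.
  rewrite (_ : F = fun x => cis (- alpha * x.1) * f x); last by apply/funext => x; rewrite mulrC.
  apply: (@L2_bounded_mul _ _ mO _ _ 1) => // [|x _]; last by rewrite sqnormc_cis.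
  exact: (cmeasurable_cisl _ false).
have iF : cintegrable O F.
  rewrite (_ : F = fun x => F x * 1); last by apply/funext => x; rewrite mulr1.
  have L1 : L2 O (fun=> 1).
    refine (@L2_Omega_bounded _ 1 (cmeasurable_cst _ _) _) => x _.
    by rewrite /sqnormc /= expr1n expr0n addr0.
  exact: (L2_mul mO LF L1).
have OE : O = rect (- pi) pi (- r) r by apply/seteqP; split.
have rF c1 c2 : - pi <= c1 -> c1 < pi -> - r <= c2 -> c2 < r -> cint (rect c1 pi c2 r) F = 0.
  move=> p1 p2 r1 r2; rewrite -(orthogonal_rect p1 p2 (lexx _) r1 r2 (lexx _)) /ip2.
  rewrite (@cint_sub _ O (rect c1 pi c2 r)).
  - apply: eq_cint => x; rewrite /rect /= => /andP[x1 x2].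
    by rewrite /F /ind x1 x2 !mulr1 cisJ mulNr.
  - by rewrite OE => x; rewrite /rect /= => /andP[/andP[a1 ->] /andP[a2 ->]]; rewrite !andbT; apply/andP; split; lra.
  - move=> x _ nx.
    have [x1|/negbTE x1] := boolP (c1 < x.1 < pi); last first.
      by rewrite (ind_out x1) !(mulr0, mul0r) rmorph0 mulr0.
    have [x2|/negbTE x2] := boolP (c2 < x.2 < r); last by rewrite (ind_out x2) mulr0 rmorph0 mulr0.
    by exfalso; apply: nx; rewrite /rect /= x1 x2.
have h1 : {ae leb2 R, forall x, O x -> complex.Re (F x) = 0}.
  rewrite OE; apply: rect_null; first by rewrite -OE; exact: iF.1.
  by move=> c1 c2 p1 p2 r1 r2; have := congr1 (@complex.Re R) (rF _ _ p1 p2 r1 r2).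
have h2 : {ae leb2 R, forall x, O x -> complex.Im (F x) = 0}.
  rewrite OE; apply: rect_null; first by rewrite -OE; exact: iF.2.
  by move=> c1 c2 p1 p2 r1 r2; have := congr1 (@complex.Im R) (rF _ _ p1 p2 r1 r2).
apply: (aeq_nsq0 mO Lf.1); move: h1 h2; apply: filterS2 => x h1 h2 Ox.
have F0 : F x = 0 by apply: complexP; rewrite ?h1 ?h2.
by rewrite -[f x]mulr1 -(cisNK (alpha * x.1)) mulrA -mulNr -/(F x) F0 mul0r.
Qed.

End orthogonal.

Lemma Omega_basis : hilbert_basis (L2 O) ip phi ZN.
Proof.
split.
- exact: Lphi.
- by move=> i j; exact: ip2_phij.
- exact: ZN_mono.
- exact: ZN_exh.
- exact: orthogonal_null.
- move=> c B hB; have [U [mU hU _]] := riesz_fischer alpha r0 hB.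
  have [LU hc] := hU 1%N (ltnSn 0); rewrite -OmegaE in LU hc.
  exists U => // eps e0; have e2 : 0 < eps / 2 by lra.
  have [N hN] := hc _ e2; exists N => n Nn.
  by apply: le_lt_trans (hN n Nn) _; lra.
Qed.

End fourier_basis.

(** * Smooth functions with compact support *)

Section smooth.
Variable R : realType.
Implicit Types (f g : R -> R) (p : {poly R}).

Fixpoint smooth n f : Prop :=
  if n is m.+1 then (forall t : R, derivable f t 1) /\ smooth m (derive1 f) else True.

Lemma smoothW n f : smooth n.+1 f -> smooth n f.
Proof. by elim: n f => [//|n IH] f [df /IH]; split. Qed.

Lemma smooth_cont f : (forall n, smooth n f) -> continuous f.
Proof.
move=> /(_ 1%N)[df _] t.
by apply: (@differentiable_continuous _ _ R^o); apply/derivable1_diffP; exact: df.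
Qed.

Lemma derive1_is_derive f t : derivable f t 1 -> is_derive t 1 f (derive1 f t).
Proof. by move=> df; apply: DeriveDef => //; rewrite derive1E. Qed.

Lemma smooth_is_derive f g n : (forall t : R, is_derive t 1 f (g t)) -> smooth n g ->
  smooth n.+1 f.
Proof.
move=> h sg; split; first by move=> t; have [] := h t.
by rewrite (_ : derive1 f = g)//; apply/funext => t; rewrite derive1E; have [] := h t.
Qed.

Lemma smoothD n f g : smooth n f -> smooth n g -> smooth n (fun t => f t + g t).
Proof.
elim: n f g => [//|n IH] f g [df sf] [dg sg].
apply: (smooth_is_derive _ (IH _ _ sf sg)) => t.
by apply: is_derive_addf; exact: derive1_is_derive.
Qed.

Lemma smoothM n f g : smooth n f -> smooth n g -> smooth n (fun t => f t * g t).
Proof.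
elim: n f g => [//|n IH] f g sf sg.
have h := smoothD (IH _ _ (smoothW sf) sg.2) (IH _ _ (smoothW sg) sf.2).
apply: (smooth_is_derive _ h) => t.
by apply: is_derive_mulf; apply: derive1_is_derive; [exact: sf.1|exact: sg.1].
Qed.

Lemma smooth_cst n (c : R) : smooth n (fun=> c).
Proof.
by elim: n c => [//|n IH] c; apply: (smooth_is_derive _ (IH 0)).
Qed.

Lemma is_derive_affine f (a b t df : R) : is_derive (a * t + b) 1 f df ->
  is_derive t 1 (fun s : R => f (a * s + b)) (a * df).
Proof.
move=> h; have h1 : is_derive t 1 (fun s : R => a * s + b) a.
  rewrite -[X in is_derive _ _ _ X]addr0; apply: is_derive_addf; exact: is_derive_mull.
by rewrite mulrC; exact: (@is_derive1_comp _ f (fun s : R => a * s + b) t _ _ h h1).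
Qed.

Lemma smooth_affine n f (a b : R) : smooth n f -> smooth n (fun t => f (a * t + b)).
Proof.
elim: n f => [//|n IH] f [df sf].
apply: (smooth_is_derive _ (smoothM (smooth_cst n a) (IH _ sf))) => t.
by apply: is_derive_affine; exact: derive1_is_derive.
Qed.

(* These functions, among which [exp (-1/t)], are stable under derivation, which makes
   their smoothness at 0 an induction. *)
Definition bell p (t : R) : R := if 0 < t then p.[t^-1] * expR (- t^-1) else 0.

(** Induction on the polynomial with the power left free: a factor X is traded for one more power of
    s. *)
Lemma poly_expR_bound p (n : nat) : exists C : R, forall s, 0 < s ->
  `|p.[s]| * s ^+ n * expR (- s) <= C.
Proof.
elim/poly_ind: p n => [|p c IH] n.
  by exists 0 => s _; rewrite horner0 normr0 !mul0r.
have [C hC] := IH n.+1; exists (C + `|c| * n.+1`!%:R * 2) => s s0.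
rewrite hornerMXaddC; set e := expR (- s); have e0 : 0 <= e := expR_ge0 _.
(* From s^n <= 1 + s^(n+1) and s^(n+1) <= (n+1)! exp(s). *)
have sn : s ^+ n * e <= n.+1`!%:R * 2.
  have es : expR s * e = 1 by rewrite -expRD subrr expR0.
  have f0 : 0 < n.+1`!%:R :> R by rewrite ltr0n fact_gt0.
  have f1 : 1 <= n.+1`!%:R :> R by rewrite ler1n fact_gt0.
  have h := expR_ge1Dxn n (ltW s0).
  have h1 : s ^+ n.+1 <= n.+1`!%:R * expR s.
    by rewrite mulrC -ler_pdivrMr//; lra.
  have h2 : s ^+ n <= 1 + s ^+ n.+1.
    have [s1|s1] := leP s 1.
      by apply: le_trans (exprn_ile1 _ (ltW s0) s1) _; rewrite lerDl exprn_ge0// ltW.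
    rewrite exprS; have : 0 <= s ^+ n by rewrite exprn_ge0// ltW.
    by move=> h3; nra.
  have e1 : e <= 1 by rewrite -expR0 ler_expR; lra.
  apply: le_trans (_ : (1 + n.+1`!%:R * expR s) * e <= _).
    by apply: ler_wpM2r => //; lra.
  rewrite mulrDl mul1r -mulrA es mulr1; lra.
have h := hC s s0; rewrite -/e in h.
have n0 : 0 <= s ^+ n by rewrite exprn_ge0// ltW.
apply: le_trans (_ : (`|p.[s]| * s + `|c|) * s ^+ n * e <= _).
  apply: ler_wpM2r => //; apply: ler_wpM2r => //.
  by apply: le_trans (ler_normD _ _) _; rewrite normrM (gtr0_norm s0).
rewrite mulrDl mulrDl -(mulrA `|c|) -[X in _ <= _ + X]mulrA.
apply: lerD; last by apply: ler_wpM2l.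
by apply: le_trans h; rewrite exprS !mulrA.
Qed.

(** The polynomial X^2 (p - p') comes from the chain rule at 1/t. At 0 the difference quotient is h
    times |p(1/h)| h^-2 exp(-1/h) in modulus, hence at most C h by the bound with power 2. *)
Lemma is_derive_bell p (t : R) : is_derive t 1 (bell p) (bell ('X^2 * (p - p^`())) t).
Proof.
have [t0|t0|->] := ltgtP t 0.
- apply: (@near_eq_is_derive _ _ _ (fun=> 0)).
    near=> s; have s0 : s < 0 by near: s; exact: lt_nbhsl.
    by rewrite /bell ltNge ltW.
  by rewrite /bell ltNge ltW//=; exact: is_derive_cst.
- have E s : 0 < s -> p.[s^-1] * expR (- s^-1) = bell p s by rewrite /bell => ->.
  apply: (@near_eq_is_derive R R R (fun s : R => p.[s^-1] * expR (- s^-1))).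
    by near=> s; apply: E; near: s; exact: lt_nbhsr.
  have hV : is_derive t 1 (fun s : R => s^-1) (- t ^- 2).
    have := @is_derive_invf _ id t 1 (lt0r_neq0 t0) (is_derive_id _ _).
    by rewrite mulr1.
  have hp : is_derive t 1 (fun s : R => p.[s^-1]) (p^`().[t^-1] * - t ^- 2).
    apply: (@is_derive1_comp _ (fun s : R => p.[s]) (fun s : R => s^-1)) => //.
    exact: is_derive_poly.
  have he : is_derive t 1 (fun s : R => expR (- s^-1)) (expR (- t^-1) * - - t ^- 2).
    by apply: (@is_derive1_comp _ expR (fun s : R => - s^-1)); exact: is_deriveN.
  have := is_derive_mulf hp he; rewrite /bell t0 => h.
  apply: (is_derive_eq h); rewrite hornerM hornerXn hornerD hornerN -exprVn.
  by set u := t^-1; move: (p^`().[u]) (p.[u]) => a b; move: (expR (- u)) => c; ring.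
- have [C hC] := poly_expR_bound p 2.
  rewrite {2}/bell ltxx.
  have hc : (fun h : R => h^-1 *: ((bell p \o shift 0) (h *: 1) - bell p 0)) @ 0^' --> (0 : R).
    apply/cvgrPdist_le => /= e e0.
    have C0 : 0 <= C by apply: le_trans (hC 1 ltr01); rewrite !mulr_ge0 ?expR_ge0.
    near=> h; rewrite sub0r normrN /= addr0 {2}/bell ltxx subr0 [_ *: 1]mulr1.
    rewrite /bell; case: ifPn => h0; last by rewrite scaler0 normr0 ltW.
    rewrite [_ *: _](_ : _ = h^-1 * (p.[h^-1] * expR (- h^-1)))//.
    have i0 : 0 < h^-1 by rewrite invr_gt0.
    have := hC _ i0; rewrite !normrM (gtr0_norm i0) (ger0_norm (expR_ge0 _)) => hh.
    have he : h <= e / (C + 1).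
      apply: le_trans (ler_norm _) _; apply: ltW; near: h.
      by apply: dnbhs0_lt; rewrite divr_gt0//; lra.
    have -> : h^-1 * (`|p.[h^-1]| * expR (- h^-1)) = h * (`|p.[h^-1]| * h^-1 ^+ 2 * expR (- h^-1)).
      by rewrite expr2; move: `|_| (expR _) => a b; field; rewrite gt_eqF.
    apply: le_trans (_ : h * (C + 1) <= _); first by apply: ler_wpM2l; [exact: ltW|lra].
    by rewrite -ler_pdivlMr//; lra.
  apply: DeriveDef; first by apply/cvg_ex; exists 0.
  by apply: cvg_lim => //; exact: hc.
Unshelve. all: by end_near.
Qed.

Lemma smooth_bell n p : smooth n (bell p).
Proof.
elim: n p => [//|n IH] p; exact: (smooth_is_derive (is_derive_bell p) (IH _)).
Qed.

(** A smooth function positive exactly on ]a, b[ and bounded by 1; the dilation n + 1 makes it tend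
    to the indicator of ]a, b[ pointwise. *)
Definition bump (n : nat) (a b t : R) : R :=
  bell 1 (n.+1%:R * t + - (n.+1%:R * a)) * bell 1 (- n.+1%:R * t + n.+1%:R * b).

Lemma smooth_bump m n a b : smooth m (bump n a b).
Proof. by apply: smoothM; apply: smooth_affine; exact: smooth_bell. Qed.

Lemma bumpE n (a b t : R) : bump n a b t = if a < t < b then
  expR (- (n.+1%:R * (t - a))^-1) * expR (- (n.+1%:R * (b - t))^-1) else 0.
Proof.
have n0 : 0 < n.+1%:R :> R by [].
rewrite /bump /bell !hornerC !mul1r mulNr (addrC (- _)) -!mulrBr !pmulr_rgt0// !subr_gt0.
by case: (a < t); case: (t < b); rewrite ?mul0r ?mulr0.
Qed.

Lemma bump_bound n (a b t : R) : 0 <= bump n a b t <= 1.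
Proof.
rewrite bumpE; case: ifP => [/andP[ta tb]|_]; last by rewrite lexx ler01.
rewrite mulr_ge0 ?expR_ge0//=; apply: mulr_ile1; rewrite ?expR_ge0// -[leRHS]expR0 ler_expR.
- by rewrite oppr_le0 invr_ge0 mulr_ge0//; lra.
- by rewrite oppr_le0 invr_ge0 mulr_ge0//; lra.
Qed.

Lemma bump_cvg (a b t : R) : bump n a b t @[n --> \oo] --> ind a b t.
Proof.
rewrite /ind; under eq_fun do rewrite bumpE; case: ifP => _; last exact: cvg_cst.
have h (c : R) : expR (- (n.+1%:R * c)^-1) @[n --> \oo] --> (1 : R).
  rewrite -[X in _ --> X]expR0; apply: continuous_cvg; first exact: continuous_expR.
  rewrite -oppr0 -(mul0r (c^-1)); apply: cvgN.
  under eq_fun do rewrite invfM.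
  by apply: cvgM; [exact: cvg_harmonic|exact: cvg_cst].
suff : expR (- (n.+1%:R * (t - a))^-1) * expR (- (n.+1%:R * (b - t))^-1) @[n --> \oo] --> (1 * 1 : R).
  by rewrite mulr1.
by apply: cvgM; exact: h.
Qed.

Definition tens f g (x : R * R) : R := f x.1 * g x.2.

Lemma cvg_dir f (t df : R) : is_derive t 1 f df ->
  (fun h : R => h^-1 *: (f (h + t) - f t)) @ 0^' --> df.
Proof.
move=> [df1 <-]; have := df1; rewrite /derivable /derive.
under eq_fun do rewrite /= [_ *: 1]mulr1.
by [].
Qed.

Lemma is_derive_tens1 f g (x : R * R) (df : R) : is_derive x.1 1 f df ->
  is_derive x (dir R false) (tens f g) (df * g x.2).
Proof.
move=> /cvg_dir h.
have hc : (fun h : R => h^-1 *: ((tens f g \o shift x) (h *: dir R false) - tens f g x)) @ 0^'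
    --> (df * g x.2).
  rewrite (_ : (fun h : R => _) = fun h : R => h^-1 *: (f (h + x.1) - f x.1) * g x.2).
    by apply: cvgM => //; exact: cvg_cst.
  apply/funext => s; rewrite /tens /dir /= [_ *: 1]mulr1 scaler0 add0r.
  by rewrite -mulrBl scalerAl.
by apply: DeriveDef; [apply/cvg_ex; exists (df * g x.2)|exact: cvg_lim].
Qed.

Lemma is_derive_tens2 f g (x : R * R) (dg : R) : is_derive x.2 1 g dg ->
  is_derive x (dir R true) (tens f g) (f x.1 * dg).
Proof.
move=> /cvg_dir h.
have hc : (fun h : R => h^-1 *: ((tens f g \o shift x) (h *: dir R true) - tens f g x)) @ 0^'
    --> (f x.1 * dg).
  rewrite (_ : (fun h : R => _) = fun h : R => f x.1 * (h^-1 *: (g (h + x.2) - g x.2))).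
    by apply: cvgM => //; exact: cvg_cst.
  apply/funext => s; rewrite /tens /dir /= [_ *: 1]mulr1 scaler0 add0r.
  by rewrite -mulrBr scalerAr.
by apply: DeriveDef; [apply/cvg_ex; exists (f x.1 * dg)|exact: cvg_lim].
Qed.

(** Partial derivatives of a tensor product of smooth functions are again of this form, which
    reduces smoothness in the plane to one variable. *)
Lemma pd_tens l f g : (forall n, smooth n f) -> (forall n, smooth n g) ->
  exists f' g', [/\ pd l (tens f g) = tens f' g', (forall n, smooth n f') & (forall n, smooth n g')].
Proof.
move=> sf sg; elim: l => [|b l [f' [g' [E sf' sg']]]]; first by exists f, g.
rewrite /= -/(pd l _) E; case: b.
- exists f', (derive1 g'); split => //; last by move=> n; exact: (sg' n.+1).2.
  apply/funext => x; have [_ ->] := @is_derive_tens2 f' g' x _ (derive1_is_derive ((sg' 1%N).1 _)).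
  by [].
- exists (derive1 f'), g'; split => //; last by move=> n; exact: (sf' n.+1).2.
  apply/funext => x; have [_ ->] := @is_derive_tens1 f' g' x _ (derive1_is_derive ((sf' 1%N).1 _)).
  by [].
Qed.

Lemma tens_cont f g : continuous f -> continuous g -> continuous (tens f g).
Proof.
move=> cf cg x; apply: cvgM.
- by apply: (@continuous_comp _ _ _ fst f); [exact: cvg_fst|exact: cf].
- by apply: (@continuous_comp _ _ _ snd g); [exact: cvg_snd|exact: cg].
Qed.

Lemma Ck_tens f g n A : (forall n, smooth n f) -> (forall n, smooth n g) -> Ck n A (tens f g).
Proof.
move=> sf sg l _ x _; have [f' [g' [-> sf' sg']]] := pd_tens l sf sg; split.
  by apply: tens_cont; exact: smooth_cont.
move=> _ [].
- by have [] := @is_derive_tens2 f' g' x _ (derive1_is_derive ((sg' 1%N).1 _)).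
- by have [] := @is_derive_tens1 f' g' x _ (derive1_is_derive ((sf' 1%N).1 _)).
Qed.

Definition crect (a1 b1 a2 b2 : R) : set (R * R) := `[a1, b1] `*` `[a2, b2].

Lemma compact_crect a1 b1 a2 b2 : compact (crect a1 b1 a2 b2).
Proof. by apply: compact_setX; exact: segment_compact. Qed.

Lemma closed_crect a1 b1 a2 b2 : closed (crect a1 b1 a2 b2).
Proof. by apply: compact_closed; [exact: norm_hausdorff|exact: compact_crect]. Qed.

Lemma test_fun_bump n (a1 b1 a2 b2 : R) A : crect a1 b1 a2 b2 `<=` A ->
  test_fun A (tens (bump n a1 b1) (bump n a2 b2)).
Proof.
move=> hA; set psi := tens _ _.
have h : closure [set x | psi x != 0] `<=` crect a1 b1 a2 b2.
  rewrite closureEbigcap; apply: bigcap_inf; split; first exact: closed_crect.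
  move=> x /=; rewrite /psi /tens !bumpE /crect /= !in_itv /=.
  case: (ltP a1 x.1) => h1; last by rewrite mul0r eqxx.
  case: (ltP x.1 b1) => h2; last by rewrite mul0r eqxx.
  case: (ltP a2 x.2) => h3; last by rewrite mulr0 eqxx.
  case: (ltP x.2 b2) => h4; last by rewrite mulr0 eqxx.
  by move=> _; rewrite !ltW.
split.
- by move=> m; apply: Ck_tens => k; exact: smooth_bump.
- by apply: (@subclosed_compact _ _ (crect a1 b1 a2 b2)) => //; [exact: closed_closure|exact: compact_crect].
- exact: subset_trans h hA.
Qed.

End smooth.

(** * Weak derivatives *)

Section cells.
Variable R : realType.
Implicit Types (A K : set (R * R)).

(** A countable cover of an open set by open squares whose closures are still contained in it, so
    that local integrability applies to each. The squares have side 2/(n+1) and overlap, so every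
    point is interior to one; indices with a closed square not inside A give the empty set. *)
Definition cell A (m : nat) : set (R * R) :=
  if (choice.unpickle m : option (nat * int * int)) is Some (n, i, j) then
    let a (k : int) : R := (k%:~R - 1) / n.+1%:R in
    let b (k : int) : R := (k%:~R + 1) / n.+1%:R in
    if `[< crect (a i) (b i) (a j) (b j) `<=` A >] then rect (a i) (b i) (a j) (b j) else set0
  else set0.

Lemma cellP A m : cell A m = set0 \/ exists a1 b1 a2 b2,
  crect a1 b1 a2 b2 `<=` A /\ cell A m = rect a1 b1 a2 b2.
Proof.
rewrite /cell; case: (choice.unpickle m : option (nat * int * int)) => [[[n i] j]|]; last by left.
by case: asboolP => h; [right; do 4 eexists; split; [exact: h|]|left].
Qed.

Lemma rect_crect (a1 b1 a2 b2 : R) : rect a1 b1 a2 b2 `<=` crect a1 b1 a2 b2.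
Proof.
move=> x; rewrite /rect /crect /= => /andP[/andP[h1 h2] /andP[h3 h4]].
by rewrite !in_itv /= !ltW.
Qed.

Lemma cell_sub A m : cell A m `<=` A.
Proof.
case: (cellP A m) => [->|[a1 [b1 [a2 [b2 [h ->]]]]]]; first exact: sub0set.
by apply: subset_trans h; exact: rect_crect.
Qed.

Lemma floor_cell (n : nat) (t : R) (i : int) : i = Num.floor (n.+1%:R * t) ->
  (i%:~R - 1) / n.+1%:R < t < (i%:~R + 1) / n.+1%:R.
Proof.
move=> ->; have n0 : 0 < n.+1%:R :> R by [].
rewrite ltr_pdivrMr// ltr_pdivlMr// (mulrC t).
have h1 := floor_le (n.+1%:R * t); have h2 := floorD1_gt (n.+1%:R * t).
rewrite intrD in h2.
by apply/andP; split; [lra|exact: h2].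
Qed.

Lemma bigcup_cell A : open A -> \bigcup_m cell A m = A.
Proof.
move=> oA; apply/seteqP; split; first by apply: bigcup_sub => m _; exact: cell_sub.
move=> x Ax; have /nbhs_ballP[e /= e0 he] : nbhs x A by exact: open_nbhs_nbhs.
pose n := Num.bound (2 / e).
have hn : 2 / n.+1%:R < e.
  have h : 2 / e < n.+1%:R.
    apply: lt_trans (_ : n%:R < _); last by rewrite ltr_nat.
    by apply: archi_boundP; rewrite divr_ge0// ltW.
  by rewrite ltr_pdivrMr// mulrC -ltr_pdivrMr.
pose i := Num.floor (n.+1%:R * x.1); pose j := Num.floor (n.+1%:R * x.2).
exists (choice.pickle (n, i, j)) => //; rewrite /cell choice.pickleK.
have hi := floor_cell (erefl i); have hj := floor_cell (erefl j).
case: asboolP => [_|[]]; first by rewrite /rect /=; apply/andP; split.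
have E (k : R) : (k + 1) / n.+1%:R = (k - 1) / n.+1%:R + 2 / n.+1%:R by rewrite -mulrDl; congr (_ * _); lra.
have aux (t s : R) : let k := Num.floor (n.+1%:R * t) in
    (k%:~R - 1) / n.+1%:R <= s <= (k%:~R + 1) / n.+1%:R -> `|t - s| < e.
  move=> k; have := floor_cell (erefl k); rewrite E => /andP[h1 h2] /andP[h3 h4].
  move: hn h1 h2 h3 h4; move: ((k%:~R - 1) / n.+1%:R) (2 / n.+1%:R) => u v ? ? ? ? ?.
  by rewrite ltr_norml; apply/andP; split; lra.
move=> y; rewrite /crect /= !in_itv /= => -[h1 h2]; apply: he; split; exact: aux.
Qed.

Lemma measurable_cell A m : measurable (cell A m : set (RR R)).
Proof.
by case: (cellP A m) => [->|[a1 [b1 [a2 [b2 [_ ->]]]]]]; [|exact: measurable_rect].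
Qed.

Lemma measurable_open A : open A -> measurable (A : set (RR R)).
Proof.
move=> oA; rewrite -(bigcup_cell oA); apply: bigcupT_measurable => m; exact: measurable_cell.
Qed.

Lemma measurable_compact K : compact K -> measurable (K : set (RR R)).
Proof.
move=> cK; rewrite -(setCK K); apply: measurableC; apply: measurable_open.
by apply: closed_openC; apply: compact_closed => //; exact: norm_hausdorff.
Qed.

Lemma measurable_cont (w : R * R -> R) : continuous w ->
  measurable_fun (setT : set (RR R)) w.
Proof.
move=> cw; apply: (measurability _ (RGenOInfty.measurableE R)).
move=> _ [_ [a ->] <-]; rewrite setTI.
apply: (@measurable_open (w @^-1` `]a, +oo[)).
by apply: open_comp => //; exact: itv_open.
Qed.

Lemma loc_integrable_measurable A f : open A -> loc_integrable A f -> cmeasurable A f.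
Proof.
move=> oA lf.
suff h (h : R * R -> R) : (forall K : set (R * R), compact K -> K `<=` A ->
    (leb2 R).-integrable K (EFin \o h)) -> measurable_fun (A : set (RR R)) h.
  by split; apply: h => K cK KA; have [] := lf K cK KA.
move=> hh; rewrite -(bigcup_cell oA).
apply/(measurable_fun_bigcup _ (measurable_cell A)) => m.
case: (cellP A m) => [->|[a1 [b1 [a2 [b2 [hA ->]]]]]]; first exact: measurable_fun_set0.
have cK := @compact_crect R a1 b1 a2 b2.
apply: (measurable_funS (measurable_compact cK)) (@rect_crect _ _ _ _) _.
by have /integrableP[/measurable_EFinP] := hh _ cK hA.
Qed.

Lemma rint_sub A B (f : R * R -> R) : B `<=` A -> (forall x, A x -> ~ B x -> f x = 0) ->
  \int[leb2 R]_(x in A) f x = \int[leb2 R]_(x in B) f x.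
Proof.
move=> BA f0; have := @cint_sub _ A B (fun x => (f x)%:C) BA _.
by move=> /(_ _)/(congr1 (@complex.Re R)); apply => x Ax nB; rewrite f0.
Qed.

(** On a cell the bumps converge boundedly to indicators of rectangles, so by dominated convergence
    h integrates to 0 over every rectangle anchored at the upper right corner. *)
Lemma du_bois_reymond_real A (h : R * R -> R) : open A ->
  (forall K, compact K -> K `<=` A -> (leb2 R).-integrable K (EFin \o h)) ->
  (forall psi, test_fun A psi -> \int[leb2 R]_(x in A) (h x * psi x) = 0) ->
  {ae leb2 R, forall x, A x -> h x = 0}.
Proof.
move=> oA ih h0.
suff hc m : {ae leb2 R, forall x, cell A m x -> h x = 0}.
  have := ae_foralln hc; apply: filterS => x hx; rewrite -(bigcup_cell oA) => -[m _].
  exact: hx.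
case: (cellP A m) => [->|[a1 [b1 [a2 [b2 [hA ->]]]]]]; first exact: aeW.
have cK := @compact_crect R a1 b1 a2 b2; have iK := ih _ cK hA.
have irect c1 c2 : a1 <= c1 -> a2 <= c2 ->
    (leb2 R).-integrable (rect c1 b1 c2 b2 : set (RR R)) (EFin \o h).
  move=> ac1 ac2; apply: (integrableS (measurable_compact cK)) iK; first exact: measurable_rect.
  apply: subset_trans (@rect_crect _ _ _ _) => x.
  by rewrite /rect /= => /andP[/andP[g1 ->] /andP[g2 ->]]; rewrite !andbT; apply/andP; split; lra.
apply: rect_null; first exact: irect.
move=> c1 c2 ac1 cb1 ac2 cb2.
pose psi n := tens (bump n c1 b1) (bump n c2 b2).
pose D : set (RR R) := rect c1 b1 c2 b2.
have mD : measurable D := measurable_rect c1 b1 c2 b2.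
have iD := irect _ _ ac1 ac2; rewrite -/D in iD.
have tpsi n : test_fun A (psi n).
  apply: test_fun_bump; apply: subset_trans hA => x; rewrite /crect /= !in_itv /=.
  by move=> [/andP[g1 ->] /andP[g2 ->]]; rewrite !andbT; split; lra.
have psi1 n x : `|psi n x| <= 1.
  have /andP[p0 p1] := bump_bound n c1 b1 x.1; have /andP[p2 p3] := bump_bound n c2 b2 x.2.
  rewrite /psi /tens ger0_norm; first exact: (mulr_ile1 p0 p2 p1 p3).
  exact: (mulr_ge0 p0 p2).
have mh : measurable_fun D h by have /integrableP[/measurable_EFinP] := iD.
have mpsi n : measurable_fun D (psi n).
  apply: measurable_funTS; apply: measurable_cont; apply: tens_cont;
  by apply: smooth_cont => k; exact: smooth_bump.
have mf n : measurable_fun D (fun x => h x * psi n x) by exact: measurable_funM.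
have iA : (leb2 R).-integrable D (fun x => (`|h x|)%:E) by have := integrable_abse iD.
have ifn n : (leb2 R).-integrable D (EFin \o (fun x => h x * psi n x)).
  apply: (integrable_dominated mD (mf n) _ iA) => x _.
  by rewrite normrM ler_piMr.
have I0 n : (\int[leb2 R]_(x in D) (h x * psi n x)%:E = 0)%E.
  have := h0 _ (tpsi n); rewrite (@rint_sub _ D).
  - move=> e0; have := congr1 EFin e0; rewrite /Rintegral fineK//.
    exact: (integrable_fin_num mD (ifn n)).
  - apply: subset_trans hA; apply: subset_trans (@rect_crect _ _ _ _) => x.
    by rewrite /rect /D /rect /= => /andP[/andP[g1 ->] /andP[g2 ->]]; rewrite !andbT; apply/andP; split; lra.
  - move=> x _; rewrite /D /rect /= /psi /tens !bumpE.
    by case: (c1 < x.1 < b1); case: (c2 < x.2 < b2); rewrite ?mulr0 ?mul0r ?mulr0.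
have [] := @dominated_convergence _ (RR R) R (leb2 R) D mD (fun n x => (h x * psi n x)%:E)
  (EFin \o h) (fun x => (`|h x|)%:E).
- by move=> n; apply/measurable_EFinP.
- by apply/measurable_EFinP.
- apply: aeW => x; rewrite /D /rect /= => /andP[x1 x2]; apply: cvg_EFin; first exact: nearW.
  have E : h x = h x * (ind c1 b1 x.1 * ind c2 b2 x.2) by rewrite /ind x1 x2 !mulr1.
  rewrite {2}E; apply: cvgM; first exact: cvg_cst.
  by apply: cvgM; exact: bump_cvg.
- exact: iA.
- by apply: aeW => x n _ /=; rewrite lee_fin normrM ler_piMr.
move=> _ _; under eq_fun do rewrite I0.
move=> hc; rewrite /Rintegral.
have := cvg_unique (@ereal_hausdorff R) hc (cvg_cst _ : _ --> (0 : \bar R)%E).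
by move=> ->.
Qed.

End cells.

Section weak.
Variable R : realType.
Implicit Types (A B K : set (R * R)) (u v f : R * R -> R[i]).

(** What a test function and its partial derivatives have in common; it makes pairings with locally
    integrable functions converge and insensitive to a change of the domain of integration. *)
Definition test_weight A (w : R * R -> R) := continuous w /\
  exists K, [/\ compact K, K `<=` A & forall x, ~ K x -> w x = 0].

(** Outside the closed support psi vanishes in a neighbourhood, hence so do its derivatives. *)
Lemma test_fun_weight A psi b : test_fun A psi ->
  test_weight A psi /\ test_weight A (pd [:: b] psi).
Proof.
move=> [hC cK KA]; set K := closure _ in cK KA.
have psi0 x : ~ K x -> psi x = 0.
  by move=> nK; apply: contrapT => /eqP p0; apply: nK; exact: subset_closure.
split; split.
- by move=> x; have [] := hC 0%N [::] isT x I.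
- by exists K.
- by move=> x; have [] := hC 1%N [:: b] isT x I.
- exists K; split => // x nK; rewrite /pd /=.
  have near0 : \near x, (fun=> 0 : R) x = psi x.
    have : nbhs x (~` K) by apply: open_nbhs_nbhs; split => //; apply: closed_openC; exact: closed_closure.
    by apply: filterS => y /psi0.
  have d0 : dir R b != 0 by case: b {near0}; rewrite /dir /=; apply/eqP => -[] /eqP; rewrite oner_eq0.
  by rewrite -(near_eq_derive (dir R b) near0) derive_cst.
Qed.

Lemma test_fun_sub A B psi : B `<=` A -> test_fun B psi -> test_fun A psi.
Proof. by move=> BA [h1 h2 h3]; split => //; exact: subset_trans BA. Qed.

Lemma cintegrable_mul_bounded A f (w : R * R -> R) (M : R) : measurable (A : set (RR R)) ->
  cintegrable A f -> measurable_fun (A : set (RR R)) w -> (forall x, A x -> `|w x| <= M) ->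
  cintegrable A (fun x => f x * (w x)%:C).
Proof.
move=> mA [i1 i2] mw hM.
have h (h : R * R -> R) : (leb2 R).-integrable A (EFin \o h) ->
    (leb2 R).-integrable A (EFin \o (fun x => h x * w x)).
  move=> ih; have iM : (leb2 R).-integrable A (EFin \o (fun x => `|M| * `|h x|)).
    rewrite (_ : _ \o _ = fun x => (`|M|%:E * `|(EFin \o h) x|)%E); last by apply/funext.
    exact: (integrableZl mA _ (integrable_abse ih)).
  apply: (integrable_dominated mA _ _ iM).
    by apply: measurable_funM => //; have /integrableP[/measurable_EFinP] := ih.
  move=> x Ax; rewrite normrM mulrC; apply: ler_wpM2r => //.
  exact: le_trans (hM _ Ax) (ler_norm _).
split; [have := h _ i1|have := h _ i2]; congr (_.-integrable _ _); apply/funext => x /=.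
- by rewrite cReM /= mulr0 subr0.
- by rewrite cImM /= mulr0 add0r.
Qed.

Lemma cintegrable_test A f w : measurable (A : set (RR R)) -> loc_integrable A f ->
  test_weight A w -> cintegrable A (fun x => f x * (w x)%:C).
Proof.
move=> mA lf [cw [K [cK KA w0]]].
have mK := measurable_compact cK.
have [M hM] : exists M, forall x, K x -> `|w x| <= M.
  have cwK : compact (w @` K).
    by apply: continuous_compact => //; exact: continuous_subspaceT.
  have [M [_ hM]] := compact_bounded cwK.
  by exists (M + 1) => x Kx; apply: hM; [rewrite ltrDl|exists x].
have mw : measurable_fun (K : set (RR R)) w.
  by apply: measurable_funTS; exact: measurable_cont.
have [h1 h2] : cintegrable K (fun x => f x * (w x)%:C).
  by apply: (cintegrable_mul_bounded mK _ mw hM); exact: lf.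
have ext (g : R * R -> R) : (forall x, ~ K x -> g x = 0) ->
    (leb2 R).-integrable K (EFin \o g) -> (leb2 R).-integrable A (EFin \o g).
  move=> g0 /(integrable_mkcond _ mK) ig; apply/(integrable_mkcond _ mA).
  rewrite (_ : _ \_ A = (EFin \o g) \_ K)//; apply/funext => x; rewrite !patchE.
  have [xK|nK] := boolP (x \in K); first by rewrite mem_set//; apply: KA; exact: set_mem.
  by case: ifP => // _ /=; rewrite g0//; move: nK; rewrite notin_setE.
split; apply: ext => // x nK; by rewrite w0// mulr0.
Qed.

Lemma loc_integrable_sub A B f : B `<=` A -> loc_integrable A f -> loc_integrable B f.
Proof. by move=> BA lf K cK KB; apply: lf => //; exact: subset_trans BA. Qed.

Lemma cint_test_sub A B f w : B `<=` A -> test_weight B w ->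
  cint B (fun x => f x * (w x)%:C) = cint A (fun x => f x * (w x)%:C).
Proof.
move=> BA [_ [K [_ KB w0]]]; rewrite (@cint_sub _ A B)// => x _ nB.
by rewrite w0 ?mulr0// => /KB.
Qed.

Lemma cint_test_sub2 A B f g w w' : B `<=` A -> test_weight B w -> test_weight B w' ->
  cint B (fun x => f x * (w x)%:C + g x * (w' x)%:C) =
  cint A (fun x => f x * (w x)%:C + g x * (w' x)%:C).
Proof.
move=> BA [_ [K [_ KB w0]]] [_ [K' [_ KB' w0']]].
rewrite (@cint_sub _ A B)// => x _ nB.
by rewrite w0 ?w0' ?mulr0 ?addr0//; [move/KB'|move/KB].
Qed.

Lemma is_wgrad_sub A B u g : B `<=` A -> is_wgrad A u g -> is_wgrad B u g.
Proof.
move=> BA [lu l1 l2 h]; split; do ?[exact: (loc_integrable_sub BA)].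
move=> psi tpsi; have [wp w1] := test_fun_weight false tpsi.
have [_ w2] := test_fun_weight true tpsi.
have E1 := cint_test_sub (fun x => (g x).1) BA wp; have E2 := cint_test_sub (fun x => (g x).2) BA wp.
by rewrite E1 E2 (cint_test_sub u BA w1) (cint_test_sub u BA w2); exact: (h psi (test_fun_sub BA tpsi)).
Qed.

Lemma is_wdiv_sub A B V v : B `<=` A -> is_wdiv A V v -> is_wdiv B V v.
Proof.
move=> BA [l1 l2 lv h]; split; do ?[exact: (loc_integrable_sub BA)].
move=> psi tpsi; have [wp w1] := test_fun_weight false tpsi.
have [_ w2] := test_fun_weight true tpsi.
by rewrite (cint_test_sub2 _ _ BA w1 w2) (cint_test_sub v BA wp); exact: (h psi (test_fun_sub BA tpsi)).
Qed.

Lemma cmeasurable_test A f w : open A -> cmeasurable A f -> test_weight A w ->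
  cmeasurable A (fun x => f x * (w x)%:C).
Proof.
move=> oA mf [cw _]; apply: cmeasurableM => //; apply: cmeasurable_real.
by apply: measurable_funTS; exact: measurable_cont.
Qed.

Lemma loc_integrable_aeq A u v : open A -> cmeasurable A v -> aeq A u v ->
  loc_integrable A u -> loc_integrable A v.
Proof.
move=> oA [m1 m2] uv lu K cK KA; have mA := measurable_open oA.
have mK := measurable_compact cK; have [/integrableP[i1 j1] /integrableP[i2 j2]] := lu K cK KA.
have aux (a b : R * R -> R) : measurable_fun (A : set (RR R)) b ->
    {ae leb2 R, forall x, A x -> a x = b x} ->
    (leb2 R).-integrable K (EFin \o a) -> (leb2 R).-integrable K (EFin \o b).
  move=> mb ab ia; have mbK : measurable_fun (K : set (RR R)) (EFin \o b).
    by apply/measurable_EFinP; exact: (measurable_funS mA) mb.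
  have /integrableP[mKa ja] := ia; apply/integrableP; split => //; apply: le_lt_trans ja.
  rewrite le_eqVlt; apply/orP; left; apply/eqP; apply: ae_eq_integral => //.
  - exact: measurableT_comp.
  - exact: measurableT_comp.
  - by apply: filterS ab => x h Kx /=; rewrite h//; exact: KA.
have [k1 k2] := lu K cK KA.
split.
- by apply: aux k1 => //; apply: filterS uv => x h Ax; rewrite h.
- by apply: aux k2 => //; apply: filterS uv => x h Ax; rewrite h.
Qed.

Lemma is_wgrad_aeq A u v g : open A -> cmeasurable A v -> aeq A u v -> is_wgrad A u g ->
  is_wgrad A v g.
Proof.
move=> oA mv uv [lu l1 l2 h]; split => //; first exact: loc_integrable_aeq lu.
have mu := loc_integrable_measurable oA lu; have mA := measurable_open oA.
move=> psi tpsi; have [h1 h2] := h _ tpsi; rewrite -h1 -h2.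
have E w : test_weight A w -> cint A (fun x => v x * (w x)%:C) = cint A (fun x => u x * (w x)%:C).
  move=> tw; apply: (cint_aeq mA); do ?exact: cmeasurable_test.
  by apply: filterS uv => x huv Ax; rewrite huv.
by split; [exact: E (test_fun_weight _ tpsi).2|exact: E (test_fun_weight _ tpsi).2].
Qed.

Lemma is_wdiv_aeq A V W v : open A ->
  cmeasurable A (fun x => (W x).1) -> cmeasurable A (fun x => (W x).2) ->
  aeq A (fun x => (V x).1) (fun x => (W x).1) -> aeq A (fun x => (V x).2) (fun x => (W x).2) ->
  is_wdiv A V v -> is_wdiv A W v.
Proof.
move=> oA m1 m2 e1 e2 [l1 l2 lv h]; split => //; do ?[exact: (loc_integrable_aeq _ _ e1)|exact: (loc_integrable_aeq _ _ e2)].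
have mA := measurable_open oA.
move=> psi tpsi; rewrite -h//; have [wp w1] := test_fun_weight false tpsi.
have [_ w2] := test_fun_weight true tpsi.
have n1 := loc_integrable_measurable oA l1; have n2 := loc_integrable_measurable oA l2.
apply: (cint_aeq mA); do ?[by apply: cmeasurableD; exact: cmeasurable_test].
by move: e1 e2; apply: filterS2 => x h1 h2 Ax; rewrite h1 ?h2.
Qed.

Lemma du_bois_reymond A u v : open A -> loc_integrable A u -> loc_integrable A v ->
  (forall psi, test_fun A psi ->
    cint A (fun x => u x * (psi x)%:C) = cint A (fun x => v x * (psi x)%:C)) ->
  aeq A u v.
Proof.
move=> oA lu lv h; have mA := measurable_open oA.
have aux (a b : R * R -> R) :
    (forall K, compact K -> K `<=` A -> (leb2 R).-integrable K (EFin \o a)) ->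
    (forall K, compact K -> K `<=` A -> (leb2 R).-integrable K (EFin \o b)) ->
    (forall psi, test_fun A psi -> (leb2 R).-integrable A (EFin \o (fun x => a x * psi x)) /\
       (leb2 R).-integrable A (EFin \o (fun x => b x * psi x))) ->
    (forall psi, test_fun A psi -> \int[leb2 R]_(x in A) (a x * psi x) = \int[leb2 R]_(x in A) (b x * psi x)) ->
    {ae leb2 R, forall x, A x -> a x = b x}.
  move=> ia ib iab ab.
  suff : {ae leb2 R, forall x, A x -> 1 * a x + -1 * b x = 0}.
    by apply: filterS => x hx /hx; lra.
  apply: (@du_bois_reymond_real _ A (fun x => 1 * a x + -1 * b x)) => //.
    move=> K cK KA; have mK := measurable_compact cK.
    exact: (integrable_lin mK 1 (-1) (ia K cK KA) (ib K cK KA)).1.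
  move=> psi tpsi; have [i1 i2] := iab _ tpsi.
  have [_ E] := integrable_lin mA 1 (-1) i1 i2.
  rewrite (_ : (fun x => _) = (fun x => 1 * (a x * psi x) + -1 * (b x * psi x))).
    by rewrite E ab// mul1r mulN1r subrr.
  by apply/funext => x; ring.
have RE (f : R * R -> R[i]) (psi : R * R -> R) :
    (fun x => complex.Re (f x * (psi x)%:C)) = (fun x => complex.Re (f x) * psi x).
  by apply/funext => x; rewrite cReM /= mulr0 subr0.
have IE (f : R * R -> R[i]) (psi : R * R -> R) :
    (fun x => complex.Im (f x * (psi x)%:C)) = (fun x => complex.Im (f x) * psi x).
  by apply/funext => x; rewrite cImM /= mulr0 add0r.
have hi psi (tp : test_fun A psi) : cintegrable A (fun x => u x * (psi x)%:C) /\
    cintegrable A (fun x => v x * (psi x)%:C).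
  by have [wp _] := test_fun_weight true tp; split; exact: cintegrable_test.
have h1 : {ae leb2 R, forall x, A x -> complex.Re (u x) = complex.Re (v x)}.
  apply: aux => [K cK KA|K cK KA|psi tp|psi tp].
  - by have [] := lu K cK KA.
  - by have [] := lv K cK KA.
  - have [[a1 _] [b1 _]] := hi psi tp; rewrite (_ : EFin \o _ = fun x => (complex.Re (u x * (psi x)%:C))%:E).
      split => //; rewrite (_ : EFin \o _ = fun x => (complex.Re (v x * (psi x)%:C))%:E)//.
      by apply/funext => x /=; rewrite cReM /= mulr0 subr0.
    by apply/funext => x /=; rewrite cReM /= mulr0 subr0.
  - by have /(congr1 (@complex.Re R)) := h psi tp; rewrite /cint /= !RE.
have h2 : {ae leb2 R, forall x, A x -> complex.Im (u x) = complex.Im (v x)}.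
  apply: aux => [K cK KA|K cK KA|psi tp|psi tp].
  - by have [] := lu K cK KA.
  - by have [] := lv K cK KA.
  - have [[_ a1] [_ b1]] := hi psi tp; rewrite (_ : EFin \o _ = fun x => (complex.Im (u x * (psi x)%:C))%:E).
      split => //; rewrite (_ : EFin \o _ = fun x => (complex.Im (v x * (psi x)%:C))%:E)//.
      by apply/funext => x /=; rewrite cImM /= mulr0 add0r.
    by apply/funext => x /=; rewrite cImM /= mulr0 add0r.
  - by have /(congr1 (@complex.Im R)) := h psi tp; rewrite /cint /= !IE.
by move: h1 h2; apply: filterS2 => x e1 e2 Ax; apply: complexP; [exact: e1|exact: e2].
Qed.

(** [wgrad] is an arbitrary choice; by du Bois-Reymond any explicit weak gradient agrees with it
    almost everywhere. *)
Lemma wgradP A u g : open A -> is_wgrad A u g ->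
  [/\ is_wgrad A u (wgrad A u), aeq A (fun x => (wgrad A u x).1) (fun x => (g x).1) &
      aeq A (fun x => (wgrad A u x).2) (fun x => (g x).2)].
Proof.
move=> oA hg; have hw : is_wgrad A u (wgrad A u).
  by apply: (@xgetPex _ (fun=> (0, 0)) [set g | is_wgrad A u g]); exists g.
split => //; case: hg hw => [_ g1 g2 hg] [_ w1 w2 hw].
- apply: du_bois_reymond => // psi tp; apply: oppr_inj.
  by rewrite -(hw _ tp).1 -(hg _ tp).1.
- apply: du_bois_reymond => // psi tp; apply: oppr_inj.
  by rewrite -(hw _ tp).2 -(hg _ tp).2.
Qed.

Lemma wdivP A V v : open A -> is_wdiv A V v ->
  is_wdiv A V (wdiv A V) /\ aeq A (wdiv A V) v.
Proof.
move=> oA hv; have hw : is_wdiv A V (wdiv A V).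
  by apply: (@xgetPex _ (fun=> 0) [set v | is_wdiv A V v]); exists v.
split => //; case: hv hw => [_ _ v1 hv] [_ _ w1 hw].
by apply: du_bois_reymond => // psi tp; apply: oppr_inj; rewrite -hw// -hv.
Qed.

Lemma is_wdiv_wgrad A V g h : open A -> is_wgrad A (fun x => (V x).1) g ->
  is_wgrad A (fun x => (V x).2) h -> is_wdiv A V (fun x => (g x).1 + (h x).2).
Proof.
move=> oA [lV1 lg1 lg2 hg] [lV2 lh1 lh2 hh]; have mA := measurable_open oA; split => //.
  move=> K cK KA; have mK := measurable_compact cK.
  exact: (cintegrableD mK (lg1 K cK KA) (lh2 K cK KA)).
move=> psi tp; have [wp w1] := test_fun_weight false tp; have [_ w2] := test_fun_weight true tp.
rewrite cintD//; do ?exact: cintegrable_test.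
rewrite (hg _ tp).1 (hh _ tp).2 -opprD -cintD//; do ?exact: cintegrable_test.
by congr (- _); apply: eq_cint => x _; rewrite mulrDl.
Qed.

End weak.

(** * Integration by parts against test functions *)

Section integration_by_parts.
Variable R : realType.
Local Notation mu := (@lebesgue_measure R).

(** Reading and replacing the coordinate selected by b lets both directions of differentiation share
    one argument. *)
Definition crd (b : bool) (x : R * R) : R := if b then x.2 else x.1.
Definition upd (b : bool) (x : R * R) (t : R) : R * R := if b then (x.1, t) else (t, x.2).

Lemma upd_crd b x : upd b x (crd b x) = x.
Proof. by case: b x => -[]. Qed.

Lemma is_derive_section (b : bool) (F : R * R -> R) (x : R * R) (l : R) :
  is_derive x (dir R b) F l -> is_derive (crd b x) 1 (fun t : R => F (upd b x t)) l.
Proof.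
move=> [h1 h2].
have E : (fun h : R => h^-1 *: ((F \o shift x) (h *: dir R b) - F x)) =
    (fun h : R => h^-1 *: (((fun t : R => F (upd b x t)) \o shift (crd b x)) (h *: (1 : R)) -
       F (upd b x (crd b x)))).
  apply/funext => h; rewrite upd_crd; congr (_ *: (F _ - _)).
  have e1 : h *: (1 : R) = h by exact: mulr1.
  by rewrite /shift /= e1; case: b {h1 h2}; rewrite /dir /upd /crd /=;
    apply: injective_projections => /=; rewrite ?e1 ?scaler0 ?add0r.
by apply: DeriveDef; [move: h1|move: h2]; rewrite /derivable /derive E.
Qed.

Lemma integral_derive0 (f g : R -> R) (a : R) : 0 < a ->
  (forall t : R, is_derive t 1 g (f t)) -> continuous f ->
  (forall t, ~ (- a < t < a) -> f t = 0 /\ g t = 0) ->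
  (\int[mu]_t (f t)%:E = 0)%E.
Proof.
move=> a0 dg cf h0; have aa : - a < a by lra.
pose I : set (measurableTypeR R) := `]- a, a[%classic.
have [i1 e1] := FTC_oo aa dg cf.
have [_ ga] : f a = 0 /\ g a = 0 by apply: h0; rewrite ltxx andbF.
rewrite ga in e1.
have [_ gb] : f (- a) = 0 /\ g (- a) = 0 by apply: h0; rewrite ltxx.
rewrite gb subr0 in e1.
transitivity (\int[mu]_(t in I) (f t)%:E)%E.
  rewrite [RHS]integral_mkcond; apply: eq_integral => t _; rewrite patchE.
  have [//|tI] := boolP (t \in I).
  rewrite (h0 t _).1// => ta; move: tI; rewrite notin_setE; apply.
  by rewrite /I /= in_itv.
have mI : measurable I by exact: measurable_itv.
rewrite -(fineK (integrable_fin_num mI i1)); congr EFin; exact: e1.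
Qed.

Lemma compact_box (K : set (R * R)) : compact K -> exists2 a : R, 0 < a & K `<=` box a a.
Proof.
move=> cK; have [M [_ hM]] := compact_bounded cK; exists (`|M| + 1).
  by have := normr_ge0 M; lra.
move=> x Kx; have : `|x| <= `|M| + 1 / 2.
  by apply: hM => //; apply: le_lt_trans (ler_norm _) _; rewrite ltrDl; lra.
rewrite prod_normE ge_max => /andP[h1 h2].
by rewrite /box /=; move: h1 h2; rewrite !ler_norml => /andP[? ?] /andP[? ?]; apply/andP; split; apply/andP; split; lra.
Qed.

Lemma compact_finite (K : set (R * R)) : compact K -> (leb2 R (K : set (RR R)) < +oo)%E.
Proof.
move=> cK; have [a a0 KB] := compact_box cK; have mK := measurable_compact cK.
have h : (leb2 R (K : set (RR R)) <= leb2 R (box a a : set (RR R)))%E.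
  by apply: le_measure; rewrite ?inE//; exact: measurable_box.
apply: le_lt_trans h _.
pose I : set (measurableTypeR R) := `]- a, a[%classic.
have mI : measurable I by exact: measurable_itv.
have -> : (leb2 R (box a a : set (RR R)) = mu I * mu I)%E by rewrite box_setX; exact: product_measure1E.
rewrite /I; by rewrite lte_mul_pinfty ?measure_ge0 ?lebesgue_measure_itv //=; case: ifP => // _; rewrite ltry.
Qed.

Lemma loc_integrable_bounded (A : set (R * R)) (f : R * R -> R[i]) (C : R) :
  cmeasurable setT f -> (forall x, cabs (f x) <= C) -> loc_integrable A f.
Proof.
move=> mf fC K cK KA; have mK := measurable_compact cK.
have iC : (leb2 R).-integrable K (fun=> C%:E).
  apply/integrableP; split; first exact: measurable_cst.
  rewrite integral_cst// lte_mul_pinfty ?lee_fin//; exact: compact_finite.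
by apply: (cintegrable_dominated mK (g := fun=> C)) => //; exact: cmeasurable_sub.
Qed.

(** Fubini's theorem with the inner integral in the direction of differentiation, where the
    fundamental theorem gives 0. *)
Lemma integral_dir_derive0 (b : bool) (F F' : R * R -> R) (a : R) : 0 < a ->
  (forall x, is_derive (crd b x) 1 (fun t : R => F (upd b x t)) (F' x)) -> continuous F' ->
  (forall x, ~ box a a x -> F x = 0 /\ F' x = 0) ->
  (leb2 R).-integrable setT (EFin \o F') /\ \int[leb2 R]_x F' x = 0.
Proof.
move=> a0 dF cF' h0.
have cK : compact (crect (- a) a (- a) a) by exact: compact_crect.
have bK : box a a `<=` crect (- a) a (- a) a.
  by move=> x; rewrite /box /crect /= !in_itv /= => /andP[/andP[h1 h2] /andP[h3 h4]]; rewrite !ltW.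
have iF : (leb2 R).-integrable setT (EFin \o F').
  have tw : test_weight setT F'.
    split => //; exists (crect (- a) a (- a) a); split => // x nx.
    by apply: (h0 x _).2 => /bK.
  have [h _] := cintegrable_test (measurableT : measurable (setT : set (RR R))) (@loc_integrable_bounded setT (fun=> 1) (cabs 1) (cmeasurable_cst _ _) (fun=> lexx _)) tw.
  move: h; congr (_.-integrable _ _); apply/funext => x /=.
  by rewrite mul1r mul0r subr0.
split => //; rewrite /Rintegral.
case: b dF => dF.
- rewrite -(integral12_prod_meas1 (f := EFin \o F' : RR R -> \bar R))//.
  rewrite (_ : (\int[_]_x _ = 0)%E)//; apply: integral0_eq => x _; rewrite /fubini_F /=.
  apply: (@integral_derive0 _ (fun t => F (x, t)) a) => // [t|t|t nt].
  + exact: (dF (x, t)).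
  + apply: (@continuous_comp _ _ _ (fun t : R => (x, t)) F'); last exact: cF'.
    by apply: (@cvg_pair _ _ _ (nbhs t) (nbhs x) (nbhs t) _ _ _ (fun=> x) id); [exact: cvg_cst|exact: cvg_id].
  + by have [-> ->] := h0 (x, t) (fun h => nt (andP h).2).
- rewrite -(integral21_prod_meas1 (f := EFin \o F' : RR R -> \bar R))//.
  rewrite (_ : (\int[_]_x _ = 0)%E)//; apply: integral0_eq => y _; rewrite /fubini_G /=.
  apply: (@integral_derive0 _ (fun t => F (t, y)) a) => // [t|t|t nt].
  + exact: (dF (t, y)).
  + apply: (@continuous_comp _ _ _ (fun t : R => (t, y)) F'); last exact: cF'.
    by apply: (@cvg_pair _ _ _ (nbhs t) (nbhs t) (nbhs y) _ _ _ id (fun=> y)); [exact: cvg_id|exact: cvg_cst].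
  + by have [-> ->] := h0 (t, y) (fun h => nt (andP h).1).
Qed.

Lemma test_fun_section (b : bool) psi (x : R * R) : test_fun setT psi ->
  is_derive (crd b x) 1 (fun t : R => psi (upd b x t)) (pd [:: b] psi x).
Proof.
move=> [hC _ _]; apply: is_derive_section.
by have [_ /(_ isT b)] := hC 1%N [::] isT x I; move=> h; apply: DeriveDef.
Qed.

Lemma test_fun_box psi : test_fun setT psi -> exists a : R, 0 < a /\
  forall x, ~ box a a x -> psi x = 0 /\ forall b, pd [:: b] psi x = 0.
Proof.
move=> tp; have [hC cK _] := tp; set K := closure _ in cK.
have [a a0 KB] := compact_box cK; exists a; split => //.
have tK : test_fun (box a a) psi by case: tp => h1 h2 h3; split.
move=> x nx; split; first by have [[_ [K' [_ KB' h]]] _] := test_fun_weight true tK; apply: h => /KB'/nx.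
by move=> b; have [_ [_ [K' [_ KB' h]]]] := test_fun_weight b tK; apply: h => /KB'/nx.
Qed.

End integration_by_parts.

Section fourier_ibp.
Variables (R : realType) (alpha r : R).
Hypothesis r0 : 0 < r.
Local Notation phi := (phij alpha r).

(** The real and imaginary parts of phi_j psi have compact support, so their derivatives integrate
    to 0; the product rule gives the two terms. *)
Lemma phij_ibp (b : bool) j psi : test_fun setT psi ->
  cint setT (fun x => phi j x * (pd [:: b] psi x)%:C) =
  - cint setT (fun x => (0 +i* xi alpha r b j) * phi j x * (psi x)%:C).
Proof.
move=> tp; have [a [a0 ha]] := test_fun_box tp.
pose e x := xi alpha r false j * x.1 + xi alpha r true j * x.2.
have phiE x : phi j x = (phic r * cos (e x)) +i* (phic r * sin (e x)).
  rewrite phijE -cisD -/(e x); apply: complexP; rewrite ?cReM ?cImM /=; ring.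
have eupd x t : e (upd b x t) = xi alpha r b j * t + xi alpha r (~~ b) j * crd (~~ b) x.
  by rewrite /e /upd /crd; case: b => /=; rewrite // addrC.
have de (x : R * R) : is_derive (crd b x) 1 (fun t : R => e (upd b x t)) (xi alpha r b j).
  under eq_fun do rewrite eupd.
  rewrite -[X in is_derive _ _ _ X]addr0; apply: is_derive_addf; exact: is_derive_mull.
have ce : continuous e.
  by move=> x; apply: cvgD; apply: cvgM; try exact: cvg_cst; [exact: cvg_fst|exact: cvg_snd].
have ccos : continuous (fun x => cos (e x)).
  by move=> x; apply: (@continuous_comp _ _ _ e cos); [exact: ce|exact: continuous_cos].
have csin : continuous (fun x => sin (e x)).
  by move=> x; apply: (@continuous_comp _ _ _ e sin); [exact: ce|exact: continuous_sin].
have [cpsi cdpsi] : continuous psi /\ continuous (pd [:: b] psi).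
  by have [[h1 _] [h2 _]] := test_fun_weight b tp.
pose Fc x := phic r * cos (e x) * psi x.
pose Fs x := phic r * sin (e x) * psi x.
pose Fc' x := phic r * (cos (e x) * pd [:: b] psi x - xi alpha r b j * sin (e x) * psi x).
pose Fs' x := phic r * (sin (e x) * pd [:: b] psi x + xi alpha r b j * cos (e x) * psi x).
have cx (c : R) (f : R * R -> R) : continuous f -> continuous (fun x => c * f x).
  by move=> cf x; apply: cvgM; [exact: cvg_cst|exact: cf].
have cm (f g : R * R -> R) : continuous f -> continuous g -> continuous (fun x => f x * g x).
  by move=> cf cg x; apply: cvgM; [exact: cf|exact: cg].
have dc x : is_derive (crd b x) 1 (fun t : R => cos (e (upd b x t))) (- sin (e x) * xi alpha r b j).
  have := @is_derive1_comp _ cos (fun t : R => e (upd b x t)) _ _ _ (is_derive_cos _) (de x).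
  by rewrite upd_crd.
have ds x : is_derive (crd b x) 1 (fun t : R => sin (e (upd b x t))) (cos (e x) * xi alpha r b j).
  have := @is_derive1_comp _ sin (fun t : R => e (upd b x t)) _ _ _ (is_derive_sin _) (de x).
  by rewrite upd_crd.
have [i1 I1] : (leb2 R).-integrable setT (EFin \o Fc') /\ \int[leb2 R]_x Fc' x = 0.
  apply: (@integral_dir_derive0 _ b Fc Fc' a a0).
  - move=> x; have h := is_derive_mulcl (phic r) (is_derive_mulf (dc x) (test_fun_section b x tp)).
    rewrite (_ : (fun t : R => Fc (upd b x t)) =
      (fun t : R => phic r * (cos (e (upd b x t)) * psi (upd b x t)))).
      by apply: (is_derive_eq h); rewrite !upd_crd /Fc'; ring.
    by apply/funext => t; rewrite /Fc mulrA.
  - apply: (cx _ _) => x; apply: cvgB; first exact: cm.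
    by apply: (cm _ _) => //; exact: (cx _ _).
  - by move=> x /ha[p0 /(_ b) d0]; rewrite /Fc /Fc' p0 d0 !mulr0 subr0 mulr0.
have [i2 I2] : (leb2 R).-integrable setT (EFin \o Fs') /\ \int[leb2 R]_x Fs' x = 0.
  apply: (@integral_dir_derive0 _ b Fs Fs' a a0).
  - move=> x; have h := is_derive_mulcl (phic r) (is_derive_mulf (ds x) (test_fun_section b x tp)).
    rewrite (_ : (fun t : R => Fs (upd b x t)) =
      (fun t : R => phic r * (sin (e (upd b x t)) * psi (upd b x t)))).
      by apply: (is_derive_eq h); rewrite !upd_crd /Fs'; ring.
    by apply/funext => t; rewrite /Fs mulrA.
  - apply: (cx _ _) => x; apply: cvgD; first exact: cm.
    by apply: (cm _ _) => //; exact: (cx _ _).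
  - by move=> x /ha[p0 /(_ b) d0]; rewrite /Fs /Fs' p0 d0 !mulr0 addr0 mulr0.
have lphi (z : R[i]) : loc_integrable setT (fun x => z * phi j x).
  apply: (@loc_integrable_bounded _ _ _ (cabs z * cabs (phi j 0))).
    by apply: cmeasurableM; [exact: cmeasurable_cst|exact: cmeasurable_phij].
  by move=> x; rewrite cabsM /cabs !sqnormc_phij.
have mT : measurable (setT : set (RR R)) by [].
have [wp wd] := test_fun_weight b tp.
have i3 := cintegrable_test mT (lphi (0 +i* xi alpha r b j)) wp.
have i4 : cintegrable setT (fun x => phi j x * (pd [:: b] psi x)%:C).
  have := cintegrable_test mT (lphi 1) wd.
  by under eq_fun do rewrite mul1r.
apply/eqP; rewrite -subr_eq0 opprK -cintD//; apply/eqP.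
have h0 f : (forall x, complex.Re (f x) = Fc' x) -> (forall x, complex.Im (f x) = Fs' x) ->
    cint setT f = 0.
  move=> hf1 hf2; rewrite /cint.
  have -> : (fun x => complex.Re (f x)) = Fc' by apply/funext.
  have -> : (fun x => complex.Im (f x)) = Fs' by apply/funext.
  by rewrite I1 I2.
apply: h0 => x; rewrite phiE !(cReM, cImM, cReD, cImD) ?/Fc' ?/Fs';
  move: (pd _ psi x) => p; rewrite /=; ring.
Qed.

End fourier_ibp.

(** * Sobolev regularity of Fourier series *)

Section fourier_fun.
Variables (R : realType) (alpha r : R).
Hypothesis r0 : 0 < r.
Local Notation phi := (phij alpha r).
Local Notation O := (Omega r).
Let mO : measurable (O : set (RR R)) := measurable_Omega r.
Let H : inner_space (L2 O) (ip2 O) := L2_inner mO.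
Let HB := Omega_basis alpha r0.
Local Notation wgt := (weight (xi alpha r)).
Local Notation wbd := (wbounded ZN (xi alpha r)).
Local Notation gcoef := (grad_coef (xi alpha r)).

(** U is the sum of the series in L^2 of every multiple of the cell, as provided by [riesz_fischer].
    Convergence on one cell would give neither local regularity across its boundary nor a function
    of [H1alpha]. *)
Definition fourier_fun (c : int * int -> R[i]) (U : R * R -> R[i]) :=
  [/\ cmeasurable setT U,
    forall M : nat, (0 < M)%N -> L2 (box (M%:R * pi) (M%:R * r)) U /\
      forall eps : R, 0 < eps -> exists N, forall n, (N <= n)%N ->
        nsq (ip2 (box (M%:R * pi) (M%:R * r))) (U - partial_sum alpha r c n) <= eps &
    quasi_periodic alpha U].

Lemma box_bigbox (a : R) : exists2 M : nat, (0 < M)%N & box a a `<=` box (M%:R * pi) (M%:R * r).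
Proof.
have pi0 := pi_gt0 R; pose M := (Num.bound (`|a| / pi) + Num.bound (`|a| / r)).+1.
have h1 : `|a| <= M%:R * pi.
  rewrite -ler_pdivrMr//; apply: le_trans (ltW (archi_boundP _)) _; first by rewrite divr_ge0// ltW.
  by rewrite ler_nat leqW// leq_addr.
have h2 : `|a| <= M%:R * r.
  rewrite -ler_pdivrMr//; apply: le_trans (ltW (archi_boundP _)) _; first by rewrite divr_ge0// ltW.
  by rewrite ler_nat leqW// leq_addl.
exists M => // x; rewrite /box /= => /andP[/andP[x1 x2] /andP[x3 x4]].
have := ler_norm a; move: (M%:R * pi) (M%:R * r) h1 h2 => p q h1 h2 h3.
by apply/andP; split; apply/andP; split; lra.
Qed.

Lemma L2_sub (A B : set (R * R)) f : measurable (A : set (RR R)) -> measurable (B : set (RR R)) ->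
  A `<=` B -> L2 B f -> L2 A f.
Proof.
move=> mA mB AB [[m1 m2] hf]; split.
  by split; [exact: (measurable_funS mB AB m1)|exact: (measurable_funS mB AB m2)].
apply: le_lt_trans hf; apply: ge0_subset_integral => //.
- by apply: (@measurable_Esqnormc _ B); split.
- by move=> x _; rewrite lee_fin sqnormc_ge0.
Qed.

Lemma fourier_L2_compact c U K : fourier_fun c U -> compact K -> L2 K U.
Proof.
move=> [_ hU _] cK; have [a _ Ka] := compact_box cK; have [M M0 aM] := box_bigbox a.
have [LU _] := hU M M0; apply: L2_sub LU; first exact: measurable_compact.
- exact: measurable_box.
- exact: subset_trans aM.
Qed.

Lemma L2_loc_integrable (A : set (R * R)) f : (forall K, compact K -> L2 K f) -> loc_integrable A f.
Proof.
move=> Lf K cK KA; have mK := measurable_compact cK.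
have L1 : L2 K (fun=> 1 : R[i]).
  split; first exact: cmeasurable_cst.
  rewrite (_ : (fun _ => _) = cst 1%E); last by apply/funext => x; rewrite /sqnormc /= expr1n expr0n addr0.
  by rewrite integral_cst// mul1e; exact: compact_finite.
have [h1 h2] := L2_mul mK (Lf K cK) L1.
by split; [move: h1|move: h2]; congr (_.-integrable _ _); apply/funext => x /=; rewrite mulr1.
Qed.

Lemma test_weight_bounded (A : set (R * R)) w : test_weight A w ->
  exists M : R, forall x, `|w x| <= M.
Proof.
move=> [cw [K [cK KA w0]]].
have cwK : compact (w @` K).
  by apply: continuous_compact => //; exact: continuous_subspaceT.
have [M [_ hM]] := compact_bounded cwK; exists (`|M| + 1) => x.
have M0 := normr_ge0 M.
have [Kx|nKx] := pselect (K x); last by rewrite w0// normr0; lra.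
by apply: hM; [apply: le_lt_trans (ler_norm _) _; lra|exists x].
Qed.

(** The identity holds for partial sums by [phij_ibp], and both sides are continuous in L^2 of a box
    containing the support of psi. *)
Lemma fourier_weak (b : bool) c U G psi : fourier_fun c U -> fourier_fun (gcoef b c) G ->
  test_fun setT psi ->
  cint setT (fun x => U x * (pd [:: b] psi x)%:C) = - cint setT (fun x => G x * (psi x)%:C).
Proof.
move=> [mU hU _] [mG hG _] tp; have [a [a0 ha]] := test_fun_box tp.
have [M M0 aM] := box_bigbox a; set B := box (M%:R * pi) (M%:R * r) in aM.
have [LU cU] := hU M M0; have [LG cG] := hG M M0.
have mB : measurable (B : set (RR R)) := measurable_box _ _.
have HB' : inner_space (L2 B) (ip2 B) := L2_inner mB.
have out x : ~ B x -> psi x = 0 /\ forall b, pd [:: b] psi x = 0.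
  by move=> nB; apply: ha => /aM/nB.
have [wp wd] := test_fun_weight b tp.
have LW w : test_weight setT w -> L2 B (fun x => (w x)%:C).
  move=> tw; have [m hm] := test_weight_bounded tw.
  apply: (@L2_bounded _ alpha _ r0 _ M0 _ (m ^+ 2)) => [|x _].
    by apply: cmeasurable_real; apply: measurable_funTS; exact: measurable_cont tw.1.
  by rewrite sqnormc_real -(real_normK (num_real (w x))) lerXn2r ?nnegrE// ?hm// (le_trans _ (hm x)).
have LP := LW _ wp; have LD := LW _ wd.
have toB f w : (forall x, ~ B x -> w x = 0) ->
    cint setT (fun x => f x * (w x)%:C) = ip2 B f (fun x => (w x)%:C).
  move=> w0; rewrite (@cint_sub _ setT B)// => [|x _ nB]; last by rewrite w0// mulr0.
  by apply: eq_cint => x _; rewrite JrealC.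
have pE f : cint setT (fun x => f x * (psi x)%:C) = ip2 B f (fun x => (psi x)%:C).
  by apply: toB => x /out[].
have dE f : cint setT (fun x => f x * (pd [:: b] psi x)%:C) = ip2 B f (fun x => (pd [:: b] psi x)%:C).
  by apply: toB => x /out[_ ->].
rewrite pE dE; apply/eqP; rewrite -subr_eq0 opprK; apply/eqP/sqnormc_eq0/eqP.
rewrite eq_le sqnormc_ge0 andbT; apply/ler_addgt0Pr => e e0; rewrite add0r.
have Lphi j : L2 B (phi j) by exact: (L2_phij alpha r0 M0).
have Lps d n : L2 B (partial_sum alpha r d n).
  by apply: (spanS HB') => j; apply: (innerZ HB').
have psum n : ip2 B (partial_sum alpha r c n) (fun x => (pd [:: b] psi x)%:C) +
    ip2 B (partial_sum alpha r (gcoef b c) n) (fun x => (psi x)%:C) = 0.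
  rewrite /partial_sum !(ip_suml HB')//; do ?by move=> j; apply: (innerZ HB').
  rewrite -big_split big1//= => j _; rewrite !(inner_ipZ HB')// -dE -pE phij_ibp//.
  have iph : cintegrable setT (fun x => phi j x * (psi x)%:C).
    apply: cintegrable_test => //; apply: (@loc_integrable_bounded _ _ _ (cabs (phi j 0))).
      exact: cmeasurable_phij.
    by move=> x; rewrite /cabs !sqnormc_phij.
  rewrite (_ : (fun x => (0 +i* _) * _ * _) = fun x => (0 +i* xi alpha r b j) * (phi j x * (psi x)%:C)).
    by rewrite cintZ// /grad_coef; ring.
  by apply/funext => x; rewrite mulrA.
set P := (fun x => (psi x)%:C) in psum LP *; set D := (fun x => (pd _ psi x)%:C) in psum LD *.
have nP := nsq_ge0 HB' LP; have nD := nsq_ge0 HB' LD.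
pose K := nsq (ip2 B) P + nsq (ip2 B) D + 1; have K0 : 0 < K by rewrite /K; lra.
have e1 : 0 < e / (2 * K) by rewrite divr_gt0//; lra.
have [N1 hN1] := cU _ e1; have [N2 hN2] := cG _ e1.
pose n := maxn N1 N2; have := hN1 n (leq_maxl _ _); have := hN2 n (leq_maxr _ _).
set s := partial_sum _ _ c n; set t := partial_sum _ _ _ n => h2 h1.
have -> : ip2 B U D + ip2 B G P = ip2 B (U - s) D + ip2 B (G - t) P.
  rewrite (ipBl HB' LU (Lps c n) LD) (ipBl HB' LG (Lps (gcoef b c) n) LP).
  have := psum n; rewrite -/s -/t => /eqP.
  rewrite addr_eq0 => /eqP ->; ring.
apply: le_trans (sqnormcD _ _) _.
have c1 := cauchy_schwarz HB' (SB HB' LU (Lps c n)) LD.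
have c2 := cauchy_schwarz HB' (SB HB' LG (Lps (gcoef b c) n)) LP.
have g1 := nsq_ge0 HB' (SB HB' LU (Lps c n)); have g2 := nsq_ge0 HB' (SB HB' LG (Lps (gcoef b c) n)).
rewrite -/s -/t in c1 c2 g1 g2.
have -> : e = 2 * (e / (2 * K) * K) by field; rewrite gt_eqF.
rewrite ler_pM2l//; apply: le_trans (lerD c1 c2) _.
move: h1 h2 c1 c2 g1 g2 e1; rewrite -/B.
move: (nsq _ (U - s)) (nsq _ (G - t)) (e / _) => u v d h1 h2 _ _ g1 g2 d0.
rewrite /K; nra.
Qed.

Lemma fourier_wgrad c U G1 G2 : fourier_fun c U -> fourier_fun (gcoef false c) G1 ->
  fourier_fun (gcoef true c) G2 -> is_wgrad setT U (fun x => (G1 x, G2 x)).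
Proof.
move=> fU fG1 fG2; split.
- by apply: L2_loc_integrable => K cK; exact: (fourier_L2_compact fU).
- by apply: L2_loc_integrable => K cK; exact: (fourier_L2_compact fG1).
- by apply: L2_loc_integrable => K cK; exact: (fourier_L2_compact fG2).
- by move=> psi tp; split; [exact: (fourier_weak fU fG1 tp)|exact: (fourier_weak fU fG2 tp)].
Qed.

Lemma fourier_coef c U : fourier_fun c U -> L2 O U /\ forall j, ip2 O U (phi j) = c j.
Proof.
move=> [_ hU _]; have [LU cU] := hU 1%N (ltnSn 0); rewrite -OmegaE in LU cU.
split => //; apply: (lim_coef H HB LU) => e e0.
have [N hN] := cU _ (divr_gt0 e0 (ltr0Sn R 1)); exists N => n Nn.
by apply: le_lt_trans (hN n Nn) _; lra.
Qed.

Lemma eq_coef_aeq f g : L2 O f -> L2 O g -> (forall j, ip2 O f (phi j) = ip2 O g (phi j)) ->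
  aeq O f g.
Proof.
move=> Lf Lg fg; have h := eq_coef H HB Lf Lg fg.
have := nsq0_aeq mO (SB H Lf Lg) h; apply: filterS => x hx Ox.
by apply/eqP; rewrite -subr_eq0; apply/eqP; exact: hx.
Qed.

Lemma sqnorm_wbounded c B : wbd c B -> forall n, \sum_(j <- ZN n) sqnormc (c j) <= B.
Proof.
move=> hc n; apply: le_trans (hc n); apply: ler_sum => j _.
by rewrite ler_peMl ?sqnormc_ge0// weight_ge1.
Qed.

Lemma gcoef_wbounded b c B : wbd c B -> forall n, \sum_(j <- ZN n) sqnormc (gcoef b c j) <= B.
Proof.
by move=> hc n; apply: le_trans (hc n); apply: ler_sum => j _; exact: grad_coef_le.
Qed.

Lemma fourier_fun_H1 c B : wbd c B -> exists U G1 G2, [/\ fourier_fun c U,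
  fourier_fun (gcoef false c) G1, fourier_fun (gcoef true c) G2 &
  is_wgrad setT U (fun x => (G1 x, G2 x))].
Proof.
move=> hc; have [U fU] := riesz_fischer alpha r0 (sqnorm_wbounded hc).
have [G1 fG1] := riesz_fischer alpha r0 (gcoef_wbounded false hc).
have [G2 fG2] := riesz_fischer alpha r0 (gcoef_wbounded true hc).
by exists U, G1, G2; split => //; exact: (@fourier_wgrad c).
Qed.

Lemma fourier_H1alpha c U G1 G2 D : fourier_fun c U -> fourier_fun (gcoef false c) G1 ->
  fourier_fun (gcoef true c) G2 -> H1alpha alpha D U.
Proof.
move=> fU fG1 fG2; exists U; split => //; last by have [] := fU.
exists (fun x => (G1 x, G2 x)); split; first exact: (@fourier_wgrad c).
move=> K cK; split; first exact: (fourier_L2_compact fU).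
by split; [exact: (fourier_L2_compact fG1)|exact: (fourier_L2_compact fG2)].
Qed.

Lemma open_Omega : open (O : set (R * R)).
Proof.
rewrite (_ : O = fst @^-1` `]- pi, pi[%classic `&` snd @^-1` `]- r, r[%classic).
  apply: openI; apply: open_comp; do ?exact: itv_open.
  - by move=> x _; exact: cvg_fst.
  - by move=> x _; exact: cvg_snd.
by apply/seteqP; split => x; rewrite /Omega /= !in_itv /= => /andP.
Qed.

(** u is square-integrable on the cell; U is a function on the whole plane summed from its
    coefficients and agreeing with u on the cell. Its weak gradient has the coefficients i xi_b c,
    so the chosen [wgrad] of u has them too. *)
Lemma wgrad_H1 u B : L2 O u -> wbd (fun j => ip2 O u (phi j)) B ->
  let c := fun j => ip2 O u (phi j) in
  exists U G1 G2, [/\ fourier_fun c U, fourier_fun (gcoef false c) G1,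
    fourier_fun (gcoef true c) G2, is_wgrad setT U (fun x => (G1 x, G2 x)) &
    [/\ aeq O u U, is_wgrad O u (wgrad O u), aeq O (fun x => (wgrad O u x).1) G1 &
        aeq O (fun x => (wgrad O u x).2) G2]].
Proof.
move=> Lu hB c; have [U [G1 [G2 [fU fG1 fG2 hw]]]] := fourier_fun_H1 hB.
exists U, G1, G2; split => //; have [LU cU] := fourier_coef fU.
have uU : aeq O u U by apply: eq_coef_aeq => // j; rewrite cU.
have hO : is_wgrad O u (fun x => (G1 x, G2 x)).
  apply: (@is_wgrad_aeq _ _ U); [exact: open_Omega|exact: Lu.1|exact: aeq_sym|].
  exact: (is_wgrad_sub (@subsetT _ O) hw).
by have [h1 h2 h3] := wgradP open_Omega hO; split.
Qed.

End fourier_fun.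

(** * One-dimensional complex calculus *)

Section calculus1.
Variable R : realType.
Local Notation mu := (@lebesgue_measure R).
Implicit Types (F G : R -> R[i]) (f p : R -> R).

Lemma FTC_cc f (F : R -> R) (a b : R) : a < b ->
  (forall x : R, a <= x <= b -> is_derive x 1 F (f x)) -> continuous f ->
  \int[mu]_(x in (`]a, b[%classic : set (measurableTypeR R))) f x = F b - F a.
Proof.
move=> ab dF cf; pose I : set (measurableTypeR R) := `]a, b[%classic.
pose J : set (measurableTypeR R) := `[a, b]%classic.
have ic : mu.-integrable J (EFin \o f).
  apply: continuous_compact_integrable; first exact: segment_compact.
  exact: continuous_subspaceT.
have io : mu.-integrable I (EFin \o f).
  by apply: integrableS ic; [exact: measurable_itv|exact: measurable_itv|exact: subset_itv_oo_cc].
have cF x : a <= x <= b -> {for x, continuous F}.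
  by move=> xab; apply: differentiable_continuous; apply/derivable1_diffP; have [] := dF x xab.
have h := @integral_itv_bndoo R a b (EFin \o f) true false.
rewrite /Rintegral -/I -h; last by case/integrableP: io.
rewrite (@continuous_FTC2 _ f F a b)//.
- exact: continuous_subspaceT.
- split.
  + by move=> x; rewrite in_itv /= => /andP[ax xb]; have [] := dF x _; rewrite ?ltW.
  + by apply: cvg_at_right_filter; apply: cF; rewrite lexx ltW.
  + by apply: cvg_at_left_filter; apply: cF; rewrite lexx ltW.
- by move=> x; rewrite in_itv /= => /andP[ax xb]; rewrite derive1E; have [] := dF x _; rewrite ?ltW.
Qed.

(** The primitive starts at B and is differentiable to the right of B only; users take B to the left
    of the interval they need. *)
Lemma antiderivative f (B : R) : continuous f ->
  exists F : R -> R, forall t : R, B < t -> is_derive t 1 F (f t).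
Proof.
move=> cf; exists (fun x => \int[mu]_(t in (`[B, x]%classic : set (measurableTypeR R))) f t) => t Bt.
have [] := @continuous_FTC1_closed R f B t (t + 1) _ _ Bt (cf t).
- by rewrite ltrDl.
- apply: continuous_compact_integrable; first exact: segment_compact.
  exact: continuous_subspaceT.
by move=> h1; rewrite derive1E => h2; exact: (DeriveDef h1 h2).
Qed.

Lemma integral_oo_split f (a b c : R) : a < b -> b < c -> continuous f ->
  \int[mu]_(x in (`]a, c[%classic : set (measurableTypeR R))) f x =
  \int[mu]_(x in (`]a, b[%classic : set (measurableTypeR R))) f x +
  \int[mu]_(x in (`]b, c[%classic : set (measurableTypeR R))) f x.
Proof.
move=> ab bc cf; have [F hF] := antiderivative (a - 1) cf.
have dF x : a <= x -> is_derive x 1 F (f x) by move=> ax; apply: hF; lra.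
have E u v : a <= u -> u < v ->
    \int[mu]_(x in (`]u, v[%classic : set (measurableTypeR R))) f x = F v - F u.
  by move=> au uv; apply: FTC_cc => // x /andP[ux _]; apply: dF; lra.
by rewrite !E//; lra.
Qed.

(** Periodicity is asked only within ]-2 r, 2 r[, since [wrap_abs] has no more. It makes F(s + r) -
    F(s - r) constant on ]-r, r[, where F is a primitive. *)
Lemma integral_period (p : R -> R) (r x : R) : 0 < r -> continuous p -> - r < x < r ->
  (forall t, - r < t < r -> p (t + r) = p (t - r)) ->
  \int[mu]_(y in (`]- r, r[%classic : set (measurableTypeR R))) p (x - y) =
  \int[mu]_(y in (`]- r, r[%classic : set (measurableTypeR R))) p y.
Proof.
move=> r0 cp /andP[x1 x2] hp; have [F hF] := antiderivative (- (3 * r)) cp.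
have rr : - r < r by lra.
have dG (y : R) : - r <= y <= r -> is_derive y 1 (fun y : R => - F (x - y)) (p (x - y)).
  move=> /andP[y1 y2]; have h := hF (x - y) _.
  have h' : is_derive ((-1) * y + x) 1 F (p (x - y)).
    by rewrite mulN1r addrC; apply: h; lra.
  have := is_derive_affine h'; rewrite mulN1r => h2.
  rewrite -[X in is_derive _ _ _ X]opprK.
  rewrite (_ : (fun y : R => - F (x - y)) = (fun s : R => - F (-1 * s + x))).
    exact: is_deriveN.
  by apply/funext => s; rewrite mulN1r addrC.
have cpx : continuous (fun y => p (x - y)).
  move=> y; apply: (@continuous_comp _ _ _ (fun y : R => x - y) p); last exact: cp.
  by apply: cvgB; [exact: cvg_cst|exact: cvg_id].
have E2 : \int[mu]_(y in (`]- r, r[%classic : set (measurableTypeR R))) p y = F r - F (- r).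
  by apply: FTC_cc => // t /andP[t1 t2]; apply: hF; lra.
have E1 := FTC_cc rr dG cpx; rewrite E1 E2.
pose D s := F (s + r) - F (s - r).
have dD (s : R) : - r < s < r -> is_derive s 1 D 0.
  move=> /andP[s1 s2]; rewrite -(subrr (p (s + r))) {2}hp ?s1 ?s2//.
  have e1 : is_derive s 1 (fun s : R => F (s + r)) (p (s + r)).
    have h : is_derive (1 * s + r) 1 F (p (s + r)) by rewrite mul1r; apply: hF; lra.
    have := is_derive_affine h; rewrite mul1r; congr (is_derive _ _ _ _).
    by apply/funext => y; rewrite mul1r.
  have e2 : is_derive s 1 (fun s : R => F (s - r)) (p (s - r)).
    have h : is_derive (1 * s - r) 1 F (p (s - r)) by rewrite mul1r; apply: hF; lra.
    have := is_derive_affine h; rewrite mul1r; congr (is_derive _ _ _ _).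
    by apply/funext => y; rewrite mul1r.
  exact: is_deriveB.
have D0 : D x = D 0.
  have c0 : continuous (fun _ : R => 0 : R) by move=> ?; exact: cvg_cst.
  have int0 a b : \int[mu]_(t in (`]a, b[%classic : set (measurableTypeR R))) (0 : R) = 0.
    by rewrite /Rintegral integral0.
  have [x0|x0|->//] := ltgtP x 0.
  - have h : forall t : R, x <= t <= 0 -> is_derive t 1 D 0.
      by move=> t /andP[t1 t2]; apply: dD; lra.
    by have := FTC_cc x0 h c0; rewrite int0 => /esym/eqP; rewrite subr_eq0 => /eqP.
  - have h : forall t : R, 0 <= t <= x -> is_derive t 1 D 0.
      by move=> t /andP[t1 t2]; apply: dD; lra.
    by have := FTC_cc x0 h c0; rewrite int0 => /esym/eqP; rewrite subr_eq0 => /eqP.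
rewrite /D add0r sub0r in D0; rewrite -D0; rewrite opprK addrC.
by congr (F _ - F _); rewrite ?opprK.
Qed.

Definition cderive F (t : R) (d : R[i]) :=
  is_derive t 1 (fun s : R => complex.Re (F s)) (complex.Re d) /\
  is_derive t 1 (fun s : R => complex.Im (F s)) (complex.Im d).

Lemma cderiveD F G t d e : cderive F t d -> cderive G t e ->
  cderive (fun s => F s + G s) t (d + e).
Proof.
move=> [f1 f2] [g1 g2]; split.
- by under eq_fun do rewrite cReD; rewrite cReD; exact: is_derive_addf.
- by under eq_fun do rewrite cImD; rewrite cImD; exact: is_derive_addf.
Qed.

Lemma cderiveM F G t d e : cderive F t d -> cderive G t e ->
  cderive (fun s => F s * G s) t (d * G t + F t * e).
Proof.
move=> [f1 f2] [g1 g2]; split.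
- under eq_fun do rewrite cReM.
  have h := is_deriveB (is_derive_mulf f1 g1) (is_derive_mulf f2 g2).
  by apply: (is_derive_eq h); rewrite !(cReD, cReM); ring.
- under eq_fun do rewrite cImM.
  have h := is_derive_addf (is_derive_mulf f1 g2) (is_derive_mulf f2 g1).
  by apply: (is_derive_eq h); rewrite !(cImD, cImM); ring.
Qed.

Lemma cderive_real f (t d : R) : is_derive t 1 f d -> cderive (fun s => (f s)%:C) t d%:C.
Proof. by move=> h; split => //=; exact: is_derive_cst. Qed.

Lemma cderive_cst (z : R[i]) t : cderive (fun=> z) t 0.
Proof. by split => /=; exact: is_derive_cst. Qed.

Lemma cexpM_real (z : R[i]) (t : R) :
  cexp (z * t%:C) = (expR (complex.Re z * t))%:C * cis (complex.Im z * t).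
Proof. by rewrite /cexp cReM cImM /= !mulr0 subr0 add0r. Qed.

Lemma cderive_cexp (z : R[i]) (t : R) :
  cderive (fun s => cexp (z * s%:C)) t (z * cexp (z * t%:C)).
Proof.
case: z => a b; under eq_fun do rewrite cexpM_real.
have h1 : is_derive t 1 (fun s : R => expR (a * s)) (expR (a * t) * a).
  exact: (@is_derive1_comp _ expR (fun s : R => a * s) t _ _ (is_derive_expR _) (is_derive_mull a t)).
have h2 : cderive (fun s => cis (b * s)) t ((- sin (b * t) * b) +i* (cos (b * t) * b)).
  split => /=.
  - exact: (@is_derive1_comp _ cos (fun s : R => b * s) t _ _ (is_derive_cos _) (is_derive_mull b t)).
  - exact: (@is_derive1_comp _ sin (fun s : R => b * s) t _ _ (is_derive_sin _) (is_derive_mull b t)).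
have := cderiveM (cderive_real h1) h2; congr (cderive _ _ _).
by rewrite cexpM_real; apply: complexP; rewrite !(cReM, cImM, cReD, cImD) /=; ring.
Qed.

Lemma bcontD F G : bcont F -> bcont G -> bcont (fun t => F t + G t).
Proof.
move=> [f1 f2] [g1 g2]; split.
- by under eq_fun do rewrite cReD; move=> t; apply: cvgD; [exact: f1|exact: g1].
- by under eq_fun do rewrite cImD; move=> t; apply: cvgD; [exact: f2|exact: g2].
Qed.

Lemma bcontM F G : bcont F -> bcont G -> bcont (fun t => F t * G t).
Proof.
move=> [f1 f2] [g1 g2]; split.
- under eq_fun do rewrite cReM; move=> t; apply: cvgB; apply: cvgM;
  by [exact: f1|exact: f2|exact: g1|exact: g2].
- under eq_fun do rewrite cImM; move=> t; apply: cvgD; apply: cvgM;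
  by [exact: f1|exact: f2|exact: g1|exact: g2].
Qed.

Lemma bcont_cst (z : R[i]) : bcont (fun=> z).
Proof. by split => t; exact: cvg_cst. Qed.

Lemma bcont_real f : continuous f -> bcont (fun t => (f t)%:C).
Proof. by move=> cf; split => //= t; exact: cvg_cst. Qed.

Lemma bcont_conj F : bcont F -> bcont (fun t => (F t)^*).
Proof.
move=> [f1 f2]; split.
- by under eq_fun do rewrite cReJ.
- by under eq_fun do rewrite cImJ; move=> t; apply: cvgN; exact: f2.
Qed.

Lemma bcont_comp F f : bcont F -> continuous f -> bcont (fun t => F (f t)).
Proof.
move=> [f1 f2] cf; split => t.
- by apply: (@continuous_comp _ _ _ f (fun s => complex.Re (F s))); [exact: cf|exact: f1].
- by apply: (@continuous_comp _ _ _ f (fun s => complex.Im (F s))); [exact: cf|exact: f2].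
Qed.

Lemma bcont_cexp (z : R[i]) : bcont (fun t => cexp (z * t%:C)).
Proof.
by split => t; apply: differentiable_continuous; apply/derivable1_diffP;
  have [[h1 _] [h2 _]] := cderive_cexp z t.
Qed.

Definition c1i (a b : R) F : R[i] :=
  (\int[mu]_(t in (`]a, b[%classic : set (measurableTypeR R))) complex.Re (F t)) +i*
  (\int[mu]_(t in (`]a, b[%classic : set (measurableTypeR R))) complex.Im (F t)).

Lemma cFTC a b F (f : R -> R[i]) : a < b ->
  (forall t, a <= t <= b -> cderive F t (f t)) -> bcont f -> c1i a b f = F b - F a.
Proof.
move=> ab dF [c1 c2]; apply: complexP; rewrite !(cReD, cImD, cReN, cImN) /=.
- have h (t : R) : a <= t <= b -> is_derive t 1 (fun s : R => complex.Re (F s)) (complex.Re (f t)).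
    by move=> /dF [h _].
  exact: (FTC_cc ab h c1).
- have h (t : R) : a <= t <= b -> is_derive t 1 (fun s : R => complex.Im (F s)) (complex.Im (f t)).
    by move=> /dF [_ h].
  exact: (FTC_cc ab h c2).
Qed.

Lemma c1i_split a b c F : a < b -> b < c -> bcont F -> c1i a c F = c1i a b F + c1i b c F.
Proof.
by move=> ab bc [c1 c2]; apply: complexP; rewrite !(cReD, cImD) /=; exact: integral_oo_split.
Qed.

Lemma eq_c1i a b F G : (forall t, a < t < b -> F t = G t) -> c1i a b F = c1i a b G.
Proof.
move=> FG; apply: complexP; apply: eq_Rintegral => t /set_mem /=; rewrite in_itv /= => tab;
  by rewrite FG.
Qed.

Lemma c1i_period (p : R -> R[i]) (r x : R) : 0 < r -> bcont p -> - r < x < r ->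
  (forall t, - r < t < r -> p (t + r) = p (t - r)) ->
  c1i (- r) r (fun y => p (x - y)) = c1i (- r) r p.
Proof.
move=> r0 [c1 c2] xr hp; apply: complexP.
- by apply: (@integral_period (fun t => complex.Re (p t))) => // t tr; rewrite hp.
- by apply: (@integral_period (fun t => complex.Im (p t))) => // t tr; rewrite hp.
Qed.

Lemma c1iD a b F G : a < b -> bcont F -> bcont G ->
  c1i a b (fun t => F t + G t) = c1i a b F + c1i a b G.
Proof.
move=> ab [f1 f2] [g1 g2].
have aux (f g : R -> R) : continuous f -> continuous g ->
    \int[mu]_(t in (`]a, b[%classic : set (measurableTypeR R))) (f t + g t) =
    \int[mu]_(t in (`]a, b[%classic : set (measurableTypeR R))) f t +
    \int[mu]_(t in (`]a, b[%classic : set (measurableTypeR R))) g t.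
  by move=> cf cg; rewrite RintegralD ?measurable_itv//; exact: integrable_cont_oo.
apply: complexP; rewrite !(cReD, cImD) /=.
- by under eq_Rintegral do rewrite cReD; exact: aux.
- by under eq_Rintegral do rewrite cImD; exact: aux.
Qed.

(** The factor 2 comes from bounding the real and imaginary parts separately. *)
Lemma c1i_bound a b F (K : R) : a < b -> bcont F ->
  (forall t, a < t < b -> cabs (F t) <= K) -> cabs (c1i a b F) <= 2 * ((b - a) * K).
Proof.
move=> ab [f1 f2] hK.
have aux (f : R -> R) : continuous f -> (forall t, a < t < b -> `|f t| <= K) ->
    `|\int[mu]_(t in (`]a, b[%classic : set (measurableTypeR R))) f t| <= (b - a) * K.
  move=> cf fK; pose I : set (measurableTypeR R) := `]a, b[%classic.
  have mI : measurable I by exact: measurable_itv.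
  have iK : mu.-integrable I (EFin \o (fun=> K)) by apply: integrable_cont_oo => t; exact: cvg_cst.
  have iF := integrable_cont_oo a b cf.
  apply: le_trans (le_normr_Rintegral mI iF) _.
  apply: le_trans (_ : \int[mu]_(t in I) K <= _).
    have iA : mu.-integrable I (EFin \o (fun t => `|f t|)) by have := integrable_abse iF.
    by apply: (le_Rintegral mI iA iK) => t; rewrite /I /= in_itv /=; exact: fK.
  have := @FTC_cc (fun=> K) (fun t => K * t) a b ab (fun t _ => is_derive_mull K t) (fun t => cvg_cst _).
  by rewrite -/I -mulrBr mulrC => ->.
have h := cabs_le_ReIm (c1i a b F); apply: le_trans h _.
have h1 : `|complex.Re (c1i a b F)| <= (b - a) * K.
  by apply: aux => // t /hK; apply: le_trans; exact: Re_le_cabs.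
have h2 : `|complex.Im (c1i a b F)| <= (b - a) * K.
  by apply: aux => // t /hK; apply: le_trans; exact: Im_le_cabs.
lra.
Qed.

End calculus1.

(** * Fourier coefficients of the smoothed kernel *)

Section kernel_coef.
Variables (R : realType) (k alpha rho r : R) (chi : R -> R).
Hypothesis r0 : 0 < r.
Hypothesis rho0 : 0 < rho.
Hypothesis chi_cutoff : cutoff rho r chi.
Hypothesis nonres : forall j : int, k ^+ 2 != alphaj alpha j ^+ 2.
Local Notation beta := (betaj k alpha).
Local Notation wgt := (weight (xi alpha r)).

Definition betai (l : int) : R[i] := (0 +i* 1) * beta l.

(** Equals the modulus of the representative [wrap r t] for |t| < 2 r, the range of differences of
    points of the cell, and is visibly continuous. *)
Definition wrap_abs (t : R) : R := Num.min `|t| (2 * r - `|t|).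

(** The dependence on x2 of the l-th mode of the smoothed kernel. *)
Definition kernel_profile (l : int) (t : R) : R[i] :=
  (chi t)%:C * cexp (betai l * (wrap_abs t)%:C).

Definition profile_coef (j : int * int) : R[i] :=
  c1i (- r) r (fun t => kernel_profile j.1 t * cis (- xi alpha r true j * t)).

(** The multiplier of convolution with the smoothed kernel. The factor i/2 is i/(4 pi) from the
    Green function times 2 pi from the integral in x1. *)
Definition kap (j : int * int) : R[i] :=
  (0 +i* 2^-1) * (beta j.1)^-1 * profile_coef j.

Lemma beta_sqr l : beta l * beta l = (k ^+ 2 - alphaj alpha l ^+ 2)%:C.
Proof.
rewrite /betaj; case: ifPn => [h|]; last rewrite -ltNge => h; apply: complexP; rewrite !(cReM, cImM) /=.
- by rewrite mulr0 subr0 -expr2 sqr_sqrtr// subr_ge0.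
- by rewrite mulr0 mul0r addr0.
- by rewrite mul0r sub0r -expr2 sqr_sqrtr ?opprB// subr_ge0 ltW.
- by rewrite mul0r mulr0 addr0.
Qed.

Lemma betai_sqr l : betai l * betai l = (alphaj alpha l ^+ 2 - k ^+ 2)%:C.
Proof.
rewrite /betai mulrACA beta_sqr.
by apply: complexP; rewrite !(cReM, cImM) /=; ring.
Qed.

(** Propagating and evanescent modes; the absence of resonances makes the inequalities strict. *)
Lemma betai_cases l : (complex.Re (betai l) = 0 /\ complex.Im (betai l) ^+ 2 = k ^+ 2 - alphaj alpha l ^+ 2
    /\ alphaj alpha l ^+ 2 < k ^+ 2) \/
  [/\ complex.Im (betai l) = 0, complex.Re (betai l) < 0,
    complex.Re (betai l) ^+ 2 = alphaj alpha l ^+ 2 - k ^+ 2 & k ^+ 2 < alphaj alpha l ^+ 2].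
Proof.
rewrite /betai /betaj; case: ifPn => [h|]; last rewrite -ltNge => h.
- left; have {}h : alphaj alpha l ^+ 2 < k ^+ 2 by rewrite lt_neqAle eq_sym nonres.
  rewrite !(cReM, cImM) /= !(mul0r, mul1r, mulr0, add0r, subr0, sub0r, addr0, oppr0); split => //.
  by rewrite sqr_sqrtr ?subr_ge0 ?ltW.
- right; rewrite !(cReM, cImM) /= !(mul0r, mul1r, mulr0, add0r, subr0, sub0r, addr0, oppr0); split => //.
  + by rewrite oppr_lt0 sqrtr_gt0 subr_gt0.
  + by rewrite sqrrN sqr_sqrtr ?subr_ge0 ?ltW.
Qed.

Lemma betai_Re_le0 l : complex.Re (betai l) <= 0.
Proof. by case: (betai_cases l) => [[-> _]|[_ /ltW]]. Qed.

Lemma sqnormc_beta l : sqnormc (beta l) = `|k ^+ 2 - alphaj alpha l ^+ 2|.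
Proof.
have h := congr1 (@sqnormc R) (beta_sqr l); rewrite sqnormcM sqnormc_real -expr2 in h.
have h2 := congr1 Num.sqrt h; rewrite !sqrtr_sqr ger0_norm ?sqnormc_ge0// in h2.
Qed.

Lemma sqnormc_beta_gt0 l : 0 < sqnormc (beta l).
Proof. by rewrite sqnormc_beta normr_gt0 subr_eq0. Qed.

Lemma beta_neq0 l : beta l != 0.
Proof. by apply/eqP => b0; have := sqnormc_beta_gt0 l; rewrite b0 sqnormc0 ltxx. Qed.

Lemma alphaj_sqr_ge l : l%:~R ^+ 2 / 2 - alpha ^+ 2 <= alphaj alpha l ^+ 2.
Proof. by rewrite /alphaj; move: (l%:~R : R) => x; have := sqr_ge0 (x + 2 * alpha); nra. Qed.

(** |beta_l|^2 grows like l^2, and none of the finitely many remaining values is 0. *)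
Lemma beta_inv_bound : exists2 C : R, 0 < C &
  forall l, (sqnormc (beta l))^-1 * (1 + l%:~R ^+ 2) <= C.
Proof.
(* Beyond L0, l^2 >= 8 (alpha^2 + k^2 + 1), and then |beta_l|^2 >= l^2 / 2 - alpha^2 - k^2 exceeds
   (1 + l^2) / 8. *)
pose L0 := Num.bound (8 * (alpha ^+ 2 + k ^+ 2 + 1)).
pose g l := (sqnormc (beta l))^-1 * (1 + l%:~R ^+ 2).
have g0 l : 0 <= g l by rewrite mulr_ge0 ?invr_ge0 ?sqnormc_ge0// addr_ge0// sqr_ge0.
have S0 : 0 <= \sum_(l <- symz L0) g l by apply: sumr_ge0.
exists (\sum_(l <- symz L0) g l + 8) => [|l]; first by lra.
have [lL|lL] := boolP (l \in symz L0).
  by rewrite (big_fsetD1 l)//= -/(g l) -addrA lerDl addr_ge0// sumr_ge0.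
apply: le_trans (_ : 8 <= _); last by lra.
rewrite mulrC ler_pdivrMr ?sqnormc_beta_gt0// sqnormc_beta.
have hl : 8 * (alpha ^+ 2 + k ^+ 2 + 1) <= l%:~R ^+ 2.
  rewrite in_symz -ltnNge in lL.
  have h1 : 8 * (alpha ^+ 2 + k ^+ 2 + 1) < L0%:R.
    by apply: archi_boundP; have := sqr_ge0 alpha; have := sqr_ge0 k; lra.
  have -> : l%:~R ^+ 2 = (absz l)%:R ^+ 2 :> R.
    by rewrite -(real_normK (num_real (l%:~R : R))) -intr_norm -abszE.
  have h2 : (L0%:R : R) <= (absz l)%:R by rewrite ler_nat ltnW.
  have h3 : 1 <= (absz l)%:R :> R by rewrite ler1n; lia.
  have : (absz l)%:R <= (absz l)%:R ^+ 2 :> R by rewrite ler_eXnr.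
  lra.
have := alphaj_sqr_ge l; rewrite distrC => h.
have := ler_norm (alphaj alpha l ^+ 2 - k ^+ 2).
have := sqr_ge0 alpha; have := sqr_ge0 k; have := sqr_ge0 (l%:~R : R); move: hl h; clear.
by move: (alpha ^+ 2) (k ^+ 2) (alphaj _ _ ^+ 2) (l%:~R ^+ 2 : R) `|_| => a b c d e; lra.
Qed.

Lemma sqr_weight_large (W : R) : exists m, forall j, j \notin ZN m -> W <= wgt j.
Proof.
pose a := Num.min 2^-1 (pi ^+ 2 / r ^+ 2 : R).
have pi0 := pi_gt0 R.
have a0 : 0 < a by rewrite lt_min invr_gt0 ltr0n divr_gt0// exprn_gt0.
have b0 : 0 <= (4 * (`|W| + alpha ^+ 2)) / a.
  by apply: divr_ge0; [rewrite mulr_ge0// addr_ge0// sqr_ge0|exact: ltW].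
pose m := (Num.bound ((4 * (`|W| + alpha ^+ 2)) / a)).+1.
exists m => j; rewrite in_ZN => hj.
have hm : 4 * (`|W| + alpha ^+ 2) <= a * m%:R ^+ 2.
  have h1 : (4 * (`|W| + alpha ^+ 2)) / a < m%:R.
    by apply: lt_trans (archi_boundP b0) _; rewrite ltr_nat.
  have h2 : m%:R <= m%:R ^+ 2 :> R by rewrite ler_eXnr// ler1n.
  by rewrite [leRHS]mulrC -ler_pdivrMr//; exact: le_trans (ltW h1) h2.
(* Outside Z_m one component satisfies |2 j_i| >= m. *)
have h : (m%:R ^+ 2 : R) <= 4 * (j.1%:~R ^+ 2 + j.2%:~R ^+ 2).
  have : (m%:Z ^+ 2 <= 4 * (j.1 ^+ 2 + j.2 ^+ 2))%R.
    have M0 : (0 <= m%:Z)%R by [].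
    move: hj M0; rewrite !negb_and -!leNgt -!ltNge; move: (m%:Z) (j.1) (j.2) => M x y hh M0.
    by case/or4P: hh => hh; nia.
  by rewrite -(ler_int R) !(rmorphM, rmorphD, rmorphXn) /=.
have hx := alphaj_sqr_ge j.1.
have a1 : a <= 2^-1 by rewrite ge_min lexx.
have a2 : a <= pi ^+ 2 / r ^+ 2 by rewrite ge_min lexx orbT.
have wE : wgt j = 1 + (alphaj alpha j.1 ^+ 2 + j.2%:~R ^+ 2 * (pi ^+ 2 / r ^+ 2)).
  rewrite /weight /xi /alphaj /=; congr (1 + (_ + _)).
  by move: (@pi R) => p; field; rewrite gt_eqF.
rewrite wE; have s1 := sqr_ge0 (j.1%:~R : R); have s2 := sqr_ge0 (j.2%:~R : R).
have g1 : a * j.1%:~R ^+ 2 <= 2^-1 * j.1%:~R ^+ 2 by apply: ler_wpM2r.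
have g2 : a * j.2%:~R ^+ 2 <= (pi ^+ 2 / r ^+ 2) * j.2%:~R ^+ 2 by apply: ler_wpM2r.
have g3 : a * m%:R ^+ 2 <= a * (4 * (j.1%:~R ^+ 2 + j.2%:~R ^+ 2)) by rewrite ler_pM2l.
have := ler_norm W; move: hm hx g1 g2 g3.
move: (`|W|) (alpha ^+ 2) (pi ^+ 2 / _) (j.1%:~R ^+ 2 : R) (j.2%:~R ^+ 2 : R) (m%:R ^+ 2 : R) (alphaj _ _ ^+ 2).
clear; move=> V A p x y M B hm hx g1 g2 g3 hV.
have : a * (4 * (x + y)) = 4 * (a * x + a * y) by ring.
by move=> e; rewrite e in g3; lra.
Qed.

Lemma chi_derive n (t : R) : (n < 3)%N -> is_derive t 1 (derive1n n chi) (derive1n n.+1 chi t).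
Proof.
case: chi_cutoff => -[h _] _ _ _ _ n3; rewrite derive1nS.
by apply: DeriveDef; [exact: h|rewrite derive1E].
Qed.

Lemma chi_cont n : (n <= 3)%N -> continuous (derive1n n chi).
Proof.
case: chi_cutoff => -[h c3] _ _ _ _; rewrite leq_eqVlt => /orP[/eqP->//|n3] t.
by apply: differentiable_continuous; apply/derivable1_diffP; exact: h.
Qed.

Lemma chi_periodic n (t : R) : (n <= 2)%N -> derive1n n chi (t + 2 * r) = derive1n n chi t.
Proof.
elim: n t => [|n IH] t n2; first by case: chi_cutoff.
have h := @chi_derive n (1 * t + 2 * r) (leqW n2).
have := is_derive_affine h; rewrite mul1r mul1r => h1.
have h2 : is_derive t 1 (derive1n n chi) (derive1n n.+1 chi (t + 2 * r)).
  have E : (fun s : R => derive1n n chi (1 * s + 2 * r)) = derive1n n chi.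
    by apply/funext => s; rewrite mul1r IH// ltnW.
  by rewrite E in h1.
by have [_ <-] := h2; have [_ <-] := chi_derive t (leqW n2).
Qed.

Lemma chi_end n : (n <= 2)%N -> derive1n n chi r = 0 /\ derive1n n chi (- r) = 0.
Proof.
move=> n2; have e : derive1n n chi r = 0 by case: chi_cutoff => _ _ _ _; apply; exact: leqW.
split => //; rewrite -chi_periodic// (_ : - r + 2 * r = r)//; lra.
Qed.

(** Used at t = 0, where the profile has its kink: of the boundary terms only the one with chi
    itself survives there. *)
Lemma chi_mid (t : R) : `|t| < 2 * rho ->
  [/\ chi t = 1, derive1n 1 chi t = 0 & derive1n 2 chi t = 0].
Proof.
have near_mid (s : R) : `|s| < 2 * rho -> \near s, `|s| < 2 * rho.
  rewrite ltr_norml => /andP[s1 s2].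
  by apply: filterS2 (lt_nbhsr s1) (lt_nbhsl s2) => x x1 x2; rewrite ltr_norml x1.
have d1 (s : R) : `|s| < 2 * rho -> derive1n 1 chi s = 0.
  move=> hs; have h : \near s, (fun=> 1 : R) s = chi s.
    by have := near_mid _ hs; apply: filterS => x hx; case: chi_cutoff => _ _ _ -> //; exact: ltW.
  have [_ <-] := chi_derive s (n := 0) isT.
  by have [_ ->] := near_eq_is_derive h (is_derive_cst (1 : R) s 1).
move=> ht; split; [by case: chi_cutoff => _ _ _ -> //; exact: ltW|exact: d1|].
have h : \near t, (fun=> 0 : R) t = derive1n 1 chi t.
  by have := near_mid _ ht; apply: filterS => x hx; rewrite d1.
have [_ <-] := chi_derive t (n := 1) isT.
by have [_ ->] := near_eq_is_derive h (is_derive_cst (0 : R) t 1).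
Qed.

Lemma cabs_cexp (u : R[i]) (t : R) : cabs (cexp (u * t%:C)) = expR (complex.Re u * t).
Proof.
by rewrite cexpM_real cabsM cabs_real ger0_norm ?expR_ge0// /cabs sqnormc_cis sqrtr1 mulr1.
Qed.

Lemma cexpD (z w : R[i]) : cexp (z + w) = cexp z * cexp w.
Proof.
have E x : cexp x = (expR (complex.Re x))%:C * cis (complex.Im x) :> R[i] by [].
by rewrite !E cReD cImD expRD cisD rmorphM /= mulrACA.
Qed.

Lemma profile_prim_aux (u e a0 a1 a2 a3 : R[i]) : u != 0 ->
  u * e * (a0 / u + a1 * - (u^-1 / u) + a2 * (u^-1 / u / u)) +
  e * (a1 / u + a2 * - (u^-1 / u) + a3 * (u^-1 / u / u)) =
  a0 * e + a3 * (u^-1 / u / u) * e.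
Proof.
move=> u0; have uv := mulfV u0; move: (u^-1) uv => v uv.
transitivity ((u * v) * e * (a0 - a1 * v + a2 * (v * v)) +
  e * (a1 * v - a2 * (v * v) + a3 * (v * v * v))); first by ring.
by rewrite uv; ring.
Qed.

(** What three integrations by parts of chi(t) exp(u t) produce. Its derivative is that integrand
    plus chi'''(t) u^-3 exp(u t). *)
Definition profile_prim (u : R[i]) (t : R) : R[i] :=
  cexp (u * t%:C) * ((chi t)%:C * u^-1 - (derive1n 1 chi t)%:C * (u^-1 * u^-1) +
    (derive1n 2 chi t)%:C * (u^-1 * u^-1 * u^-1)).

(** The error is the integral of chi''' u^-3 exp(u t), and the sign condition keeps the exponential
    at most 1. *)
Lemma half_profile (u : R[i]) (a b M : R) : a < b -> u != 0 ->
  (forall t, a < t < b -> `|derive1n 3 chi t| <= M) ->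
  (forall t, a < t < b -> complex.Re u * t <= 0) ->
  cabs (c1i a b (fun t => (chi t)%:C * cexp (u * t%:C)) -
    (profile_prim u b - profile_prim u a)) <=
  2 * ((b - a) * (M * cabs u^-1 ^+ 3)).
Proof.
move=> ab u0 hM hu; pose E := profile_prim u; rewrite -/E.
pose f t := (chi t)%:C * cexp (u * t%:C).
pose g t := (derive1n 3 chi t)%:C * (u^-1 * u^-1 * u^-1) * cexp (u * t%:C).
have cf : bcont f.
  by apply: bcontM; [exact: bcont_real (chi_cont (n := 0) isT)|exact: bcont_cexp].
have cg : bcont g.
  apply: bcontM; last exact: bcont_cexp.
  by apply: bcontM; [exact: bcont_real (chi_cont (n := 3) isT)|exact: bcont_cst].
have dE t : cderive E t (f t + g t).
  have d0 : cderive (fun s => (chi s)%:C) t (derive1n 1 chi t)%:C := cderive_real (chi_derive t (n := 0) isT).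
  have d1 := cderive_real (chi_derive t (n := 1) isT).
  have d2 := cderive_real (chi_derive t (n := 2) isT).
  have dM z F d : cderive F t d -> cderive (fun s => F s * z) t (d * z).
    by move=> hF; have := cderiveM hF (cderive_cst z t); rewrite mulr0 addr0.
  have := cderiveM (cderive_cexp u t) (cderiveD (cderiveD (dM u^-1 _ _ d0)
    (dM (- (u^-1 * u^-1)) _ _ d1)) (dM (u^-1 * u^-1 * u^-1) _ _ d2)).
  rewrite (_ : (fun s => _) = E); last by apply/funext => s; rewrite /E /profile_prim mulrN.
  congr (cderive _ _ _); rewrite /f /g.
  exact: profile_prim_aux.
have h := cFTC ab (fun t _ => dE t) (bcontD cf cg).
rewrite (c1iD ab cf cg) in h; rewrite -/f -h opprD addNKr cabsN.
apply: c1i_bound => // t tab; rewrite /g cabsM cabs_cexp !cabsM cabs_real.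
have e1 : expR (complex.Re u * t) <= 1 by rewrite -expR0 ler_expR hu.
have v0 := cabs_ge0 u^-1; have -> : cabs u^-1 * cabs u^-1 * cabs u^-1 = cabs u^-1 ^+ 3 by ring.
have v3 : 0 <= cabs u^-1 ^+ 3 by rewrite exprn_ge0.
apply: le_trans (_ : `|derive1n 3 chi t| * cabs u^-1 ^+ 3 * 1 <= _).
  by apply: ler_wpM2l => //; rewrite mulr_ge0.
by rewrite mulr1; apply: ler_wpM2r => //; exact: hM.
Qed.

Lemma wrap_abs_norm t : `|t| <= r -> wrap_abs t = `|t|.
Proof. by move=> h; rewrite /wrap_abs min_l//; lra. Qed.

Lemma continuous_wrap_abs : continuous wrap_abs.
Proof.
move=> t; apply: continuous_min; first exact: (@norm_continuous _ R^o).
by apply: cvgB; [exact: cvg_cst|exact: (@norm_continuous _ R^o)].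
Qed.

Lemma bcont_profile l : bcont (kernel_profile l).
Proof.
apply: bcontM; first exact: bcont_real (chi_cont (n := 0) isT).
exact: (bcont_comp (bcont_cexp (betai l)) continuous_wrap_abs).
Qed.

(** The integral is split at the kink 0, where the exponent changes from w on the left to u on the
    right. Boundary terms at r and -r vanish with chi and its derivatives; those at 0 leave -1/u and
    1/w. *)
Lemma profile_coef_est j (M : R) :
  let z := betai j.1 in let x := xi alpha r true j in
  let u := z + (0 +i* - x) in let w := - z + (0 +i* - x) in
  (forall t, - r < t < r -> `|derive1n 3 chi t| <= M) -> u != 0 -> w != 0 ->
  cabs (profile_coef j - (- u^-1 + w^-1)) <=
  2 * (r * (M * cabs u^-1 ^+ 3)) + 2 * (r * (M * cabs w^-1 ^+ 3)).
Proof.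
move=> z x u w hM u0 w0.
have mr0 : - r < 0 by rewrite oppr_lt0.
have cx t : cis (- x * t) = cexp ((0 +i* - x) * t%:C).
  by rewrite cexpM_real /= mul0r expR0 mul1r.
have z0 := betai_Re_le0 j.1.
rewrite /profile_coef (c1i_split mr0 r0); last first.
  by apply: bcontM; [exact: bcont_profile|exact: bcont_cis].
have -> : c1i 0 r (fun t => kernel_profile j.1 t * cis (- x * t)) =
    c1i 0 r (fun t => (chi t)%:C * cexp (u * t%:C)).
  apply: eq_c1i => t /andP[t0 tr]; rewrite /kernel_profile wrap_abs_norm gtr0_norm// ?ltW//.
  by rewrite cx -mulrA -cexpD -mulrDl.
have -> : c1i (- r) 0 (fun t => kernel_profile j.1 t * cis (- x * t)) =
    c1i (- r) 0 (fun t => (chi t)%:C * cexp (w * t%:C)).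
  apply: eq_c1i => t /andP[t0 tr]; rewrite /kernel_profile wrap_abs_norm ltr0_norm//; last by lra.
  by rewrite cx -mulrA -cexpD rmorphN mulrN -mulNr -mulrDl.
have hu : complex.Re u <= 0 by rewrite cReD /= addr0.
have hw : 0 <= complex.Re w by rewrite cReD cReN /= addr0 oppr_ge0.
have rho2 : `|0 : R| < 2 * rho by rewrite normr0 mulr_gt0.
have [c0 c1 c2] := chi_mid rho2.
have [e0 e0'] : chi r = 0 /\ chi (- r) = 0 := chi_end (n := 0) isT.
have [e1 e1'] := chi_end (n := 1) isT.
have [e2 e2'] := chi_end (n := 2) isT.
have ce v : cexp (v * 0%:C) = 1 :> R[i] by rewrite cexpM_real !mulr0 expR0 cis0 mulr1.
have h1 : cabs (c1i 0 r (fun t => (chi t)%:C * cexp (u * t%:C)) - (- u^-1)) <=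
    2 * (r * (M * cabs u^-1 ^+ 3)).
  have := @half_profile u 0 r M r0 u0; rewrite /profile_prim c0 c1 c2 e0 e1 e2 ce !mul0r subr0 !addr0 !mulr0 !mul1r subr0.
  rewrite (sub0r u^-1) (subr0 r); apply.
  - by move=> t /andP[t0 tr]; apply: hM; rewrite tr andbT; exact: lt_trans mr0 t0.
  - by move=> t /andP[t0 tr]; rewrite mulr_le0_ge0// ltW.
have h2 : cabs (c1i (- r) 0 (fun t => (chi t)%:C * cexp (w * t%:C)) - w^-1) <=
    2 * (r * (M * cabs w^-1 ^+ 3)).
  have := @half_profile w (- r) 0 M mr0 w0; rewrite /profile_prim c0 c1 c2 e0' e1' e2' ce !(mul0r, subr0, addr0, mulr0, mul1r).
  rewrite (sub0r (- r)) opprK; apply.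
  - by move=> t /andP[t0 tr]; apply: hM; rewrite t0; exact: lt_trans tr r0.
  - by move=> t /andP[t0 tr]; rewrite mulr_ge0_le0// ltW.
have -> (a b c d : R[i]) : a + b - (c + d) = (b - c) + (a - d) by ring.
by apply: le_trans (cabsD _ _) _; exact: lerD.
Qed.

(** T = |xi(j)|^2 - k^2 is the symbol of minus the Helmholtz operator. Here u w = - T, and u - w = 2
    i beta cancels the factor 1/beta of [kap]. *)
Lemma kap_main j : let z := betai j.1 in let x := xi alpha r true j in
  let u := z + (0 +i* - x) in let w := - z + (0 +i* - x) in
  let T := wgt j - 1 - k ^+ 2 in T != 0 ->
  [/\ u != 0, w != 0 & (0 +i* 2^-1) * (beta j.1)^-1 * (- u^-1 + w^-1) = (T^-1)%:C].
Proof.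
move=> z x u w T T0.
have uw : u * w = (- T)%:C.
  have -> : u * w = - (z * z) + (0 +i* - x) * (0 +i* - x) by rewrite /u /w; ring.
  rewrite betai_sqr; apply: complexP; rewrite !(cReD, cImD, cReM, cImM, cReN, cImN) /=.
    by rewrite /T /weight -/(alphaj alpha j.1) /xi /= -/(alphaj alpha j.1) -/x /x /xi; ring.
  by ring.
have uw0 : u * w != 0 by rewrite uw; apply/eqP => /(congr1 (@complex.Re R)) /= /eqP; rewrite oppr_eq0 (negbTE T0).
have [u0 w0] : u != 0 /\ w != 0 by move: uw0; rewrite mulf_eq0 negb_or => /andP.
split => //.
have -> : - u^-1 + w^-1 = (u - w) * (u * w)^-1 by field; rewrite u0 w0.
have -> : u - w = (0 +i* 2) * beta j.1.
  rewrite /u /w /z /betai; have -> : (0 +i* 2 : R[i]) = (0 +i* 1) + (0 +i* 1).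
    by apply: complexP => /=; rewrite ?addr0.
  ring.
have b0 := beta_neq0 j.1.
have -> : (0 +i* 2^-1) * (beta j.1)^-1 * ((0 +i* 2) * beta j.1 * (u * w)^-1) =
    (0 +i* 2^-1) * (0 +i* 2) * (u * w)^-1 by field; rewrite u0 w0 b0.
have -> : (0 +i* 2^-1 : R[i]) * (0 +i* 2) = -1.
  by apply: complexP; rewrite !(cReM, cImM, cReN, cImN) /=; field.
rewrite uw rmorphN /= invrN mulrN mulN1r opprK.
by rewrite -fmorphV.
Qed.

(** Evanescent modes give |u|^2 = |w|^2 = |xi(j)|^2 - k^2. For propagating modes the squared sum or
    difference of x and the real beta is at least x^2 / 2 - beta^2. *)
Lemma sqr_roots_ge j : let z := betai j.1 in let x := xi alpha r true j in
  (wgt j - 1 - 3 * k ^+ 2) / 2 <= sqnormc (z + (0 +i* - x)) /\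
  (wgt j - 1 - 3 * k ^+ 2) / 2 <= sqnormc (- z + (0 +i* - x)).
Proof.
move=> z x; have wE : wgt j = 1 + (alphaj alpha j.1 ^+ 2 + x ^+ 2) by [].
rewrite wE /sqnormc !(cReD, cImD, cReN, cImN) /= !addr0.
have k0 := sqr_ge0 k; have x0 := sqr_ge0 x; have a0 := sqr_ge0 (alphaj alpha j.1).
case: (betai_cases j.1) => [[h1 [h2 h3]]|[h1 h2 h3 h4]]; rewrite -/z in h1 h2 *.
- rewrite h1 oppr0 !expr0n /= !add0r; move: h2 h3 k0 x0 a0; clear.
  move: (complex.Im z) (alphaj _ _ ^+ 2) (k ^+ 2) x => b a K y h2 h3 k0 x0 a0.
  have g1 := sqr_ge0 (y - 2 * b); have g2 := sqr_ge0 (y + 2 * b).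
  by split; nra.
- rewrite h1 oppr0 !add0r !sqrrN h3; move: h4 a0 k0 x0; clear.
  by move: (alphaj _ _ ^+ 2) (k ^+ 2) (x ^+ 2) => a K y *; split; lra.
Qed.

Lemma chi3_bounded : exists2 M : R, 0 <= M & forall t, - r < t < r -> `|derive1n 3 chi t| <= M.
Proof.
have cK : compact (derive1n 3 chi @` `[- r, r]%classic).
  apply: continuous_compact; last exact: segment_compact.
  by apply: continuous_subspaceT; exact: chi_cont.
have [M [_ hM]] := compact_bounded cK; exists (`|M| + 1); first by have := normr_ge0 M; lra.
move=> t /andP[t1 t2]; apply: hM; first by apply: le_lt_trans (ler_norm _) _; rewrite ltrDl.
by exists t => //; rewrite /= in_itv /= !ltW.
Qed.

Lemma cabsV (z : R[i]) : cabs z^-1 = (cabs z)^-1.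
Proof.
have [->|z0] := eqVneq z 0; first by rewrite invr0 cabs0 invr0.
have h : cabs z * cabs z^-1 = 1 by rewrite -cabsM mulfV// cabs_real normr1.
have c0 : cabs z != 0 by apply/eqP => c0; move: h; rewrite c0 mul0r => /eqP; rewrite eq_sym oner_eq0.
by apply: (mulfI c0); rewrite h mulfV.
Qed.

Lemma cabsV_le (u : R[i]) (s : R) : 0 < s -> s ^+ 2 / 4 <= sqnormc u -> cabs u^-1 <= 2 / s.
Proof.
move=> s0 h; have c0 : 0 < cabs u.
  by rewrite /cabs sqrtr_gt0; apply: lt_le_trans h; rewrite divr_gt0// exprn_gt0.
have h2 : s / 2 <= cabs u.
  rewrite -(@ler_pXn2r _ 2) ?nnegrE ?cabs_ge0//; last by rewrite divr_ge0 ?ltW.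
  by rewrite cabs_sqr; apply: le_trans h; rewrite expr_div_n; lra.
rewrite cabsV -[2 / s]invf_div lef_pV2// posrE ?divr_gt0//.
Qed.

(** With s the square root of the weight, the remainder of [profile_coef_est] is of order s^-3, so
    after multiplication by the weight it is of order 1/s; the main term weight / T differs from 1
    by order s^-2. *)
Lemma kap_lim (eps : R) : 0 < eps -> exists m, forall j, j \notin ZN m ->
  sqnormc ((wgt j)%:C * kap j - 1) <= eps.
Proof.
move=> e0; have [M M0 hM] := chi3_bounded; have [Cb Cb0 hCb] := beta_inv_bound.
pose B := 1 + Cb; pose C2 := 16 * B * r * M + 2 * (1 + k ^+ 2).
have k0 := sqr_ge0 k.
have B0 : 0 < B by rewrite /B; lra.
have C20 : 0 <= C2.
  by rewrite /C2 addr_ge0//; [rewrite !mulr_ge0// ltW|rewrite mulr_ge0//; lra].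
(* A weight of at least 2 + 6 k^2 makes |u|^2 and |w|^2 at least weight / 4 and T positive; the last
   term makes (C2 / s)^2 at most eps. *)
pose W := 2 + 6 * k ^+ 2 + C2 ^+ 2 / eps.
have WC : 0 <= C2 ^+ 2 / eps by rewrite divr_ge0 ?sqr_ge0 ?ltW.
have [m hm] := sqr_weight_large W; exists m => j /hm hw.
set w := wgt j in hw *; pose s := Num.sqrt w.
have w1 : 2 + 6 * k ^+ 2 <= w by rewrite /W in hw; lra.
have w0 : 0 < w by lra.
have s0 : 0 < s by rewrite sqrtr_gt0.
have sw : s ^+ 2 = w by rewrite sqr_sqrtr ?ltW.
have T0 : 0 < w - 1 - k ^+ 2 by lra.
have [u0 v0 hmain] := @kap_main j (lt0r_neq0 T0); rewrite -/w in hmain.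
have [hu hv] := sqr_roots_ge j; rewrite -/w in hu hv.
have hest := @profile_coef_est j M hM u0 v0.
set u := betai j.1 + _ in u0 hu hest hmain; set v := - betai j.1 + _ in v0 hv hest hmain.
have cu : cabs u^-1 <= 2 / s by apply: cabsV_le => //; rewrite sw; apply: le_trans hu; lra.
have cv : cabs v^-1 <= 2 / s by apply: cabsV_le => //; rewrite sw; apply: le_trans hv; lra.
set J := profile_coef j in hest; set J0 := - u^-1 + v^-1 in hest hmain.
(* A number whose square is at most Cb is at most 1 + Cb, hence the choice of B. *)
have cb : cabs (beta j.1)^-1 <= B.
  have h1 : cabs (beta j.1)^-1 ^+ 2 <= Cb.
    rewrite cabsV exprVn cabs_sqr; apply: le_trans (hCb j.1).
    by rewrite ler_peMr ?invr_ge0 ?sqnormc_ge0// lerDl sqr_ge0.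
  rewrite /B; move: (cabs _) (cabs_ge0 (beta j.1)^-1) h1 => x x0 h1; nra.
set c := (0 +i* 2^-1) * (beta j.1)^-1 in hmain.
have cc : cabs c <= B / 2.
  by rewrite /c cabsM cabsi ger0_norm ?invr_ge0// mulrC ler_pM2r.
have cu3 : cabs u^-1 ^+ 3 <= 8 / s ^+ 3.
  have -> : 8 / s ^+ 3 = (2 / s) ^+ 3 by rewrite expr_div_n; congr (_ / _); ring.
  by rewrite lerXn2r ?nnegrE ?cabs_ge0// divr_ge0// ltW.
have cv3 : cabs v^-1 ^+ 3 <= 8 / s ^+ 3.
  have -> : 8 / s ^+ 3 = (2 / s) ^+ 3 by rewrite expr_div_n; congr (_ / _); ring.
  by rewrite lerXn2r ?nnegrE ?cabs_ge0// divr_ge0// ltW.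
have hJ : cabs (J - J0) <= 32 * r * M / s ^+ 3.
  apply: le_trans hest _; have rM : 0 <= r * M by rewrite mulr_ge0// ltW.
  have g1 := ler_wpM2l rM cu3; have g2 := ler_wpM2l rM cv3.
  move: g1 g2; move: (cabs u^-1 ^+ 3) (cabs v^-1 ^+ 3) (s ^+ 3)^-1 => a b d g1 g2.
  have -> : 2 * (r * (M * a)) + 2 * (r * (M * b)) = 2 * (r * M * a) + 2 * (r * M * b) by ring.
  have -> : 32 * r * M * d = 2 * (r * M * (8 * d)) + 2 * (r * M * (8 * d)) by ring.
  by lra.
have E : w%:C * kap j - 1 = w%:C * c * (J - J0) + ((1 + k ^+ 2) / (w - 1 - k ^+ 2))%:C.
  have -> : (1 + k ^+ 2) / (w - 1 - k ^+ 2) = w * (w - 1 - k ^+ 2)^-1 - 1.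
    by field; rewrite gt_eqF.
  rewrite /kap -/c -/J rmorphB rmorphM /= -hmain; ring.
have hs1 : 1 <= s.
  by rewrite -(@ler_pXn2r _ 2) ?nnegrE ?ler01 ?ltW// sw expr1n; lra.
have h1 : cabs (w%:C * c * (J - J0)) <= 16 * B * r * M / s.
  rewrite cabsM (cabsM w%:C c) cabs_real gtr0_norm//.
  apply: le_trans (_ : w * (B / 2) * (32 * r * M / s ^+ 3) <= _).
    apply: ler_pM => //; [|exact: cabs_ge0|].
      by apply: mulr_ge0; [exact: ltW|exact: cabs_ge0].
    by apply: ler_wpM2l => //; exact: ltW.
  by rewrite -sw le_eqVlt; apply/orP; left; apply/eqP; field; rewrite gt_eqF.
have h2 : cabs ((1 + k ^+ 2) / (w - 1 - k ^+ 2))%:C <= 2 * (1 + k ^+ 2) / s.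
  rewrite cabs_real ger0_norm; last by rewrite divr_ge0 ?ltW//; lra.
  rewrite ler_pdivrMr// mulrAC ler_pdivlMr// -mulrA [2 * _]mulrCA; apply: ler_wpM2l; first by lra.
  have : s <= w by rewrite -sw ler_eXnr.
  lra.
have h3 : cabs (w%:C * kap j - 1) <= C2 / s.
  rewrite E; apply: le_trans (cabsD _ _) _; rewrite /C2 [leRHS]mulrDl; exact: lerD.
rewrite -cabs_sqr; apply: le_trans (_ : (C2 / s) ^+ 2 <= _).
  by rewrite lerXn2r ?nnegrE ?cabs_ge0// divr_ge0// ltW.
rewrite expr_div_n sw ler_pdivrMr// mulrC -ler_pdivrMr//.
by rewrite /W in hw; lra.
Qed.

End kernel_coef.

(** * The volume potential as a Fourier multiplier *)

Section potential.
Variables (R : realType) (k alpha rho r : R) (chi : R -> R).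
Hypothesis r0 : 0 < r.
Hypothesis rho0 : 0 < rho.
Hypothesis chi_cutoff : cutoff rho r chi.
Hypothesis nonres : forall j : int, k ^+ 2 != alphaj alpha j ^+ 2.
Local Notation beta := (betaj k alpha).
Local Notation phi := (phij alpha r).
Local Notation O := (Omega r).
Local Notation prof := (kernel_profile k alpha r chi).
Local Notation zb := (betai k alpha).
Local Notation kp := (kap k alpha r chi).
Let mO : measurable (O : set (RR R)) := measurable_Omega r.
Let H : inner_space (L2 O) (ip2 O) := L2_inner mO.
Let HB := Omega_basis alpha r0.

Lemma fsbig_symz (n : nat) (F : int -> R[i]) :
  \sum_(j \in [set j : int | `|j| <= n%:Z]) F j = \sum_(j <- symz n) F j.
Proof.
have -> : [set j : int | `|j| <= n%:Z] = [set` symz n].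
  by apply/seteqP; split => j; rewrite /= in_symz -abszE.
by rewrite fsbig_finite ?set_fsetK//; exact: finite_fset.
Qed.

Lemma wrap_absE (t : R) : - (2 * r) < t < 2 * r -> `|Defs.wrap r t| = wrap_abs r t.
Proof.
move=> /andP[t1 t2]; have fl (m : int) : m%:~R <= (t + r) / (2 * r) < m%:~R + 1 ->
    Num.floor ((t + r) / (2 * r)) = m.
  by move=> h; apply: floor_def; rewrite intrD.
have r2 : 0 < 2 * r by rewrite mulr_gt0.
rewrite /Defs.wrap /wrap_abs; have [h|h] := ltP t (- r).
  rewrite (fl (-1)); last by rewrite ler_pdivlMr// ltr_pdivrMr// rmorphN /=; lra.
  rewrite rmorphN /= mulrN1 opprK (@ltr0_norm _ t); last by lra.
  by rewrite (@ger0_norm _ (t + 2 * r)) ?min_r; lra.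
have [h'|h'] := ltP t r.
  rewrite (fl 0); last by rewrite ler_pdivlMr// ltr_pdivrMr//=; lra.
  rewrite mulr0 subr0 min_l//; have : `|t| <= r by rewrite ler_norml; lra.
  lra.
rewrite (fl 1); last by rewrite ler_pdivlMr// ltr_pdivrMr//=; lra.
rewrite mulr1 (@ger0_norm _ t); last by lra.
by rewrite (@ler0_norm _ (t - 2 * r)) ?min_r; lra.
Qed.

Lemma wrap_abs_ge0 (t : R) : - (2 * r) < t < 2 * r -> 0 <= wrap_abs r t.
Proof. by move=> h; rewrite -wrap_absE. Qed.

Lemma chi_sq (t : R) : chi t ^+ 2 <= 1.
Proof.
case: chi_cutoff => _ _ h _ _; have /andP[h0 h1] := h t.
by rewrite -(expr1n _ 2) lerXn2r ?nnegrE.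
Qed.

Lemma sqnormc_prof_le l (t : R) : - (2 * r) < t < 2 * r -> sqnormc (prof l t) <= 1.
Proof.
move=> ht; rewrite /kernel_profile sqnormcM sqnormc_real -(cabs_sqr (cexp _)) cabs_cexp.
have e1 : expR (complex.Re (zb l) * wrap_abs r t) <= 1.
  by rewrite -expR0 ler_expR mulr_le0_ge0 ?wrap_abs_ge0// betai_Re_le0.
rewrite -[leRHS]mulr1; apply: ler_pM; [exact: sqr_ge0|exact: sqr_ge0|exact: chi_sq|].
by rewrite -(expr1n _ 2) lerXn2r ?nnegrE ?expR_ge0.
Qed.

(* The [l]-th term, as a function of [y], of the series of the kernel at [x - y]. *)
Definition kernel_term (x : R * R) (l : int) (y : R * R) : R[i] :=
  (0 +i* (4 * pi)^-1) * (beta l)^-1 * cis (alphaj alpha l * (x.1 - y.1)) * prof l (x.2 - y.2).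

Lemma green_term (t s : R) (l : int) :
  cexp ((0 +i* (alphaj alpha l * t)) + (0 +i* 1) * beta l * `|s|%:C) =
  cis (alphaj alpha l * t) * cexp (zb l * `|s|%:C).
Proof. by rewrite cexpD cexpi. Qed.

Lemma Omega_diff (x y : R * R) : O x -> O y -> - (2 * r) < x.2 - y.2 < 2 * r.
Proof.
by move=> /andP[_ /andP[h1 h2]] /andP[_ /andP[h3 h4]]; apply/andP; split; lra.
Qed.

Lemma Ksm_clim (x y : R * R) : O x -> O y ->
  Ksm k alpha r chi (x - y) = (chi (x.2 - y.2))%:C * ((0 +i* (4 * pi)^-1) *
    clim (fun n => \sum_(l <- symz n) (beta l)^-1 * (cis (alphaj alpha l * (x.1 - y.1)) *
      cexp (zb l * (wrap_abs r (x.2 - y.2))%:C)))).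
Proof.
move=> Ox Oy; rewrite /Ksm /KR /green; congr (_ * (_ * clim _)).
apply/funext => n; rewrite fsbig_symz; apply: eq_bigr => l _.
rewrite green_term; congr (_ * (_ * cexp (_ * _%:C))).
by apply: wrap_absE; exact: Omega_diff.
Qed.

(** Telescoping, since 1 / (1 + N^2) <= 2 / (N (N + 1)), with two such terms at each step. *)
Lemma sum_inv_sqr_bound n : \sum_(l <- symz n) (1 + l%:~R ^+ 2)^-1 <= 5 - 4 / n.+1%:R :> R.
Proof.
elim: n => [|n IH]; first by rewrite /= big_seq_fset1 expr0n addr0 invr1; lra.
rewrite sum_symz_recr mulrNz sqrrN.
have N1 : 1 <= n.+1%:R :> R by rewrite ler1n.
rewrite (_ : n.+1%:~R = n.+1%:R :> R)// -[n.+2%:R]natr1.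
move: (\sum_(l <- _) _) IH => S IH; move: (n.+1%:R : R) N1 IH => N N1 IH.
have h : (1 + N ^+ 2)^-1 <= 2 * (N^-1 - (N + 1)^-1).
  have -> : 2 * (N^-1 - (N + 1)^-1) = (N * (N + 1) / 2)^-1 by field; rewrite !gt_eqF//; lra.
  by rewrite lef_pV2 ?posrE; nra.
move: N^-1 (N + 1)^-1 h IH => a b h IH; lra.
Qed.

Lemma beta_sum_bound : exists B : R, forall n, \sum_(l <- symz n) (sqnormc (beta l))^-1 <= B.
Proof.
have [C C0 hC] := beta_inv_bound r0 rho0 nonres; exists (C * 5) => n.
apply: le_trans (_ : \sum_(l <- symz n) C * (1 + l%:~R ^+ 2)^-1 <= _).
  apply: ler_sum => l _; rewrite ler_pdivlMr//.
  by have := sqr_ge0 (l%:~R : R); lra.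
rewrite -mulr_sumr ler_pM2l//; apply: le_trans (sum_inv_sqr_bound n) _.
by rewrite lerBlDr lerDl divr_ge0.
Qed.

(** Off the line s = 0 the series converges absolutely: evanescent modes satisfy |beta| exp(- |beta|
    s) <= 1/s, propagating ones |beta| <= |k|. *)
Lemma green_term_bound (l : int) (t s : R) : 0 < s ->
  cabs ((beta l)^-1 * (cis t * cexp (zb l * s%:C))) <= (s^-1 + `|k|) * (sqnormc (beta l))^-1.
Proof.
move=> s0; have b0 := sqnormc_beta_gt0 nonres l.
have c0 : 0 < cabs (beta l) by rewrite /cabs sqrtr_gt0.
rewrite cabsM cabsV (cabsM (cis t)) cabs_cexp {1}/cabs.
have -> : Num.sqrt (sqnormc (beta l)) = cabs (beta l) by [].
have -> : cabs (cis t) = 1 by rewrite /cabs sqnormc_cis sqrtr1.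
rewrite mul1r -cabs_sqr; set c := cabs (beta l) in c0 *.
have cE : c ^+ 2 = `|k ^+ 2 - alphaj alpha l ^+ 2| by rewrite cabs_sqr sqnormc_beta.
suff h : c * expR (complex.Re (zb l) * s) <= s^-1 + `|k|.
  have -> : c^-1 * expR (complex.Re (zb l) * s) = c * expR (complex.Re (zb l) * s) * (c ^+ 2)^-1.
    by move: (expR _) => e; field; rewrite gt_eqF.
  by apply: ler_wpM2r => //; rewrite invr_ge0 sqr_ge0.
have s1 : 0 < s^-1 by rewrite invr_gt0.
case: (betai_cases nonres l) => [[h1 [h2 h3]]|[h1 h2 h3 h4]].
- rewrite h1 mul0r expR0 mulr1; apply: le_trans (_ : `|k| <= _); last by rewrite lerDr ltW.
  rewrite -(@ler_pXn2r _ 2) ?nnegrE//; last exact: ltW.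
  rewrite cE real_normK ?num_real// ger0_norm; last by rewrite subr_ge0 ltW.
  by rewrite lerBlDr lerDl sqr_ge0.
- have {}cE : complex.Re (zb l) = - c.
    have : complex.Re (zb l) ^+ 2 = c ^+ 2.
      by rewrite cE h3 distrC ger0_norm// subr_ge0 ltW.
    by move=> /eqP; rewrite eqf_sqr => /orP[/eqP e|/eqP//]; move: h2; rewrite e => /(lt_trans c0); rewrite ltxx.
  rewrite cE mulNr expRN; apply: le_trans (_ : s^-1 <= _); last by rewrite lerDl.
  rewrite ler_pdivrMr ?expR_gt0// mulrC -ler_pdivrMr ?invr_gt0// invrK.
  by apply: le_trans (expR_ge1Dx _); rewrite mulrC; lra.
Qed.

Lemma symz_sum_cvg (a : int -> R[i]) (b : int -> R) (B : R) :
  (forall l, cabs (a l) <= b l) -> (forall n, \sum_(l <- symz n) b l <= B) ->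
  ccvgn (fun n => \sum_(l <- symz n) a l) (clim (fun n => \sum_(l <- symz n) a l)).
Proof.
move=> ab hB; have b0 l : 0 <= b l by apply: le_trans (ab l); exact: cabs_ge0.
have hc (eps : R) : 0 < eps -> exists N, forall m, (N <= m)%N ->
    cabs (\sum_(l <- symz m) a l - \sum_(l <- symz N) a l) <= eps.
  move=> e0; have [N hN] := bounded_partial_sums_cauchy b0 symz_mono hB e0.
  exists N => m Nm; apply: le_trans (hN m Nm).
  rewrite (fset_sum_split a (symz_mono Nm)) (fset_sum_split b (symz_mono Nm)).
  rewrite [_ + _ - _]addrAC subrr add0r [_ + _ - _]addrAC subrr add0r.
  apply: le_trans (cabs_sum _ _ _) _; apply: ler_sum => l _.
  by case: (l \in symz N); [rewrite cabs0|exact: ab].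
have aux (g : R[i] -> R) : (forall z w, `|g z - g w| <= cabs (z - w)) ->
    cvgn (fun n => g (\sum_(l <- symz n) a l)).
  move=> hg; apply: cauchy_real_cvg => eps e0.
  by have [N hN] := hc _ e0; exists N => m /hN; exact: le_trans (hg _ _).
split.
- by apply: (aux (@complex.Re R)) => z w; rewrite -cReN -cReD; exact: Re_le_cabs.
- by apply: (aux (@complex.Im R)) => z w; rewrite -cImN -cImD; exact: Im_le_cabs.
Qed.

Lemma ccvgnZ (a : R[i]) (z : nat -> R[i]) l : ccvgn z l -> ccvgn (fun n => a * z n) (a * l).
Proof.
move=> [h1 h2]; split.
- by under eq_fun do rewrite cReM; rewrite cReM; apply: cvgB; apply: cvgM => //; exact: cvg_cst.
- by under eq_fun do rewrite cImM; rewrite cImM; apply: cvgD; apply: cvgM => //; exact: cvg_cst.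
Qed.

Lemma ccvgnJ (z : nat -> R[i]) l : ccvgn z l -> ccvgn (fun n => (z n)^*) (l^*).
Proof.
move=> [h1 h2]; split.
- by under eq_fun do rewrite cReJ; rewrite cReJ.
- by under eq_fun do rewrite cImJ; rewrite cImJ; exact: cvgN.
Qed.

Lemma cmeasurable_sub1 (p : R -> R[i]) (c : R) (b : bool) (A : set (R * R)) : bcont p ->
  cmeasurable A (fun y => p (c - crd b y)).
Proof.
move=> [c1 c2]; apply: cmeasurable_sub.
have m (q : R -> R) : continuous q -> measurable_fun [set: RR R] (fun y => q (c - crd b y)).
  move=> cq; have cq' : continuous (fun t => q (c - t)).
    move=> t; apply: (@continuous_comp _ _ _ (fun t : R => c - t) q); last exact: cq.
    by apply: cvgB; [exact: cvg_cst|exact: cvg_id].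
  case: b; [exact: (measurableT_comp (continuous_measurable_fun cq') measurable_snd)|].
  exact: (measurableT_comp (continuous_measurable_fun cq') measurable_fst).
by split; [exact: (m _ c1)|exact: (m _ c2)].
Qed.

Lemma cmeasurable_clim (A : set (RR R)) (S : nat -> R * R -> R[i]) : measurable A ->
  (forall n, cmeasurable A (S n)) -> cmeasurable A (fun y => clim (fun n => S n y)).
Proof.
move=> mA mS; split => /=.
- by apply: measurable_fun_limn => // n; have [] := mS n.
- by apply: measurable_fun_limn => // n; have [] := mS n.
Qed.

Lemma eq_cmeasurable (A : set (RR R)) f g : (forall y, A y -> f y = g y) ->
  cmeasurable A f -> cmeasurable A g.
Proof.
move=> fg [m1 m2]; split.
- by apply: eq_measurable_fun m1 => y /set_mem Ay; rewrite fg.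
- by apply: eq_measurable_fun m2 => y /set_mem Ay; rewrite fg.
Qed.

Lemma orthogonal_nsq (w : int -> R * R -> R[i]) (s : {fset int}) : (forall l, L2 O (w l)) ->
  (forall l m, l != m -> ip2 O (w l) (w m) = 0) ->
  nsq (ip2 O) (\sum_(l <- s) w l) = \sum_(l <- s) nsq (ip2 O) (w l).
Proof.
move=> Lw ow; rewrite /nsq (ip_suml H)//; last exact: (spanS H).
rewrite cRe_sum big_seq [RHS]big_seq; apply: eq_bigr => l ls.
rewrite (ip_sumr H)// (bigD1_seq l)//= big1 ?addr0// => m ml.
by rewrite ow// eq_sym.
Qed.

Lemma orthogonal_cauchy (w : int -> R * R -> R[i]) (B : R) : (forall l, L2 O (w l)) ->
  (forall l m, l != m -> ip2 O (w l) (w m) = 0) ->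
  (forall n, \sum_(l <- symz n) nsq (ip2 O) (w l) <= B) ->
  forall eps : R, 0 < eps -> exists N, forall m n, (N <= m)%N -> (N <= n)%N ->
    nsq (ip2 O) (\sum_(l <- symz m) w l - \sum_(l <- symz n) w l) <= eps.
Proof.
move=> Lw ow hB eps e0; have w0 l := nsq_ge0 H (Lw l).
have [N hN] := bounded_partial_sums_cauchy w0 symz_mono hB (divr_gt0 e0 (ltr0Sn R 3)).
have L0 : L2 O 0 by exact: (inner0 H).
have LS n : L2 O (\sum_(l <- symz n) w l) by exact: (spanS H).
have hS m : (N <= m)%N -> nsq (ip2 O) (\sum_(l <- symz m) w l - \sum_(l <- symz N) w l) <= eps / 4.
  move=> Nm; apply: le_trans (hN m Nm).
  rewrite (fset_sum_split w (symz_mono Nm)) (fset_sum_split (fun l => nsq (ip2 O) (w l)) (symz_mono Nm)).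
  rewrite [_ + _ - _]addrAC subrr add0r [_ + _ - _]addrAC subrr add0r.
  rewrite orthogonal_nsq.
  - apply: ler_sum => l _; case: (l \in symz N) => //.
    by rewrite /nsq (ip0l H).
  - by move=> l; case: ifP.
  - move=> l m' lm; case: ifP => _; first by rewrite (ip0l H)//; case: ifP.
    by case: ifP => _; [rewrite (inner_ipC H)// (ip0l H)// rmorph0|exact: ow].
exists N => m n Nm Nn; have h1 := hS m Nm; have h2 := hS n Nn.
have -> : \sum_(l <- symz m) w l - \sum_(l <- symz n) w l =
  (\sum_(l <- symz m) w l - \sum_(l <- symz N) w l) - (\sum_(l <- symz n) w l - \sum_(l <- symz N) w l).
  by rewrite opprB addrA subrK.
apply: le_trans (nsqB_le H (SB H (LS m) (LS N)) (SB H (LS n) (LS N))) _.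
move: h1 h2; move: (nsq _ _) (nsq _ _) => a b; lra.
Qed.

Section fixed_x.
Variable x : R * R.
Hypothesis Ox : O x.

Let w (l : int) (y : R * R) : R[i] := (kernel_term x l y)^*.
Let c (l : int) : R[i] := (0 +i* (4 * pi)^-1) * (beta l)^-1.

Lemma cmeasurable_term l : cmeasurable O (kernel_term x l).
Proof.
apply: cmeasurableM.
  apply: cmeasurableM; first exact: cmeasurable_cst.
  exact: (@cmeasurable_sub1 (fun t => cis (alphaj alpha l * t)) x.1 false O (bcont_cis _)).
exact: (@cmeasurable_sub1 (prof l) x.2 true O (bcont_profile k alpha chi_cutoff l)).
Qed.

Lemma sqnormc_term l y : O y ->
  sqnormc (kernel_term x l y) <= ((4 * pi)^-1) ^+ 2 * (sqnormc (beta l))^-1.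
Proof.
move=> Oy; rewrite /kernel_term sqnormcM [sqnormc (_ * cis _)]sqnormcM.
rewrite [sqnormc (_ * (beta l)^-1)]sqnormcM sqnormci sqnormc_cis mulr1.
have h := sqnormc_prof_le l (Omega_diff Ox Oy).
have -> : sqnormc (beta l)^-1 = (sqnormc (beta l))^-1 by rewrite -!cabs_sqr cabsV exprVn.
rewrite -[leRHS]mulr1; apply: ler_wpM2l => //.
by rewrite mulr_ge0 ?sqr_ge0// invr_ge0 sqnormc_ge0.
Qed.

Lemma L2_w l : L2 O (w l).
Proof.
apply: (L2_Omega_bounded alpha r0 (C := ((4 * pi)^-1) ^+ 2 * (sqnormc (beta l))^-1)) => //.
  by apply: cmeasurableJ; exact: cmeasurable_term.
by move=> y Oy; rewrite sqnormcJ; exact: sqnormc_term.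
Qed.

(** A multiple of phi_(0,0), which has constant modulus and norm 1, serves as the constant
    majorant. *)
Lemma nsq_w l : nsq (ip2 O) (w l) <= ((4 * pi)^-1) ^+ 2 * (phic r) ^- 2 * (sqnormc (beta l))^-1.
Proof.
have p0 := phic_gt0 r0.
pose g : R * R -> R[i] := ((4 * pi)^-1 * cabs (beta l)^-1 / phic r)%:C *: phi (0, 0).
have Lphi := L2_phij_Omega alpha r0 (0, 0).
have Lg : L2 O g by exact: (innerZ H).
have gE y : g y = ((4 * pi)^-1 * cabs (beta l)^-1 / phic r)%:C * phi (0, 0) y by [].
have bE : cabs (beta l)^-1 ^+ 2 = (sqnormc (beta l))^-1 by rewrite cabsV exprVn cabs_sqr.
apply: le_trans (_ : nsq (ip2 O) g <= _).
  apply: (nsq_le (L2_w l) Lg) => y Oy; rewrite sqnormcJ; apply: le_trans (sqnormc_term l Oy) _.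
  rewrite gE sqnormcM sqnormc_real sqnormc_phij -exprMn divfK ?gt_eqF// exprMn bE.
  exact: lexx.
rewrite (nsqZ H)// (nsq_basis HB) mulr1 sqnormc_real !exprMn bE exprVn.
by rewrite (exprVn (phic r)) mulrAC.
Qed.

Lemma cint_sep (m : R) (z : R[i]) (p : R -> R[i]) : bcont p ->
  cint O (fun y => z * (cis (m * y.1) * p (x.2 - y.2))) =
  z * (c1int pi (fun t => cis (m * t)) * c1i (- r) r (fun t => p (x.2 - t))).
Proof.
move=> cp; have cp' : bcont (fun t => p (x.2 - t)).
  apply: (bcont_comp cp) => t; by apply: cvgB; [exact: cvg_cst|exact: cvg_id].
have OE : O = box pi r by [].
have [i e] := cint_prod pi (bcont_cis m) (integrable_cont_oo (- r) r cp'.1) (integrable_cont_oo (- r) r cp'.2).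
by rewrite -e -OE; apply: (cintZ mO); rewrite OE.
Qed.

Lemma c1int_delta (l m : int) : c1int pi (fun t => cis ((l - m)%:~R * t)) =
  (if l == m then (2 * pi)%:C else 0) :> R[i].
Proof.
have pi0 := pi_gt0 R; case: eqVneq => [->|lm].
  by rewrite subrr; under [X in c1int _ X]eq_fun do rewrite mul0r cis0; rewrite c1int1.
apply: c1int_cis => //; first by rewrite intr_eq0 subr_eq0.
exact: sin_mulpi.
Qed.

Lemma orthogonal_w l m : l != m -> ip2 O (w l) (w m) = 0.
Proof.
move=> lm; rewrite /ip2.
pose p t := (prof l t)^* * prof m t.
have cp : bcont p.
  by apply: bcontM; [apply: bcont_conj|]; exact: (bcont_profile k alpha chi_cutoff _).
rewrite (@eq_cint _ _ _ (fun y => ((c l)^* * c m * cis (- (alphaj alpha l * x.1)) * cis (alphaj alpha m * x.1)) *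
   (cis ((l - m)%:~R * y.1) * p (x.2 - y.2)))).
  by rewrite cint_sep// c1int_delta (negbTE lm) mul0r mulr0.
move=> y Oy; rewrite /w /kernel_term -/(c l) -/(c m) /p.
rewrite conjCK !rmorphM /= cisJ !mulrBr !opprB.
rewrite (_ : (l - m)%:~R * y.1 = alphaj alpha l * y.1 - alphaj alpha m * y.1).
  by rewrite ![cis (_ - _)]cisD; ring.
by rewrite /alphaj intrB; ring.
Qed.

(** The substitution y -> x2 - y moves the interval out of ]-r, r[; periodicity of the integrand
    brings it back. *)
Lemma profile_periodic j : c1i (- r) r (fun t => prof j.1 (x.2 - t) * cis (- xi alpha r true j * (x.2 - t))) =
  profile_coef k alpha r chi j.
Proof.
have x2 : - r < x.2 < r by case/andP: Ox.
have cpr : bcont (fun t => prof j.1 t * cis (- xi alpha r true j * t)).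
  by apply: bcontM; [exact: (bcont_profile k alpha chi_cutoff _)|exact: bcont_cis].
rewrite (c1i_period r0 cpr x2)// => t /andP[t1 t2]; congr (_ * _).
  rewrite /kernel_profile; congr (_%:C * cexp (_ * _%:C)).
    case: chi_cutoff => _ hp _ _ _; rewrite -(hp (t - r)); congr chi; lra.
  rewrite /wrap_abs (@ger0_norm _ (t + r)); last by lra.
  rewrite (@ler0_norm _ (t - r)); last by lra.
  by rewrite minC; congr Num.min; lra.
(* A shift by 2 r changes the phase by an integer multiple of 2 pi. *)
have -> : - xi alpha r true j * (t + r) = - xi alpha r true j * (t - r) + (- j.2)%:~R * (2 * pi).
  by rewrite /xi rmorphN /=; move: (@pi R) => p; field; rewrite gt_eqF.
by rewrite cisD cis_mul2pi mulr1.
Qed.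

(** Integration in x1 selects the mode l = j.1; the x2-integral is then the profile coefficient, and
    the factors collect into [kap]. *)
Lemma ip_w_phij l j : ip2 O (w l) (phi j) = if l == j.1 then (kp j * phi j x)^* else 0.
Proof.
have pi0 := pi_gt0 R.
have mw := cmeasurable_term l.
pose p t := prof l t * cis (- xi alpha r true j * t).
have cpr : bcont p by apply: bcontM; [exact: (bcont_profile k alpha chi_cutoff _)|exact: bcont_cis].
pose z := c l * cis (alphaj alpha l * x.1) * (phic r)%:C * cis (xi alpha r true j * x.2).
have E y : kernel_term x l y * phi j y = z * (cis ((j.1 - l)%:~R * y.1) * p (x.2 - y.2)).
  rewrite /kernel_term -/(c l) phijE /p /z !mulrBr !mulNr opprK.
  rewrite (_ : (j.1 - l)%:~R * y.1 = xi alpha r false j * y.1 - alphaj alpha l * y.1).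
    rewrite ![cis (_ - _)]cisD [cis (- (_ * x.2) + _)]cisD.
    have := cisNK (xi alpha r true j * x.2); move: (cis (- (_ * x.2))) => e he.
    set d := cis (xi alpha r true j * x.2) in he *.
    rewrite -[LHS]mulr1 -he; ring.
  by rewrite /alphaj /xi /= intrB; ring.
have -> : ip2 O (w l) (phi j) = (cint O (fun y => kernel_term x l y * phi j y))^*.
  rewrite -(cint_conj mO); last first.
    apply: (L2_mul mO); last exact: (L2_phij_Omega alpha r0).
    by have := L2_J (L2_w l); rewrite /w; under eq_fun do rewrite conjCK.
  by apply: eq_cint => y _; rewrite /w [RHS]rmorphM.
rewrite (@eq_cint _ _ _ (fun y => z * (cis ((j.1 - l)%:~R * y.1) * p (x.2 - y.2)))) //.
rewrite cint_sep// c1int_delta eq_sym; case: eqVneq => [lj|_]; last by rewrite mul0r mulr0 rmorph0.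
congr (_^*); rewrite /p lj profile_periodic /z lj /c /kap phijE.
have -> : alphaj alpha j.1 = xi alpha r false j by [].
have e4 : (0 +i* (4 * pi)^-1) * (2 * pi)%:C = (0 +i* 2^-1) :> R[i].
  apply: complexP; rewrite !(cReM, cImM) /=; first by ring.
  by move: (@pi R) pi0 => q q0; field; rewrite gt_eqF.
rewrite -e4; ring.
Qed.

(** Conjugated, so that the potential of f at x is the inner product of f with this function. *)
Definition kernel_conj (y : R * R) : R[i] := (Ksm k alpha r chi (x - y))^*.

(** The series converges pointwise off the null line y2 = x2, and it is Cauchy in L^2 because its
    terms are mutually orthogonal with norms summable in square. [L2_cauchy_lim] identifies the two
    limits. *)
Lemma kernel_conj_L2 : L2 O kernel_conj /\ forall eps : R, 0 < eps -> exists N, forall n, (N <= n)%N ->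
  nsq (ip2 O) (kernel_conj - \sum_(l <- symz n) w l) <= eps.
Proof.
pose S n y := \sum_(l <- symz n) (beta l)^-1 * (cis (alphaj alpha l * (x.1 - y.1)) *
      cexp (zb l * (wrap_abs r (x.2 - y.2))%:C)).
have mS n : cmeasurable O (S n).
  apply: cmeasurable_sum => l; apply: cmeasurableM; first exact: cmeasurable_cst.
  apply: cmeasurableM.
    exact: (@cmeasurable_sub1 (fun t => cis (alphaj alpha l * t)) x.1 false O (bcont_cis _)).
  exact: (@cmeasurable_sub1 (fun t => cexp (zb l * (wrap_abs r t)%:C)) x.2 true O
    (bcont_comp (bcont_cexp (zb l)) (@continuous_wrap_abs R r))).
have mchi : cmeasurable O (fun y => (chi (x.2 - y.2))%:C).
  exact: (@cmeasurable_sub1 (fun t => (chi t)%:C) x.2 true O (bcont_real (chi_cont chi_cutoff (n := 0) isT))).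
have KE y : O y -> kernel_conj y = ((chi (x.2 - y.2))%:C * ((0 +i* (4 * pi)^-1) * clim (fun n => S n y)))^*.
  by move=> Oy; rewrite /kernel_conj Ksm_clim.
have [B hB] := beta_sum_bound.
apply: (L2_cauchy_lim mO).
- by move=> n; apply: (spanS H) => l; exact: L2_w.
- apply: (@eq_cmeasurable O (fun y => ((chi (x.2 - y.2))%:C * ((0 +i* (4 * pi)^-1) * clim (fun n => S n y)))^*)).
    by move=> y /KE.
  apply: cmeasurableJ; apply: cmeasurableM => //; apply: cmeasurableM; first exact: cmeasurable_cst.
  exact: cmeasurable_clim.
- have := ae_snd_neq x.2; apply: filterS => y y2 Oy; rewrite KE//.
  have d := Omega_diff Ox Oy.
  have s0 : 0 < wrap_abs r (x.2 - y.2).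
    rewrite /wrap_abs lt_min normr_gt0 subr_eq0 eq_sym y2 /= subr_gt0 ltr_norml; lra.
  have hc := @symz_sum_cvg (fun l => (beta l)^-1 * (cis (alphaj alpha l * (x.1 - y.1)) *
      cexp (zb l * (wrap_abs r (x.2 - y.2))%:C)))
      (fun l => ((wrap_abs r (x.2 - y.2))^-1 + `|k|) * (sqnormc (beta l))^-1)
      (((wrap_abs r (x.2 - y.2))^-1 + `|k|) * B).
  have {}hc : ccvgn (fun n => S n y) (clim (fun n => S n y)).
    apply: hc => [l|n]; first exact: green_term_bound.
    rewrite -mulr_sumr; apply: ler_wpM2l => //.
    by rewrite addr_ge0// invr_ge0 ltW.
  have := ccvgnJ (ccvgnZ (chi (x.2 - y.2))%:C (ccvgnZ (0 +i* (4 * pi)^-1) hc)).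
  congr (ccvgn _ _); apply/funext => n; rewrite fct_sumE /S !mulr_sumr rmorph_sum.
  apply: eq_bigr => l _; rewrite /w /kernel_term /kernel_profile; congr (_^*); ring.
- apply: (@orthogonal_cauchy w (((4 * pi)^-1) ^+ 2 * (phic r) ^- 2 * B)) => [l|l m|n].
  + exact: L2_w.
  + exact: orthogonal_w.
  + apply: le_trans (_ : \sum_(l <- symz n) ((4 * pi)^-1) ^+ 2 * (phic r) ^- 2 * (sqnormc (beta l))^-1 <= _).
      by apply: ler_sum => l _; exact: nsq_w.
    rewrite -mulr_sumr; apply: ler_wpM2l => //.
    by rewrite mulr_ge0// ?sqr_ge0// invr_ge0 sqr_ge0.
Qed.

Lemma ip_kernel_conj j : ip2 O kernel_conj (phi j) = (kp j * phi j x)^*.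
Proof.
have [LK hK] := kernel_conj_L2; have Lphi := L2_phij_Omega alpha r0 j.
have Lg n : L2 O (\sum_(l <- symz n) w l) by apply: (spanS H) => l; exact: L2_w.
apply/eqP; rewrite -subr_eq0; apply/eqP/sqnormc_eq0/eqP.
rewrite eq_le sqnormc_ge0 andbT; apply/ler_addgt0Pr => e e0; rewrite add0r.
have [N hN] := hK _ e0; pose n := maxn N (absz j.1).
have := hN n (leq_maxl _ _); set g := \sum_(l <- _) _ => hn.
have gE : ip2 O g (phi j) = (kp j * phi j x)^*.
  rewrite /g (ip_suml H)//; last by move=> l; exact: L2_w.
  rewrite (big_fsetD1 j.1) /=; last by rewrite in_symz leq_maxr.
  rewrite ip_w_phij eqxx big_seq big1 ?addr0// => l; rewrite !inE => /andP[lj _].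
  by rewrite ip_w_phij (negbTE lj).
rewrite -gE -(ipBl H LK (Lg n) Lphi).
apply: le_trans (cauchy_schwarz H (SB H LK (Lg n)) Lphi) _.
by rewrite (nsq_basis HB) mulr1.
Qed.

(** Fourier partial sums of f converge in L^2 and the potential at x is an inner product with a
    fixed L^2 function, so the multiplied series converges at every point of the cell. *)
Lemma vpot_point f : L2 O f -> forall eps : R, 0 < eps -> exists N, forall n, (N <= n)%N ->
  sqnormc (cint O (fun y : R * R => Ksm k alpha r chi (x - y) * f y) -
    partial_sum alpha r (fun j => kp j * ip2 O f (phi j)) n x) <= eps.
Proof.
move=> Lf eps e0; have [LK _] := kernel_conj_L2.
have -> : cint O (fun y : R * R => Ksm k alpha r chi (x - y) * f y) = ip2 O f kernel_conj.
  by apply: eq_cint => y _; rewrite /kernel_conj conjCK mulrC.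
have K0 := nsq_ge0 H LK.
have e1 : 0 < eps / (nsq (ip2 O) kernel_conj + 1) by rewrite divr_gt0//; lra.
have [N hN] := proj_cvg H HB Lf e1; exists N => n /hN hn.
have Lphi j : L2 O (phi j) by exact: (L2_phij_Omega alpha r0).
have Lp : L2 O (proj (ip2 O) phi (ZN n) f) by exact: (Sproj H Lphi _ _).
have -> : partial_sum alpha r (fun j => kp j * ip2 O f (phi j)) n x =
    ip2 O (proj (ip2 O) phi (ZN n) f) kernel_conj.
  rewrite partial_sumE /proj (ip_suml H)//; last by move=> j; exact: (innerZ H).
  apply: eq_bigr => j _; rewrite (inner_ipZ H)// (inner_ipC H LK (Lphi j)) ip_kernel_conj conjCK; ring.
rewrite -(ipBl H)//; apply: le_trans (cauchy_schwarz H (SB H Lf Lp) LK) _.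
have h0 := nsq_ge0 H (SB H Lf Lp).
apply: le_trans (_ : eps / (nsq (ip2 O) kernel_conj + 1) * (nsq (ip2 O) kernel_conj + 1) <= _).
  by apply: ler_pM => //; [exact: ltW|lra].
by rewrite divfK// gt_eqF//; lra.
Qed.

End fixed_x.

Lemma sqnormc_cvg (z : nat -> R[i]) l : (forall eps : R, 0 < eps -> exists N, forall n, (N <= n)%N ->
  sqnormc (l - z n) <= eps) -> ccvgn z l.
Proof.
move=> h; have aux (g : R[i] -> R) : (forall z w, `|g z - g w| <= cabs (z - w)) ->
    g (z n) @[n --> \oo] --> g l.
  move=> hg; apply/cvgrPdist_le => e e0; have [N hN] := h _ (exprn_gt0 2 e0).
  exists N => // n /= Nn; apply: le_trans (hg _ _) _.
  rewrite -(@ler_pXn2r _ 2) ?nnegrE ?cabs_ge0//; last exact: ltW.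
  by rewrite cabs_sqr; exact: hN.
split.
- by apply: (aux (@complex.Re R)) => a b; rewrite -cReN -cReD; exact: Re_le_cabs.
- by apply: (aux (@complex.Im R)) => a b; rewrite -cImN -cImD; exact: Im_le_cabs.
Qed.

Lemma kap_bounded : exists2 K : R, 0 < K & forall j, sqnormc (kp j) <= K.
Proof.
have [K K0 hK] := @wkap_bounded R _ ZN (xi alpha r) kp (kap_lim r0 rho0 chi_cutoff nonres).
exists K => // j; apply: le_trans (hK j); rewrite sqnormcM sqnormc_real ler_peMl ?sqnormc_ge0//.
have := weight_ge1 (xi alpha r) j; move: (weight _ j) => y y1; nra.
Qed.

Definition scalar_pot (f : R * R -> R[i]) (x : R * R) : R[i] :=
  cint O (fun y : R * R => Ksm k alpha r chi (x - y) * f y).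

(** Convergence at every point, from [vpot_point], gives measurability of the potential and
    identifies it with the L^2 limit of its series. *)
Lemma scalar_pot_fourier (f : R * R -> R[i]) : L2 O f -> L2 O (scalar_pot f) /\
  forall j, ip2 O (scalar_pot f) (phi j) = kp j * ip2 O f (phi j).
Proof.
move=> Lf; set V := scalar_pot f; pose d j := kp j * ip2 O f (phi j).
have Lphi j : L2 O (phi j) by exact: (L2_phij_Omega alpha r0).
have Lps n : L2 O (partial_sum alpha r d n).
  by apply: (spanS H) => j; apply: (innerZ H).
have [K K0 hK] := kap_bounded.
have hd n : \sum_(j <- ZN n) sqnormc (d j) <= K * nsq (ip2 O) f.
  apply: le_trans (_ : K * \sum_(j <- ZN n) sqnormc (ip2 O f (phi j)) <= _).
    rewrite mulr_sumr; apply: ler_sum => j _; rewrite sqnormcM.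
    by apply: ler_wpM2r; [exact: sqnormc_ge0|exact: hK].
  by rewrite ler_pM2l//; by apply: (bessel H Lphi (ip2_phij alpha r0)) => //; exact: fset_uniq.
have cv x : O x -> ccvgn (fun n => partial_sum alpha r d n x) (V x).
  by move=> Ox; apply: sqnormc_cvg; exact: vpot_point.
have mV : cmeasurable O V.
  apply: (@eq_cmeasurable O (fun x => clim (fun n => partial_sum alpha r d n x))).
    by move=> x /cv[h1 h2]; apply: complexP; exact: cvg_lim.
  by apply: cmeasurable_clim => // n; exact: cmeasurable_partial_sum.
have hae : {ae leb2 R, forall x, O x -> ccvgn ((partial_sum alpha r d) ^~ x) (V x)}.
  by apply: aeW => x; exact: cv.
have hc := orthonormal_cauchy H Lphi (ip2_phij alpha r0) (c := d) ZN_mono hd.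
have [LV hV] := @L2_cauchy_lim _ _ mO (partial_sum alpha r d) V Lps mV hae hc.
split => //; apply: (lim_coef H HB LV) => e e0.
have [N hN] := hV _ (divr_gt0 e0 (ltr0Sn R 1)); exists N => n Nn.
by apply: le_lt_trans (hN n Nn) _; lra.
Qed.

End potential.

(** * Weighted Fourier sums and the periodic Sobolev norms *)

Lemma sqrD_le (R : realType) (x y : R) : (x + y) ^+ 2 <= 2 * x ^+ 2 + 2 * y ^+ 2.
Proof.
rewrite -subr_ge0 (_ : _ - _ = (x - y) ^+ 2); last by ring.
exact: sqr_ge0.
Qed.

(** Used with P = (pi / r)^2 and its inverse P': the weights 1 + |xi(j)|^2 and 1 + |j|^2 are
    comparable, the shift being handled by (m + a)^2 <= 2 m^2 + 2 a^2 and its converse. *)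
Lemma weight_arith (R : realType) (m n a P P' : R) : 0 <= P -> 0 <= P' -> P' * P = 1 ->
  let c := 3 + 2 * a ^+ 2 + P + P' in
  1 + ((m + a) ^+ 2 + P * n ^+ 2) <= c * (1 + (m ^+ 2 + n ^+ 2)) /\
  1 + (m ^+ 2 + n ^+ 2) <= c * (1 + ((m + a) ^+ 2 + P * n ^+ 2)).
Proof.
move=> P0 P'0 PP c; rewrite {}/c.
have h1 := sqrD_le m a; have h2 := sqrD_le (m + a) (- a); rewrite addrK sqrrN in h2.
have h3 : n ^+ 2 = P' * (P * n ^+ 2) by rewrite mulrA PP mul1r.
have m0 := sqr_ge0 m; have n0 := sqr_ge0 n; have x0 := sqr_ge0 (m + a); have a0 := sqr_ge0 a.
have y0 : 0 <= P * n ^+ 2 by rewrite mulr_ge0.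
move: h1 h2 h3 m0 n0 x0 y0 a0 => {PP}.
move: ((m + a) ^+ 2) (n ^+ 2) (m ^+ 2) (a ^+ 2) => x n2 m2 b h1 h2 h3 m0 n0 x0 y0 b0.
have q1 := mulr_ge0 b0 m0; have q2 := mulr_ge0 b0 n0; have q3 := mulr_ge0 P0 m0.
have q4 := mulr_ge0 P'0 m0; have q5 := mulr_ge0 P'0 n0.
have p1 := mulr_ge0 b0 x0; have p2 := mulr_ge0 b0 y0; have p3 := mulr_ge0 P0 x0.
have p4 := mulr_ge0 P'0 x0; have p5 := mulr_ge0 P0 y0.
by split; lra.
Qed.

Section sobolev_norm.
Variables (R : realType) (alpha r : R).
Hypothesis r0 : 0 < r.
Local Notation phi := (phij alpha r).
Local Notation O := (Omega r).
Local Notation wgt := (weight (xi alpha r)).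
Local Notation wbd := (wbounded ZN (xi alpha r)).
Local Notation coefs f := (fun j => ip2 O f (phi j)).
Implicit Types (c : int * int -> R[i]) (s : R).
Let mO : measurable (O : set (RR R)) := measurable_Omega r.
Let H : inner_space (L2 O) (ip2 O) := L2_inner mO.
Let Lphi := L2_phij_Omega alpha r0.

Lemma fset_sub_ZN (s : seq (int * int)) : exists n, {subset s <= ZN n}.
Proof.
elim: s => [|j s [n hn]]; first by exists 0%N => x; rewrite in_nil.
have [m hm] := ZN_exh j; exists (maxn m n) => x; rewrite inE => /orP[/eqP->|/hn xn].
- exact: (ZN_mono (leq_maxl m n)).
- exact: (ZN_mono (leq_maxr m n)).
Qed.

Lemma esum_ZN_le (a : int * int -> R) (T : R) : (forall j, 0 <= a j) ->
  (forall n, \sum_(j <- ZN n) a j <= T) ->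
  (\esum_(j in [set: int * int]) (a j)%:E <= T%:E)%E.
Proof.
move=> a0 hT; rewrite /esum; apply: ge_ereal_sup => _ [X [fX _] <-].
rewrite fsbig_finite//= sumEFin lee_fin.
have [n hn] := fset_sub_ZN (fset_set X).
by apply: le_trans (hT n); exact: fset_sum_sub.
Qed.

Lemma ZN_le_esum (a : int * int -> R) n :
  ((\sum_(j <- ZN n) a j)%:E <= \esum_(j in [set: int * int]) (a j)%:E)%E.
Proof.
apply: ereal_sup_ubound; exists (Z2N n); first by split; [exact: finite_Z2N|].
by rewrite fsbig_finite ?sumEFin//; exact: finite_Z2N.
Qed.

Lemma hterm_ge0 s c j : 0 <= hweight s j * sqnormc (c j).
Proof. by rewrite mulr_ge0 ?powR_ge0 ?sqnormc_ge0. Qed.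

Lemma Hnorm_le s f (t : R) : 0 <= t ->
  (forall n, \sum_(j <- ZN n) hweight s j * sqnormc (ip2 O f (phi j)) <= t ^+ 2) ->
  (Hnorm alpha r s f <= t%:E)%E.
Proof.
move=> t0 hT; have h := esum_ZN_le (fun j => hterm_ge0 s (coefs f) j) hT.
have e0 : (0 <= \esum_(j in [set: int * int]) (hweight s j * sqnormc (ip2 O f (phi j)))%:E)%E.
  by apply: esum_ge0 => j _; rewrite lee_fin; exact: (hterm_ge0 s (coefs f)).
have -> : t%:E = ((t ^+ 2)%:E `^ 2^-1)%E.
  by rewrite poweR_EFin powR12_sqrt ?sqr_ge0// sqrtr_sqr ger0_norm.
apply: gt0_ler_poweR => //.
- by rewrite in_itv/= e0 leey.
- by rewrite in_itv/= lee_fin sqr_ge0 leey.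
Qed.

(** In the finite case the norm is turned into bounds on finite sums, the form in which all
    estimates are made. *)
Lemma Hnorm_cases s f : Hnorm alpha r s f = +oo%E \/
  exists t : R, [/\ 0 <= t, Hnorm alpha r s f = t%:E &
    forall n, \sum_(j <- ZN n) hweight s j * sqnormc (ip2 O f (phi j)) <= t ^+ 2].
Proof.
have e0 : (0 <= \esum_(j in [set: int * int]) (hweight s j * sqnormc (ip2 O f (phi j)))%:E)%E.
  by apply: esum_ge0 => j _; rewrite lee_fin; exact: (hterm_ge0 s (coefs f)).
have hE := @ZN_le_esum (fun j => hweight s j * sqnormc (ip2 O f (phi j))).
have HE : Hnorm alpha r s f = ((\esum_(j in [set: int * int])
  (hweight s j * sqnormc (ip2 O f (phi j)))%:E) `^ 2^-1)%E by [].
move: e0 hE HE; case: (\esum_(j in _) _) => [E| |].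
- rewrite lee_fin => E0 hE HE; right; exists (Num.sqrt E); split; first exact: sqrtr_ge0.
  + by rewrite HE poweR_EFin powR12_sqrt.
  + by move=> n; rewrite sqr_sqrtr// -lee_fin; exact: hE.
- by move=> _ _ HE; left; rewrite HE poweRyr// invr_eq0 pnatr_eq0.
- by [].
Qed.

Lemma hweight1 (j : int * int) : hweight 1 j = 1 + (j.1%:~R ^+ 2 + j.2%:~R ^+ 2) :> R.
Proof. by rewrite /hweight powRr1// addr_ge0 ?addr_ge0 ?sqr_ge0. Qed.

Lemma hweight_equiv : exists2 c : R, 0 < c &
  forall j, wgt j <= c * hweight 1 j /\ hweight 1 j <= c * wgt j.
Proof.
have pi0 := pi_gt0 R.
pose P : R := pi ^+ 2 / r ^+ 2; pose P' : R := r ^+ 2 / pi ^+ 2.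
have P0 : 0 < P by rewrite divr_gt0// exprn_gt0.
have P'0 : 0 < P' by rewrite divr_gt0// exprn_gt0.
have n1 : pi ^+ 2 != 0 :> R by rewrite expf_neq0// gt_eqF.
have n2 : r ^+ 2 != 0 by rewrite expf_neq0// gt_eqF.
have PP : P' * P = 1 by rewrite /P /P' mulrA divfK// divff.
have a0 := sqr_ge0 alpha.
exists (3 + 2 * alpha ^+ 2 + P + P').
  by apply: addr_gt0 => //; apply: addr_gt0 => //; apply: ltr_pwDl => //; exact: mulr_ge0.
move=> j; rewrite hweight1 /weight /xi.
have -> : (j.2%:~R * pi / r) ^+ 2 = P * j.2%:~R ^+ 2 by rewrite /P; field; rewrite gt_eqF.
by apply: weight_arith => //; exact: ltW.
Qed.

Lemma wbounded_lin a c c' (B B' : R) : wbd c B -> wbd c' B' ->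
  wbd (fun j => a * c j + c' j) (2 * (sqnormc a * B + B')).
Proof.
move=> hB hB' n; apply: le_trans (_ : \sum_(j <- ZN n) 2 * (sqnormc a * (wgt j * sqnormc (c j)) +
    wgt j * sqnormc (c' j)) <= _).
  apply: ler_sum => j _; have := sqnormcD (a * c j) (c' j); rewrite sqnormcM.
  have := weight_ge1 (xi alpha r) j.
  move: (wgt j) (sqnormc (a * c j + c' j)) (sqnormc a) (sqnormc (c j)) (sqnormc (c' j)) => w x y z t w1 h.
  have -> : 2 * (y * (w * z) + w * t) = w * (2 * (y * z + t)) by ring.
  by apply: ler_wpM2l => //; apply: le_trans w1.
rewrite -mulr_sumr big_split /= -mulr_sumr ler_pM2l//; apply: lerD => //.
by apply: ler_wpM2l; [exact: sqnormc_ge0|exact: hB].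
Qed.

Lemma wbounded_term c (B : R) j : wbd c B -> wgt j * sqnormc (c j) <= B.
Proof.
move=> hB; have [n jn] := ZN_exh j; apply: le_trans (hB n).
rewrite (bigD1_seq j) ?fset_uniq//= lerDl; apply: sumr_ge0 => i _.
by rewrite mulr_ge0 ?sqnormc_ge0// (le_trans _ (weight_ge1 _ _)).
Qed.

Lemma wbounded0_eq0 c : wbd c 0 -> forall j, c j = 0.
Proof.
move=> h j; apply: sqnormc_eq0; apply/eqP; rewrite eq_le sqnormc_ge0 andbT.
apply: le_trans (wbounded_term j h).
by rewrite ler_peMl ?sqnormc_ge0// weight_ge1.
Qed.

Lemma Hper_wbd f : Hper alpha r 1 f -> L2 O f /\ exists2 B, 0 <= B & wbd (coefs f) B.
Proof.
move=> [Lf hf]; split => //; have [cw cw0 hcw] := hweight_equiv.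
case: (Hnorm_cases 1 f) => [E|[t [t0 _ ht]]]; first by move: hf; rewrite E.
exists (cw * t ^+ 2) => [|n]; first by rewrite mulr_ge0 ?sqr_ge0// ltW.
apply: le_trans (_ : cw * \sum_(j <- ZN n) hweight 1 j * sqnormc (ip2 O f (phi j)) <= _).
  rewrite mulr_sumr; apply: ler_sum => j _; rewrite mulrA.
  by apply: ler_wpM2r; [exact: sqnormc_ge0|exact: (hcw j).1].
by rewrite ler_pM2l.
Qed.

Lemma Hnorm_wbd (cw : R) f (t B : R) : 0 < cw -> (forall j, hweight 1 j <= cw * wgt j) -> 0 <= t ->
  cw * B <= t ^+ 2 -> wbd (coefs f) B -> (Hnorm alpha r 1 f <= t%:E)%E.
Proof.
move=> cw0 hcw t0 Bt hB; apply: Hnorm_le => // n; apply: le_trans Bt.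
apply: le_trans (_ : cw * \sum_(j <- ZN n) wgt j * sqnormc (ip2 O f (phi j)) <= _).
  rewrite mulr_sumr; apply: ler_sum => j _; rewrite mulrA.
  by apply: ler_wpM2r; [exact: sqnormc_ge0|exact: hcw].
by rewrite ler_pM2l.
Qed.

Lemma wbd_Hper f (B : R) : L2 O f -> wbd (coefs f) B -> Hper alpha r 1 f.
Proof.
move=> Lf hB; split => //; have [cw cw0 hcw] := hweight_equiv.
have B0 : 0 <= B.
  apply: le_trans (wbounded_term (0, 0) hB).
  by rewrite mulr_ge0 ?sqnormc_ge0// (le_trans _ (weight_ge1 _ _)).
apply: le_lt_trans (Hnorm_wbd cw0 (fun j => (hcw j).2) (sqrtr_ge0 (cw * B)) _ hB) (ltry _).
by rewrite sqr_sqrtr// mulr_ge0// ltW.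
Qed.

Lemma TN_partial_sum N w : TN alpha r N w <-> exists c, w = partial_sum alpha r c N.
Proof.
have E c x : \sum_(j \in Z2N N) (c j * phi j x) = partial_sum alpha r c N x.
  by rewrite partial_sumE fsbig_finite//; exact: finite_Z2N.
split=> -[c hc]; exists c; first by apply/funext => x; rewrite hc E.
by move=> x; rewrite hc E.
Qed.

Lemma L2_partial_sum c n : L2 O (partial_sum alpha r c n).
Proof. by apply: (spanS H) => j; apply: (innerZ H); exact: Lphi. Qed.

Lemma coef_partial_sum c n j :
  ip2 O (partial_sum alpha r c n) (phi j) = if j \in ZN n then c j else 0.
Proof. by rewrite (ip_comb H Lphi (ip2_phij alpha r0))//; exact: fset_uniq. Qed.

Lemma coefB f g j : L2 O f -> L2 O g ->
  ip2 O (f \- g) (phi j) = ip2 O f (phi j) - ip2 O g (phi j).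
Proof. by move=> Lf Lg; exact: (ipBl H). Qed.

(** Against a trigonometric polynomial the sums over squares are eventually constant, so no
    convergence question arises for f. *)
Lemma Hinner_supported s f w N : supported ZN N (coefs w) ->
  Hinner alpha r s f w = \sum_(j <- ZN N) (hweight s j)%:C * ip2 O f (phi j) * (ip2 O w (phi j))^*.
Proof.
move=> hw; set S := RHS; rewrite /Hinner /clim.
pose a n : R[i] := \sum_(j \in [set j : int * int | (`|j.1| <= n%:Z) && (`|j.2| <= n%:Z)])
  ((hweight s j)%:C * fhat alpha r f j * (fhat alpha r w j)^*).
have ha : \forall n \near \oo, a n = S.
  near=> n; rewrite /a -(fsbig_widen (Z2N N)).
  - by rewrite fsbig_finite//; exact: finite_Z2N.
  - have : (N <= n)%N by near: n; exact: nbhs_infty_ge.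
    move=> Nn j; rewrite /Z2N /= => /and4P[h1 h2 h3 h4]; lia.
  - move=> j [_ hj] /=; rewrite [fhat _ _ w j]hw ?rmorph0 ?mulr0//.
    by apply/negP; rewrite in_fset_set ?inE//; exact: finite_Z2N.
rewrite [LHS](_ : _ = complex.Re S +i* complex.Im S); first by case: (S).
congr (_ +i* _); apply: lim_near_cst => //; apply: filterS ha => n h;
  first [exact: (congr1 (@complex.Re R) h)|exact: (congr1 (@complex.Im R) h)].
Unshelve. all: by end_near. Qed.

(** Testing with a single basis function isolates one coefficient times a positive weight. The weak
    Galerkin equations are therefore equalities of the coefficients in Z_N. *)
Lemma Hinner_eq s f g N : (forall w, TN alpha r N w -> Hinner alpha r s f w = Hinner alpha r s g w) <->
  forall j, j \in ZN N -> ip2 O f (phi j) = ip2 O g (phi j).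
Proof.
have sup c : supported ZN N (coefs (partial_sum alpha r c N)).
  by move=> j jN; rewrite coef_partial_sum (negbTE jN).
split=> [h j jN|h w /TN_partial_sum[c ->]]; last first.
  rewrite !(Hinner_supported _ _ (sup c)); apply: eq_big_seq => j jN; by rewrite h.
pose w := partial_sum alpha r (fun i => (i == j)%:R) N.
have hT : TN alpha r N w by apply/TN_partial_sum; exists (fun i => (i == j)%:R).
have E f' : Hinner alpha r s f' w = (hweight s j)%:C * ip2 O f' (phi j).
  rewrite (Hinner_supported _ _ (sup _)) (bigD1_seq j) ?fset_uniq//= big1 ?addr0.
    by rewrite coef_partial_sum jN eqxx rmorph1 mulr1.
  by move=> i ij; rewrite coef_partial_sum (negbTE ij); case: (i \in _); rewrite rmorph0 mulr0.
have := h w hT; rewrite !E => /mulfI; apply.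
rewrite (_ : 0 = 0%:C)// (inj_eq (@complexI _)) gt_eqF// powR_gt0//.
by rewrite ltr_wpDr ?addr_ge0 ?sqr_ge0.
Qed.

(** Outside Z_N one has N^2 <= 4 (1 + |j|^2), hence N^(2 s) <= 4 (1 + |j|^2)^s for s <= 1. *)
Lemma hweight_tail (s : R) N j : (0 < N)%N -> 0 <= s <= 1 -> j \notin ZN N ->
  hweight 1 j <= (2 * N%:R `^ (- s)) ^+ 2 * hweight (1 + s) j.
Proof.
move=> N0 /andP[s0 s1] jN.
pose h : R := 1 + (j.1%:~R ^+ 2 + j.2%:~R ^+ 2).
have h0 : 0 < h by rewrite /h ltr_wpDr ?addr_ge0 ?sqr_ge0.
have N0' : 0 < N%:R :> R by rewrite ltr0n.
have hN : N%:R * N%:R <= 4 * h.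
  have hz : ((N%:Z * N%:Z) <= 4 * (1 + (j.1 ^+ 2 + j.2 ^+ 2)))%R.
    move: jN; rewrite in_ZN; move: (j.1) (j.2) => a b hab; nia.
  have : (N%:Z * N%:Z)%:~R <= (4 * (1 + (j.1 ^+ 2 + j.2 ^+ 2)))%:~R :> R by rewrite ler_int.
  by rewrite !(rmorphM, rmorphD, rmorphXn) /=.
have E : hweight (1 + s) j = h * h `^ s.
  rewrite /hweight -/h powRD ?powRr1 ?ltW//; by rewrite (gt_eqF h0) implybT.
have -> : hweight 1 j = h by rewrite hweight1.
rewrite E powRN; set y := N%:R `^ s.
have y0 : 0 < y by exact: powR_gt0.
have hy : y * y <= 4 * h `^ s.
  rewrite /y -powRM ?ler0n//; apply: le_trans (_ : (4 * h) `^ s <= _).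
    by apply: ge0_ler_powR => //; rewrite nnegrE ?mulr_ge0 ?ler0n// ltW.
  have -> : (4 * h) `^ s = 4 `^ s * h `^ s by rewrite powRM//; exact: ltW.
  apply: ler_wpM2r; first exact: powR_ge0.
  by rewrite -[leRHS](powRr1 (a := 4))//; apply: ler_powR => //; rewrite ler1n.
have -> : (2 * y^-1) ^+ 2 * (h * h `^ s) = (4 * h `^ s) / (y * y) * h by field; rewrite gt_eqF.
by rewrite ler_pMl// ler_pdivlMr ?mulr_gt0// mul1r.
Qed.

(** The truncated Fourier series of u is the competitor. *)
Lemma best_approx_rate (s : R) N u : (0 < N)%N -> 0 <= s <= 1 -> L2 O u ->
  (best_approx alpha r N u <= (2 * N%:R `^ (- s))%:E * Hnorm alpha r (1 + s) u)%E.
Proof.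
move=> N0 hs Lu; have x0 : 0 < 2 * N%:R `^ (- s) :> R by rewrite mulr_gt0// powR_gt0// ltr0n.
case: (Hnorm_cases (1 + s) u) => [->|[t [t0 -> ht]]]; first by rewrite gt0_muley ?lte_fin// leey.
pose w := partial_sum alpha r (coefs u) N.
apply: ge_ereal_inf; exists (Hnorm alpha r 1 (w \- u)).
  by exists w => //; apply/TN_partial_sum; exists (coefs u).
rewrite -EFinM; apply: Hnorm_le => [|n]; first by rewrite mulr_ge0// ltW.
rewrite exprMn; apply: le_trans (_ : (2 * N%:R `^ (- s)) ^+ 2 *
    \sum_(j <- ZN n) hweight (1 + s) j * sqnormc (ip2 O u (phi j)) <= _); last first.
  by apply: ler_wpM2l; [exact: sqr_ge0|exact: ht].
rewrite mulr_sumr; apply: ler_sum => j _.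
rewrite coefB//; last exact: L2_partial_sum.
rewrite coef_partial_sum; have [jN|jN] := boolP (j \in ZN N).
  rewrite subrr sqnormc0 mulr0 mulr_ge0 ?sqr_ge0//; exact: (hterm_ge0 _ (coefs u)).
rewrite sub0r sqnormcN mulrA; apply: ler_wpM2r; first exact: sqnormc_ge0.
exact: hweight_tail.
Qed.

End sobolev_norm.

(** * Injectivity of the periodized operator *)

Section operators.
Variables (R : realType) (k alpha rho r : R) (chi : R -> R).
Hypothesis r0 : 0 < r.
Hypothesis rho0 : 0 < rho.
Hypothesis rho_lt : 2 * rho < r.
Hypothesis chi_cutoff : cutoff rho r chi.
Hypothesis nonres : forall j : int, k ^+ 2 != alphaj alpha j ^+ 2.
Variables (D : set (R * R)) (q : R * R -> R) (M : R).
Hypothesis oD : open D.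
Hypothesis D_sub : D `<=` Omega rho.
Hypothesis q_out : forall x, ~ D x -> q x = 0.
Hypothesis q_ge0 : forall x, 0 <= q x.
Hypothesis q_le : forall x, `|q x| <= M.
Hypothesis mq : measurable_fun (setT : set (RR R)) q.
Local Notation phi := (phij alpha r).
Local Notation O := (Omega r).
Local Notation kp := (kap k alpha r chi).
Local Notation spot := (scalar_pot k alpha r chi).
Local Notation wgt := (weight (xi alpha r)).
Local Notation wbd := (wbounded ZN (xi alpha r)).
Local Notation gcoef := (grad_coef (xi alpha r)).
Local Notation lper := (Lper k alpha r chi).
Let mO : measurable (O : set (RR R)) := measurable_Omega r.
Let oO : open (O : set (R * R)) := @open_Omega R r.
Let mD : measurable (D : set (RR R)) := measurable_open oD.
Let H : inner_space (L2 O) (ip2 O) := L2_inner mO.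
Let HB := Omega_basis alpha r0.
Let Lphi := L2_phij_Omega alpha r0.
Let klim := kap_lim r0 rho0 chi_cutoff nonres.

Lemma D_sub_Omega : D `<=` O.
Proof.
have r1 : rho < r by apply: lt_trans rho_lt; rewrite ltr_pMl// ltr1n.
move=> x /D_sub; rewrite /Omega /= => /andP[-> /andP[h1 h2]] /=.
by rewrite (lt_trans h2 r1) andbT; apply: lt_trans h1; rewrite ltrN2.
Qed.
Let DO := D_sub_Omega.

Definition lper_coef (f : R * R -> R[i] * R[i]) (j : int * int) : R[i] :=
  kp j * \sum_(b : bool) (0 +i* xi alpha r b j) * ip2 O (fun x => if b then (f x).2 else (f x).1) (phi j).

Lemma spot_wbounded f : L2 O f -> exists B, wbd (fun j => ip2 O (spot f) (phi j)) B.
Proof.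
move=> Lf; have [K K0 hK] := wkap_bounded klim; exists (K * nsq (ip2 O) f) => n.
apply: le_trans (_ : K * \sum_(j <- ZN n) sqnormc (ip2 O f (phi j)) <= _).
  rewrite mulr_sumr; apply: ler_sum => j _.
  rewrite (scalar_pot_fourier r0 rho0 chi_cutoff nonres Lf).2 sqnormcM mulrA.
  apply: ler_wpM2r; first exact: sqnormc_ge0.
  apply: le_trans (hK j); rewrite sqnormcM sqnormc_real; apply: ler_wpM2r; first exact: sqnormc_ge0.
  have := weight_ge1 (xi alpha r) j; move: (wgt j) => y y1; nra.
by rewrite ler_pM2l//; apply: (bessel H Lphi (ip2_phij alpha r0)) => //; exact: fset_uniq.
Qed.

(** Both component potentials have coefficients of H^1 size, because weight times [kap] is bounded;
    hence they have weak gradients, and the divergence, although an arbitrary choice in [lper], is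
    known almost everywhere. *)
Lemma lper_spec f : L2vec O f -> exists v, [/\ is_wdiv O (vpot O (Ksm k alpha r chi) f) v,
  aeq O (lper f) v, L2 O (lper f) & forall j, ip2 O (lper f) (phi j) = lper_coef f j].
Proof.
move=> [L1 L2']; have [LV1 c1] := scalar_pot_fourier r0 rho0 chi_cutoff nonres L1.
have [LV2 c2] := scalar_pot_fourier r0 rho0 chi_cutoff nonres L2'.
have [B1 hB1] := spot_wbounded L1; have [B2 hB2] := spot_wbounded L2'.
have [U [G1 [G2 [_ fG1 _ _ [_ w1 e1 _]]]]] := wgrad_H1 r0 LV1 hB1.
have [U' [G1' [G2' [_ _ fG2 _ [_ w2 _ e2]]]]] := wgrad_H1 r0 LV2 hB2.
pose g1 := wgrad O (spot (fun x => (f x).1)); pose g2 := wgrad O (spot (fun x => (f x).2)).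
have hdiv : is_wdiv O (vpot O (Ksm k alpha r chi) f) (fun x => (g1 x).1 + (g2 x).2).
  exact: (@is_wdiv_wgrad _ O (vpot O (Ksm k alpha r chi) f) g1 g2 oO w1 w2).
have [hw he] := wdivP oO hdiv.
have [LG1 d1] := fourier_coef r0 fG1; have [LG2 d2] := fourier_coef r0 fG2.
have LG : L2 O (G1 + G2') by exact: (innerD H LG1 LG2).
have heG : aeq O (lper f) (G1 + G2').
  apply: (aeq_trans he); move: e1 e2; apply: filterS2 => x h1 h2 Ox.
  by rewrite [RHS](_ : _ = G1 x + G2' x)// -h1// -h2.
have mL : cmeasurable O (lper f) by case: hw => _ _ lw _; exact: loc_integrable_measurable lw.
have LL : L2 O (lper f) by exact: (L2_aeq mO mL (aeq_sym heG) LG).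
exists (fun x => (g1 x).1 + (g2 x).2); split => // j.
rewrite (ip2_aeq mO LL LG (Lphi j) (Lphi j) heG (aeq_refl _ _)) (inner_ipD H)// d1 d2.
by rewrite /grad_coef c1 c2 /lper_coef big_bool /=; ring.
Qed.

Lemma lper_coef_wbounded f : L2vec O f -> exists B, wbd (lper_coef f) B.
Proof.
move=> [L1 L2']; have [K K0 hK] := wkap_bounded klim.
exists (2 * K * (nsq (ip2 O) (fun x => (f x).1) + nsq (ip2 O) (fun x => (f x).2))) => n.
apply: le_trans (_ : 2 * K * \sum_(j <- ZN n) (sqnormc (ip2 O (fun x => (f x).1) (phi j)) +
    sqnormc (ip2 O (fun x => (f x).2) (phi j))) <= _).
  rewrite mulr_sumr; apply: ler_sum => j _; rewrite /lper_coef big_bool /= sqnormcM.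
  have h := sqnormcD ((0 +i* xi alpha r true j) * ip2 O (fun x => (f x).2) (phi j))
    ((0 +i* xi alpha r false j) * ip2 O (fun x => (f x).1) (phi j)).
  rewrite !sqnormcM !sqnormci in h; have := hK j; rewrite sqnormcM sqnormc_real => hk.
  have w1 := weight_ge1 (xi alpha r) j.
  have wE : wgt j = 1 + (xi alpha r false j ^+ 2 + xi alpha r true j ^+ 2) by [].
  have s1 := sqr_ge0 (xi alpha r false j); have s2 := sqr_ge0 (xi alpha r true j).
  have p0 := sqnormc_ge0 (kp j); have a0 := sqnormc_ge0 (ip2 O (fun x => (f x).1) (phi j)).
  have b0 := sqnormc_ge0 (ip2 O (fun x => (f x).2) (phi j)).
  move: h hk w1 wE s1 s2 p0 a0 b0; move: (sqnormc (_ + _)) (sqnormc (kp j)) (wgt j).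
  move: (sqnormc _) (sqnormc _) (_ ^+ 2) (_ ^+ 2) => b a y z S p w h hk w1 wE s1 s2 p0 a0 b0.
  apply: le_trans (_ : w * (p * (2 * (w * b + w * a))) <= _).
    apply: ler_wpM2l; first by lra.
    apply: ler_wpM2l => //; apply: le_trans h _; nra.
  have -> : w * (p * (2 * (w * b + w * a))) = 2 * (w ^+ 2 * p) * (a + b) by ring.
  by rewrite [a + b]addrC; apply: ler_wpM2r; [lra|rewrite ler_pM2l].
rewrite big_split /=; apply: ler_wpM2l; first by rewrite mulr_ge0// ltW.
by apply: lerD; apply: (bessel H Lphi (ip2_phij alpha r0)) => //; exact: fset_uniq.
Qed.

Definition mulq (f : R * R -> R[i]) (x : R * R) : R[i] := (q x)%:C * f x.

Lemma cmeasurable_q A : cmeasurable A (fun x => (q x)%:C).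
Proof. by apply: cmeasurable_sub; apply: (@cmeasurable_real _ setT). Qed.

Lemma sqnormc_q x : sqnormc (q x)%:C <= M ^+ 2.
Proof.
rewrite sqnormc_real -(real_normK (num_real (q x))) lerXn2r ?nnegrE ?q_le//.
exact: le_trans (q_le x).
Qed.

Lemma L2_mulq f : L2 O f -> L2 O (mulq f).
Proof.
move=> Lf; apply: (@L2_bounded_mul _ _ mO f (fun x => (q x)%:C) (M ^+ 2)) => //; first exact: cmeasurable_q.
by move=> x _; exact: sqnormc_q.
Qed.

Lemma mulq_sym f g : L2 O f -> L2 O g -> ip2 O (mulq f) g = ip2 O f (mulq g).
Proof.
move=> _ _; apply: eq_cint => x _; rewrite /mulq rmorphM /= JrealC; ring.
Qed.

Lemma mulq_ge0 f : L2 O f -> 0 <= complex.Re (ip2 O (mulq f) f).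
Proof.
move=> _; apply: Rintegral_ge0 => x _; rewrite /mulq -mulrA mulcJ.
by rewrite -rmorphM /= mulr_ge0// sqnormc_ge0.
Qed.

Lemma mulq_bounded f : L2 O f -> nsq (ip2 O) (mulq f) <= M ^+ 2 * nsq (ip2 O) f.
Proof.
move=> Lf; have Lg : L2 O (M%:C *: f) by exact: (innerZ H).
apply: le_trans (nsq_le (L2_mulq Lf) Lg _) _ => [x _|].
  rewrite [(M%:C *: f) x](_ : _ = M%:C * f x)// !sqnormcM.
  by apply: ler_wpM2r; [exact: sqnormc_ge0|rewrite (sqnormc_real M); exact: sqnormc_q].
by rewrite (nsqZ H)// sqnormc_real.
Qed.

Local Notation A := (galerkin_op (L2 O) (ip2 O) phi mulq (xi alpha r) kp).

(** The bridge between the function-level operator and the abstract one; [galerkin_opE] absorbs the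
    freedom in the choice of the gradient. *)
Lemma per_op_spec u B : L2 O u -> wbd (fun j => ip2 O u (phi j)) B ->
  [/\ L2vec O (rscale q (wgrad O u)), L2 O (per_op k alpha r chi q u) &
      forall j, ip2 O (per_op k alpha r chi q u) (phi j) = A (fun j => ip2 O u (phi j)) j].
Proof.
move=> Lu hB; have [U [G1 [G2 [fU fG1 fG2 hw [uU w e1 e2]]]]] := wgrad_H1 r0 Lu hB.
have [LG1 d1] := fourier_coef r0 fG1; have [LG2 d2] := fourier_coef r0 fG2.
have [_ l1 l2 _] := w.
have Lw1 : L2 O (fun x => (wgrad O u x).1).
  by apply: (L2_aeq mO _ (aeq_sym e1) LG1); exact: loc_integrable_measurable l1.
have Lw2 : L2 O (fun x => (wgrad O u x).2).
  by apply: (L2_aeq mO _ (aeq_sym e2) LG2); exact: loc_integrable_measurable l2.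
have Lq : L2vec O (rscale q (wgrad O u)) by split; exact: L2_mulq.
have [v [_ _ LL cL]] := lper_spec Lq.
have LP : L2 O (per_op k alpha r chi q u) by exact: (SB H Lu LL).
split => // j.
rewrite [LHS](_ : _ = ip2 O (u - lper (rscale q (wgrad O u))) (phi j))// (ipBl H)// cL.
have Sg : forall b : bool, L2 O (if b then G2 else G1) by case.
have cg : forall (b : bool) i, ip2 O (if b then G2 else G1) (phi i) =
    gcoef b (fun j => ip2 O u (phi j)) i by case.
have -> := @galerkin_opE R _ (L2 O) (ip2 O) _ phi ZN H HB mulq (xi alpha r) kp L2_mulq mulq_sym
  (fun j => ip2 O u (phi j)) j (fun b => if b then G2 else G1) Sg cg.
congr (_ - _ * _); apply: eq_bigr => b _; congr (_ * _).
have q1 f g : aeq O f g -> aeq O (mulq f) (mulq g).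
  by apply: filterS => x h Ox; rewrite /mulq h.
case: b.
- by apply: (ip2_aeq mO (L2_mulq Lw2) (L2_mulq LG2) (Lphi j) (Lphi j)) => //; [exact: q1|exact: aeq_refl].
- by apply: (ip2_aeq mO (L2_mulq Lw1) (L2_mulq LG1) (Lphi j) (Lphi j)) => //; [exact: q1|exact: aeq_refl].
Qed.

(** Two points of D differ by less than 2 rho < r in x2, where the cutoff is 1 and [wrap] is the
    identity. *)
Lemma Ksm_green (x y : R * R) : D x -> D y -> Ksm k alpha r chi (x - y) = green k alpha (x - y).
Proof.
move=> /D_sub/andP[_ /andP[x1 x2]] /D_sub/andP[_ /andP[y1 y2]].
have h : `|x.2 - y.2| < 2 * rho by rewrite ltr_norml; lra.
rewrite /Ksm /KR [(x - y).2](_ : _ = x.2 - y.2)//.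
have -> : chi (x.2 - y.2) = 1 by case: chi_cutoff => _ _ _ -> //; exact: ltW.
rewrite mul1r; congr (green _ _ _); rewrite [RHS]surjective_pairing; congr (_, _).
rewrite /Defs.wrap (_ : Num.floor _ = 0); first by rewrite mulr0 subr0.
apply: floor_def; move: h; rewrite ltr_norml => /andP[h1 h2].
have r2 : 0 < 2 * r by rewrite mulr_gt0.
rewrite (_ : (0 + 1)%:~R = 1 :> R)// (_ : 0%:~R = 0 :> R)// ltr_pdivrMr// mul1r.
have := rho_lt; move: h1 h2; move: (x.2 - y.2) => d h1 h2 h3.
by apply/andP; split; [apply: divr_ge0|]; lra.
Qed.

(** The fluxes are compared almost everywhere only, because the gradients chosen on D and on the
    cell are independent representatives. The potentials then coincide at every point of D, and weak
    divergences restrict to open subsets. *)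
Lemma Lop_Lper g f : L2vec O f -> (forall x, ~ D x -> f x = (0, 0)) ->
  cmeasurable D (fun x => (g x).1) -> cmeasurable D (fun x => (g x).2) ->
  aeq D (fun x => (g x).1) (fun x => (f x).1) -> aeq D (fun x => (g x).2) (fun x => (f x).2) ->
  aeq D (Lop k alpha D g) (lper f).
Proof.
move=> Lf f0 m1 m2 e1 e2; have [v [hdiv hv LL _]] := lper_spec Lf.
have hcint x (a b : R * R -> R[i]) : D x -> (forall y, ~ D y -> b y = 0) -> cmeasurable D a ->
    cmeasurable D b -> aeq D a b ->
    cint D (fun y => green k alpha (x - y) * a y) = cint O (fun y => Ksm k alpha r chi (x - y) * b y).
  move=> Dx b0 ma mb ab; rewrite (cint_sub DO); last by move=> y _ /b0 ->; rewrite mulr0.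
  have mK : cmeasurable D (fun y => Ksm k alpha r chi (x - y)).
    have [[mk _] _] := kernel_conj_L2 r0 rho0 chi_cutoff nonres (DO Dx).
    have := cmeasurableJ mk; rewrite /kernel_conj => -[k1 k2].
    by split; [move: k1|move: k2]; move=> /(measurable_funS mO DO); apply: eq_measurable_fun => y _; rewrite conjCK.
  rewrite (@eq_cint _ _ _ (fun y => Ksm k alpha r chi (x - y) * a y)); last by move=> y Dy; rewrite Ksm_green.
  apply: (cint_aeq mD); do ?exact: cmeasurableM.
  by apply: filterS ab => y h Dy; rewrite h.
have mf b : cmeasurable D (fun x => if b then (f x).2 else (f x).1).
  by case: Lf => -[[a1 a2] _] [[a3 a4] _]; case: b; split; exact: (measurable_funS mO DO).
have V1 x : D x -> (vpot D (green k alpha) g x).1 = (vpot O (Ksm k alpha r chi) f x).1.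
  by move=> Dx; apply: hcint => //; [move=> y /f0 ->|exact: (mf false)].
have V2 x : D x -> (vpot D (green k alpha) g x).2 = (vpot O (Ksm k alpha r chi) f x).2.
  by move=> Dx; apply: hcint => //; [move=> y /f0 ->|exact: (mf true)].
have hD := is_wdiv_sub DO hdiv; have [k1 k2 _ _] := hD.
have hD' : is_wdiv D (vpot D (green k alpha) g) v.
  apply: (is_wdiv_aeq oD _ _ _ _ hD).
  - by apply: eq_cmeasurable (loc_integrable_measurable oD k1) => y Dy; rewrite V1.
  - by apply: eq_cmeasurable (loc_integrable_measurable oD k2) => y Dy; rewrite V2.
  - by apply: aeW => y Dy; rewrite V1.
  - by apply: aeW => y Dy; rewrite V2.
have [_ h] := wdivP oD hD'; apply: (aeq_trans h).
by apply: aeq_sym; apply: filterS hv => y hy /DO.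
Qed.

Hypothesis L_uniq : forall f, L2vec D f ->
  exists_unique_ae D (fun us =>
    H1alpha alpha D us /\ scatter_eq k alpha D q (Lop k alpha D f) us).

Lemma fourier_zero U (c : int * int -> R[i]) : fourier_fun alpha r c U -> (forall j, c j = 0) ->
  aeq O U (fun=> 0).
Proof.
move=> fU c0; have [LU cU] := fourier_coef r0 fU.
apply: (@eq_coef_aeq _ alpha r r0 _ _ LU (inner0 H)) => j.
by rewrite cU c0 (ip0l H).
Qed.

(** The solution is built on the whole plane, so that its restriction to D belongs to [H1alpha];
    there the periodized equation becomes the scattering equation with zero source. *)
Lemma homogeneous_solution c B : wbd c B -> (forall j, A c j = 0) ->
  exists U G1 G2, [/\ fourier_fun alpha r c U, fourier_fun alpha r (gcoef false c) G1,
    fourier_fun alpha r (gcoef true c) G2, is_wgrad setT U (fun x => (G1 x, G2 x)) &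
    H1alpha alpha D U /\ scatter_eq k alpha D q (Lop k alpha D (fun=> (0, 0))) U].
Proof.
move=> hB A0; have [U [G1 [G2 [fU fG1 fG2 hw]]]] := fourier_fun_H1 r0 hB.
exists U, G1, G2; split => //; split; first exact: (fourier_H1alpha r0 D fU fG1 fG2).
have [LU cU] := fourier_coef r0 fU.
have cUE : (fun j => ip2 O U (phi j)) = c by apply/funext.
have hB' : wbd (fun j => ip2 O U (phi j)) B by rewrite cUE.
have [Lq LP cP] := per_op_spec LU hB'.
have P0 : aeq O (per_op k alpha r chi q U) (fun=> 0).
  apply: (@eq_coef_aeq _ alpha r r0 _ _ LP (inner0 H)) => j.
  by rewrite cP cUE A0 (ip0l H).
have [_ wO1 wO2] := wgradP oO (is_wgrad_sub (@subsetT _ O) hw).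
have [wD wD1 wD2] := wgradP oD (is_wgrad_sub (@subsetT _ D) hw).
have [_ l1 l2 _] := wD.
have onD f g : aeq O f g -> aeq D f g by apply: filterS => x h /DO.
have hL : aeq D (Lop k alpha D (rscale q (wgrad D U))) (lper (rscale q (wgrad O U))).
  apply: Lop_Lper => //.
  - by move=> x /q_out q0; rewrite /rscale q0 !mul0r.
  - by apply: cmeasurableM; [exact: cmeasurable_q|exact: loc_integrable_measurable l1].
  - by apply: cmeasurableM; [exact: cmeasurable_q|exact: loc_integrable_measurable l2].
  - move: wD1 (onD _ _ wO1); apply: filterS2 => x h1 h2 Dx /=; congr (_ * _).
    by rewrite h1// h2.
  - move: wD2 (onD _ _ wO2); apply: filterS2 => x h1 h2 Dx /=; congr (_ * _).
    by rewrite h1// h2.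
have L00 : L2vec O (fun=> (0, 0)) by split; exact: (inner0 H).
have h0 : aeq D (Lop k alpha D (fun=> (0, 0))) (fun=> 0).
  have m0 : cmeasurable D (fun=> 0) by exact: cmeasurable_cst.
  have := @Lop_Lper (fun=> (0, 0)) (fun=> (0, 0)) L00 (fun _ _ => erefl) m0 m0 (aeq_refl _ _) (aeq_refl _ _).
  move=> h; apply: (aeq_trans h); apply: onD.
  have [_ [_ _ LL cL]] := lper_spec L00; apply: (@eq_coef_aeq _ alpha r r0 _ _ LL (inner0 H)) => j.
  by rewrite cL /lper_coef big_bool /= !(ip0l H (Lphi j)) !mulr0 addr0 mulr0.
apply: (aeq_trans _ (aeq_sym h0)); move: hL (onD _ _ P0); apply: filterS2 => x h1 h2 Dx.
by rewrite h1//; exact: h2.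
Qed.

(** Uniqueness on D makes the gradient vanish on D; since q vanishes elsewhere, q grad U is null on
    the whole cell, and (A c)_j = 0 reduces to c_j = 0. *)
Lemma A_inj c B : wbd c B -> (forall j, A c j = 0) -> forall j, c j = 0.
Proof.
move=> hB A0 j; have [U [G1 [G2 [fU fG1 fG2 hw PU]]]] := homogeneous_solution hB A0.
have Z0 j' : A (fun=> 0) j' = 0 by exact: (@galerkin_op0 R _ (L2 O) (ip2 O) _ phi ZN H HB mulq (xi alpha r) kp L2_mulq mulq_sym j').
(* That zero solves the homogeneous scattering equation is obtained from the same lemma, applied to
   zero coefficients; uniqueness then compares U with U0. *)
have [U0 [G01 [G02 [fU0 fG01 fG02 hw0 PU0]]]] := homogeneous_solution (@wbounded0 _ _ ZN (xi alpha r)) Z0.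
have L0 : L2vec D (fun=> (0, 0)).
  by split; exact: (inner0 (L2_inner mD)).
have [us [_ hus]] := L_uniq L0.
have UU0 : aeq D U0 U := aeq_trans (hus _ PU0) (aeq_sym (hus _ PU)).
have gz b j' : gcoef b (fun=> 0) j' = 0 by rewrite /grad_coef mulr0.
have z1 := fourier_zero fG01 (gz false); have z2 := fourier_zero fG02 (gz true).
have wU := is_wgrad_sub (@subsetT _ D) hw.
have wU0 : is_wgrad D U (fun x => (G01 x, G02 x)).
  apply: (is_wgrad_aeq oD _ UU0 (is_wgrad_sub (@subsetT _ D) hw0)).
  by case: fU => mU _ _; exact: cmeasurable_sub.
have [_ a1 a2] := wgradP oD wU; have [_ b1 b2] := wgradP oD wU0.
have onD f g : aeq O f g -> aeq D f g by apply: filterS => x h /DO.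
have G10 : aeq D G1 (fun=> 0) := aeq_trans (aeq_trans (aeq_sym a1) b1) (onD _ _ z1).
have G20 : aeq D G2 (fun=> 0) := aeq_trans (aeq_trans (aeq_sym a2) b2) (onD _ _ z2).
have q0 f : aeq D f (fun=> 0) -> aeq O (mulq f) (fun=> 0).
  apply: filterS => x h Ox; rewrite /mulq; have [Dx|/q_out ->] := pselect (D x); last by rewrite mul0r.
  by rewrite h// mulr0.
have [LG1 d1] := fourier_coef r0 fG1; have [LG2 d2] := fourier_coef r0 fG2.
have i0 f : L2 O f -> aeq D f (fun=> 0) -> ip2 O (mulq f) (phi j) = 0.
  move=> Lf /q0 h; rewrite (ip2_aeq mO (L2_mulq Lf) (inner0 H) (Lphi j) (Lphi j) h (aeq_refl _ _)).
  exact: (ip0l H).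
have Sg : forall b : bool, L2 O (if b then G2 else G1) by case.
have cg : forall (b : bool) i, ip2 O (if b then G2 else G1) (phi i) = gcoef b c i by case.
have := A0 j.
have -> := @galerkin_opE R _ (L2 O) (ip2 O) _ phi ZN H HB mulq (xi alpha r) kp L2_mulq mulq_sym
  c j (fun b => if b then G2 else G1) Sg cg.
by rewrite big_bool /= !i0// !mulr0 addr0 mulr0 subr0.
Qed.

Lemma A_lin a c c' B B' j : wbd c B -> wbd c' B' ->
  A (fun i => a * c i + c' i) j = a * A c j + A c' j.
Proof.
exact: (@galerkin_op_lin R _ (L2 O) (ip2 O) _ phi ZN H HB mulq (xi alpha r) kp L2_mulq mulq_sym).
Qed.

Let M20 : 0 <= M ^+ 2 := sqr_ge0 M.

Lemma A_stability : exists2 N0 : nat, (0 < N0)%N & exists2 C : R, 0 < C &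
  forall N c, (N0 <= N)%N -> supported ZN N c ->
  \sum_(j <- ZN N) wgt j * sqnormc (c j) <=
  C * \sum_(j <- ZN N) wgt j * sqnormc (A c j).
Proof. exact: (galerkin_stability H HB L2_mulq mulq_sym mulq_ge0 mulq_bounded M20 klim A_inj). Qed.

Lemma A_surj G B : wbd G B -> exists c, (exists B', wbd c B') /\ forall j, A c j = G j.
Proof. exact: (galerkin_op_surj H HB L2_mulq mulq_sym mulq_ge0 mulq_bounded M20 klim A_inj). Qed.

Lemma A_bounded : exists2 K, 0 < K & forall c B, wbd c B -> wbd (A c) (K * B).
Proof. exact: (galerkin_op_bounded H HB L2_mulq mulq_bounded M20 klim). Qed.

Lemma A_solvable N (C : R) :
  (forall c, supported ZN N c -> \sum_(j <- ZN N) wgt j * sqnormc (c j) <=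
     C * \sum_(j <- ZN N) wgt j * sqnormc (A c j)) ->
  forall G, exists2 c, supported ZN N c & forall j, j \in ZN N -> A c j = G j.
Proof. exact: (galerkin_solvable H HB L2_mulq mulq_sym). Qed.

Local Notation coefs f := (fun j => ip2 O f (phi j)).

Lemma L2vec_extend0 f : L2vec D f -> L2vec O (extend0 D f).
Proof.
have h g : L2 D g -> L2 O (fun x => if `[< D x >] then g x else 0).
  move=> [[m1 m2] hg]; split.
    have m (p : R * R -> R) (p' : R * R -> R) : measurable_fun (D : set (RR R)) p ->
        (forall x, p' x = if `[< D x >] then p x else 0) -> measurable_fun (O : set (RR R)) p'.
      move=> /(measurable_restrictT _ mD) mp hp; apply: (@measurable_funTS _ _ (RR R)).
      apply: eq_measurable_fun mp => x _; rewrite hp patchE.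
      by have [Dx|nDx] := pselect (D x); [rewrite mem_set// asboolT|rewrite memNset// asboolF].
    by split; [apply: (m _ _ m1)|apply: (m _ _ m2)] => x; case: asbool.
  have -> : (\int[leb2 R]_(x in O) (sqnormc (if `[< D x >] then g x else 0))%:E =
      \int[leb2 R]_(x in O `&` D) (sqnormc (g x))%:E)%E.
    rewrite integral_mkcondr; apply: eq_integral => x _; rewrite patchE.
    have [Dx|nDx] := pselect (D x); first by rewrite mem_set// asboolT.
    by rewrite memNset// asboolF// sqnormc0.
  by rewrite setIC (setIidl DO).
move=> [/h h1 /h h2]; split; [move: h1|move: h2]; congr (L2 O _); apply/funext => x;
  by rewrite /extend0; case: asbool.
Qed.

(** Existence is surjectivity of the coefficient operator on H^1 sequences; uniqueness is its
    injectivity applied to the difference of two solutions. *)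
Lemma per_solution g : L2vec O g -> exists_unique_ae O (fun u =>
  Hper alpha r 1 u /\ per_eq k alpha r chi q (lper g) u).
Proof.
move=> Lg; have [v [_ _ LL cL]] := lper_spec Lg; have [B hB] := lper_coef_wbounded Lg.
have [c [[B' hB'] hc]] := A_surj hB.
have [U [G1 [G2 [fU _ _ _]]]] := fourier_fun_H1 r0 hB'.
have [LU cU] := fourier_coef r0 fU.
have cE : coefs U = c by apply/funext.
have hU : wbd (coefs U) B' by rewrite cE.
exists U; split.
  split; first exact: (wbd_Hper r0 LU hU).
  have [_ LP cP] := per_op_spec LU hU.
  apply: (@eq_coef_aeq _ alpha r r0 _ _ LP LL) => j.
  by rewrite cP cL cE hc.
move=> w [/(Hper_wbd r0)[Lw [Bw _ hw]] ew].
have [_ LP cP] := per_op_spec Lw hw.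
apply: (@eq_coef_aeq _ alpha r r0 _ _ Lw LU) => j; rewrite cU.
pose e i := -1 * c i + ip2 O w (phi i).
have he := wbounded_lin (-1) hB' hw.
have e0 : forall i, e i = 0.
  apply: (A_inj he) => i; rewrite (A_lin _ _ hB' hw) hc -cP.
  rewrite (ip2_aeq mO LP LL (Lphi i) (Lphi i) ew (aeq_refl _ _)) cL; ring.
by have := e0 j; rewrite /e mulN1r addrC => /eqP; rewrite subr_eq0 => /eqP.
Qed.

Lemma galerkin_solP N F uN : TN alpha r N uN ->
  (galerkin_sol k alpha r chi q N F uN <->
  forall j, j \in ZN N -> A (coefs uN) j = ip2 O F (phi j)).
Proof.
move=> hT; have [c uE] := (TN_partial_sum alpha r N uN).1 hT.
have LuN : L2 O uN by rewrite uE; exact: L2_partial_sum.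
have sN : supported ZN N (coefs uN).
  by move=> j jN; rewrite uE coef_partial_sum// (negbTE jN).
have [_ LP cP] := per_op_spec LuN (supported_wbounded (xi alpha r) sN).
have HE := Hinner_eq alpha r0 1 (per_op k alpha r chi q uN) F N.
split=> [[_ h] j jN|h]; first by rewrite -cP; exact: (HE.1 h).
by split; [exact: hT|exact: (HE.2 (fun j jN => etrans (cP j) (h j jN)))].
Qed.

Lemma TN_spec N w : TN alpha r N w -> L2 O w /\ supported ZN N (coefs w).
Proof.
move=> /TN_partial_sum[c ->]; split; first exact: L2_partial_sum.
by move=> j jN; rewrite coef_partial_sum// (negbTE jN).
Qed.

(** A Cea estimate: for a competitor w the discrete error uN - w is controlled, by stability, by its
    residual on Z_N, which up to sign is that of w - u, because uN and u have the same image on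
    Z_N. *)
Lemma galerkin_quasioptimal : exists (N0 : nat) (C : R), [/\ (0 < N0)%N, 0 < C &
  forall N F, (N0 <= N)%N -> Hper alpha r 1 F ->
    exists_unique_ae O (galerkin_sol k alpha r chi q N F) /\
    forall uN u, galerkin_sol k alpha r chi q N F uN -> Hper alpha r 1 u ->
      per_eq k alpha r chi q F u ->
      (Hnorm alpha r 1 (uN \- u)%R <= C%:E * best_approx alpha r N u)%E].
Proof.
have [N0 N00 [Cs Cs0 hCs]] := A_stability.
have [K K0 hK] := A_bounded.
have [cw cw0 hcw] := hweight_equiv alpha r0.
(* Stability Cs times continuity K bounds the discrete part and 1 the approximation part; 2 is the
   cost of the triangle inequality for squares, and each cw that of one change of weights. *)
pose C2 := 2 * cw ^+ 2 * (Cs * K + 1).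
have C20 : 0 < C2 by rewrite /C2 !mulr_gt0 ?exprn_gt0// addr_gt0// mulr_gt0.
exists N0, (Num.sqrt C2); split => //; first by rewrite sqrtr_gt0.
move=> N F hN [LF _].
have supB c c' (a : R[i]) : supported ZN N c -> supported ZN N c' ->
    supported ZN N (fun j => a * c j + c' j).
  by move=> h h' j jN; rewrite h// h'// mulr0 addr0.
split.
  have [c sc hc] := A_solvable (fun c => hCs N c hN) (coefs F).
  have hT : TN alpha r N (partial_sum alpha r c N) by apply/TN_partial_sum; exists c.
  have cE : coefs (partial_sum alpha r c N) = c.
    apply/funext => j; rewrite coef_partial_sum//.
    by have [//|jN] := boolP (j \in ZN N); rewrite sc.
  have [L1 s1] := TN_spec hT.
  exists (partial_sum alpha r c N); split; first by apply/(galerkin_solP F hT); rewrite cE.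
  move=> w hw; have hTw : TN alpha r N w by case: hw.
  have [L2' s2] := TN_spec hTw; have h2 := (galerkin_solP F hTw).1 hw.
  apply: (@eq_coef_aeq _ alpha r r0 _ _ L2' L1) => j.
  pose e i := -1 * ip2 O (partial_sum alpha r c N) (phi i) + ip2 O w (phi i).
  have se : supported ZN N e by exact: supB.
  have e0 : wbd e 0.
    move=> n; apply: le_trans (supported_wbounded (xi alpha r) se n) _.
    apply: le_trans (hCs N e hN se) _; rewrite big_seq big1 ?mulr0// => i iN.
    have -> : A e i = -1 * A (coefs (partial_sum alpha r c N)) i + A (coefs w) i.
      exact: (A_lin _ _ (supported_wbounded (xi alpha r) s1) (supported_wbounded (xi alpha r) s2)).
    by rewrite cE hc// h2// mulN1r addNr sqnormc0 mulr0.
  have := wbounded0_eq0 e0 j; rewrite /e mulN1r addrC => /eqP.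
  by rewrite subr_eq0 => /eqP.
move=> uN u hsol hu equ; have hT : TN alpha r N uN by case: hsol.
have [LuN sN] := TN_spec hT; have hA := (galerkin_solP F hT).1 hsol.
have [Lu [Bu _ hBu]] := Hper_wbd r0 hu.
have [_ LP cP] := per_op_spec Lu hBu.
have Au j : A (coefs u) j = ip2 O F (phi j).
  by rewrite -cP (ip2_aeq mO LP LF (Lphi j) (Lphi j) equ (aeq_refl _ _)).
(* The constant is moved to the other side so that the infimum can be bounded below competitor by
   competitor. *)
rewrite -lee_pdivrMl ?sqrtr_gt0//; apply: le_ereal_inf_tmp => _ [w hw <-].
rewrite lee_pdivrMl ?sqrtr_gt0//.
have [Lw sw] := TN_spec hw.
case: (Hnorm_cases alpha r 1 (w \- u)) => [->|[t [t0 -> ht]]].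
  by rewrite gt0_muley ?lte_fin ?sqrtr_gt0// leey.
have wN := supported_wbounded (xi alpha r) sN; have ww := supported_wbounded (xi alpha r) sw.
pose d j := -1 * ip2 O u (phi j) + ip2 O w (phi j).
pose e j := -1 * ip2 O w (phi j) + ip2 O uN (phi j).
have dE j : d j = ip2 O (w \- u) (phi j) by rewrite coefB// /d mulN1r addrC.
have hd : wbd d (cw * t ^+ 2).
  move=> n; apply: le_trans (_ : cw * \sum_(j <- ZN n) hweight 1 j * sqnormc (ip2 O (w \- u) (phi j)) <= _).
    rewrite mulr_sumr; apply: ler_sum => j _; rewrite mulrA dE.
    by apply: ler_wpM2r; [exact: sqnormc_ge0|exact: (hcw j).1].
  by rewrite ler_pM2l.
have se : supported ZN N e by exact: supB.
have Ae j : j \in ZN N -> sqnormc (A e j) = sqnormc (A d j).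
  move=> jN; have -> : A e j = -1 * A (coefs w) j + A (coefs uN) j by exact: (A_lin _ _ ww wN).
  have -> : A d j = -1 * A (coefs u) j + A (coefs w) j by exact: (A_lin _ _ hBu ww).
  by rewrite hA// Au -[in RHS]sqnormcN; congr sqnormc; ring.
have he : wbd e (Cs * (K * (cw * t ^+ 2))).
  move=> n; apply: le_trans (supported_wbounded (xi alpha r) se n) _.
  apply: le_trans (hCs N e hN se) _; rewrite ler_pM2l//.
  rewrite (eq_big_seq (fun j => wgt j * sqnormc (A d j))); first exact: hK.
  by move=> j jN; exact: (congr1 (fun x => wgt j * x) (Ae j jN)).
have hs : wbd (coefs (uN \- u)) (2 * (sqnormc 1 * (Cs * (K * (cw * t ^+ 2))) + cw * t ^+ 2)).
  have -> : coefs (uN \- u) = (fun j => 1 * e j + d j).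
    by apply/funext => j; rewrite coefB// /e /d; ring.
  exact: wbounded_lin.
rewrite -EFinM; apply: (Hnorm_wbd cw0 (fun j => (hcw j).2) _ _ hs).
  by rewrite mulr_ge0// sqrtr_ge0.
rewrite exprMn sqr_sqrtr; last exact: ltW.
rewrite (_ : sqnormc 1 = 1); last by rewrite /sqnormc /= expr1n expr0n addr0.
rewrite (_ : _ * _ = C2 * t ^+ 2)//; rewrite /C2; ring.
Qed.

End operators.

(** * Measurability of the contrast and assembly of the theorem *)

Lemma measurable_open_cont (R : realType) (A : set (R * R)) (f : R * R -> R) : open A ->
  (forall x, A x -> {for x, continuous f}) -> measurable_fun (A : set (RR R)) f.
Proof.
move=> oA cf; apply: (measurability _ (RGenOInfty.measurableE R)).
move=> _ [_ [a ->] <-]; apply: (@measurable_open R (A `&` f @^-1` `]a, +oo[)).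
rewrite openE => x [Ax fx]; apply: filterI; first exact: open_nbhs_nbhs.
by apply: (cf x Ax); apply: open_nbhs_nbhs; split => //; exact: itv_open.
Qed.

Lemma measurable_extension (R : realType) (A : set (R * R)) (f : R * R -> R) : open A ->
  measurable_fun (A : set (RR R)) f -> (forall x, ~ A x -> f x = 0) ->
  measurable_fun (setT : set (RR R)) f.
Proof.
move=> oA mf f0; have := (measurable_restrictT f (measurable_open oA)).1 mf.
apply: eq_measurable_fun => x _; rewrite patchE.
by have [Ax|nAx] := pselect (A x); [rewrite mem_set|rewrite memNset// f0].
Qed.

Theorem proposition4p1 (R : realType) (k d1 d2 alpha rho rR q0 : R)
    (chi : R -> R) (D : set (R * R)) (q : R * R -> R)
    (k_gt0 : 0 < k)
    (d_unit : d1 ^+ 2 + d2 ^+ 2 = 1) (d2_neq0 : d2 != 0)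
    (alphaE : alpha = k * d1)
    (nonresonant : forall j : int, k ^+ 2 != alphaj alpha j ^+ 2)
    (rho_gt0 : 0 < rho) (rho_lt : 2 * rho < rR)
    (chi_cutoff : cutoff rho rR chi)
    (D_lipschitz : lipschitz_domain D)
    (q_bounded : exists M : R, forall x, `|q x| <= M)
    (q_out : forall x, ~ D x -> q x = 0)
    (q_supp : closure [set x | q x != 0] = closure D)
    (D_sub : closure D `<=` Omega rho)
    (sqrt_q_C21 : C21_closure D (fun x => Num.sqrt (q x)))
    (q0_gt0 : 0 < q0) (q_ge : forall x, D x -> q0 <= q x)
    (D_C21 : C21_domain D)
    (L_uniq_solvable : forall f, L2vec D f ->
       exists_unique_ae D (fun us =>
         H1alpha alpha D us /\ scatter_eq k alpha D q (Lop k alpha D f) us)) :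
  (forall f, L2vec D f ->
     exists_unique_ae (Omega rR) (fun u =>
       Hper alpha rR 1 u /\
       per_eq k alpha rR chi q (Lper k alpha rR chi (extend0 D f)) u)) /\
  exists (N0 : nat) (C C' : R), [/\ (0 < N0)%N, 0 < C, 0 < C' &
    forall (N : nat) (F : R * R -> R[i]), (N0 <= N)%N -> Hper alpha rR 1 F ->
      exists_unique_ae (Omega rR) (galerkin_sol k alpha rR chi q N F) /\
      forall uN u : R * R -> R[i],
        galerkin_sol k alpha rR chi q N F uN ->
        Hper alpha rR 1 u -> per_eq k alpha rR chi q F u ->
        (Hnorm alpha rR 1 (uN \- u)%R <=
           C%:E * best_approx alpha rR N u)%E /\
        forall s : R, 0 <= s < 2^-1 ->
          (C%:E * best_approx alpha rR N u <=
             C'%:E * (N%:R `^ (- s))%:E * Hnorm alpha rR (1 + s) u)%E].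
Proof.
have r0 : 0 < rR by apply: lt_trans rho_lt; rewrite mulr_gt0.
have [[oD _ _] _] := D_lipschitz.
have DO : D `<=` Omega rho by move=> x /subset_closure; exact: D_sub.
have q_ge0 x : 0 <= q x.
  by have [/q_ge|/q_out->//] := pselect (D x); apply: le_trans; exact: ltW.
have [M hM] := q_bounded.
(* On the open set D, q is the square of a continuous function, and it vanishes outside. *)
have mq : measurable_fun (setT : set (RR R)) q.
  apply: (measurable_extension oD) => //; case: sqrt_q_C21 => hC _ _.
  have ms : measurable_fun (D : set (RR R)) (fun x => Num.sqrt (q x)).
    by apply: measurable_open_cont => // x Dx; have [] := hC [::] isT x Dx.
  by apply: eq_measurable_fun (measurable_funX 2 ms) => x _ /=; rewrite sqr_sqrtr.
split=> [f Lf|].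
  apply: (per_solution r0 rho_gt0 rho_lt chi_cutoff nonresonant oD DO q_out q_ge0 hM mq L_uniq_solvable).
  exact: (L2vec_extend0 rho_gt0 rho_lt oD DO).
have [N0 [C [N00 C0 h]]] := galerkin_quasioptimal r0 rho_gt0 rho_lt chi_cutoff nonresonant
  oD DO q_out q_ge0 hM mq L_uniq_solvable.
(* The extra factor 2 is the constant of [best_approx_rate]. *)
exists N0, C, (C * 2); split => // [|N F hN hF]; first by rewrite mulr_gt0.
have [h1 h2] := h N F hN hF; split => // uN u hsol hu equ.
split=> [|s /andP[s0 s1]]; first exact: (h2 _ _ hsol hu equ).
have hs : 0 <= s <= 1 by rewrite s0 (le_trans (ltW s1))// invf_le1// ler1n.
have N_gt0 : (0 < N)%N by exact: leq_trans hN.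
have [Lu _] := hu.
have C0' : (0 <= C%:E)%E by rewrite lee_fin ltW.
apply: le_trans (lee_wpmul2l C0' (best_approx_rate alpha r0 N_gt0 hs Lu)) _.
by rewrite muleA -!EFinM mulrA.
Qed.
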